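(* Let $\Omega'\subseteq\mathbb{R}^{n'}$, $\Omega\subseteq\mathbb{R}^n$ be open, $m\in\mathbb{R}$, $\rho\in(0,1]$, $\delta\in[0,1)$. Let $\phi\in\widetilde{\Phi}(\Omega';\Omega\times\mathbb{R}^p)$ be a generalized phase function with respect to the variables in $\Omega\times\mathbb{R}^p$, let $a\in\widetilde{\mathcal{S}}^m_{\rho,\delta}(\Omega'\times\Omega\times\mathbb{R}^p)$ and $u\in\mathcal{G}_c(\Omega)$. Then the generalized oscillatory integral $$I_\phi(a)(u)(x)=\int_{\Omega\times\mathbb{R}^p}e^{i\phi(x,y,\xi)}a(x,y,\xi)u(y)\,dy\,\frac{d\xi}{(2\pi)^p}$$ defines a generalized function in $\mathcal{G}(\Omega')$, and the map $A:\mathcal{G}_c(\Omega)\to\mathcal{G}(\Omega'):u\mapsto I_\phi(a)(u)$ is continuous.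
   Context: **Nets.** All nets are indexed by $\varepsilon\in(0,1]$; $O(\cdot)$ is meant as $\varepsilon\to0$. A net $(u_\varepsilon)_\varepsilon$ in $\mathbb{C}$ is strictly nonzero if there are $r>0$, $\eta\in(0,1]$ with $|u_\varepsilon|\ge\varepsilon^r$ for all $\varepsilon\in(0,\eta]$. For a locally convex space $E$ with seminorms $(p_i)_{i\in I}$: $\mathcal{M}_E=\{(u_\varepsilon)\in E^{(0,1]}:\forall i\,\exists N\in\mathbb{N}:\ p_i(u_\varepsilon)=O(\varepsilon^{-N})\}$, $\mathcal{N}_E=\{(u_\varepsilon)\in E^{(0,1]}:\forall i\,\forall q\in\mathbb{N}:\ p_i(u_\varepsilon)=O(\varepsilon^{q})\}$, $\mathcal{G}_E=\mathcal{M}_E/\mathcal{N}_E$. $\widetilde{\mathbb{C}}=\mathcal{G}_{\mathbb{C}}$ (a ring), and $\mathcal{G}_E$ is a $\widetilde{\mathbb{C}}$-module. **Colombeau algebras.** $\mathcal{G}(\Omega)=\mathcal{G}_E$ for $E=C^\infty(\Omega)$ with seminorms $p_{K,i}(f)=\sup_{x\in K,|\alpha|\le i}|\partial^\alpha f(x)|$, $K\Subset\Omega$ compact, $i\in\mathbb{N}$. It is a sheaf; $\mathcal{G}_c(\Omega)$ denotes its elements with compact support. $\mathcal{G}(\Omega')$ is regarded as a subset of $\mathcal{G}_{C^0(\Omega')}$ (the natural map is injective). Topologies: for a seminorm $p$ on $E$ put $\mathrm{v}_p(u)=\sup\{b\in\mathbb{R}:p(u_\varepsilon)=O(\varepsilon^b)\}$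 and $\mathcal{P}_p(u)=e^{-\mathrm{v}_p(u)}$. $\mathcal{G}(\Omega')$ carries the topology defined by the ultra-pseudo-seminorms $\mathcal{P}_{p_{K,i}}$. For $K\Subset\Omega$, $\mathcal{G}_K(\Omega)=\{u\in\mathcal{G}_c(\Omega):\operatorname{supp}u\subseteq K\}$ carries the topology of the ultra-pseudo-seminorms $e^{-\mathrm{v}_{p_{K',n}}(u)}$, $n\in\mathbb{N}$, computed on representatives supported in $K'$, where $K'\Subset\Omega$ is any compact set containing $K$ in its interior. $\mathcal{G}_c(\Omega)$ carries the strict inductive limit topology (in the category of locally convex topological $\widetilde{\mathbb{C}}$-modules) of the $\mathcal{G}_{K_n}(\Omega)$ for an exhausting increasing sequence of compact sets $K_n$; a $\widetilde{\mathbb{C}}$-linear map from $\mathcal{G}_c(\Omega)$ into a locally convex topological $\widetilde{\mathbb{C}}$-module is continuous iff its restriction to every $\mathcal{G}_K(\Omega)$ is continuous. **Symbols.** For an open set $X$ (here $X=\Omega'\times\Omega$, variable $z=(x,y)$), $S^m_{\rho,\delta}(X\times\mathbb{R}^p)$ is Hörmander's symbol space with seminorms $\sup_{z\in K,\xi\in\mathbb{R}^p,|\alpha+\beta|\le j}\langle\xi\rangle^{-m+\rho|\alpha|-\delta|\beta|}|\partial_\xi^\alpha\partial_z^\beta a(z,\xi)|$, and $\widetilde{\mathcal{S}}^m_{\rho,\delta}(X\times\mathbb{R}^p)=\mathcal{G}_{S^m_{\rho,\delta}(X\times\mathbb{R}^p)}$. $S^1_{\rm hg}(X\times\mathbb{R}^p\setminus0)$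 is the space of smooth functions on $X\times(\mathbb{R}^p\setminus0)$ positively homogeneous of degree $1$ in $\xi$, with seminorms $\sup_{z\in K,\xi\ne0}|\xi|^{-1+|\alpha|}|\partial^\alpha_\xi\partial^\beta_z a(z,\xi)|$. **Generalized phase functions.** A phase function on $\Omega\times\mathbb{R}^p$ is a real-valued function, smooth on $\Omega\times(\mathbb{R}^p\setminus0)$, positively homogeneous of degree $1$ in $\xi$, with $\nabla_{y,\xi}\phi(y,\xi)\ne0$ for all $y\in\Omega$, $\xi\ne0$. $\mathcal{M}_\Phi(\Omega';\Omega\times\mathbb{R}^p)$ is the set of nets $(\phi_\varepsilon)_\varepsilon$ of continuous functions on $\Omega'\times\Omega\times\mathbb{R}^p$, smooth on $\Omega'\times\Omega\times(\mathbb{R}^p\setminus0)$, such that $\phi_\varepsilon(x,\cdot,\cdot)$ is a phase function on $\Omega\times\mathbb{R}^p$ for all $x\in\Omega'$ and all $\varepsilon$, and: (i) $(\phi_\varepsilon)_\varepsilon\in\mathcal{M}_{S^1_{\rm hg}(\Omega'\times\Omega\times\mathbb{R}^p\setminus0)}$; (ii) for all $K'\Subset\Omega'$, $K\Subset\Omega$ the net $\big(\inf_{x\in K',y\in K,\xi\neq0}|\nabla_{y,\xi}\phi_\varepsilon(x,y,\xi/|\xi|)|^2\big)_\varepsilon$ is strictly nonzero. $\widetilde\Phi(\Omega';\Omega\times\mathbb{R}^p)$ is the quotient by the relation $(\phi_\varepsilon)\sim(\omega_\varepsilon)\iff(\phi_\varepsilon-\omega_\varepsilon)_\varepsilon\in\mathcal{N}_{S^1_{\rm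 hg}(\Omega'\times\Omega\times\mathbb{R}^p\setminus0)}$. **Oscillatory integral.** Fix $\chi\in C_c^\infty(\mathbb{R}^p)$ with $\chi=1$ for $|\xi|<1/4$, $\chi=0$ for $|\xi|>1/2$, and set $\varphi_{\phi_\varepsilon}(x,y,\xi)=|\nabla_{y,\xi}\phi_\varepsilon(x,y,\xi/|\xi|)|^{-2}$, $a_{j,\varepsilon}=i(1-\chi)\varphi_{\phi_\varepsilon}\partial_{\xi_j}\phi_\varepsilon$, $b_{k,\varepsilon}=i(1-\chi)|\xi|^{-2}\varphi_{\phi_\varepsilon}\partial_{y_k}\phi_\varepsilon$, $c_\varepsilon=\chi+\sum_{j=1}^p\partial_{\xi_j}a_{j,\varepsilon}+\sum_{k=1}^n\partial_{y_k}b_{k,\varepsilon}$, $L_{\phi_\varepsilon}=\sum_j a_{j,\varepsilon}\partial_{\xi_j}+\sum_kb_{k,\varepsilon}\partial_{y_k}+c_\varepsilon$; then ${}^tL_{\phi_\varepsilon}e^{i\phi_\varepsilon}=e^{i\phi_\varepsilon}$. With $s=\min\{\rho,1-\delta\}$ and any $h\in\mathbb{N}$ with $m-hs+1<-p$, $I_\phi(a)(u)$ is the element of $\mathcal{G}_{C^0(\Omega')}$ with representative $$\Big(\int_{\Omega\times\mathbb{R}^p}e^{i\phi_\varepsilon(x,y,\xi)}L^h_{\phi_\varepsilon}\big(a_\varepsilon(x,y,\xi)u_\varepsilon(y)\big)\,dy\,\frac{d\xi}{(2\pi)^p}\Big)_\varepsilon,$$ where $(\phi_\varepsilon),(a_\varepsilon),(u_\varepsilon)$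 are representatives of $\phi,a,u$, with all $u_\varepsilon$ supported in a common compact set; it is independent of the choices. *)

(* Defs.v *)
From HB Require Import structures.
From mathcomp Require Import all_boot all_order all_algebra.
From mathcomp Require Import complex.
From mathcomp Require Import all_classical all_reals all_analysis.

Set Implicit Arguments.
Unset Strict Implicit.
Unset Printing Implicit Defensive.

Import Order.TTheory GRing.Theory Num.Theory.
Import numFieldNormedType.Exports.
Import ComplexField.Normc.

Local Open Scope classical_set_scope.
Local Open Scope ring_scope.

Local Notation cRe := (@complex.Re _).
Local Notation cIm := (@complex.Im _).

Section Euclid.
Context {R : realType}.

(* [`|v|] on ['rV_n] is the sup norm, hence an explicit Euclidean norm. *)
Definition enorm n (v : 'rV[R]_n) : R := Num.sqrt (\sum_(i < n) v 0 i ^+ 2).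

Definition japanese n (v : 'rV[R]_n) : R := Num.sqrt (1 + enorm v ^+ 2).

Definition std {n} (i : 'I_n) : 'rV[R]_n := delta_mx 0 i.

Definition bprod (U V : normedModType R) (I J : Type) (e : I -> U) (f : J -> V)
  (k : I + J) : U * V :=
  match k with inl i => (e i, 0) | inr j => (0, f j) end.

Local Notation RT := (measurableTypeR R).

Definition tcons n (z : RT * n.-tuple RT) : n.+1.-tuple RT :=
  [tuple of z.1 :: z.2].

Definition tuncons n (t : n.+1.-tuple RT) : RT * n.-tuple RT :=
  (thead t, [tuple of behead t]).

Lemma tconsK n : cancel (@tcons n) (@tuncons n).
Proof. by case=> x t; congr pair; apply: val_inj. Qed.

Lemma tunconsK n : cancel (@tuncons n) (@tcons n).
Proof. by move=> t; rewrite /tcons/= -tuple_eta. Qed.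

Lemma measurable_tcons n : measurable_fun [set: RT * n.-tuple RT] (@tcons n).
Proof. by apply: measurable_cons. Qed.

Lemma measurable_tuncons n : measurable_fun [set: n.+1.-tuple RT] (@tuncons n).
Proof.
by apply/measurable_fun_pair; [exact: measurable_tnth|exact: measurable_behead].
Qed.

Section lebesgue_step.
Context n (mu : {sigma_finite_measure set (n.-tuple RT) -> \bar R}).

Definition lebesgue_step : set (n.+1.-tuple RT) -> \bar R :=
  pushforward (@lebesgue_measure R \x mu)%E (@tcons n).

Let pm : {measure set (n.+1.-tuple RT) -> \bar R} :=
  measure_function_pushforward__canonical__measure_function_Measure
    (@lebesgue_measure R \x mu)%E (@measurable_tcons n).

HB.instance Definition _ := isMeasure.Build _ _ _ lebesgue_step
  (measure0 pm) (measure_ge0 pm) (@measure_semi_sigma_additive _ _ _ pm).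

Let lebesgue_step_sigma_finite : sigma_finite setT lebesgue_step.
Proof.
have /sigma_finiteP[F [TF ndF Foo]] := sigma_finiteT (@lebesgue_measure R).
have /sigma_finiteP[G [TG ndG Goo]] := sigma_finiteT mu.
exists (fun k => @tuncons n @^-1` (F k `*` G k)).
  rewrite -preimage_bigcup -[LHS](preimage_setT (@tuncons n)); congr preimage.
  rewrite -setXTT TF TG predeqE => -[x y]; split.
    move=> [/= [i _ Fx] [k _ Gy]]; exists (maxn i k) => //; split.
    - by move: x Fx; exact/subsetPset/ndF/leq_maxl.
    - by move: y Gy; exact/subsetPset/ndG/leq_maxr.
  by move=> [i _ []/= ? ?]; split; exists i.
move=> k; have [? ?] := Foo k; have [? ?] := Goo k; split.
  rewrite -[X in measurable X]setTI; apply: measurable_tuncons => //.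
  exact: measurableX.
rewrite /lebesgue_step /pushforward -comp_preimage.
rewrite (_ : _ \o _ = id); last by apply/funext => z /=; exact: tconsK.
by rewrite preimage_id product_measure1E// lte_mul_pinfty// ge0_fin_numE.
Qed.

HB.instance Definition _ := Measure_isSigmaFinite.Build _ _ _
  lebesgue_step lebesgue_step_sigma_finite.

End lebesgue_step.

(* The n-fold product of the one-dimensional Lebesgue measure, on tuples. *)
Fixpoint lebesgue_tuple n : {sigma_finite_measure set (n.-tuple RT) -> \bar R} :=
  match n with
  | 0 => dirac [tuple]
  | n'.+1 => lebesgue_step (lebesgue_tuple n')
  end.

Definition row_of_tuple n (t : n.-tuple RT) : 'rV[R]_n := \row_i tnth t i.

End Euclid.

Section Derivatives.
Context {R : realType} {V : normedModType R}.
Local Notation C := R[i].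

Definition cderiv (v : V) (f : V -> C) (x : V) : C :=
  Complex ('D_v (cRe \o f) x) ('D_v (cIm \o f) x).

Definition multi_cderiv (I : finType) (e : I -> V) (alpha : I -> nat)
    (f : V -> C) : V -> C :=
  foldr (fun i => iter (alpha i) (cderiv (e i))) f (enum I).

Definition word_deriv (I : Type) (e : I -> V) (s : seq I) (f : V -> R) : V -> R :=
  foldr (fun i g x => 'D_(e i) g x) f s.

(* C^infinity on the open set U: all iterated partial derivatives along the
   basis e, in every order, exist and are continuous at every point of U. *)
Definition smooth_on (I : Type) (e : I -> V) (U : set V) (f : V -> R) : Prop :=
  forall (s : seq I) (x : V), U x ->
    {for x, continuous (word_deriv e s f)} /\
    forall i, derivable (word_deriv e s f) x (e i).

Definition csmooth_on (I : Type) (e : I -> V) (U : set V) (f : V -> C) : Prop :=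
  smooth_on e U (cRe \o f) /\ smooth_on e U (cIm \o f).

End Derivatives.

Section Colombeau.
Context {R : realType}.
Local Notation C := R[i].

(* A supremum taken in [0, +oo], so that the supremum of the empty set is 0. *)
Definition sup0 (A : set \bar R) : \bar R := ereal_sup ([set 0%E] `|` A).

Definition bigO_eps (f : R -> \bar R) (b : R) : Prop :=
  exists M : R, \forall e \near 0^'+, (f e <= (M * e `^ b)%:E)%E.

Definition strictly_nonzero (f : R -> \bar R) : Prop :=
  exists r eta : R, [/\ 0 < r, 0 < eta <= 1 &
    forall e, 0 < e <= eta -> ((e `^ r)%:E <= f e)%E].

(* A locally convex space E of complex functions on T, presented by its
   underlying set of functions and its set of seminorms. Functions are total;
   those representing elements of C^infinity(Omega), say, may take arbitrary
   values off Omega, which no seminorm sees. *)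
Record lcspace (T : Type) := LCSpace {
  lcs_dom : set (T -> C);
  lcs_seminorm : set ((T -> C) -> \bar R) }.

(* Nets indexed by ]0, 1]; values at the other reals are irrelevant. *)
Definition net (T : Type) := R -> T -> C.

Section Quotient.
Context {T : Type} (E : lcspace T).

Definition in_space (u : net T) : Prop :=
  forall e, 0 < e <= 1 -> lcs_dom E (u e).

Definition moderate (u : net T) : Prop :=
  in_space u /\ forall p, lcs_seminorm E p ->
    exists N : nat, bigO_eps (fun e => p (u e)) (- N%:R).

Definition negligible (u : net T) : Prop :=
  in_space u /\ forall p, lcs_seminorm E p ->
    forall q : nat, bigO_eps (fun e => p (u e)) q%:R.

Definition coset (u : net T) : set (net T) := [set w | negligible (w - u)].

Record colombeau := Colombeau {
  reprs :> set (net T);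
  _ : exists2 u, moderate u & reprs = coset u }.

End Quotient.

Definition valuation (T : Type) (p : (T -> C) -> \bar R) (U : set (net T)) :
    \bar R :=
  ereal_sup [set b%:E | b in
    [set b | exists2 u, U u & bigO_eps (fun e => p (u e)) b]].

Definition ultranorm (T : Type) (p : (T -> C) -> \bar R) (U : set (net T)) :
    \bar R :=
  expeR (- valuation p U).

Definition coset_add (T : Type) (U V : set (net T)) : set (net T) :=
  [set u + v | u in U & v in V].

Definition coset_sub (T : Type) (U V : set (net T)) : set (net T) :=
  [set u - v | u in U & v in V].

Section GTopology.
Context {T : Type} (E : lcspace T).

HB.instance Definition _ := gen_eqMixin (colombeau E).
HB.instance Definition _ := gen_choiceMixin (colombeau E).

Definition ultraballs : set (set (colombeau E)) :=
  [set B | exists (u0 : colombeau E) (p : (T -> C) -> \bar R) (r : R),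
    [/\ lcs_seminorm E p, 0 < r &
        B = [set u : colombeau E |
              (ultranorm p (coset_sub u u0) < r%:E)%E]]].

HB.instance Definition _ :=
  isSubBaseTopological.Build (colombeau E) ultraballs id.

End GTopology.

Definition cst_space : lcspace unit :=
  LCSpace setT [set (fun f : unit -> C => (normc (f tt))%:E)].

Definition Ctilde := colombeau cst_space.

Definition scalar_ultranorm (l : Ctilde) : \bar R :=
  ultranorm (fun f : unit -> C => (normc (f tt))%:E) l.

Definition coset_scale (T : Type) (E : lcspace T) (l : Ctilde) (U : set (net T)) :
    set (net T) :=
  [set w | exists l' u, [/\ (l : set (net unit)) l', U u &
     negligible E (w - (fun e x => l' e tt * u e x))]].

Definition eps_power (b : R) : net unit := fun e _ => (e `^ b)%:C%C.

End Colombeau.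

Arguments net : clear implicits.
Arguments lcspace : clear implicits.

Section FunctionSpaces.
Context {R : realType}.
Local Notation C := R[i].

Definition compact_in (V : topologicalType) (U K : set V) : Prop :=
  compact K /\ K `<=` U.

Section Smooth.
Context {n : nat} (Omega : set 'rV[R]_n).

Definition Cinf_seminorm (K : set 'rV[R]_n) (i : nat) (f : 'rV[R]_n -> C) : \bar R :=
  sup0 [set z | exists (x : 'rV[R]_n) (alpha : 'I_n -> nat),
    [/\ K x, (\sum_k alpha k <= i)%N &
        z = (normc (multi_cderiv std alpha f x))%:E]].

Definition Cinf : lcspace R 'rV[R]_n :=
  LCSpace (csmooth_on std Omega)
    [set p | exists K i, compact_in Omega K /\ p = Cinf_seminorm K i].

Definition C0 : lcspace R 'rV[R]_n :=
  LCSpace [set f : 'rV[R]_n -> C | forall x, Omega x ->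
             {for x, continuous (cRe \o f)} /\ {for x, continuous (cIm \o f)}]
    [set p | exists2 K, compact_in Omega K &
             p = fun f : 'rV[R]_n -> C => sup0 [set (normc (f x))%:E | x in K]].

Definition G := colombeau Cinf.

(* The image in G_(C^0(Omega)) of an element of G(Omega). *)
Definition to_C0 (u : G) : set (net R 'rV[R]_n) :=
  [set w | exists2 v, (u : set (net R 'rV[R]_n)) v & negligible C0 (w - v)].

End Smooth.

Section CompactSupport.
Context {n : nat} (Omega : set 'rV[R]_n).

Definition gsupp (u : G Omega) : set 'rV[R]_n :=
  [set x | Omega x /\
    ~ exists V : set 'rV[R]_n, [/\ open V, V `<=` Omega, V x &
        exists2 v, (u : set (net R 'rV[R]_n)) v & negligible (Cinf V) v]].

Definition supported_in (K : set 'rV[R]_n) (u : net R 'rV[R]_n) : Prop :=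
  forall e, 0 < e <= 1 -> forall x, Omega x -> ~ K x -> u e x = 0.

Definition exhaustion (K : nat -> set 'rV[R]_n) : Prop :=
  [/\ forall k, compact_in Omega (K k),
      forall k, K k `<=` (K k.+1)^° &
      \bigcup_k K k = Omega].

Definition Gc (K : nat -> set 'rV[R]_n) := {u : G Omega | compact (gsupp u)}.

Definition Gc_reprs (K : nat -> set 'rV[R]_n) (u : Gc K) : set (net R 'rV[R]_n) :=
  sval u.

Section Topology.
Context (Kex : nat -> set 'rV[R]_n).
Local Notation Gc := (Gc Kex).

HB.instance Definition _ := gen_eqMixin Gc.
HB.instance Definition _ := gen_choiceMixin Gc.

(* The trace of U on G_K(Omega) is a neighborhood of 0. The seminorms
   p_(K', i) increase with i, so their balls form a base. *)
Definition GK_nbhs0 (K : set 'rV[R]_n) (U : set Gc) : Prop :=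
  exists (K' : set 'rV[R]_n) (i : nat) (r : R),
    [/\ compact_in Omega K', K `<=` K'^°, 0 < r &
     forall u : Gc, gsupp (sval u) `<=` K ->
       (ultranorm (Cinf_seminorm K' i)
          (Gc_reprs u `&` supported_in K') < r%:E)%E -> U u].

Definition gen_convex (U : set Gc) : Prop :=
  (forall u v w : Gc, U u -> U v ->
     Gc_reprs w = coset_add (Gc_reprs u) (Gc_reprs v) -> U w) /\
  (forall (b : R) (l : Ctilde) (u w : Gc), 0 <= b ->
     (l : set (net R unit)) (eps_power b) -> U u ->
     Gc_reprs w = coset_scale (Cinf Omega) l (Gc_reprs u) -> U w).

Definition gen_balanced (U : set Gc) : Prop :=
  forall (l : Ctilde) (u w : Gc), (scalar_ultranorm l <= 1)%E -> U u ->
    Gc_reprs w = coset_scale (Cinf Omega) l (Gc_reprs u) -> U w.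

(* Inductive limit topology: a base of neighborhoods of 0 consists of the
   absolutely convex sets whose trace on every step is a neighborhood of 0. *)
Definition indlim_nbhs0 (U : set Gc) : Prop :=
  [/\ gen_convex U, gen_balanced U & forall k, GK_nbhs0 (Kex k) U].

Definition indlim_subbase : set (set Gc) :=
  [set B | exists (u0 : Gc) (U : set Gc), indlim_nbhs0 U /\
    B = [set u | exists2 v : Gc, U v &
           Gc_reprs u = coset_add (Gc_reprs u0) (Gc_reprs v)]].

HB.instance Definition _ := isSubBaseTopological.Build Gc indlim_subbase id.

End Topology.

End CompactSupport.

Section Phases.
Context {n' n p : nat}.
Local Notation Z := ('rV[R]_n' * 'rV[R]_n * 'rV[R]_p)%type.

Definition eZ : ('I_n' + 'I_n) + 'I_p -> Z := bprod (bprod std std) std.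
Definition ez (k : 'I_n' + 'I_n) : Z := eZ (inl k).
Definition ey (k : 'I_n) : Z := eZ (inl (inr k)).
Definition exi (j : 'I_p) : Z := eZ (inr j).

Definition mixed_deriv (alpha : 'I_p -> nat) (beta : 'I_n' + 'I_n -> nat)
    (f : Z -> C) : Z -> C :=
  multi_cderiv exi alpha (multi_cderiv ez beta f).

Definition order (alpha : 'I_p -> nat) : nat := (\sum_j alpha j)%N.

Definition symbol_seminorm (m rho delta : R) (K : set ('rV[R]_n' * 'rV[R]_n)) (j : nat)
    (a : Z -> C) : \bar R :=
  sup0 [set s | exists (z : 'rV[R]_n' * 'rV[R]_n) (xi : 'rV[R]_p)
      (alpha : 'I_p -> nat) (beta : 'I_n' + 'I_n -> nat),
    [/\ K z, (order alpha + \sum_k beta k <= j)%N &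
      s = (japanese xi `^ (- m + rho * (order alpha)%:R
                           - delta * ((\sum_k beta k)%N)%:R)
           * normc (mixed_deriv alpha beta a (z, xi)))%:E]].

Definition symbol_space (m rho delta : R) (X : set ('rV[R]_n' * 'rV[R]_n)) :
    lcspace R Z :=
  LCSpace [set a : Z -> C | csmooth_on eZ (X `*` setT) a /\
             forall K j, compact_in X K ->
               (symbol_seminorm m rho delta K j a < +oo)%E]
    [set q | exists K j, compact_in X K /\
             q = symbol_seminorm m rho delta K j].

Definition Stilde (m rho delta : R) (X : set ('rV[R]_n' * 'rV[R]_n)) :=
  colombeau (symbol_space m rho delta X).

Definition hg_seminorm (K : set ('rV[R]_n' * 'rV[R]_n)) (alpha : 'I_p -> nat)
    (beta : 'I_n' + 'I_n -> nat) (a : Z -> C) : \bar R :=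
  sup0 [set s | exists (z : 'rV[R]_n' * 'rV[R]_n) (xi : 'rV[R]_p),
    [/\ K z, xi != 0 &
      s = (enorm xi `^ (-1 + (order alpha)%:R)
           * normc (mixed_deriv alpha beta a (z, xi)))%:E]].

Definition hg_space (X : set ('rV[R]_n' * 'rV[R]_n)) : lcspace R Z :=
  LCSpace [set a : Z -> C | csmooth_on eZ (X `*` [set xi | xi != 0]) a /\
             forall z xi (t : R), X z -> xi != 0 -> 0 < t ->
               a (z, t *: xi) = t%:C%C * a (z, xi)]
    [set q | exists K alpha beta, compact_in X K /\
             q = hg_seminorm K alpha beta].

Definition phase_function (Omega : set 'rV[R]_n) (psi : 'rV[R]_n * 'rV[R]_p -> R) : Prop :=
  let e := bprod (@std R n) (@std R p) in
  [/\ smooth_on e (Omega `*` [set xi | xi != 0]) psi,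
      forall y xi (t : R), Omega y -> 0 < t -> psi (y, t *: xi) = t * psi (y, xi) &
      forall y xi, Omega y -> xi != 0 -> exists k, 'D_(e k) psi (y, xi) != 0].

Definition grad_sq (f : Z -> R) (w : Z) : R :=
  \sum_(k < n) ('D_(ey k) f w) ^+ 2 + \sum_(j < p) ('D_(exi j) f w) ^+ 2.

Definition normalized (w : Z) : Z := (w.1, (enorm w.2)^-1 *: w.2).

Section GeneralizedPhase.
Context (Omega' : set 'rV[R]_n') (Omega : set 'rV[R]_n).

Definition cnet (phi : R -> Z -> R) : net R Z := fun e w => (phi e w)%:C%C.

Definition M_Phi (phi : R -> Z -> R) : Prop :=
  [/\ forall e, 0 < e <= 1 -> forall w, Omega' w.1.1 -> Omega w.1.2 ->
        {for w, continuous (phi e)},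
      forall e, 0 < e <= 1 -> forall x, Omega' x ->
        phase_function Omega (fun w => phi e (x, w.1, w.2)),
      moderate (hg_space (Omega' `*` Omega)) (cnet phi) &
      forall K' K, compact_in Omega' K' -> compact_in Omega K ->
        strictly_nonzero (fun e =>
          ereal_inf [set (grad_sq (phi e) (normalized w))%:E | w in
                      (K' `*` K) `*` [set xi | xi != 0]])].

Record Phi := MkPhi {
  phi_reprs :> set (R -> Z -> R);
  _ : exists2 phi, M_Phi phi &
        phi_reprs = [set omega | M_Phi omega /\
          negligible (hg_space (Omega' `*` Omega)) (cnet (phi - omega))] }.

End GeneralizedPhase.

Section Oscillatory.
Context (chi : 'rV[R]_p -> C) (phi : Z -> R).

(* The gradient of phi is taken first and then evaluated at the normalized
   point. At xi = 0 the factor 1 - chi vanishes. *)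
Definition varphi (w : Z) : R := (grad_sq phi (normalized w))^-1.

Definition La (j : 'I_p) (w : Z) : C :=
  Complex 0 1 * (1 - chi w.2) * (varphi w * 'D_(exi j) phi w)%:C%C.

Definition Lb (k : 'I_n) (w : Z) : C :=
  Complex 0 1 * (1 - chi w.2)
    * ((enorm w.2) ^- 2 * varphi w * 'D_(ey k) phi w)%:C%C.

Definition Lc (w : Z) : C :=
  chi w.2 + \sum_j cderiv (exi j) (La j) w + \sum_k cderiv (ey k) (Lb k) w.

Definition L (f : Z -> C) (w : Z) : C :=
  \sum_j La j w * cderiv (exi j) f w + \sum_k Lb k w * cderiv (ey k) f w
  + Lc w * f w.

End Oscillatory.

Definition expi (t : R) : C := Complex (cos t) (sin t).

Definition integral_yxi (Omega : set 'rV[R]_n) (f : 'rV[R]_n -> 'rV[R]_p -> R) : R :=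
  \int[(lebesgue_tuple n \x lebesgue_tuple p)%E]_(t in
      [set t | Omega (row_of_tuple t.1)])
    f (row_of_tuple t.1) (row_of_tuple t.2).

Definition cintegral_yxi (Omega : set 'rV[R]_n) (f : 'rV[R]_n -> 'rV[R]_p -> C) : C :=
  Complex (integral_yxi Omega (fun y xi => cRe (f y xi)))
          (integral_yxi Omega (fun y xi => cIm (f y xi))).

Definition osc_net (chi : 'rV[R]_p -> C) (Omega : set 'rV[R]_n) (h : nat)
    (phi : R -> Z -> R) (a : net R Z) (u : net R 'rV[R]_n) : net R 'rV[R]_n' :=
  fun e x => ((2 * pi) ^- p)%:C%C *
    cintegral_yxi Omega (fun y xi =>
      expi (phi e (x, y, xi)) *
      iter h (L chi (phi e)) (fun w => a e w * u e w.1.2) (x, y, xi)).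

Definition cutoff (chi : 'rV[R]_p -> C) : Prop :=
  [/\ csmooth_on std setT chi,
      forall xi, enorm xi < 4^-1 -> chi xi = 1 &
      forall xi, 2^-1 < enorm xi -> chi xi = 0].

(* I_phi(a)(u) as a set of nets: the union, over all admissible choices, of
   the cosets modulo N_(C^0(Omega')) of the representing integrals. It is a
   single element of G_(C^0(Omega')) exactly when all choices agree. *)
Definition osc_integral (Omega' : set 'rV[R]_n') (Omega : set 'rV[R]_n)
    (m rho delta : R) (chi : 'rV[R]_p -> C) (phi : Phi Omega' Omega)
    (a : Stilde m rho delta (Omega' `*` Omega)) (u : set (net R 'rV[R]_n)) :
    set (net R 'rV[R]_n') :=
  [set w | exists phi_ a_ u_ h,
    [/\ (phi : set (R -> Z -> R)) phi_,
        (a : set (net R Z)) a_ /\ u u_,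
        exists2 K, compact_in Omega K & supported_in Omega K u_,
        m - h%:R * Num.min rho (1 - delta) + 1 < - p%:R &
        coset (C0 Omega') (osc_net chi Omega h phi_ a_ u_) w]].

End Phases.

End FunctionSpaces.

(* Main.v *)
(* The lower bound on the gradient of phi makes the coefficients of L moderate
   nets of symbols, so that L^h (a u) is a moderate net of symbols of order
   m - h s. Each x-derivative of e^{i phi} L^h (a u) raises the order by a fixed
   amount, so for every k the integral is k times differentiable under the
   integral sign once h is large. Integrating by parts with
   tL e^{i phi} = e^{i phi} shows that all admissible h give the same function,
   which is therefore smooth in x with moderate derivatives.

   All estimates are made for pairs of nets that are moderate and differ by a
   negligible net, a relation preserved by products, inverses, exponentials,
   derivatives and integrals. It contains at once the moderateness of the
   integral and its independence of the representatives of phi, a and u.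

   The derivatives of A u of order at most k on a compact set are bounded by a
   moderate net times the derivatives of u up to some order j on a compact
   set containing supp u. Hence the valuation drops by at most a constant, and
   the inverse image of an ultraball around 0 is an absolutely convex set whose
   trace on every G_K is a neighbourhood of 0. *)

Require Import Defs.
From HB Require Import structures.
From mathcomp Require Import all_boot all_order all_algebra.
From mathcomp Require Import complex ring lra finmap.
From mathcomp Require Import all_classical all_reals all_analysis measurable_realfun.

Set Implicit Arguments.
Unset Strict Implicit.
Unset Printing Implicit Defensive.

Import Order.TTheory GRing.Theory Num.Theory.
Import numFieldNormedType.Exports.
Import ComplexField.Normc.

Local Open Scope classical_set_scope.
Local Open Scope ring_scope.

(** * Smooth functions on open sets *)

(** A phase is homogeneous of degree 1 and therefore smooth only off xi = 0, while the integral runs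
    over all xi. Two kinds of estimates are kept side by side. For |xi| > 1/8 all derivatives are
    controlled; the coefficients a_j and b_k vanish for |xi| < 1/4, so their estimates extend by
    zero. Across xi = 0 only derivatives in x are used: those of the phase are again homogeneous of
    degree 1, hence continuous there.

    Neither dominated convergence nor the divergence theorem is invoked. A second order Taylor bound
    gives differentiation under the integral, and translation invariance shows that the integral of
    a derivative vanishes.

    Nets are indexed by an arbitrary type E lying over ]0, 1]. Taking for E the pairs of an epsilon
    and a test function whose derivatives up to order j are bounded by 1 turns moderateness of the
    integral into a bound uniform in the test function, and by homogeneity into the estimate on
    which continuity rests. *)

Section RealSmooth.
Context {R : realType} {V : normedModType R} {I : Type} (e : I -> V).
Implicit Types (U : set V) (f g : V -> R).

Lemma continuous_eq_on U f g x : open U -> U x -> (forall y, U y -> f y = g y) ->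
  {for x, continuous f} -> {for x, continuous g}.
Proof.
move=> oU Ux fg cf; rewrite /prop_for /continuous_at -fg//.
apply: cvg_trans cf; apply: near_eq_cvg.
by near do apply: fg; exact: open_nbhs_nbhs.
Unshelve. all: by end_near. Qed.

Lemma near_eq_on U f g x : open U -> U x -> (forall y, U y -> f y = g y) ->
  \near x, f x = g x.
Proof. by move=> oU Ux fg; near do apply: fg; exact: open_nbhs_nbhs.
Unshelve. all: by end_near. Qed.

(** [smooth_on] quantifies over words whose head is the outermost derivative, a form on which the
    product and chain rules do not induct. [Ck] peels off the innermost derivative instead;
    [word_deriv_rcons] reconciles the two. *)
Fixpoint Ck k U f : Prop := (forall x, U x -> {for x, continuous f}) /\
  if k is k'.+1 then forall i, (forall x, U x -> derivable f x (e i)) /\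
                               Ck k' U ('D_(e i) f)
  else True.

Lemma word_deriv_rcons s i f :
  word_deriv e (rcons s i) f = word_deriv e s ('D_(e i) f).
Proof. by rewrite /word_deriv foldr_rcons. Qed.

Lemma Ck0 k U f : Ck k U f -> forall x, U x -> {for x, continuous f}.
Proof. by case: k => [|k] []. Qed.

Lemma smooth_on_D U f i : smooth_on e U f -> smooth_on e U ('D_(e i) f).
Proof.
by move=> sf s x Ux; have := sf (rcons s i) x Ux; rewrite word_deriv_rcons.
Qed.

Lemma smooth_onP U f : smooth_on e U f <-> forall k, Ck k U f.
Proof.
split=> [sf k|Cf s].
  elim: k f sf => [|k IH] f sf; first by split=> // x /(sf [::])[].
  split=> [x /(sf [::])[]//|i]; split=> [x /(sf [::])[_ /(_ i)]//|].
  exact/IH/smooth_on_D.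
elim/last_ind: s f Cf => [|s i IH] f Cf x Ux.
  split=> [|i]; first exact: Ck0 (Cf 0%N) x Ux.
  by have [_ /(_ i)[/(_ x Ux)]] := Cf 1%N.
rewrite word_deriv_rcons; apply: IH => // k.
by have [_ /(_ i)[]] := Cf k.+1.
Qed.

Lemma Ck_eq k U f g : open U -> (forall x, U x -> f x = g x) ->
  Ck k U f -> Ck k U g.
Proof.
move=> oU; elim: k f g => [|k IH] f g fg /=.
  by move=> [cf _]; split=> // x Ux; exact: continuous_eq_on fg (cf _ Ux).
move=> [cf df]; split=> [x Ux|i]; first exact: continuous_eq_on fg (cf _ Ux).
have [di Ci] := df i; split=> [x Ux|].
  by apply: near_eq_derivable (di _ Ux); exact: near_eq_on fg.
by apply: IH Ci => x Ux; apply: near_eq_derive; exact: near_eq_on fg.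
Qed.

Lemma Ck_leq k U f : Ck k.+1 U f -> Ck k U f.
Proof.
elim: k f => [|k IH] f [cf df]; split=> // i.
by have [di Ci] := df i; split=> //; exact: IH.
Qed.

Lemma Ck_cst k U (c : R) : Ck k U (fun=> c).
Proof.
elim: k c => [|k IH] c; first by split=> // x _; exact: cst_continuous.
split=> [x _|i]; first exact: cst_continuous.
split=> [x _|]; first exact: derivable_cst.
by rewrite (_ : 'D_(e i) _ = fun=> 0)//; apply/funext => x; rewrite derive_cst.
Qed.

Lemma Ck_add k U f g : open U -> Ck k U f -> Ck k U g ->
  Ck k U (fun x => f x + g x).
Proof.
move=> oU; elim: k f g => [|k IH] f g [cf df] [cg dg].
  by split=> // x Ux; apply: continuousD; [exact: cf|exact: cg].
split=> [x Ux|i]; first by apply: continuousD; [exact: cf|exact: cg].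
have [dif Cif] := df i; have [dig Cig] := dg i; split=> [x Ux|].
  by apply: derivableD; [exact: dif|exact: dig].
apply: Ck_eq (IH _ _ Cif Cig) => // x Ux.
by rewrite -[RHS]/('D_(e i) (f + g) x) deriveD//; [exact: dif|exact: dig].
Qed.

Lemma Ck_mul k U f g : open U -> Ck k U f -> Ck k U g ->
  Ck k U (fun x => f x * g x).
Proof.
move=> oU; elim: k f g => [|k IH] f g Cf Cg.
  split=> // x Ux; have [cf _] := Cf; have [cg _] := Cg.
  by apply: continuousM; [exact: cf|exact: cg].
have [cf df] := Cf; have [cg dg] := Cg; split=> [x Ux|i].
  by apply: continuousM; [exact: cf|exact: cg].
have [dif Cif] := df i; have [dig Cig] := dg i; split=> [x Ux|].
  by apply: derivableM; [exact: dif|exact: dig].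
have := Ck_add oU (IH _ _ (Ck_leq Cf) Cig) (IH _ _ (Ck_leq Cg) Cif).
apply: Ck_eq => // x Ux.
by rewrite -[RHS]/('D_(e i) (f * g) x) deriveM//; [exact: dif|exact: dig].
Qed.

Lemma Ck_opp k U f : open U -> Ck k U f -> Ck k U (fun x => - f x).
Proof.
move=> oU /(Ck_mul oU (Ck_cst k U (-1))); apply: Ck_eq => // x _.
by rewrite mulN1r.
Qed.

Lemma Ck_inv k U f : open U -> (forall x, U x -> f x != 0) -> Ck k U f ->
  Ck k U (fun x => (f x)^-1).
Proof.
move=> oU f0; elim: k => [|k IH] Cf.
  by split=> // x Ux; apply: continuousV; [exact: f0|exact: Ck0 Cf _ Ux].
split=> [x Ux|i]; first by apply: continuousV; [exact: f0|exact: Ck0 Cf _ Ux].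
have [_ df] := Cf; have [di Ci] := df i; split=> [x Ux|].
  by apply: derivableV; [exact: f0|exact: di].
have CV := IH (Ck_leq Cf).
apply: Ck_eq (Ck_mul oU (Ck_opp oU Ci) (Ck_mul oU CV CV)) => // x Ux.
rewrite -[RHS]/('D_(e i) (fun y => (f y)^-1) x) deriveV//; [|exact: f0|exact: di].
by rewrite -[_ *: _]/(_ * _) mulNr mulNr mulrC -expr2 exprVn.
Qed.

Lemma smooth_on_eq U f g : open U -> (forall x, U x -> f x = g x) ->
  smooth_on e U f -> smooth_on e U g.
Proof. by move=> oU fg /smooth_onP Cf; apply/smooth_onP => k; exact: Ck_eq fg (Cf k). Qed.

Lemma smooth_on_sub U U' f : U' `<=` U -> smooth_on e U f -> smooth_on e U' f.
Proof. by move=> U'U sf s x /U'U; exact: sf. Qed.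

Lemma smooth_onU U U' f : smooth_on e U f -> smooth_on e U' f ->
  smooth_on e (U `|` U') f.
Proof. by move=> sf sf' s x [/sf|/sf']. Qed.

Lemma smooth_on_cst U (c : R) : smooth_on e U (fun=> c).
Proof. by apply/smooth_onP => k; exact: Ck_cst. Qed.

Lemma smooth_on_add U f g : open U -> smooth_on e U f -> smooth_on e U g ->
  smooth_on e U (fun x => f x + g x).
Proof. by move=> oU /smooth_onP ? /smooth_onP ?; apply/smooth_onP => k; exact: Ck_add. Qed.

Lemma smooth_on_mul U f g : open U -> smooth_on e U f -> smooth_on e U g ->
  smooth_on e U (fun x => f x * g x).
Proof. by move=> oU /smooth_onP ? /smooth_onP ?; apply/smooth_onP => k; exact: Ck_mul. Qed.

Lemma smooth_on_opp U f : open U -> smooth_on e U f ->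
  smooth_on e U (fun x => - f x).
Proof. by move=> oU /smooth_onP ?; apply/smooth_onP => k; exact: Ck_opp. Qed.

Lemma smooth_on_inv U f : open U -> (forall x, U x -> f x != 0) ->
  smooth_on e U f -> smooth_on e U (fun x => (f x)^-1).
Proof. by move=> oU f0 /smooth_onP ?; apply/smooth_onP => k; exact: Ck_inv. Qed.

Lemma smooth_on_sum (J : Type) (r : seq J) U (F : J -> V -> R) : open U ->
  (forall j, smooth_on e U (F j)) -> smooth_on e U (fun x => \sum_(j <- r) F j x).
Proof.
move=> oU sF; elim: r => [|j r IH].
  by apply: (smooth_on_eq oU _ (smooth_on_cst 0)) => x _; rewrite big_nil.
by apply: (smooth_on_eq oU _ (smooth_on_add oU (sF j) IH)) => x _; rewrite big_cons.
Qed.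

Lemma smooth_on_cont U f : smooth_on e U f ->
  forall x, U x -> {for x, continuous f}.
Proof. by move=> sf x /(sf [::])[]. Qed.

Lemma smooth_on_derivable U f i : smooth_on e U f ->
  forall x, U x -> derivable f x (e i).
Proof. by move=> sf x /(sf [::])[_ /(_ i)]. Qed.

End RealSmooth.

(** Forgets directions: smoothness along the whole basis gives smoothness along the x-directions
    alone. *)
Lemma smooth_on_reindex {R : realType} {V : normedModType R} (I J : Type)
    (e : I -> V) (r : J -> I) (U : set V) (f : V -> R) :
  smooth_on e U f -> smooth_on (e \o r) U f.
Proof.
move=> /smooth_onP Cf; apply/smooth_onP => k.
elim: k f {Cf}(Cf k) => [|k IH] f [cf df]; split=> // j.
by have [di Ci] := df (r j); split=> //; exact: IH.
Qed.

(** * Calculus along lines and symmetry of mixed derivatives *)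

Section Lines.
Context {R : realType} {V : normedModType R}.
Implicit Types (f : V -> R) (u v x : V).

Lemma is_derive_line f v x (t : R) : derivable f (t *: v + x) v ->
  is_derive t 1 (fun t => f (t *: v + x)) ('D_v f (t *: v + x)).
Proof.
have E : (fun h : R => h^-1 *: (f ((h *: 1 + t) *: v + x) - f (t *: v + x))) =
    (fun h : R => h^-1 *: (f (h *: v + (t *: v + x)) - f (t *: v + x))).
  by apply/funext => h; rewrite [h *: 1]mulr1 scalerDl addrA.
by move=> df; split; rewrite /derivable /derive E.
Qed.

Lemma is_derive_lineZ f v x (h s : R) : derivable f ((s * h) *: v + x) v ->
  is_derive s 1 (fun s => f ((s * h) *: v + x)) (h * 'D_v f ((s * h) *: v + x)).
Proof.
move=> /is_derive_line df.
have dh : is_derive s 1 (fun s => s * h) h.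
  have -> : (fun s => s * h) = (fun s => h *: (id : R -> R) s).
    by apply/funext => y /=; rewrite mulrC.
  by apply: is_derive_eq; rewrite [_ *: _]mulr1.
have := @is_derive1_comp R (fun t => f (t *: v + x)) (fun s => s * h) s _ _ df dh.
by rewrite mulrC.
Qed.

Lemma derive_translate f w v y :
  'D_v (fun z => f (w + z)) y = 'D_v f (w + y) /\
  (derivable f (w + y) v -> derivable (fun z => f (w + z)) y v).
Proof.
have E : (fun h : R => h^-1 *: (f (w + (h *: v + y)) - f (w + y))) =
    (fun h : R => h^-1 *: (f (h *: v + (w + y)) - f (w + y))).
  by apply/funext => h; rewrite addrCA.
by rewrite /derivable /derive E.
Qed.

#[local] Opaque derive derivable.

Lemma MVT_line f v x (h : R) :
  (forall s, 0 <= s <= 1 -> derivable f ((s * h) *: v + x) v) ->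
  exists2 s, 0 <= s <= 1 & f (h *: v + x) - f x = h * 'D_v f ((s * h) *: v + x).
Proof.
move=> df.
have [s| |s s01] := @MVT R (fun s => f ((s * h) *: v + x))
    (fun s => h * 'D_v f ((s * h) *: v + x)) 0 1 ltr01.
- rewrite in_itv/= => /andP[s0 s1]; apply: is_derive_lineZ.
  by apply: df; rewrite !ltW.
- apply: derivable_within_continuous => s; rewrite in_itv/= => s01.
  by have [] := is_derive_lineZ (df s s01).
rewrite mul1r mul0r scale0r add0r subr0 mulr1 => E; exists s => //.
by move: s01; rewrite in_itv/= => /andP[s0 s1]; rewrite !ltW.
Qed.

(** Two applications of the mean value theorem. The usual factor 1/2 becomes some s in [0, 1], which
    is enough for a remainder of size h^2. *)
Lemma Taylor_line f v x (h : R) :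
  (forall s, 0 <= s <= 1 -> derivable f ((s * h) *: v + x) v) ->
  (forall s, 0 <= s <= 1 -> derivable ('D_v f) ((s * h) *: v + x) v) ->
  exists s s', [/\ 0 <= s <= 1, 0 <= s' <= 1 &
    f (h *: v + x) - f x - h * 'D_v f x =
    s * h ^+ 2 * 'D_v ('D_v f) ((s' * h) *: v + x)].
Proof.
move=> df ddf; have [s s01 ->] := MVT_line df.
have [|t t01 E] := @MVT_line ('D_v f) v x (s * h).
  move=> t t01; rewrite mulrA; apply: ddf.
  have /andP[s0 s1] := s01; have /andP[t0 t1] := t01.
  by rewrite mulr_ge0//= mulr_ile1.
exists s, (t * s); split; first exact: s01.
  have /andP[s0 s1] := s01; have /andP[t0 t1] := t01.
  by rewrite mulr_ge0//= mulr_ile1.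
rewrite -mulrBr E (mulrA t s h).
by move: ('D_v ('D_v f) (_ + _)) => d; rewrite expr2 !mulrA (mulrC h s).
Qed.

(** The mean value theorem is applied along v to z |-> f (h u + z) - f z, and then along u to the
    derivative of f in the direction v. *)
Lemma second_difference f u v x (h : R) :
  (forall s t, 0 <= s <= 1 -> 0 <= t <= 1 ->
    derivable f ((s * h) *: u + ((t * h) *: v + x)) v /\
    derivable ('D_v f) ((s * h) *: u + ((t * h) *: v + x)) u) ->
  exists s t, [/\ 0 <= s <= 1, 0 <= t <= 1 &
    f (h *: u + (h *: v + x)) - f (h *: v + x) - (f (h *: u + x) - f x) =
    h ^+ 2 * 'D_u ('D_v f) ((s * h) *: u + ((t * h) *: v + x))].
Proof.
move=> H; have i0 : 0 <= (0:R) <= 1 by lra.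
have i1 : 0 <= (1:R) <= 1 by lra.
pose g z := f (h *: u + z) - f z.
have dg t : 0 <= t <= 1 -> derivable g ((t * h) *: v + x) v.
  move=> t01; apply: derivableB.
    apply: (derive_translate _ _ _ _).2; have [dA _] := H 1 t i1 t01.
    by rewrite mul1r in dA; exact: dA.
  by have [dA _] := H 0 t i0 t01; rewrite mul0r scale0r add0r in dA; exact: dA.
have [t t01 E] := MVT_line dg.
have [|s s01 E2] := @MVT_line ('D_v f) u ((t * h) *: v + x) h.
  by move=> s s01; have [] := H s t s01 t01.
exists s, t; split=> //; rewrite -/(g (h *: v + x)) -/(g x) E expr2 -mulrA -E2.
congr (_ * _); rewrite deriveB.
- by rewrite (derive_translate _ _ _ _).1.
- apply: (derive_translate _ _ _ _).2; have [dA _] := H 1 t i1 t01.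
  by rewrite mul1r in dA; exact: dA.
- by have [dA _] := H 0 t i0 t01; rewrite mul0r scale0r add0r in dA; exact: dA.
Qed.

Lemma subrACA (a b c d : R) : a - b - (c - d) = a - c - (b - d).
Proof. by ring. Qed.

Lemma dist_lt_half (a b c eps : R) :
  `|a - c| < eps / 2 -> `|b - c| < eps / 2 -> `|a - b| < eps.
Proof.
by move=> ac bc; rewrite -(subrKA c) (le_lt_trans (ler_normD _ _))// (splitr eps)
  ltrD// distrC.
Qed.

(** The second difference is symmetric in u and v, and [second_difference] evaluates it in both
    orders. So the two mixed derivatives agree at two points near x, and their continuity at x
    concludes. *)
Lemma derive_comm (U : set V) f u v x : open U -> U x ->
  (forall y, U y -> [/\ derivable f y u, derivable f y v,
     derivable ('D_u f) y v & derivable ('D_v f) y u]) ->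
  {for x, continuous ('D_u ('D_v f))} -> {for x, continuous ('D_v ('D_u f))} ->
  'D_u ('D_v f) x = 'D_v ('D_u f) x.
Proof.
move=> oU Ux dU /cvgrPdist_lt cuv /cvgrPdist_lt cvu.
apply/eqP; rewrite -subr_eq0 -normr_eq0 eq_le normr_ge0 andbT.
apply/ler_addgt0Pr => eps eps0; rewrite add0r.
have eps2 : 0 < eps / 2 by rewrite divr_gt0.
have /nbhs_normP[r /= r0 Br] : \forall y \near x,
    [/\ U y, `|'D_u ('D_v f) x - 'D_u ('D_v f) y| < eps / 2 &
             `|'D_v ('D_u f) x - 'D_v ('D_u f) y| < eps / 2].
  have nU : \forall y \near x, U y by exact: open_nbhs_nbhs.
  by apply: filterS3 nU (cuv _ eps2) (cvu _ eps2) => y Uy A B; exact: And3 Uy A B.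
(* With h = r / N the parallelogram spanned by h u and h v at x lies in the ball of radius r. The
   summand 1 makes this strict and keeps N positive when u = v = 0. *)
pose N := `|u| + `|v| + 1.
have N0 : 0 < N by rewrite ltr_wpDl// addr_ge0.
pose h := r / N; have h0 : 0 < h by rewrite divr_gt0.
have seg w w' (s t : R) : `|w| + `|w'| + 1 = N -> 0 <= s <= 1 -> 0 <= t <= 1 ->
    ball_ Num.norm x r ((s * h) *: w + ((t * h) *: w' + x)).
  move=> ww' /andP[s0 s1] /andP[t0 t1].
  rewrite /ball_/= addrA opprD [- _ - x]addrC addNKr normrN.
  rewrite (le_lt_trans (ler_normD _ _))// !normrZ.
  rewrite (ger0_norm s0) (ger0_norm t0) -!normrM.
  rewrite -/h (gtr0_norm h0).
  apply: (@le_lt_trans _ _ (h * `|w| + h * `|w'|)).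
    by apply: lerD; apply: ler_wpM2r => //; apply: ler_piMl => //; apply: ltW.
  by rewrite -mulrDr /h -ww' mulrAC ltr_pdivrMr ?ww'// ltr_pM2l// -ww' ltrDl.
have Nvu : `|v| + `|u| + 1 = N by rewrite [ `|v| + _]addrC.
have [|s [t [s01 t01 E]]] := @second_difference f u v x h.
  move=> s t s01 t01; have [Uy _ _] := Br _ (seg u v s t erefl s01 t01).
  by have [_ A _ B] := dU _ Uy; exact: conj A B.
have [|s' [t' [s01' t01' E']]] := @second_difference f v u x h.
  move=> s' t' s01' t01'; have [Uy _ _] := Br _ (seg v u s' t' Nvu s01' t01').
  by have [A _ B _] := dU _ Uy; exact: conj A B.
have [_ A _] := Br _ (seg u v s t erefl s01 t01).
have [_ _ B] := Br _ (seg v u s' t' Nvu s01' t01').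
have E0 : f (h *: u + (h *: v + x)) - f (h *: v + x) - (f (h *: u + x) - f x) =
    f (h *: v + (h *: u + x)) - f (h *: u + x) - (f (h *: v + x) - f x).
  by rewrite [h *: v + (h *: u + x)]addrCA; exact: subrACA.
have h2 : h ^+ 2 != 0 by rewrite gt_eqF// exprn_gt0.
have EE := mulfI h2 (etrans (esym E) (etrans E0 E')).
rewrite EE in A; apply: ltW; exact: dist_lt_half A B.
Qed.

End Lines.

Section Words.
Context {R : realType} {V : normedModType R}.

Lemma word_deriv_smooth (I : Type) (e : I -> V) (U : set V) (f : V -> R) s :
  smooth_on e U f -> smooth_on e U (word_deriv e s f).
Proof.
elim/last_ind: s f => [f sf|s i IH f sf]; first exact: sf.
by rewrite word_deriv_rcons; apply: IH; exact: smooth_on_D.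
Qed.

Lemma word_deriv_perm (I : eqType) (e : I -> V) (U : set V) (f : V -> R) s t :
  open U -> smooth_on e U f -> perm_eq s t ->
  forall x, U x -> word_deriv e s f x = word_deriv e t f x.
Proof.
move=> oU sf; move: s t.
have swap i j s x : U x ->
    word_deriv e [:: i, j & s] f x = word_deriv e [:: j, i & s] f x.
  move=> Ux; have sg := word_deriv_smooth s sf.
  have [cij _] := sg [:: i; j] x Ux; have [cji _] := sg [:: j; i] x Ux.
  refine (@derive_comm _ _ U (word_deriv e s f) (e i) (e j) x oU Ux _ cij cji).
  move=> y Uy; have [_ d0] := sg [::] y Uy; have [_ di] := sg [:: i] y Uy.
  have [_ dj] := sg [:: j] y Uy; exact: (And4 (d0 i) (d0 j) (di j) (dj i)).
have front i s1 s2 : forall x, U x ->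
    word_deriv e (s1 ++ i :: s2) f x = word_deriv e (i :: s1 ++ s2) f x.
  elim: s1 => [|j s1 IH x Ux]; first by [].
  refine (etrans _ (swap j i (s1 ++ s2) x Ux)).
  by apply: near_eq_derive; exact: (near_eq_on oU Ux IH).
elim=> [|i s IH] t; first by move=> /perm_size/eqP; rewrite eq_sym size_eq0 => /eqP->.
move=> st; have it : i \in t by rewrite -(perm_mem st) mem_head.
case/splitPr: it st => t1 t2; rewrite perm_sym perm_catC/= perm_cons perm_catC perm_sym.
move=> /IH st x Ux; refine (etrans _ (esym (front i t1 t2 x Ux))).
by apply: near_eq_derive; exact: (near_eq_on oU Ux st).
Qed.

End Words.

Section Composition.
Context {R : realType} {V : normedModType R}.

(** Only one directional derivative of g is assumed, so the chain rule is applied to the restriction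
    of g to the line through x in the direction v. *)
Lemma is_derive_comp1 (F : R -> R) (g : V -> R) (x v : V) (a : R) :
  is_derive (g x) 1 F a -> derivable g x v ->
  is_derive x v (F \o g) (a * 'D_v g x).
Proof.
move=> dF dg; pose l h := g (h *: v + x).
have l0 : l 0 = g x by rewrite /l scale0r add0r.
have dl : is_derive (0 : R) (1 : R) l ('D_v g x).
  by have := @is_derive_line _ _ g v x 0; rewrite scale0r add0r => /(_ dg) dl; exact: dl.
have := @is_derive1_comp R F l 0 a ('D_v g x).
rewrite l0 => /(_ dF dl)[dc Ec]; split; first exact/derivable1P.
rewrite -Ec /derive.
have -> // : (fun h : R => h^-1 *: ((F \o g) (h *: v + x) - (F \o g) x)) =
    (fun h : R => h^-1 *: ((F \o l) (h *: (1 : R) + 0) - (F \o l) 0)).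
by apply/funext => h /=; rewrite l0 /l [h *: 1]mulr1 addr0.
Qed.

Lemma Ck_comp (I : Type) (e : I -> V) k (U : set V) (F : R -> R) (g : V -> R) :
  open U -> Ck (fun _ : unit => 1 : R) k setT F -> Ck e k U g -> Ck e k U (F \o g).
Proof.
move=> oU; elim: k F g => [|k IH] F g CF Cg.
  split=> // x Ux; apply: continuous_comp; first exact: Ck0 Cg _ Ux.
  exact: Ck0 CF _ _.
have dF (t : R) : is_derive t (1 : R) F ('D_(1 : R) F t).
  by apply: derivableP; have [_ /(_ tt)[dF _]] := CF; exact: dF.
have [cg dg] := Cg; split=> [x Ux|i].
  by apply: continuous_comp; [exact: cg|exact: Ck0 CF _ _].
have [dig Cig] := dg i; split=> [x Ux|].
  by have [dc _] := is_derive_comp1 (dF (g x)) (dig _ Ux); exact: dc.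
have [_ /(_ tt)[_ CdF]] := CF.
apply: (Ck_eq oU _ (Ck_mul oU (IH _ _ CdF (Ck_leq Cg)) Cig)) => x Ux.
by have [_ E] := is_derive_comp1 (dF (g x)) (dig _ Ux); exact: esym E.
Qed.

Lemma smooth_on_comp (I : Type) (e : I -> V) (U : set V) (F : R -> R) (g : V -> R) :
  open U -> smooth_on (fun _ : unit => 1 : R) setT F -> smooth_on e U g ->
  smooth_on e U (F \o g).
Proof.
by move=> oU /smooth_onP CF /smooth_onP Cg; apply/smooth_onP => k; exact: Ck_comp.
Qed.

Lemma smooth_cos_sin : smooth_on (fun _ : unit => 1 : R) setT (@cos R) /\
  smooth_on (fun _ : unit => 1 : R) setT (@sin R).
Proof.
suff H k : Ck (fun _ : unit => 1 : R) k setT (@cos R) /\ Ck (fun _ : unit => 1 : R) k setT (@sin R).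
  by split; apply/smooth_onP => k; have [] := H k.
have ds : 'D_(1 : R) (@sin R) = cos by apply/funext => t; have [_ ->] := is_derive_sin t.
have dc : 'D_(1 : R) (@cos R) = (fun t => - sin t).
  by apply/funext => t; have [_ ->] := is_derive_cos t.
elim: k => [|k [IHc IHs]].
  by split; split=> // x _; [exact: continuous_cos|exact: continuous_sin].
split; (split=> [x _|_]; first by [exact: continuous_cos|exact: continuous_sin]).
  split=> [t _|]; first by have [] := is_derive_cos t.
  by rewrite dc; apply: Ck_opp => //; exact: openT.
by split=> [t _|]; [have [] := is_derive_sin t|rewrite ds].
Qed.

End Composition.

(** * Complex-valued functions *)

Section Complex.
Context {R : realType}.
Local Notation C := R[i].
Local Notation cRe := (@complex.Re _).
Local Notation cIm := (@complex.Im _).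

Lemma ReM (z w : C) : cRe (z * w) = cRe z * cRe w - cIm z * cIm w.
Proof. by case: z; case: w. Qed.

Lemma ImM (z w : C) : cIm (z * w) = cRe z * cIm w + cIm z * cRe w.
Proof. by case: z; case: w. Qed.

Lemma ReD (z w : C) : cRe (z + w) = cRe z + cRe w.
Proof. by case: z; case: w. Qed.

Lemma ImD (z w : C) : cIm (z + w) = cIm z + cIm w.
Proof. by case: z; case: w. Qed.

Lemma ReN (z : C) : cRe (- z) = - cRe z. Proof. by case: z. Qed.
Lemma ImN (z : C) : cIm (- z) = - cIm z. Proof. by case: z. Qed.

Lemma complex_eq (z w : C) : cRe z = cRe w -> cIm z = cIm w -> z = w.
Proof. by case: z w => [a b] [c d] /= -> ->. Qed.

Lemma normc_ge0 (z : C) : 0 <= normc z.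
Proof. by case: z => a b; exact: sqrtr_ge0. Qed.

Lemma normc_Re (z : C) : `|cRe z| <= normc z.
Proof.
case: z => a b /=; rewrite -sqrtr_sqr ler_sqrt ?addr_ge0 ?sqr_ge0//.
by rewrite lerDl sqr_ge0.
Qed.

Lemma normc_Im (z : C) : `|cIm z| <= normc z.
Proof.
case: z => a b /=; rewrite -sqrtr_sqr ler_sqrt ?addr_ge0 ?sqr_ge0//.
by rewrite lerDr sqr_ge0.
Qed.

Lemma normc_real (x : R) : normc (x%:C)%C = `|x|.
Proof. by rewrite /normc/= expr0n addr0 sqrtr_sqr. Qed.

Lemma normc_le (z : C) : normc z <= `|cRe z| + `|cIm z|.
Proof.
have -> : z = (cRe z)%:C%C + (cIm z)%:C%C * 'i%C.
  by case: z => a b; apply: complex_eq; rewrite /= ?ReD ?ImD ?ReM ?ImM/=; ring.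
rewrite (le_trans (le_normcD _ _))// normcM !normc_real !ReD !ImD !ReM !ImM/=.
by rewrite expr0n expr1n add0r sqrtr1 !(mulr0,mulr1,mul0r,subr0,add0r,addr0).
Qed.

Lemma normc_expi (t : R) : normc (expi t) = 1.
Proof. by rewrite /expi /normc cos2Dsin2 sqrtr1. Qed.

Section CalculusC.
Context {V : normedModType R}.
Implicit Types (f g : V -> C) (U : set V) (v x : V).

Definition cderivable f x v := derivable (cRe \o f) x v /\ derivable (cIm \o f) x v.

Lemma cderiv_eq U f g v x : open U -> (forall y, U y -> f y = g y) -> U x ->
  cderiv v f x = cderiv v g x.
Proof.
by move=> oU fg Ux; congr Complex; apply: near_eq_derive;
   apply: near_eq_on oU Ux _ => y Uy /=; rewrite fg.
Qed.

Lemma cderivD f g v x : cderivable f x v -> cderivable g x v ->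
  cderiv v (fun y => f y + g y) x = cderiv v f x + cderiv v g x.
Proof.
move=> [f1 f2] [g1 g2]; rewrite /cderiv; apply: complex_eq; rewrite ?ReD ?ImD/=.
  rewrite -deriveD//; congr ('D_v _ x); apply/funext => y /=; exact: ReD.
rewrite -deriveD//; congr ('D_v _ x); apply/funext => y /=; exact: ImD.
Qed.

Lemma deriveMr_Ml (p q : V -> R) v x : derivable p x v -> derivable q x v ->
  'D_v (p * q) x = 'D_v p x * q x + p x * 'D_v q x.
Proof.
by move=> dp dq; rewrite (deriveM dp dq) addrC; congr (_ + _); exact: mulrC.
Qed.

Lemma cderivM f g v x : cderivable f x v -> cderivable g x v ->
  cderiv v (fun y => f y * g y) x = cderiv v f x * g x + f x * cderiv v g x.
Proof.
move=> [f1 f2] [g1 g2]; rewrite /cderiv.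
have -> : cRe \o (fun y => f y * g y) =
    (cRe \o f) * (cRe \o g) - (cIm \o f) * (cIm \o g).
  by apply/funext => y /=; rewrite ReM.
have -> : cIm \o (fun y => f y * g y) =
    (cRe \o f) * (cIm \o g) + (cIm \o f) * (cRe \o g).
  by apply/funext => y /=; rewrite ImM.
rewrite (deriveB (derivableM f1 g1) (derivableM f2 g2)).
rewrite (deriveD (derivableM f1 g2) (derivableM f2 g1)).
rewrite (deriveMr_Ml f1 g1) (deriveMr_Ml f2 g2) (deriveMr_Ml f1 g2) (deriveMr_Ml f2 g1).
rewrite [(cRe \o f) x]/(cRe (f x)) [(cIm \o f) x]/(cIm (f x)).
rewrite [(cRe \o g) x]/(cRe (g x)) [(cIm \o g) x]/(cIm (g x)).
move: ('D_v (cRe \o f) x) ('D_v (cIm \o f) x) ('D_v (cRe \o g) x)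
  ('D_v (cIm \o g) x) (f x) (g x) => a b c d [z1 z2] [w1 w2].
by apply: complex_eq => /=; ring.
Qed.

Lemma cderiv_cst (c : C) v x : cderiv v (fun=> c) x = 0.
Proof.
rewrite /cderiv (_ : cRe \o _ = cst (cRe c)); last exact/funext.
by rewrite (_ : cIm \o _ = cst (cIm c)) ?derive_cst//; exact/funext.
Qed.

Lemma cderiv_real (g : V -> R) v x :
  cderiv v (fun y => (g y)%:C%C) x = ('D_v g x)%:C%C.
Proof.
rewrite /cderiv; apply: complex_eq => /=.
  by congr ('D_v _ x); apply/funext.
by rewrite (_ : cIm \o _ = cst 0) ?derive_cst//; apply/funext.
Qed.

Section Smooth.
Context (I : Type) (e : I -> V).

Lemma csmooth_cderivable U f i x : csmooth_on e U f -> U x -> cderivable f x (e i).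
Proof. by move=> [sr si] Ux; split; [exact: smooth_on_derivable sr _ Ux|exact: smooth_on_derivable si _ Ux]. Qed.

Lemma csmooth_on_D U f i : csmooth_on e U f -> csmooth_on e U (cderiv (e i) f).
Proof. by move=> [sr si]; split; exact: smooth_on_D. Qed.

Lemma csmooth_on_eq U f g : open U -> (forall x, U x -> f x = g x) ->
  csmooth_on e U f -> csmooth_on e U g.
Proof.
by move=> oU fg [sr si]; split; [apply: (smooth_on_eq oU _ sr)|apply: (smooth_on_eq oU _ si)];
   move=> x Ux /=; rewrite fg.
Qed.

Lemma csmooth_on_sub U U' f : U' `<=` U -> csmooth_on e U f -> csmooth_on e U' f.
Proof. by move=> U'U [sr si]; split; apply: (smooth_on_sub U'U). Qed.

Lemma csmooth_onU U U' f : csmooth_on e U f -> csmooth_on e U' f ->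
  csmooth_on e (U `|` U') f.
Proof. by move=> [? ?] [? ?]; split; exact: smooth_onU. Qed.

Lemma csmooth_on_cst U (c : C) : csmooth_on e U (fun=> c).
Proof. by split; exact: smooth_on_cst. Qed.

Lemma csmooth_on_add U f g : open U -> csmooth_on e U f -> csmooth_on e U g ->
  csmooth_on e U (fun x => f x + g x).
Proof.
move=> oU [f1 f2] [g1 g2]; split.
  by apply: (smooth_on_eq oU _ (smooth_on_add oU f1 g1)) => x _ /=; rewrite ReD.
by apply: (smooth_on_eq oU _ (smooth_on_add oU f2 g2)) => x _ /=; rewrite ImD.
Qed.

Lemma csmooth_on_opp U f : open U -> csmooth_on e U f -> csmooth_on e U (fun x => - f x).
Proof.
move=> oU [f1 f2]; split.
  by apply: (smooth_on_eq oU _ (smooth_on_opp oU f1)) => x _ /=; rewrite ReN.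
by apply: (smooth_on_eq oU _ (smooth_on_opp oU f2)) => x _ /=; rewrite ImN.
Qed.

Lemma csmooth_on_mul U f g : open U -> csmooth_on e U f -> csmooth_on e U g ->
  csmooth_on e U (fun x => f x * g x).
Proof.
move=> oU [f1 f2] [g1 g2]; split.
  apply: (smooth_on_eq oU _ (smooth_on_add oU (smooth_on_mul oU f1 g1)
    (smooth_on_opp oU (smooth_on_mul oU f2 g2)))) => x _ /=; by rewrite ReM.
apply: (smooth_on_eq oU _ (smooth_on_add oU (smooth_on_mul oU f1 g2)
    (smooth_on_mul oU f2 g1))) => x _ /=; by rewrite ImM.
Qed.

Lemma csmooth_on_real U (g : V -> R) : smooth_on e U g ->
  csmooth_on e U (fun x => (g x)%:C%C).
Proof. by move=> sg; split; [exact: sg|exact: smooth_on_cst]. Qed.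

Lemma csmooth_on_sum (J : Type) (r : seq J) U (F : J -> V -> C) : open U ->
  (forall j, csmooth_on e U (F j)) ->
  csmooth_on e U (fun x => \sum_(j <- r) F j x).
Proof.
move=> oU sF; elim: r => [|j r IH].
  by apply: (csmooth_on_eq oU _ (csmooth_on_cst U 0)) => x _; rewrite big_nil.
by apply: (csmooth_on_eq oU _ (csmooth_on_add oU (sF j) IH)) => x _; rewrite big_cons.
Qed.

Lemma csmooth_on_expi U (g : V -> R) : open U -> smooth_on e U g ->
  csmooth_on e U (fun x => expi (g x)).
Proof.
by move=> oU sg; have [sc ss] := @smooth_cos_sin R; split; exact: smooth_on_comp.
Qed.

(** Words keep the order of differentiation, so that concatenation is exactly composition and most
    inductions need no symmetry of derivatives. *)
Definition cword_deriv (s : seq I) f : V -> C := foldr (fun i => cderiv (e i)) f s.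

Lemma Re_cword s f : cRe \o cword_deriv s f = word_deriv e s (cRe \o f).
Proof. by elim: s => // i s IH; rewrite /= -IH; apply/funext. Qed.

Lemma Im_cword s f : cIm \o cword_deriv s f = word_deriv e s (cIm \o f).
Proof. by elim: s => // i s IH; rewrite /= -IH; apply/funext. Qed.

Lemma cword_deriv_rcons s i f :
  cword_deriv (rcons s i) f = cword_deriv s (cderiv (e i) f).
Proof. by rewrite /cword_deriv foldr_rcons. Qed.

Lemma cword_deriv_cat s t f :
  cword_deriv (s ++ t) f = cword_deriv s (cword_deriv t f).
Proof. by rewrite /cword_deriv foldr_cat. Qed.

Lemma cword_deriv_eq U f g s : open U -> (forall y, U y -> f y = g y) ->
  forall x, U x -> cword_deriv s f x = cword_deriv s g x.
Proof.
by move=> oU fg; elim: s => //= i s IH x Ux; exact: cderiv_eq Ux.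
Qed.

Lemma csmooth_on_word U f s : csmooth_on e U f -> csmooth_on e U (cword_deriv s f).
Proof.
by elim: s => [|i s IH] sf; [exact: sf|apply: csmooth_on_D; exact: IH sf].
Qed.

End Smooth.

Lemma cderiv_expi (g : V -> R) v x : derivable g x v ->
  cderiv v (fun y => expi (g y)) x = Complex 0 1 * ('D_v g x)%:C%C * expi (g x).
Proof.
move=> dg; rewrite /cderiv; apply: complex_eq; rewrite !(ReM,ImM)/=.
  have [_ E] := is_derive_comp1 (is_derive_cos (g x)) dg.
  rewrite (_ : cRe \o _ = cos \o g) ?E//; ring.
have [_ E] := is_derive_comp1 (is_derive_sin (g x)) dg.
rewrite (_ : cIm \o _ = sin \o g) ?E//; ring.
Qed.

Lemma cword_deriv_perm (I : eqType) (e : I -> V) U f s t :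
  open U -> csmooth_on e U f -> perm_eq s t ->
  forall x, U x -> cword_deriv e s f x = cword_deriv e t f x.
Proof.
move=> oU [f1 f2] st x Ux; apply: complex_eq.
  by have /(congr1 (@^~ x))/= -> := Re_cword e s f;
     have /(congr1 (@^~ x))/= -> := Re_cword e t f; exact: (word_deriv_perm oU).
by have /(congr1 (@^~ x))/= -> := Im_cword e s f;
   have /(congr1 (@^~ x))/= -> := Im_cword e t f; exact: (word_deriv_perm oU).
Qed.

Lemma multi_cderivE (I : finType) (e : I -> V) (alpha : I -> nat) f :
  multi_cderiv e alpha f =
  cword_deriv e (flatten [seq nseq (alpha i) i | i <- enum I]) f.
Proof.
rewrite /multi_cderiv; elim: (enum I) => //= i s ->.
by rewrite cword_deriv_cat; elim: (alpha i) => //= n ->.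
Qed.

(** The bridge from words, on which inductions run, to multi-indices, in which the seminorms are
    stated. This is where the symmetry of derivatives is used. *)
Lemma multi_cderiv_word (I : finType) (e : I -> V) U f s x :
  open U -> csmooth_on e U f -> U x ->
  cword_deriv e s f x = multi_cderiv e (fun i => count_mem i s) f x.
Proof.
move=> oU sf Ux; rewrite multi_cderivE; apply: cword_deriv_perm oU sf _ _ Ux.
apply/allP => i _ /=; apply/eqP; rewrite count_flatten -map_comp.
rewrite (eq_map (g := fun j => (j == i) * count_mem j s)%N); last first.
  by move=> j /=; rewrite count_nseq.
by rewrite sumnE big_map big_enum/= (bigD1 i)//= eqxx mul1n big1 ?addn0// => j /negPf->.
Qed.

Lemma sum_count_mem (I : finType) (s : seq I) :
  (\sum_i count_mem i s)%N = size s.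
Proof.
elim: s => [|j s IH]; first by rewrite big1.
rewrite /= big_split/= IH (bigD1 j)//= eqxx big1 ?addn0 ?add1n// => i.
by rewrite eq_sym => /negPf->.
Qed.

End CalculusC.
End Complex.

(** * Moderate and negligible nets *)

Section Scales.
Context {R : realType}.
Implicit Types A B : R -> R.

Definition powO A (b : R) := exists M : R, \forall e \near 0^'+, A e <= M * e `^ b.

(** Nonnegativity is imposed at every t, also outside ]0, 1], so that such bounds can be added and
    multiplied without side conditions. *)
Definition tempered A := (forall t, 0 <= A t) /\ exists N : nat, powO A (- N%:R).

Definition rapid A := (forall t, 0 <= A t) /\ forall q : nat, powO A q%:R.

Lemma powO_mul A B a b : (forall t, 0 <= A t) -> (forall t, 0 <= B t) ->
  powO A a -> powO B b -> powO (fun t => A t * B t) (a + b).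
Proof.
move=> A0 B0 [M HM] [N HN]; exists (M * N); near=> e.
rewrite powRD; last by apply/implyP => _; near: e; exact: nbhs_right_neq.
by rewrite mulrACA ler_pM//; near: e.
Unshelve. all: by end_near. Qed.

Lemma powO_le A a b : (forall t, 0 <= A t) -> b <= a -> powO A a -> powO A b.
Proof.
move=> A0 ba [M HM]; exists `|M|; near=> e.
have e0 : 0 < e by near: e; exact: nbhs_right_gt.
have e1 : e <= 1 by near: e; exact: nbhs_right_le.
have : A e <= M * e `^ a by near: e.
move/le_trans; apply; rewrite (le_trans (ler_wpM2r _ (ler_norm M)))// ?powR_ge0//.
by rewrite ler_wpM2l// ger_powR// e0.
Unshelve. all: by end_near. Qed.

Lemma powO_add A B a : powO A a -> powO B a -> powO (fun t => A t + B t) a.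
Proof.
move=> [M HM] [N HN]; exists (M + N); near=> e.
by rewrite mulrDl lerD//; near: e.
Unshelve. all: by end_near. Qed.

Lemma tempered_add A B : tempered A -> tempered B -> tempered (fun t => A t + B t).
Proof.
move=> [A0 [N HN]] [B0 [M HM]]; split=> [t|]; first exact: addr_ge0.
exists (N + M)%N; apply: powO_add; [apply: powO_le HN|apply: powO_le HM] => //;
  by rewrite lerN2 ler_nat ?leq_addr ?leq_addl.
Qed.

Lemma tempered_mul A B : tempered A -> tempered B -> tempered (fun t => A t * B t).
Proof.
move=> [A0 [N HN]] [B0 [M HM]]; split=> [t|]; first exact: mulr_ge0.
by exists (N + M)%N; rewrite natrD opprD; exact: powO_mul.
Qed.

Lemma rapid_add A B : rapid A -> rapid B -> rapid (fun t => A t + B t).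
Proof.
move=> [A0 HA] [B0 HB]; split=> [t|q]; first exact: addr_ge0.
exact: powO_add.
Qed.

Lemma rapid_mul A B : tempered A -> rapid B -> rapid (fun t => A t * B t).
Proof.
move=> [A0 [N HN]] [B0 HB]; split=> [t|q]; first exact: mulr_ge0.
have := powO_mul A0 B0 HN (HB (N + q)%N).
by rewrite natrD addrA addNr add0r.
Qed.

Lemma tempered_cst c : 0 <= c -> tempered (fun=> c).
Proof.
by move=> c0; split=> //; exists 0%N, c; near=> e; rewrite oppr0 powRr0 mulr1.
Unshelve. all: by end_near. Qed.

Lemma rapid0 : rapid (fun=> 0).
Proof. by split=> // q; exists 0; near=> e; rewrite mul0r.
Unshelve. all: by end_near. Qed.

Lemma rapid_tempered A : rapid A -> tempered A.
Proof. by move=> [A0 HA]; split=> //; exists 0%N; rewrite oppr0; exact: HA 0%N. Qed.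

End Scales.

Lemma normc_realB {R : realType} (a b : R) : normc ((a%:C)%C - (b%:C)%C) = `|a - b|.
Proof. by rewrite -normc_real; congr normc; apply: complex_eq => //=; rewrite oppr0 addr0. Qed.

Section Rel.
Context {R : realType} {E : Type} (eps : E -> R) {V : normedModType R}.
Local Notation C := R[i].
Context {I : Type} (e_ : I -> V) (wt : I -> R).
Context (D : set V) (KK : set (set V)) (J : V -> R).
Implicit Types (f g : E -> V -> C) (mu nu : R).

Definition nderiv i f : E -> V -> C := fun e => cderiv (e_ i) (f e).

Definition nsmooth f := forall e, csmooth_on e_ D (f e).

(** A and B see the index e only through [eps e]. When E is larger than the interval of the
    epsilons, the bounds are thereby uniform in the additional parameters. *)
Definition bound mu f g := forall K, KK K -> exists A B,
  [/\ tempered A, rapid B & forall e w, K w ->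
    [/\ normc (f e w) <= A (eps e) * J w `^ mu,
        normc (g e w) <= A (eps e) * J w `^ mu &
        normc (f e w - g e w) <= B (eps e) * J w `^ mu]].

(* [nrel k mu f g]: the nets f and g of symbols of order mu are moderate and
   equal up to a negligible net, derivatives being considered up to order k;
   f is moderate when [nrel k mu f f]. *)
Fixpoint nrel k mu f g : Prop := bound mu f g /\
  if k is k'.+1 then forall i, nrel k' (mu + wt i) (nderiv i f) (nderiv i g)
  else True.

Hypothesis oD : open D.
Hypothesis KD : forall K, KK K -> K `<=` D.
Hypothesis J1 : forall w, D w -> 1 <= J w.

Let J0 w : D w -> 0 < J w. Proof. by move/J1; exact: lt_le_trans. Qed.

Lemma nsmooth_D f i : nsmooth f -> nsmooth (nderiv i f).
Proof. by move=> sf e; exact: csmooth_on_D. Qed.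

Lemma nsmooth_add f g : nsmooth f -> nsmooth g -> nsmooth (fun e w => f e w + g e w).
Proof. by move=> sf sg e; exact: csmooth_on_add. Qed.

Lemma nsmooth_mul f g : nsmooth f -> nsmooth g -> nsmooth (fun e w => f e w * g e w).
Proof. by move=> sf sg e; exact: csmooth_on_mul. Qed.

Lemma rel_bound k mu f g : nrel k mu f g -> bound mu f g.
Proof. by case: k => [|k] []. Qed.

Lemma rel_eq k mu f g f' g' : (forall e w, D w -> f e w = f' e w) ->
  (forall e w, D w -> g e w = g' e w) -> nrel k mu f g -> nrel k mu f' g'.
Proof.
have beq mu' f1 g1 f1' g1' : (forall e w, D w -> f1 e w = f1' e w) ->
    (forall e w, D w -> g1 e w = g1' e w) -> bound mu' f1 g1 -> bound mu' f1' g1'.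
  move=> ff gg b K KK_; have [A [B [tA rB H]]] := b _ KK_.
  exists A, B; split=> // e w Kw; have Dw := KD KK_ Kw.
  by rewrite -ff// -gg//; exact: H.
elim: k mu f g f' g' => [|k IH] mu f g f' g' ff gg [b d].
  by split=> //; exact: beq b.
split=> [|i]; first exact: beq b.
apply: IH (d i) => e w Dw; apply: (cderiv_eq _ oD _ Dw) => y Dy;
  [exact: ff|exact: gg].
Qed.

Lemma rel_leq k mu f g : nrel k.+1 mu f g -> nrel k mu f g.
Proof. by elim: k mu f g => [|k IH] mu f g [b d]; split=> // i; exact: IH. Qed.

Lemma rel_mono k mu nu f g : mu <= nu -> nrel k mu f g -> nrel k nu f g.
Proof.
have bm mu' nu' f1 g1 : mu' <= nu' -> bound mu' f1 g1 -> bound nu' f1 g1.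
  move=> mn b K KK_; have [A [B [tA rB H]]] := b _ KK_.
  exists A, B; split=> // e w Kw; have Dw := KD KK_ Kw.
  have [h1 h2 h3] := H e w Kw.
  have JJ : J w `^ mu' <= J w `^ nu' by apply: ler_powR => //; exact: J1.
  have [A0 _] := tA; have [B0 _] := rB.
  by split; [move: h1|move: h2|move: h3] => /le_trans; apply; exact: ler_wpM2l.
elim: k mu nu f g => [|k IH] mu nu f g mn [b d]; split=> //; try exact: bm b.
by move=> i; apply: IH (d i); rewrite lerD2r.
Qed.

Lemma rel_sym k mu f g : nrel k mu f g -> nrel k mu g f.
Proof.
have bs mu' f1 g1 : bound mu' f1 g1 -> bound mu' g1 f1.
  move=> b K KK_; have [A [B [tA rB H]]] := b _ KK_.
  exists A, B; split=> // e w Kw; have [h1 h2 h3] := H e w Kw.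
  by split=> //; rewrite -opprB normcN.
elim: k mu f g => [|k IH] mu f g [b d]; split=> //; try exact: bs b.
by move=> i; exact: IH (d i).
Qed.

Lemma rel_trans k mu f g h : nrel k mu f g -> nrel k mu g h -> nrel k mu f h.
Proof.
have bt mu' f1 g1 h1 : bound mu' f1 g1 -> bound mu' g1 h1 -> bound mu' f1 h1.
  move=> b b' K KK_; have [A [B [tA rB H]]] := b _ KK_.
  have [A' [B' [tA' rB' H']]] := b' _ KK_.
  exists (fun t => A t + A' t), (fun t => B t + B' t).
  split; [exact: tempered_add|exact: rapid_add|move=> e w Kw].
  have [b1 b2 b3] := H e w Kw; have [b1' b2' b3'] := H' e w Kw.
  have [A0 _] := tA; have [A0' _] := tA'; rewrite !mulrDl; split.
  - by rewrite (le_trans b1)// lerDl mulr_ge0// powR_ge0.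
  - by rewrite (le_trans b2')// lerDr mulr_ge0// powR_ge0.
  - rewrite -(subrKA (g1 e w)) (le_trans (le_normcD _ _))//.
    by rewrite lerD.
elim: k mu f g h => [|k IH] mu f g h [b d] [b' d']; split=> //; try exact: bt b b'.
by move=> i; exact: IH (d i) (d' i).
Qed.

Lemma bound_add mu f f' g g' : bound mu f f' -> bound mu g g' ->
  bound mu (fun e w => f e w + g e w) (fun e w => f' e w + g' e w).
Proof.
move=> b b' K KK_; have [A [B [tA rB H]]] := b _ KK_.
have [A' [B' [tA' rB' H']]] := b' _ KK_.
exists (fun t => A t + A' t), (fun t => B t + B' t).
split; [exact: tempered_add|exact: rapid_add|move=> e w Kw].
have [b1 b2 b3] := H e w Kw; have [b1' b2' b3'] := H' e w Kw.
rewrite !mulrDl; split.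
- by rewrite (le_trans (le_normcD _ _))// lerD.
- by rewrite (le_trans (le_normcD _ _))// lerD.
by rewrite opprD addrACA (le_trans (le_normcD _ _))// lerD.
Qed.

Lemma bound_mul mu nu f f' g g' : bound mu f f' -> bound nu g g' ->
  bound (mu + nu) (fun e w => f e w * g e w) (fun e w => f' e w * g' e w).
Proof.
move=> b b' K KK_; have [A [B [tA rB H]]] := b _ KK_.
have [A' [B' [tA' rB' H']]] := b' _ KK_.
have [A0 _] := tA; have [A0' _] := tA'; have [B0 _] := rB; have [B0' _] := rB'.
exists (fun t => A t * A' t), (fun t => A' t * B t + A t * B' t).
split; [exact: tempered_mul|by apply: rapid_add; exact: rapid_mul|move=> e w Kw].
have [b1 b2 b3] := H e w Kw; have [b1' b2' b3'] := H' e w Kw.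
have Jw : J w != 0 by rewrite gt_eqF// J0//; exact: KD Kw.
rewrite powRD ?Jw ?implybT//; set a := J w `^ mu in b1 b2 b3 *; set c := J w `^ nu in b1' b2' b3' *.
have a0 : 0 <= a by exact: powR_ge0. have c0 : 0 <= c by exact: powR_ge0.
split.
- by rewrite mulrACA normcM ler_pM// normc_ge0.
- by rewrite mulrACA normcM ler_pM// normc_ge0.
have -> : f e w * g e w - f' e w * g' e w =
    (f e w - f' e w) * g e w + f' e w * (g e w - g' e w).
  by rewrite mulrBl mulrBr addrA subrK.
rewrite (le_trans (le_normcD _ _))// !normcM mulrDl lerD//.
  by rewrite [A' _ * _]mulrC mulrACA ler_pM// normc_ge0.
by rewrite mulrACA ler_pM// normc_ge0.
Qed.

Lemma rel_add k mu f f' g g' : nsmooth f -> nsmooth f' -> nsmooth g -> nsmooth g' ->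
  nrel k mu f f' -> nrel k mu g g' ->
  nrel k mu (fun e w => f e w + g e w) (fun e w => f' e w + g' e w).
Proof.
elim: k mu f f' g g' => [|k IH] mu f f' g g' sf sf' sg sg' [b d] [b' d'].
  by split=> //; exact: bound_add.
split=> [|i]; first exact: bound_add.
apply: rel_eq (IH _ _ _ _ _ (nsmooth_D i sf) (nsmooth_D i sf') (nsmooth_D i sg)
  (nsmooth_D i sg') (d i) (d' i)).
  move=> e w Dw; apply: esym; apply: cderivD.
    exact: csmooth_cderivable (sf e) Dw.
  exact: csmooth_cderivable (sg e) Dw.
move=> e w Dw; apply: esym; apply: cderivD.
  exact: csmooth_cderivable (sf' e) Dw.
exact: csmooth_cderivable (sg' e) Dw.
Qed.

Lemma rel_mul k mu nu f f' g g' : nsmooth f -> nsmooth f' -> nsmooth g -> nsmooth g' ->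
  nrel k mu f f' -> nrel k nu g g' ->
  nrel k (mu + nu) (fun e w => f e w * g e w) (fun e w => f' e w * g' e w).
Proof.
elim: k mu nu f f' g g' => [|k IH] mu nu f f' g g' sf sf' sg sg' r r'.
  by have [b _] := r; have [b' _] := r'; split=> //; exact: bound_mul.
have [b d] := r; have [b' d'] := r'; split=> [|i]; first exact: bound_mul.
have h1 := IH _ _ _ _ _ _ (nsmooth_D i sf) (nsmooth_D i sf') sg sg' (d i) (rel_leq r').
have h2 := IH _ _ _ _ _ _ sf sf' (nsmooth_D i sg) (nsmooth_D i sg') (rel_leq r) (d' i).
rewrite addrAC in h1; rewrite addrA in h2.
apply: rel_eq (rel_add (nsmooth_mul (nsmooth_D i sf) sg)
  (nsmooth_mul (nsmooth_D i sf') sg') (nsmooth_mul sf (nsmooth_D i sg))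
  (nsmooth_mul sf' (nsmooth_D i sg')) h1 h2).
  move=> e w Dw; apply: esym; apply: cderivM.
    exact: csmooth_cderivable (sf e) Dw.
  exact: csmooth_cderivable (sg e) Dw.
move=> e w Dw; apply: esym; apply: cderivM.
  exact: csmooth_cderivable (sf' e) Dw.
exact: csmooth_cderivable (sg' e) Dw.
Qed.

Lemma nsmooth_cst (c : E -> C) : nsmooth (fun e _ => c e).
Proof. by move=> e; exact: csmooth_on_cst. Qed.

Lemma rel0 k mu : nrel k mu (fun _ _ => 0) (fun _ _ => 0).
Proof.
have b mu' : bound mu' (fun _ _ => 0) (fun _ _ => 0).
  move=> K _; exists (fun=> 0), (fun=> 0).
  split=> [||e w _]; [exact: tempered_cst|exact: rapid0|].
  by rewrite mul0r subr0 normc0.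
elim: k mu => [|k IH] mu; split=> // i.
by apply: rel_eq (IH _) => e w Dw; rewrite /nderiv cderiv_cst.
Qed.

Lemma rel_cst k mu (c : C) : 0 <= mu -> nrel k mu (fun _ _ => c) (fun _ _ => c).
Proof.
move=> mu0; apply: (rel_mono mu0) => {mu mu0}.
have b : bound 0 (fun _ _ => c) (fun _ _ => c).
  move=> K _; exists (fun=> normc c), (fun=> 0).
  split; [by apply: tempered_cst; exact: normc_ge0|exact: rapid0|move=> e w _].
  by rewrite powRr0 mulr1 subrr normc0 mul0r.
case: k => [|k]; split=> // i.
by apply: rel_eq (rel0 k _) => e w Dw; rewrite /nderiv cderiv_cst.
Qed.

Lemma rel_opp k mu f f' : nsmooth f -> nsmooth f' ->
  nrel k mu f f' -> nrel k mu (fun e w => - f e w) (fun e w => - f' e w).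
Proof.
move=> sf sf' r.
have := rel_mul (nsmooth_cst (fun=> -1)) (nsmooth_cst (fun=> -1)) sf sf' (rel_cst k (-1) (lexx 0)) r.
by rewrite add0r; apply: rel_eq => e w _; rewrite mulN1r.
Qed.

Lemma nsmooth_sum (T : Type) (r : seq T) (F : T -> E -> V -> C) :
  (forall j, nsmooth (F j)) -> nsmooth (fun e w => \sum_(j <- r) F j e w).
Proof. by move=> sF e; apply: csmooth_on_sum => // j; exact: sF. Qed.

Lemma rel_sum (T : Type) (r : seq T) k mu (F F' : T -> E -> V -> C) :
  (forall j, nsmooth (F j)) -> (forall j, nsmooth (F' j)) ->
  (forall j, nrel k mu (F j) (F' j)) ->
  nrel k mu (fun e w => \sum_(j <- r) F j e w) (fun e w => \sum_(j <- r) F' j e w).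
Proof.
move=> sF sF' rF; elim: r => [|j r IH].
  by apply: rel_eq (rel0 k mu) => e w _; rewrite big_nil.
apply: rel_eq (rel_add (sF j) (sF' j) _ _ (rF j) IH); do ?exact: nsmooth_sum.
  by move=> e w _; rewrite big_cons.
by move=> e w _; rewrite big_cons.
Qed.

(** Moderateness of the inverses is the hypothesis. Their difference is 1/g * 1/g' * (g' - g),
    moderate times negligible, and the derivatives follow from the rule - g' / g^2 by induction on
    k. The order 0 of all factors keeps the order at 0. *)
Lemma rel_inv k (g g' : E -> V -> R) :
  (forall e, smooth_on e_ D (g e)) -> (forall e, smooth_on e_ D (g' e)) ->
  (forall e w, D w -> g e w != 0 /\ g' e w != 0) ->
  (forall K, KK K -> exists2 A, tempered A & forall e w, K w ->
     `|(g e w)^-1| <= A (eps e) /\ `|(g' e w)^-1| <= A (eps e)) ->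
  nrel k 0 (fun e w => (g e w)%:C%C) (fun e w => (g' e w)%:C%C) ->
  nrel k 0 (fun e w => (g e w)^-1%:C%C) (fun e w => (g' e w)^-1%:C%C).
Proof.
move=> sg sg' gn0 H.
have b : bound 0 (fun e w => (g e w)%:C%C) (fun e w => (g' e w)%:C%C) ->
    bound 0 (fun e w => (g e w)^-1%:C%C) (fun e w => (g' e w)^-1%:C%C).
  move=> b K KK_; have [A tA HA] := H _ KK_; have [A' [B [_ rB HB]]] := b _ KK_.
  exists A, (fun t => A t * A t * B t).
  split; [by []|by apply: rapid_mul => //; exact: tempered_mul|move=> e w Kw].
  have [h1 h2] := HA e w Kw; have [_ _] := HB e w Kw.
  have [g0 g'0] := gn0 e w (KD KK_ Kw).
  rewrite !powRr0 !mulr1 !normc_realB !normc_real => h3; split=> //.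
  have -> : (g e w)^-1 - (g' e w)^-1 = (g e w)^-1 * (g' e w)^-1 * (g' e w - g e w).
    by field; rewrite g0 g'0.
  by rewrite !normrM ler_pM ?mulr_ge0// ?ler_pM// distrC.
have sc (h : E -> V -> R) : (forall e, smooth_on e_ D (h e)) ->
    nsmooth (fun e w => (h e w)%:C%C) by move=> sh e; exact: csmooth_on_real.
have sv (h : E -> V -> R) : (forall e w, D w -> h e w != 0) ->
    (forall e, smooth_on e_ D (h e)) -> nsmooth (fun e w => (h e w)^-1%:C%C).
  by move=> h0 sh; apply: (sc (fun e w => (h e w)^-1)) => e; apply: smooth_on_inv => //; exact: h0.
have s1 := sv _ (fun e w Dw => (gn0 e w Dw).1) sg.
have s2 := sv _ (fun e w Dw => (gn0 e w Dw).2) sg'.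
have dv (h : E -> V -> R) i e w : D w -> h e w != 0 -> smooth_on e_ D (h e) ->
   (- nderiv i (fun e w => (h e w)%:C%C) e w) * ((h e w)^-1%:C%C * (h e w)^-1%:C%C) =
   nderiv i (fun e w => (h e w)^-1%:C%C) e w.
  move=> Dw h0 sh; rewrite /nderiv !cderiv_real.
  have dh : derivable (h e) w (e_ i) by exact: smooth_on_derivable sh _ Dw.
  rewrite (deriveV h0 dh); move: ('D_(e_ i) (h e) w) => d.
  have -> : - h e w ^- 2 *: d = - (h e w)^-1 * (h e w)^-1 * d.
    by rewrite -exprVn expr2 mulNr.
  by apply: complex_eq => /=; ring.
elim: k => [|k IH] r; first by have [b0 _] := r; split=> //; exact: b.
have [b0 d] := r; split=> [|i]; first exact: b.
have h1 := rel_opp (nsmooth_D i (sc _ sg)) (nsmooth_D i (sc _ sg')) (d i).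
have h2 := rel_mul s1 s2 s1 s2 (IH (rel_leq r)) (IH (rel_leq r)).
have sn (h : E -> V -> R) : (forall e, smooth_on e_ D (h e)) ->
    nsmooth (fun e w => - nderiv i (fun e w => (h e w)%:C%C) e w).
  by move=> sh e; apply: csmooth_on_opp => //; exact: (nsmooth_D i (sc _ sh)).
have := rel_mul (sn _ sg) (sn _ sg') (nsmooth_mul s1 s1) (nsmooth_mul s2 s2) h1 h2.
rewrite !addr0; apply: rel_eq => e w Dw; apply: dv => //; have [] := gn0 e w Dw => //.
Qed.

(** The entry point from seminorms: these bound one word at a time, whereas [nrel] is recursive. *)
Lemma rel_words k mu f g :
  (forall s, (size s <= k)%N -> bound (mu + \sum_(i <- s) wt i)
     (fun e => cword_deriv e_ s (f e)) (fun e => cword_deriv e_ s (g e))) ->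
  nrel k mu f g.
Proof.
elim: k mu f g => [|k IH] mu f g H.
  by split=> //; have := H [::] isT; rewrite big_nil addr0.
split=> [|i]; first by have := H [::] isT; rewrite big_nil addr0.
apply: IH => s sk; have := H (rcons s i); rewrite size_rcons => /(_ sk).
rewrite big_rcons/= addrA [in X in _ -> X]addrAC.
have E1 h : (fun e => cword_deriv e_ (rcons s i) (h e)) = (fun e => cword_deriv e_ s (nderiv i h e)).
  by apply/funext => e; rewrite cword_deriv_rcons.
by rewrite !E1.
Qed.

End Rel.

Lemma rel_pull {R : realType} {E E' : Type} (eps : E -> R) (r : E' -> E)
    {V : normedModType R} {I : Type} (e_ : I -> V) (wt : I -> R)
    (KK : set (set V)) (J : V -> R) k mu (f g : E -> V -> R[i]) :
  nrel eps e_ wt KK J k mu f g ->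
  nrel (eps \o r) e_ wt KK J k mu (f \o r) (g \o r).
Proof.
have b mu' (f1 g1 : E -> V -> R[i]) : bound eps KK J mu' f1 g1 ->
    bound (eps \o r) KK J mu' (f1 \o r) (g1 \o r).
  move=> b K KK_; have [A [B [tA rB H]]] := b _ KK_.
  by exists A, B; split=> // e w Kw; exact: H.
elim: k mu f g => [|k IH] mu f g [b0 d]; split=> //; try exact: b.
by move=> i; exact: IH (d i).
Qed.

(** Serves to change the type of a symbol class, to shrink the domain in xi, and to keep the
    x-directions only. *)
Lemma rel_restrict {R : realType} {E : Type} (eps : E -> R) {V : normedModType R}
    {I I' : Type} (e_ : I -> V) (wt : I -> R) (r : I' -> I) (wt' : I' -> R)
    (D : set V) (KK KK' : set (set V)) (J : V -> R) k mu (f g : E -> V -> R[i]) :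
  (forall K, KK' K -> exists2 K1, KK K1 & K `<=` K1) ->
  (forall K, KK' K -> K `<=` D) -> (forall w, D w -> 1 <= J w) ->
  open D ->
  (forall i, wt (r i) <= wt' i) ->
  nrel eps e_ wt KK J k mu f g -> nrel eps (e_ \o r) wt' KK' J k mu f g.
Proof.
move=> KS KD J1 oD wr.
have b mu' (f1 g1 : E -> V -> R[i]) : bound eps KK J mu' f1 g1 ->
    bound eps KK' J mu' f1 g1.
  move=> b K /KS[K1 KK1 sK]; have [A [B [tA rB H]]] := b _ KK1.
  by exists A, B; split=> // e w Kw; exact/H/sK.
elim: k mu f g => [|k IH] mu f g [b0 d]; split=> //; try exact: b.
move=> i; apply: (rel_mono KD J1 _ (IH _ _ _ (d (r i)))).
by rewrite lerD2l.
Qed.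

(** * Integration over the fibre *)

Section TupleMeasure.
Context {R : realType}.
Local Notation RT := (measurableTypeR R).
Local Notation mu := (@lebesgue_measure R).
Local Open Scope ereal_scope.

Lemma measurable_shift (a : R) : measurable_fun [set: RT] (fun x : RT => (x + a)%R : RT).
Proof. exact: measurable_funD. Qed.

(** By uniqueness of the Lebesgue measure it is enough to compare the two measures on half-open
    intervals. *)
Lemma lebesgue_measure_shift (a : R) (A : set RT) : measurable A ->
  pushforward mu (fun x : RT => (x + a)%R : RT) A = mu A.
Proof.
move=> mA.
pose pm : {measure set RT -> \bar R} :=
  measure_function_pushforward__canonical__measure_function_Measure mu
    (measurable_shift a).
apply/esym; apply: (@lebesgue_measure_unique R pm) => // _ [[b c] _ <-].
rewrite /pm/= /pushforward.
have -> : (fun x : RT => (x + a)%R : RT) @^-1` (`]b, c]%classic : set R) =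
    `](b - a)%R, (c - a)%R]%classic.
  apply/seteqP; split=> x /=; rewrite !in_itv/= ltrBlDr lerBrDr//.
rewrite !lebesgue_measure_itv/= !lte_fin ltrD2r.
by case: ifP => // _; rewrite -!EFinB; congr EFin; ring.
Qed.

Lemma ge0_integral_shift (a : R) (f : RT -> \bar R) :
  measurable_fun [set: RT] f -> (forall x, 0 <= f x) ->
  \int[mu]_x f (x + a)%R = \int[mu]_x f x.
Proof.
move=> mf f0.
have := @ge0_integral_pushforward _ _ _ _ R _ (measurable_shift a) mu setT f
  measurableT mf (fun y _ => f0 y).
pose pm : {measure set RT -> \bar R} :=
  measure_function_pushforward__canonical__measure_function_Measure mu
    (measurable_shift a).
rewrite preimage_setT => <-; apply: (@eq_measure_integral _ _ _ _ mu pm).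
by move=> A mA _; exact: lebesgue_measure_shift.
Qed.

Lemma ge0_integral_tupleS n (f : n.+1.-tuple RT -> \bar R) :
  measurable_fun [set: _] f -> (forall t, 0 <= f t) ->
  \int[lebesgue_tuple n.+1]_t f t =
  \int[mu]_x \int[lebesgue_tuple n]_t f (tcons (x, t)).
Proof.
move=> mf f0.
rewrite -[LHS]/(\int[pushforward (mu \x lebesgue_tuple n) (@tcons R n)]_t f t).
rewrite (@ge0_integral_pushforward _ _ _ _ R _ (@measurable_tcons R n) _ setT f
  measurableT mf (fun y _ => f0 y)).
rewrite preimage_setT fubini_tonelli1//; last by move=> x; exact: f0.
by apply: measurableT_comp => //; exact: measurable_tcons.
Qed.

Definition tadd n (v t : n.-tuple RT) : n.-tuple RT :=
  [tuple (tnth t i + tnth v i)%R : RT | i < n].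

Lemma measurable_tadd n (v : n.-tuple RT) : measurable_fun [set: n.-tuple RT] (tadd v).
Proof.
apply/measurable_fun_tnthP => i; rewrite (_ : _ \o _ = (fun t => (tnth t i + tnth v i)%R : RT)).
  by apply: measurable_funD => //; exact: measurable_tnth.
by apply/funext => t /=; rewrite tnth_mktuple.
Qed.

Lemma tadd_tcons n (x y : RT) (v t : n.-tuple RT) :
  tadd (tcons (y, v)) (tcons (x, t)) = tcons ((x + y)%R, tadd v t).
Proof.
apply: eq_from_tnth => i; rewrite tnth_mktuple.
have [j ->|->] := unliftP ord0 i; last by rewrite /tcons !tnth0.
by rewrite /tcons !tnthS tnth_mktuple.
Qed.

Lemma measurable_tcons1 n (x : RT) : measurable_fun [set: _] (fun t : n.-tuple RT => tcons (x, t)).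
Proof.
by apply: measurableT_comp; [exact: measurable_tcons|exact: pair1_measurable].
Qed.

(** Tonelli's theorem isolates the first coordinate, where the one-dimensional invariance applies;
    the induction hypothesis translates the others. *)
Lemma ge0_integral_tadd n (v : n.-tuple RT) (f : n.-tuple RT -> \bar R) :
  measurable_fun [set: _] f -> (forall t, 0 <= f t) ->
  \int[lebesgue_tuple n]_t f (tadd v t) = \int[lebesgue_tuple n]_t f t.
Proof.
elim: n v f => [|n IH] v f mf f0.
  by apply: eq_integral => t _; rewrite (tuple0 (tadd v t)) (tuple0 t).
rewrite !ge0_integral_tupleS//; last first.
  by apply: measurableT_comp => //; exact: measurable_tadd.
rewrite -(tunconsK v); case: (tuncons v) => y w.
under eq_integral do under eq_integral do rewrite tadd_tcons.
have mfc : measurable_fun [set: _] (fun p : RT * n.-tuple RT => f (tcons p)).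
  by apply: measurableT_comp => //; exact: measurable_tcons.
rewrite -[RHS](ge0_integral_shift y); first last.
- by move=> x; exact: integral_ge0.
- exact: (@measurable_fun_fubini_tonelli_F _ _ _ _ R (lebesgue_tuple n)
    (fun p => f (tcons p)) mfc (fun p => f0 _)).
apply: eq_integral => x _; rewrite (IH w (fun t => f (tcons ((x + y)%R, t))))//.
by apply: measurableT_comp => //; exact: measurable_tcons1.
Qed.

Lemma ge0_integral_prod_lty n (g : RT -> R) : measurable_fun [set: RT] g ->
  (forall x, (0 <= g x)%R) -> \int[mu]_x (g x)%:E < +oo ->
  \int[lebesgue_tuple n]_t (\prod_(i < n) g (tnth t i))%:E < +oo.
Proof.
move=> mg g0 goo.
have mp m : measurable_fun [set: _] (fun t : m.-tuple RT => (\prod_(i < m) g (tnth t i))%R).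
  apply: measurable_prod => i _.
  by apply: measurableT_comp => //; exact: measurable_tnth.
have p0 m (t : m.-tuple RT) : 0 <= (\prod_(i < m) g (tnth t i))%:E.
  by rewrite lee_fin prodr_ge0.
elim: n => [|n IH].
  under eq_integral do rewrite big_ord0.
  rewrite integral_cst// mul1e/= diracT ltry//.
have mpE m : measurable_fun [set: m.-tuple RT] (fun t => (\prod_(i < m) g (tnth t i))%:E).
  by apply/measurable_EFinP; exact: mp.
rewrite (ge0_integral_tupleS (mpE n.+1) (p0 n.+1)).
have E x (t : n.-tuple RT) : (\prod_(i < n.+1) g (tnth (tcons (x, t)) i))%:E =
    (g x)%:E * (\prod_(i < n) g (tnth t i))%:E.
  by rewrite big_ord_recl /tcons tnth0 EFinM; under eq_bigr do rewrite tnthS.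
have E2 x : \int[lebesgue_tuple n]_t (\prod_(i < n.+1) g (tnth (tcons (x, t)) i))%:E =
    (\int[lebesgue_tuple n]_t (\prod_(i < n) g (tnth t i))%:E) * (g x)%:E.
  rewrite muleC -ge0_integralZl; [|exact: measurableT|exact: mpE|by move=> t _; exact: p0|by rewrite lee_fin].
  by apply: eq_integral => t _; rewrite E.
under eq_integral do rewrite E2.
have I0 : 0 <= \int[lebesgue_tuple n]_t (\prod_(i < n) g (tnth t i))%:E.
  by apply: integral_ge0 => t _; exact: p0.
rewrite ge0_integralZl; [|exact: measurableT|by apply/measurable_EFinP; exact: mg|by move=> x _; rewrite lee_fin|exact: I0].
by rewrite lte_mul_pinfty// ge0_fin_numE.
Qed.

End TupleMeasure.

(** * Measurability of open sets in tuple coordinates *)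

Section OpenMeasurable.
Context {R : realType}.
Local Notation RT := (measurableTypeR R).
Variables n p : nat.

Lemma row_ball_measurable m (x : 'rV[R]_m) (r : R) : 0 < r ->
  measurable [set t : m.-tuple RT | ball x r (row_of_tuple t)].
Proof.
move=> r0; rewrite (_ : [set _ | _] = \bigcap_(i in [set: 'I_m])
    ((fun t : m.-tuple RT => tnth t i) @^-1` ball (x 0 i) r)).
  apply: fin_bigcap_measurable => // i _.
  rewrite -[X in measurable X]setTI; apply: measurable_tnth => //.
  exact: measurable_ball.
apply/seteqP; split=> t /=.
  by move=> [_ xt] i _ /=; have := xt 0 i; rewrite mxE.
by move=> H; split=> // i j; rewrite mxE ord1; exact: H.
Qed.

(** The sigma-algebra on pairs of tuples is a product one, so the open set is written as a countable
    union of products of balls, with rational centres and radii 1 / (k + 1), that it contains. *)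
Lemma open_row_measurable (O : set ('rV[R]_n * 'rV[R]_p)) : open O ->
  measurable [set t : n.-tuple RT * p.-tuple RT | O (row_of_tuple t.1, row_of_tuple t.2)].
Proof.
move=> oO.
pose B (q : 'rV[rat]_n * 'rV[rat]_p * nat) (z : 'rV[R]_n * 'rV[R]_p) :=
  ball (map_mx ratr q.1.1 : 'rV[R]_n) q.2.+1%:R^-1 z.1 /\
  ball (map_mx ratr q.1.2 : 'rV[R]_p) q.2.+1%:R^-1 z.2.
pose F q : set (n.-tuple RT * p.-tuple RT) :=
  [set t | B q (row_of_tuple t.1, row_of_tuple t.2) /\ (forall z, B q z -> O z)].
rewrite (_ : [set _ | _] = \bigcup_q F q).
  apply: countable_bigcupT_measurable => [|q]; first exact: countableP.
  have [BO|nBO] := pselect (forall z, B q z -> O z); last first.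
    by rewrite (_ : F q = set0)//; apply/seteqP; split=> // t [_].
  rewrite (_ : F q = [set t | ball (map_mx ratr q.1.1 : 'rV[R]_n) q.2.+1%:R^-1 (row_of_tuple t)]
     `*` [set t | ball (map_mx ratr q.1.2 : 'rV[R]_p) q.2.+1%:R^-1 (row_of_tuple t)]).
    by apply: measurableX; exact: row_ball_measurable.
  by apply/seteqP; split=> t /=; [case|].
apply/seteqP; split=> t /=; last by move=> [q _ [Bq]]; apply.
move=> Ot.
have [eps /= eps0 HO] : exists2 eps : R, 0 < eps & forall z : 'rV[R]_n * 'rV[R]_p,
    ball (row_of_tuple t.1) eps z.1 -> ball (row_of_tuple t.2) eps z.2 -> O z.
  have [[P Q] /= [nP nQ] PQ] := open_nbhs_nbhs (conj oO Ot).
  move/nbhs_ballP : nP => [e1 /= e10 P1]; move/nbhs_ballP : nQ => [e2 /= e20 Q2].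
  exists (Num.min e1 e2); first by rewrite lt_min e10.
  move=> z z1 z2; apply: PQ; split=> /=.
    by apply: P1; apply: le_ball z1; rewrite ge_min lexx.
  by apply: Q2; apply: le_ball z2; rewrite ge_min lexx orbT.
(* The radius is below eps / 2, so that a ball of this radius containing the point lies in the ball
   of radius eps around the point, wherever its centre is. *)
have [k ke] : exists k : nat, k.+1%:R^-1 < eps / 2.
  have eps2 : 0 < eps / 2 by rewrite divr_gt0.
  have [k] := ltr_add_invr eps2.
  by rewrite add0r; exists k.
have approx m (x : 'rV[R]_m) : exists q : 'rV[rat]_m, ball (map_mx ratr q : 'rV[R]_m) k.+1%:R^-1 x.
  have k0 : 0 < k.+1%:R^-1 :> R by rewrite invr_gt0.
  have H (i : 'I_m) : exists q : rat, ratr q \in `]x 0 i - k.+1%:R^-1, x 0 i + k.+1%:R^-1[%R.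
    by apply: rat_in_itvoo; rewrite ltrD2l gt0_cp.
  have [q Hq] := choice H.
  exists (\row_i q i); split=> // i j; rewrite !mxE ord1 /ball/= ltr_distlC.
  by have := Hq j; rewrite in_itv/= ltrBlDr ltrBlDr andbC.
have [q1 Hq1] := approx _ (row_of_tuple t.1).
have [q2 Hq2] := approx _ (row_of_tuple t.2).
exists (q1, q2, k) => //; split=> // z [/= Bz1 Bz2]; apply: HO.
- by apply: (@ball_splitr _ _ (map_mx ratr q1 : 'rV[R]_n)); apply: le_ball (ltW ke) _ _.
- by apply: (@ball_splitr _ _ (map_mx ratr q2 : 'rV[R]_p)); apply: le_ball (ltW ke) _ _.
Qed.

End OpenMeasurable.

(** * Integrability of powers at infinity *)

Section Tails.
Context {R : realType}.
Local Notation mu := (@lebesgue_measure R).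

Lemma continuous_bracket (s : R) : continuous (fun x : R => (1 + x ^+ 2) `^ s).
Proof.
move=> x; apply: (@continuous_comp _ _ _ (fun x : R => 1 + x ^+ 2) (fun y => y `^ s)).
  by apply: continuousD; [exact: cst_continuous|exact: exprn_continuous].
apply: differentiable_continuous; apply/derivable1_diffP.
by apply: derivable_powR; rewrite in_itv/= andbT ltr_pwDl// sqr_ge0.
Qed.

Lemma ler_powRn (a b s : R) : 0 < a -> a <= b -> s <= 0 -> b `^ s <= a `^ s.
Proof.
move=> a0 ab s0; rewrite -[s]opprK !(powRN _ (- s)) lef_pV2 ?posrE ?powR_gt0//.
  by apply: ge0_ler_powR; rewrite ?nnegrE ?oppr_ge0// ltW// (lt_le_trans a0).
exact: lt_le_trans ab.
Qed.

Lemma powRVn (a s : R) : 0 < a -> a^-1 `^ s = a `^ (- s).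
Proof. by move=> a0; rewrite -(powR_inv1 (ltW a0)) -powRrM mulN1r. Qed.

Lemma integral_powR_tail (s : R) : 1 < s ->
  (\int[mu]_(x in `[1%R, +oo[) (x `^ (- s))%:E < +oo)%E.
Proof.
move=> s1; have s10 : 0 < s - 1 by rewrite subr_gt0.
pose P (y : R) : R := y `^ (1 - s).
pose F : R -> R := (- (s - 1)^-1 : R) *: P.
have dF (x : R) : 0 < x -> is_derive x 1 F (x `^ (- s)).
  move=> x0; have dp : is_derive x 1 P ((1 - s) * x `^ (1 - s - 1)).
    split; first by apply: derivable_powR; rewrite in_itv/= andbT.
    by rewrite -derive1E powR_derive1// in_itv/= andbT.
  apply: (is_derive_eq (is_deriveZ (- (s - 1)^-1) dp)).
  rewrite /GRing.scale/= mulrA.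
  have -> : - (s - 1)^-1 * (1 - s) = 1 by field; rewrite gt_eqF.
  by rewrite mul1r; congr (_ `^ _); ring.
rewrite (@ge0_continuous_FTC2y R (fun x => x `^ (- s)) F 1 0).
- by rewrite -EFinB ltry.
- by move=> x _; exact: powR_ge0.
- apply: derivable_within_continuous => x; rewrite in_itv/= andbT => x1.
  by apply: derivable_powR; rewrite in_itv/= andbT (lt_le_trans ltr01).
- rewrite -(mulr0 (- (s - 1)^-1)); apply: (@cvgM R R +oo%R _ (fun=> - (s - 1)^-1) P); first exact: cvg_cst.
  apply/cvgrPdist_lt => eps eps0; near=> x.
  have x0 : 0 < x by near: x; exact: nbhs_pinfty_gt.
  rewrite sub0r normrN ger0_norm ?powR_ge0// /P -opprB powRN.
  rewrite -[ltRHS]invrK ltf_pV2 ?posrE ?powR_gt0 ?invr_gt0//.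
  have -> : eps^-1 = (eps^-1 `^ (s - 1)^-1) `^ (s - 1).
    by rewrite -powRrM mulVf ?powRr1 ?gt_eqF// invr_ge0 ltW.
  by apply: gt0_ltr_powR; rewrite ?nnegrE ?powR_ge0 ?ltW//; near: x; exact: nbhs_pinfty_gt.
- by move=> x x1; have [] := dF x (lt_trans ltr01 x1).
- apply: cvg_at_right_filter; apply: differentiable_continuous; apply/derivable1_diffP.
  by have [] := dF 1 ltr01.
- move=> x; rewrite in_itv/= andbT => x1; rewrite derive1E.
  by have [_ ->] := dF x (lt_trans ltr01 x1).
Unshelve. all: by end_near. Qed.

(** By symmetry it suffices to integrate over x >= 0. There 1 + x^2 >= (x + 1)^2 / 2, and as s < 0
    the integrand is at most 2^(-s) (x + 1)^(2 s), a translated power tail with exponent 2 s <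
    -1. *)
Lemma integral_bracket_lty (s : R) : s < - 2^-1 ->
  (\int[mu]_x ((1 + x ^+ 2) `^ s)%:E < +oo)%E.
Proof.
move=> hs; pose g (x : R) := (1 + x ^+ 2) `^ s.
have cg : continuous g := @continuous_bracket s.
have mg : measurable_fun setT g by exact: continuous_measurable_fun.
(* The power tail, cut off below 1, is a function on the whole line and can be translated by
   [ge0_integral_shift]. *)
pose h (x : R) : R := x `^ (2 * s) * \1_(`[1, +oo[%classic : set R) x.
have mh : measurable_fun setT h.
  apply: measurable_funM; first exact: measurable_powR.
  by apply: measurable_indic; exact: measurable_itv.
have hoo : (\int[mu]_x (h x)%:E < +oo)%E.
  have s2 : 1 < - (2 * s) by lra.
  have := integral_powR_tail s2; rewrite opprK integral_mkcond.
  congr (_ < _)%E; apply: eq_integral => x _; rewrite /h indicE patchE.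
  by case: ifP => _; rewrite ?mulr1 ?mulr0.
have eg : g =1 g \o -%R by move=> x; rewrite /g /= sqrrN.
rewrite (@ge0_symfun_integralT R g (fun x => powR_ge0 _ _) cg eg).
rewrite lte_mul_pinfty ?lee_fin//.
have Ih : (\int[mu]_x (h (x + 1))%:E < +oo)%E.
  rewrite (@ge0_integral_shift R 1 (fun x => (h x)%:E))//; first exact/measurable_EFinP.
  by move=> x; rewrite lee_fin mulr_ge0 ?powR_ge0.
have mh1 : measurable_fun [set: R] (fun x : R => h (x + 1)).
  by apply: measurableT_comp => //; exact: measurable_shift.
apply: (@le_lt_trans _ _ (\int[mu]_x ((2 `^ (- s))%:E * (h (x + 1))%:E))%E); last first.
  rewrite ge0_integralZl//; do ?by [apply/measurable_EFinP|move=> x _; rewrite lee_fin mulr_ge0 ?powR_ge0|rewrite lee_fin powR_ge0].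
  by rewrite lte_mul_pinfty// lee_fin powR_ge0.
rewrite integral_mkcond; apply: ge0_le_integral => //.
- move=> x _; rewrite patchE; case: ifP => _ //; by rewrite lee_fin powR_ge0.
- apply/(measurable_restrictT _ _).1 => //; first by
    rewrite (_ : [set _ | _] = `[0, +oo[%classic);
      [exact: measurable_itv|apply/seteqP; split=> x /=; rewrite in_itv/= andbT].
  by apply: measurable_funTS; exact/measurable_EFinP.
- by apply/measurable_EFinP; apply: measurable_funM.
move=> x _; rewrite patchE; case: ifPn => [|_]; last first.
  by rewrite -EFinM lee_fin !mulr_ge0 ?powR_ge0.
rewrite inE/= => x0; rewrite -EFinM lee_fin /h indicE mem_set/=; last first.
  by rewrite in_itv/= andbT lerDr.
have x10 : 0 <= x + 1 by rewrite addr_ge0.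
rewrite mulr1 powRrM powR_mulrn// -powRVn// -powRM ?sqr_ge0 ?invr_ge0//.
apply: ler_powRn.
- by rewrite mulr_gt0 ?invr_gt0// exprn_gt0// ltr_wpDl.
- by have := sqr_ge0 (x - 1); rewrite !expr2; lra.
- by lra.
Qed.
End Tails.

(** * The Japanese bracket *)

Section Japanese.
Context {R : realType}.
Implicit Types n p : nat.

Lemma enorm_sqr n (v : 'rV[R]_n) : enorm v ^+ 2 = \sum_(i < n) v 0 i ^+ 2.
Proof. by rewrite sqr_sqrtr// sumr_ge0// => i _; exact: sqr_ge0. Qed.

Lemma enorm_ge0 n (v : 'rV[R]_n) : 0 <= enorm v.
Proof. exact: sqrtr_ge0. Qed.

Lemma japanese_ge1 n (v : 'rV[R]_n) : 1 <= japanese v.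
Proof. by rewrite -{1}sqrtr1 ler_sqrt ?lerDl ?sqr_ge0// addr_ge0// sqr_ge0. Qed.

Lemma japanese_gt0 n (v : 'rV[R]_n) : 0 < japanese v.
Proof. exact: lt_le_trans ltr01 (japanese_ge1 v). Qed.

Lemma japanese_sqr n (v : 'rV[R]_n) : japanese v ^+ 2 = 1 + \sum_(i < n) v 0 i ^+ 2.
Proof.
have h0 : 0 <= 1 + enorm v ^+ 2 by rewrite addr_ge0// sqr_ge0.
by rewrite /japanese (sqr_sqrtr h0) enorm_sqr.
Qed.

Lemma japanese_powR n (v : 'rV[R]_n) (mu : R) :
  japanese v `^ mu = (1 + \sum_(i < n) v 0 i ^+ 2) `^ (mu / 2).
Proof.
rewrite -enorm_sqr /japanese -powR12_sqrt ?addr_ge0 ?sqr_ge0// -powRrM.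
by rewrite mulrC.
Qed.

(** The square of the bracket dominates each 1 + xi_j^2. Sharing the exponent mu / 2 equally among
    the p coordinates gives each factor an exponent below -1/2, and the product form suits Tonelli's
    theorem. For p = 0 the product is empty and any s will do. *)
Lemma japanese_prod p (mu : R) : mu < - p%:R -> exists2 s : R, s < - 2^-1 &
  forall v : 'rV[R]_p, japanese v `^ mu <= \prod_(j < p) (1 + v 0 j ^+ 2) `^ s.
Proof.
case: p => [|p] hmu.
  exists (-1); first by lra.
  by move=> v; rewrite japanese_powR !big_ord0 addr0 powR1.
have p0 : 0 < p.+1%:R :> R by rewrite ltr0n.
pose s := mu / 2 / p.+1%:R.
have hs : s < - 2^-1 by rewrite ltr_pdivrMr//; lra.
have Es : mu / 2 = s * p.+1%:R by rewrite divfK ?lt0r_neq0.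
exists s => // v; rewrite japanese_powR Es powRrM.
have prodE (x : R) : x ^+ p.+1 = \prod_(j < p.+1) x by rewrite prodr_const card_ord.
rewrite powR_mulrn ?powR_ge0// prodE.
apply: ler_prod => j _; rewrite powR_ge0/=; apply: ler_powRn.
- by rewrite ltr_pwDl// sqr_ge0.
- by rewrite lerD2l (bigD1 j)//= lerDl sumr_ge0// => i _; exact: sqr_ge0.
- by lra.
Qed.

(** Peetre's inequality for translations of length at most 1: from |v|^2 <= 2 |w + v|^2 + 2 |w|^2
    the bracket of v is at most twice that of w + v. *)
Lemma japanese_translate n (v w : 'rV[R]_n) (mu : R) : mu <= 0 -> enorm w <= 1 ->
  japanese (w + v) `^ mu <= 2 `^ (- mu) * japanese v `^ mu.
Proof.
move=> mu0 w1; have j0 := japanese_gt0.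
have H : 2^-1 * japanese v <= japanese (w + v).
  rewrite -(@ler_pXn2r _ 2)// ?nnegrE ?mulr_ge0 ?ltW// exprMn !japanese_sqr.
  have w2 : \sum_(i < n) w 0 i ^+ 2 <= 1.
    by rewrite -enorm_sqr exprn_ile1 ?enorm_ge0.
  have : \sum_(i < n) v 0 i ^+ 2 <= \sum_(i < n) (2 * (w + v) 0 i ^+ 2 + 2 * w 0 i ^+ 2).
    apply: ler_sum => i _; rewrite mxE.
    by have := sqr_ge0 (w 0 i + w 0 i + v 0 i); rewrite !expr2; lra.
  rewrite big_split/= -!mulr_sumr => H2.
  have : 0 <= \sum_(i < n) (w + v) 0 i ^+ 2 by apply: sumr_ge0 => i _; exact: sqr_ge0.
  by rewrite expr2; lra.
rewrite -powRVn// -powRM ?invr_ge0// ?(ltW (j0 _ v))//.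
by apply: ler_powRn => //; rewrite mulr_gt0// invr_gt0.
Qed.

Lemma coord_le_norm n (v : 'rV[R]_n) i : `|v 0 i| <= `|v|.
Proof.
rewrite [ `|v|]mx_normrE.
exact: (le_bigmax_cond _ (fun i : 'I_1 * 'I_n => `|v i.1 i.2|) (j := (0, i))).
Qed.

End Japanese.

(** * Integrands dominated by a power of the Japanese bracket *)

Section Admissible.
Context {R : realType} {n p : nat}.
Local Notation RT := (measurableTypeR R).
Implicit Types (Om : set 'rV[R]_n) (F G : 'rV[R]_n -> 'rV[R]_p -> R).

(** For mu < - p this implies integrability, and the integral is bounded by A times a constant that
    depends on [Om], b and mu only. Keeping A explicit is what makes difference quotients and
    negligible differences pass through the integral. *)
Definition adm Om (b mu A : R) F :=
  [/\ forall z : 'rV[R]_n * 'rV[R]_p, Om z.1 -> {for z, continuous (fun z => F z.1 z.2)},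
      forall y xi, Om y -> b < `|y| -> F y xi = 0 &
      forall y xi, Om y -> `|F y xi| <= A * japanese xi `^ mu].

Definition dom Om := [set t : n.-tuple RT * p.-tuple RT | Om (row_of_tuple t.1)].

Definition rows F (t : n.-tuple RT * p.-tuple RT) :=
  F (row_of_tuple t.1) (row_of_tuple t.2).

Local Notation M := (@lebesgue_tuple R n \x @lebesgue_tuple R p)%E.

Lemma measurable_dom Om : open Om -> measurable (dom Om).
Proof.
move=> oO; apply: (@open_row_measurable R n p [set z | Om z.1]).
by apply: open_comp => // z _; exact: cvg_fst.
Qed.

Lemma measurable_rows Om F : open Om ->
  (forall z : 'rV[R]_n * 'rV[R]_p, Om z.1 -> {for z, continuous (fun z => F z.1 z.2)}) ->
  measurable_fun (dom Om) (rows F).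
Proof.
move=> oO cF mD; apply: (measurability _ (RGenOInfty.measurableE R)) => //.
move=> _ [_ [a ->] <-].
rewrite (_ : _ `&` _ = [set t | [set z | Om z.1 /\ a < F z.1 z.2]
  (row_of_tuple t.1, row_of_tuple t.2)]).
  apply: open_row_measurable; rewrite openE => z [Oz az].
  have := cF z Oz => /cvgr_gt /(_ _ az) n1.
  have n2 : nbhs z [set z : 'rV[R]_n * 'rV[R]_p | Om z.1].
    by have := @cvg_fst _ _ (nbhs z.1) (nbhs z.2); apply; exact: open_nbhs_nbhs.
  by apply: filterS2 n1 n2 => w; split.
apply/seteqP; split=> t /=; rewrite in_itv/= andbT => -[].
  by [].
by [].
Qed.

(** An integrable majorant that is a product over the coordinates. The norm on rows being the sup
    norm, the ball of radius b in y is a cube. *)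
Definition envelope (b s : R) (t : n.-tuple RT * p.-tuple RT) : R :=
  (\prod_(i < n) \1_(`[-b, b]%classic : set R) (tnth t.1 i)) *
  (\prod_(j < p) (1 + tnth t.2 j ^+ 2) `^ s).

Lemma envelope_ge0 b s t : 0 <= envelope b s t.
Proof.
by rewrite mulr_ge0// prodr_ge0// => i _; rewrite ?powR_ge0.
Qed.

Lemma envelope_integrable b s : s < - 2^-1 ->
  M.-integrable setT (EFin \o envelope b s).
Proof.
move=> hs; pose A (t : n.-tuple RT) : R := \prod_(i < n) \1_(`[-b, b]%classic : set R) (tnth t i).
pose B (t : p.-tuple RT) : R := \prod_(j < p) (1 + tnth t j ^+ 2) `^ s.
have mg : measurable_fun [set: RT] (fun x : RT => (1 + x ^+ 2) `^ s : R).
  by apply: continuous_measurable_fun; exact: continuous_bracket.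
have mi : measurable_fun [set: RT] (fun x : RT => \1_(`[-b, b]%classic : set R) x : R).
  by apply: measurable_indic; exact: measurable_itv.
have mA : measurable_fun [set: n.-tuple RT] A.
  apply: measurable_prod => i _.
  by apply: (measurableT_comp mi); exact: measurable_tnth.
have mB : measurable_fun [set: p.-tuple RT] B.
  apply: measurable_prod => i _.
  by apply: (measurableT_comp mg); exact: measurable_tnth.
have A0 t : 0 <= A t by rewrite prodr_ge0.
have B0 t : 0 <= B t by rewrite prodr_ge0// => i _; rewrite powR_ge0.
have IA : (\int[lebesgue_tuple n]_t (A t)%:E < +oo)%E.
  refine (@ge0_integral_prod_lty R n _ mi _ _) => //.
  rewrite integral_indic; [|exact: measurableT|exact: measurable_itv].
  rewrite setIT -[X in (X < _)%E]/(lebesgue_measure (`[- b, b]%classic : set R)).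
  by rewrite lebesgue_measure_itv; case: ifP => _; rewrite ?ltry// -EFinB ltry.
have IB : (\int[lebesgue_tuple p]_t (B t)%:E < +oo)%E.
  refine (@ge0_integral_prod_lty R p _ mg _ _) => [x|]; first exact: powR_ge0.
  exact: integral_bracket_lty.
have mE : measurable_fun [set: n.-tuple RT * p.-tuple RT] (envelope b s).
  by apply: measurable_funM;
    [apply: (measurableT_comp mA); exact: measurable_fst|apply: (measurableT_comp mB); exact: measurable_snd].
apply/integrableP; split; first by apply/measurable_EFinP.
have -> : (\int[M]_x `|(EFin \o envelope b s) x| = \int[M]_x ((A x.1)%:E * (B x.2)%:E))%E.
  by apply: eq_integral => t _ /=; rewrite ger0_norm ?envelope_ge0.
rewrite fubini_tonelli1/=; last 2 first.
- by apply/measurable_EFinP.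
- by move=> t; rewrite mule_ge0// lee_fin.
have E1 x : (\int[lebesgue_tuple p]_y ((A x)%:E * (B y)%:E) =
   (\int[lebesgue_tuple p]_y (B y)%:E) * (A x)%:E)%E.
  rewrite muleC ge0_integralZl//; [exact/measurable_EFinP|by move=> y _; rewrite lee_fin|by rewrite lee_fin].
rewrite /fubini_F/=; under eq_integral do rewrite E1.
have I0 : (0 <= \int[lebesgue_tuple p]_y (B y)%:E)%E.
  by apply: integral_ge0 => y _; rewrite lee_fin.
rewrite ge0_integralZl//; [|exact/measurable_EFinP|by move=> x _; rewrite lee_fin].
by rewrite lte_mul_pinfty// ge0_fin_numE.
Qed.

Lemma adm_le_envelope (mu b : R) : mu < - p%:R -> exists2 s : R, s < - 2^-1 &
  forall Om A F, 0 <= A -> adm Om b mu A F ->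
  forall t, dom Om t -> `|rows F t| <= A * envelope b s t.
Proof.
move=> hmu; have [s hs Hs] := japanese_prod hmu; exists s => // Om A F A0 [_ F0 Fb] t Dt.
have [by_|yb] := ltP b `|row_of_tuple t.1|.
  by rewrite /rows F0// normr0 mulr_ge0// envelope_ge0.
rewrite (le_trans (Fb _ _ Dt))// ler_wpM2l// (le_trans (Hs _))//.
rewrite /envelope [X in X * _]big1 ?mul1r.
  by apply: ler_prod => j _; rewrite powR_ge0/= mxE.
move=> i _; rewrite indicE mem_set//= in_itv/= -ler_norml.
by apply: le_trans yb; have := coord_le_norm (row_of_tuple t.1) i; rewrite mxE.
Qed.

Lemma adm_integrable Om b mu A F : open Om -> mu < - p%:R -> 0 <= A ->
  adm Om b mu A F -> M.-integrable (dom Om) (EFin \o rows F).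
Proof.
move=> oO hmu A0 aF; have [s hs H] := adm_le_envelope b hmu.
have mD := measurable_dom oO.
have iE : M.-integrable (dom Om) (fun t => A%:E * (EFin \o envelope b s) t)%E.
  by apply: integrableZl => //; apply: integrableS (envelope_integrable b hs).
apply: (le_integrable mD _ _ iE).
  by apply/measurable_EFinP; apply: measurable_rows => //; have [] := aF.
move=> t Dt /=; rewrite lee_fin (le_trans (H _ _ _ A0 aF _ Dt))// ger0_norm//.
by rewrite mulr_ge0// envelope_ge0.
Qed.

Lemma adm_bound Om b mu : open Om -> mu < - p%:R -> exists2 c, 0 <= c &
  forall A F, 0 <= A -> adm Om b mu A F -> `|integral_yxi Om F| <= A * c.
Proof.
move=> oO hmu; have [s hs H] := adm_le_envelope b hmu.
have mD := measurable_dom oO.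
have iE : M.-integrable (dom Om) (EFin \o envelope b s).
  by apply: integrableS (envelope_integrable b hs).
exists (\int[M]_(t in dom Om) envelope b s t)%R.
  by apply: Rintegral_ge0 => t _; exact: envelope_ge0.
move=> A F A0 aF; have iF := adm_integrable oO hmu A0 aF.
rewrite (le_trans (le_normr_Rintegral mD iF))// -RintegralZl//.
apply: le_Rintegral => //; last by move=> t Dt; exact: H aF _ Dt.
  exact: (integrable_norm iF).
by have := integrableZl mD A iE.
Qed.

Lemma adm_add Om b mu A B F G : adm Om b mu A F -> adm Om b mu B G ->
  adm Om b mu (A + B) (fun y xi => F y xi + G y xi).
Proof.
move=> [cF F0 Fb] [cG G0 Gb]; split=> [z Oz|y xi Oy yb|y xi Oy].
- by apply: continuousD; [exact: cF|exact: cG].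
- by rewrite F0// G0// addr0.
- by rewrite mulrDl (le_trans (ler_normD _ _))// lerD// ?Fb ?Gb.
Qed.

Lemma adm_scale Om b mu A c F : adm Om b mu A F ->
  adm Om b mu (`|c| * A) (fun y xi => c * F y xi).
Proof.
move=> [cF F0 Fb]; split=> [z Oz|y xi Oy yb|y xi Oy].
- by apply: continuousM; [exact: cst_continuous|exact: cF].
- by rewrite F0// mulr0.
- by rewrite normrM -mulrA ler_wpM2l// Fb.
Qed.

Lemma integral_yxiD Om b mu A B F G : open Om -> mu < - p%:R -> 0 <= A -> 0 <= B ->
  adm Om b mu A F -> adm Om b mu B G ->
  integral_yxi Om (fun y xi => F y xi + G y xi) = integral_yxi Om F + integral_yxi Om G.
Proof.
move=> oO hmu A0 B0 aF aG; apply: RintegralD; first exact: measurable_dom.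
  exact: (adm_integrable oO hmu A0 aF).
exact: (adm_integrable oO hmu B0 aG).
Qed.

Lemma integral_yxiZ Om b mu A F c : open Om -> mu < - p%:R -> 0 <= A ->
  adm Om b mu A F ->
  integral_yxi Om (fun y xi => c * F y xi) = c * integral_yxi Om F.
Proof.
move=> oO hmu A0 aF; apply: RintegralZl; first exact: measurable_dom.
exact: (adm_integrable oO hmu A0 aF).
Qed.

Lemma eq_integral_yxi Om F G : (forall y xi, Om y -> F y xi = G y xi) ->
  integral_yxi Om F = integral_yxi Om G.
Proof. by move=> FG; apply: eq_Rintegral => t /set_mem Ot; exact: FG. Qed.

End Admissible.

(** * Translation invariance of the integral *)

Section Translation.
Context {R : realType} {n p : nat}.
Local Notation RT := (measurableTypeR R).
Local Notation M := (@lebesgue_tuple R n \x @lebesgue_tuple R p)%E.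

Definition tuple_of_row m (v : 'rV[R]_m) : m.-tuple RT := [tuple v 0 i : RT | i < m].

Lemma row_of_tadd m (v : 'rV[R]_m) (t : m.-tuple RT) :
  row_of_tuple (tadd (tuple_of_row v) t) = v + row_of_tuple t.
Proof. by apply/rowP => i; rewrite !mxE !tnth_mktuple addrC. Qed.

Lemma ge0_integral_tadd2 (v : n.-tuple RT) (w : p.-tuple RT)
    (f : n.-tuple RT * p.-tuple RT -> \bar R) :
  measurable_fun setT f -> (forall t, 0 <= f t)%E ->
  (\int[M]_t f (tadd v t.1, tadd w t.2) = \int[M]_t f t)%E.
Proof.
move=> mf f0.
have mg : measurable_fun [set: n.-tuple RT * p.-tuple RT]
    (fun t => f (tadd v t.1, tadd w t.2)).
  apply: measurableT_comp => //; apply/measurable_fun_pair => /=.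
    by apply: (measurableT_comp (measurable_tadd v)); exact: measurable_fst.
  by apply: (measurableT_comp (measurable_tadd w)); exact: measurable_snd.
rewrite !fubini_tonelli1//= /fubini_F/=.
have mF := @measurable_fun_fubini_tonelli_F _ _ _ _ R (lebesgue_tuple p) f mf f0.
rewrite -[RHS](ge0_integral_tadd v mF); last first.
  by move=> x; apply: integral_ge0 => y _; exact: f0.
apply: eq_integral => x _.
rewrite (@ge0_integral_tadd R p w (fun y => f (tadd v x, y)))//.
by apply: measurableT_comp => //; exact: pair1_measurable.
Qed.

Lemma integral_yxi_translate (v : 'rV[R]_n) (w : 'rV[R]_p) (F : 'rV[R]_n -> 'rV[R]_p -> R) :
  continuous (fun z : 'rV[R]_n * 'rV[R]_p => F z.1 z.2) ->
  integral_yxi setT (fun y xi => F (v + y) (w + xi)) = integral_yxi setT F.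
Proof.
move=> cF; rewrite /integral_yxi /Rintegral; congr fine.
have mF : measurable_fun [set: n.-tuple RT * p.-tuple RT] (EFin \o rows F).
  apply/measurable_EFinP.
  by have := @measurable_rows R n p setT F openT (fun z _ => cF z).
pose g : n.-tuple RT * p.-tuple RT -> \bar R := EFin \o rows F.
pose gv t := g (tadd (tuple_of_row v) t.1, tadd (tuple_of_row w) t.2).
have gE t : (F (v + row_of_tuple t.1) (w + row_of_tuple t.2))%:E = gv t.
  by rewrite /gv /g /rows /= !row_of_tadd.
rewrite (_ : [set t | _] = setT); last by apply/seteqP; split.
under eq_integral do rewrite gE.
rewrite -[RHS]/(integral M setT g) (integralE _ _ gv) (integralE _ _ g).
have p0 t : (0 <= g^\+ t)%E by exact: funepos_ge0.
have n0 t : (0 <= g^\- t)%E by exact: funeneg_ge0.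
have Ep := ge0_integral_tadd2 (tuple_of_row v) (tuple_of_row w) (measurable_funepos mF) p0.
have En := ge0_integral_tadd2 (tuple_of_row v) (tuple_of_row w) (measurable_funeneg mF) n0.
have Fp : (\int[M]_t gv^\+ t = \int[M]_t g^\+ t)%E.
  by refine (etrans _ Ep); apply: eq_integral => t _; rewrite !funeposE.
have Fn : (\int[M]_t gv^\- t = \int[M]_t g^\- t)%E.
  by refine (etrans _ En); apply: eq_integral => t _; rewrite !funenegE.
by rewrite Fp Fn.
Qed.

End Translation.

(** * Derivatives and the integral *)

Section IntegralDerivative.
Context {R : realType} {n p : nat}.
Local Notation Y := ('rV[R]_n * 'rV[R]_p)%type.

(* By translation invariance [\int (Psi (z + h v) - Psi z) = 0], while the
   integrand is [h D_v Psi z] up to a second order Taylor remainder. *)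
Lemma integral_derive_eq0 (v : Y) (b mu A : R) (Psi : Y -> R) :
  mu < - p%:R -> 0 <= A -> `|v.1| <= 1 -> enorm v.2 <= 1 ->
  (forall z, derivable Psi z v) -> (forall z, derivable ('D_v Psi) z v) ->
  adm setT b mu A (fun y xi => Psi (y, xi)) ->
  adm setT b mu A (fun y xi => 'D_v Psi (y, xi)) ->
  (forall y xi, b < `|y| -> 'D_v ('D_v Psi) (y, xi) = 0) ->
  (forall y xi, `|'D_v ('D_v Psi) (y, xi)| <= A * japanese xi `^ mu) ->
  integral_yxi setT (fun y xi => 'D_v Psi (y, xi)) = 0.
Proof.
move=> hmu A0 v1 v2 d1 d2 aP aD D0 Db.
have mu0 : mu <= 0 by rewrite (le_trans (ltW hmu))// oppr_le0.
(* A translation by h v with h <= 1 moves the support by at most 1, so all integrands below fit the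
   radius b + 1. *)
have [c c0 Hc] := @adm_bound R n p setT (b + 1) mu openT hmu.
have wid B (F : 'rV[R]_n -> 'rV[R]_p -> R) : adm setT b mu B F -> adm setT (b + 1) mu B F.
  move=> [cF F0 Fb]; split=> // y xi Oy yb.
  by apply: F0 => //; apply: lt_trans yb; rewrite ltrDl.
have aP1 := wid _ _ aP; have aD1 := wid _ _ aD.
set I := integral_yxi setT _.
(* The power of 2 is the price of [japanese_translate]: derivatives are evaluated at translated
   points and compared with the weight at the original one. *)
pose K := 2 `^ (- mu) * A.
have K0 : 0 <= K by rewrite mulr_ge0// powR_ge0.
have KJ (w xi : 'rV[R]_p) : enorm w <= 1 ->
    A * japanese (w + xi) `^ mu <= K * japanese xi `^ mu.
  move=> w1; rewrite /K -[leRHS]mulrA mulrCA ler_wpM2l//.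
  exact: japanese_translate.
have main h : 0 < h -> h <= 1 -> `|h * I| <= h ^+ 2 * K * c.
  move=> h0 h1.
  pose S y xi := Psi (h *: v + (y, xi)).
  pose T y xi := S y xi + (-1 * Psi (y, xi) + - h * 'D_v Psi (y, xi)).
  have hh s : 0 <= s <= 1 -> `|s * h| <= 1.
    by move=> /andP[s0 s1]; rewrite ger0_norm ?mulr_ge0 ?mulr_ile1// ltW.
  have far s y : 0 <= s <= 1 -> b + 1 < `|y| -> b < `|(s * h) *: v.1 + y|.
    move=> s01 yb; have := lerB_dist y (- ((s * h) *: v.1)).
    rewrite opprK normrN [y + _]addrC => H.
    have : `|(s * h) *: v.1| <= 1 by rewrite normrZ mulr_ile1// hh.
    by move: H yb; move: `|_ + y| `|y| `|_ *: v.1| => x1 x2 x3; lra.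
  have en s : 0 <= s <= 1 -> enorm ((s * h) *: v.2) <= 1.
    move=> s01; rewrite -(@ler_pXn2r _ 2)// ?nnegrE ?enorm_ge0// expr1n enorm_sqr.
    under eq_bigr do rewrite mxE exprMn.
    rewrite -mulr_sumr -enorm_sqr mulr_ile1 ?sqr_ge0//.
      by rewrite -real_normK ?num_real// exprn_ile1 ?normr_ge0 ?hh.
    by rewrite exprn_ile1 ?enorm_ge0.
  have i1 : 0 <= (1 : R) <= 1 by rewrite ler01 lexx.
  have [cP P0 Pb] := aP; have [cD _ _] := aD.
  have cPsi : continuous Psi.
    move=> z; have := cP z Logic.I.
    by rewrite (_ : (fun z => _) = Psi)//; apply/funext => -[].
  have cDv : continuous ('D_v Psi).
    move=> z; have := cD z Logic.I.
    by rewrite (_ : (fun z => _) = 'D_v Psi)//; apply/funext => -[].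
  have cS : continuous (fun z : Y => S z.1 z.2).
    move=> z; rewrite (_ : (fun z => _) = (fun z => Psi (h *: v + z))); last first.
      by apply/funext => -[].
    apply: continuous_comp; last exact: cPsi.
    by apply: continuousD; [exact: cst_continuous|exact: cvg_id].
  have hvE y xi (s : R) : s *: v + (y, xi) = (s *: v.1 + y, s *: v.2 + xi) by [].
  have aS : adm setT (b + 1) mu K S.
    split=> [z _|y xi _ yb|y xi _]; first exact: cS.
      rewrite /S hvE P0//; have := far 1 y i1 yb; rewrite mul1r; exact.
    rewrite /S hvE; have := Pb (h *: v.1 + y) (h *: v.2 + xi) Logic.I.
    move: (Psi _) => d Hd; have e1 := en 1 i1; rewrite mul1r in e1.
    exact: (le_trans Hd (KJ _ _ e1)).
  have aT : adm setT (b + 1) mu (h ^+ 2 * K) T.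
    have TE y xi : T y xi = Psi (h *: v + (y, xi)) - Psi (y, xi) - h * 'D_v Psi (y, xi).
      by rewrite /T /S mulN1r mulNr addrA.
    split=> [z _|y xi _ yb|y xi _].
    - apply: continuousD; first exact: cS.
      by apply: continuousD; (apply: continuousM; first exact: cst_continuous); [exact: cP|exact: cD].
    - have [s [s' [s01 s'01 ->]]] : exists s s', [/\ 0 <= s <= 1, 0 <= s' <= 1 &
          T y xi = s * h ^+ 2 * 'D_v ('D_v Psi) ((s' * h) *: v + (y, xi))].
        by rewrite TE; apply: Taylor_line => s _; [exact: d1|exact: d2].
      by rewrite hvE D0 ?mulr0//; exact: far.
    - have [s [s' [s01 s'01 ->]]] : exists s s', [/\ 0 <= s <= 1, 0 <= s' <= 1 &
          T y xi = s * h ^+ 2 * 'D_v ('D_v Psi) ((s' * h) *: v + (y, xi))].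
        by rewrite TE; apply: Taylor_line => s _; [exact: d1|exact: d2].
      have /andP[s0 s1] := s01.
      rewrite hvE; have := Db ((s' * h) *: v.1 + y) ((s' * h) *: v.2 + xi).
      move: ('D_v ('D_v Psi) _) => d Hd.
      have Hd' := le_trans Hd (KJ _ _ (en _ s'01)).
      rewrite normrM -(mulrA _ K).
      apply: ler_pM; [exact: normr_ge0|exact: normr_ge0| |exact: Hd'].
      have sh0 : 0 <= s * h ^+ 2 by rewrite mulr_ge0 ?sqr_ge0.
      by rewrite (ger0_norm sh0); apply: ler_piMl => //; exact: sqr_ge0.
  have h2K0 : 0 <= h ^+ 2 * K by rewrite mulr_ge0 ?sqr_ge0.
  have -> : h * I = - integral_yxi setT T.
    have a1 := adm_scale (-1) aP1; have a2 := adm_scale (- h) aD1.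
    rewrite (integral_yxiD openT hmu K0 _ aS (adm_add a1 a2)); last first.
      by rewrite addr_ge0 ?mulr_ge0.
    rewrite (integral_yxiD openT hmu _ _ a1 a2) ?mulr_ge0//.
    rewrite (integral_yxiZ _ openT hmu A0 aP1) (integral_yxiZ _ openT hmu A0 aD1).
    have -> : integral_yxi setT S = integral_yxi setT (fun y xi => Psi (y, xi)).
      exact: (@integral_yxi_translate R n p (h *: v.1) (h *: v.2)
        (fun y xi => Psi (y, xi)) (fun z => cP z Logic.I)).
    by rewrite mulN1r addrA subrr add0r mulNr opprK.
  by rewrite normrN; exact: Hc aT.
apply/eqP; rewrite -normr_eq0 eq_le normr_ge0 andbT leNgt; apply/negP => I0.
have Kc0 : 0 <= K * c by rewrite mulr_ge0.
(* Chosen so that 0 < h <= 1 and h * (K * c) < |I|, against the bound |I| <= h * (K * c) that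
   follows from [main]. *)
pose h := `|I| / (`|I| + K * c + 1).
have den : 0 < `|I| + K * c + 1 by lra.
have h0 : 0 < h by rewrite divr_gt0.
have h1 : h <= 1 by rewrite ler_pdivrMr//; lra.
have E : h * (`|I| + K * c + 1) = `|I| by rewrite /h divfK// gt_eqF.
have := main h h0 h1; rewrite normrM (gtr0_norm h0); clearbody h K I => H.
have H' : `|I| <= h * (K * c) by rewrite -(ler_pM2l h0) !mulrA -expr2.
have hI := mulr_gt0 h0 I0; move: E hI H' h0; rewrite !mulrDr mulr1.
by move: (h * `|I|) (h * (K * c)) `|I| => x1 x2 x3; lra.
Qed.

End IntegralDerivative.

(** A quadratic error is more than differentiability needs, but it is what Taylor bounds deliver
    after integration. The lemma also serves for [flat] at the origin. *)
Lemma is_derive_quadratic {R : realType} {W : normedModType R} (f : W -> R) x v (l B r : R) :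
  0 <= B -> 0 < r ->
  (forall h : R, `|h| < r -> `|f (h *: v + x) - f x - h * l| <= h ^+ 2 * B) ->
  is_derive x v f l.
Proof.
move=> B0 r0 main.
have cvf : h^-1 *: (f (h *: v + x) - f x) @[h --> 0^'] --> l.
  apply/cvgrPdist_lt => eps eps0.
  have d0 : 0 < eps / (B + 1) by rewrite divr_gt0// ltr_wpDl.
  near=> h.
  have h0 : h != 0 by near: h; exact: nbhs_dnbhs_neq.
  have hr : `|h| < r by near: h; apply: dnbhs0_lt.
  have hd : `|h| < eps / (B + 1) by near: h; apply: dnbhs0_lt.
  have hh : 0 < `|h| by rewrite normr_gt0.
  rewrite distrC -(ltr_pM2l hh) -normrM mulrBr.
  have -> : h * (h^-1 *: (f (h *: v + x) - f x)) = f (h *: v + x) - f x.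
    by rewrite [_ *: _]/(_ * _) mulVKf.
  apply: (le_lt_trans (main h hr)).
  rewrite -real_normK ?num_real// expr2 -!mulrA ltr_pM2l//.
  rewrite ltr_pdivlMr in hd; last by rewrite ltr_wpDl.
  by apply: le_lt_trans hd; rewrite ler_wpM2l//; lra.
split; first by apply/cvg_ex; exists l.
exact: cvg_lim cvf.
Unshelve. all: by end_near. Qed.

Section ParametricIntegral.
Context {R : realType} {n p : nat} {W : normedModType R}.
Implicit Type F : W -> 'rV[R]_n -> 'rV[R]_p -> R.

(** Replaces dominated convergence: the Taylor remainder, of size h^2 times an integrable weight,
    integrates to O(h^2). *)
Lemma is_derive_integral (Om : set 'rV[R]_n) (b mu A B r : R) F
    (D : 'rV[R]_n -> 'rV[R]_p -> R) (x v : W) :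
  open Om -> mu < - p%:R -> 0 <= A -> 0 <= B -> 0 < r ->
  (forall h : R, `|h| < r -> adm Om b mu A (F (h *: v + x))) ->
  adm Om b mu A D ->
  (forall (h : R) y xi, `|h| < r -> Om y ->
    `|F (h *: v + x) y xi - F x y xi - h * D y xi| <= h ^+ 2 * B * japanese xi `^ mu) ->
  is_derive x v (fun x => integral_yxi Om (F x)) (integral_yxi Om D).
Proof.
move=> oO hmu A0 B0 r0 aF aD FD.
have [c c0 Hc] := @adm_bound R n p Om b mu oO hmu.
have aFx : adm Om b mu A (F x) by have := aF 0; rewrite normr0 scale0r add0r; exact.
have main h : `|h| < r -> `|integral_yxi Om (F (h *: v + x)) -
    integral_yxi Om (F x) - h * integral_yxi Om D| <= h ^+ 2 * B * c.
  move=> hr; have aFh := aF h hr.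
  pose T y xi := F (h *: v + x) y xi + (-1 * F x y xi + - h * D y xi).
  have a1 := adm_scale (-1) aFx; have a2 := adm_scale (- h) aD.
  have aT : adm Om b mu (h ^+ 2 * B) T.
    have [c1 z1 _] := adm_add aFh (adm_add a1 a2); split=> // y xi Oy.
    by rewrite /T mulN1r mulNr addrA; exact: FD.
  have -> : integral_yxi Om (F (h *: v + x)) - integral_yxi Om (F x) -
      h * integral_yxi Om D = integral_yxi Om T.
    rewrite (integral_yxiD oO hmu A0 _ aFh (adm_add a1 a2)) ?addr_ge0 ?mulr_ge0//.
    rewrite (integral_yxiD oO hmu _ _ a1 a2) ?mulr_ge0//.
    rewrite (integral_yxiZ _ oO hmu A0 aFx) (integral_yxiZ _ oO hmu A0 aD).
    by rewrite mulN1r mulNr addrA.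
  by apply: Hc => //; rewrite mulr_ge0 ?sqr_ge0.
apply: (@is_derive_quadratic _ _ _ _ _ _ (B * c) r); [exact: mulr_ge0|exact: r0|].
by move=> h hr; rewrite mulrA; exact: main.
Qed.

End ParametricIntegral.

(** * Nets of symbols and of phase functions *)

Section Sup0.
Context {R : realType}.

Lemma sup0_ub (A : set \bar R) x : A x -> (x <= Defs.sup0 A)%E.
Proof. by move=> Ax; apply: ereal_sup_ubound; right. Qed.

Lemma sup0_ge0 (A : set \bar R) : (0 <= Defs.sup0 A)%E.
Proof. by apply: ereal_sup_ubound; left. Qed.

Lemma sup0_le (A : set \bar R) (y : \bar R) : (0 <= y)%E -> (forall x, A x -> (x <= y)%E) ->
  (Defs.sup0 A <= y)%E.
Proof. by move=> y0 Ay; apply: ge_ereal_sup => x [->|/Ay]. Qed.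

(** Turns an extended real net of seminorms into a total real one. Values off ]0, 1] are irrelevant
    and set to 0; [fine] loses nothing where the seminorm is finite. *)
Definition sizes (q : R -> \bar R) (e : R) : R := if (0 < e <= 1) then fine (q e) else 0.

Lemma near0_unit : \forall e \near (0 : R)^'+, 0 < e <= 1.
Proof.
near=> e; apply/andP; split; near: e; [exact: nbhs_right_gt|exact: nbhs_right_le].
Unshelve. all: by end_near. Qed.

Lemma sizes_ge0 q e : (forall e, 0 <= q e)%E -> 0 <= sizes q e.
Proof. by move=> q0; rewrite /sizes; case: ifP => // _; exact: fine_ge0. Qed.

Lemma powO_sizes q b : (forall e, 0 <= q e)%E ->
  bigO_eps q b -> powO (sizes q) b.
Proof.
move=> q0 [M HM]; exists M; near=> e.
have e01 : 0 < e <= 1 by near: e; exact: near0_unit.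
have qM : (q e <= (M * e `^ b)%:E)%E by near: e.
rewrite /sizes e01 -lee_fin fineK// ge0_fin_numE//.
exact: le_lt_trans qM (ltry _).
Unshelve. all: by end_near. Qed.

Lemma tempered_sizes q : (forall e, 0 <= q e)%E ->
  (exists N : nat, bigO_eps q (- N%:R)) -> tempered (sizes q).
Proof.
by move=> q0 [N HN]; split=> [t|]; [exact: sizes_ge0|exists N; exact: powO_sizes].
Qed.

Lemma rapid_sizes q : (forall e, 0 <= q e)%E ->
  (forall k : nat, bigO_eps q k%:R) -> rapid (sizes q).
Proof.
by move=> q0 HN; split=> [t|k]; [exact: sizes_ge0|exact: powO_sizes].
Qed.

Lemma le_sizes q e (x : R) : (forall e, 0 <= q e)%E -> 0 < e <= 1 -> (q e < +oo)%E ->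
  (x%:E <= q e)%E -> x <= sizes q e.
Proof.
by move=> q0 e01 qoo xq; rewrite /sizes e01 -lee_fin fineK// ge0_fin_numE.
Qed.

End Sup0.

Lemma open_setX (T T' : topologicalType) (A : set T) (B : set T') :
  open A -> open B -> open (A `*` B).
Proof.
move=> oA oB; rewrite openE => -[a b] [/= Aa Bb].
by exists (A, B) => //; split; exact: open_nbhs_nbhs.
Qed.

Section SymbolClass.
Context {R : realType} {n' n p : nat}.
Local Notation C := R[i].
Local Notation Z := ('rV[R]_n' * 'rV[R]_n * 'rV[R]_p)%type.
Context (Omega' : set 'rV[R]_n') (Omega : set 'rV[R]_n).
Hypotheses (oO' : open Omega') (oO : open Omega).
Local Notation X := (Omega' `*` Omega).

Definition jap (w : Z) : R := japanese w.2.

(** The amount by which one derivative changes the order of a symbol of type (rho, delta). *)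
Definition fullwt (rho delta : R) (k : ('I_n' + 'I_n) + 'I_p) : R :=
  if k is inl _ then delta else - rho.

(** Symbol estimates are local in z and global in xi. Taking U away from the origin leaves room for
    phases, which are not smooth at xi = 0. *)
Definition cylinders (U : set 'rV[R]_p) : set (set Z) :=
  [set S | exists2 K, compact_in X K & S = K `*` U].

Lemma openX_ : open X. Proof. exact: open_setX. Qed.

Lemma open_domain (U : set 'rV[R]_p) : open U -> open (X `*` U).
Proof. by move=> oU; apply: open_setX => //; exact: openX_. Qed.

Lemma cylinders_sub U K : cylinders U K -> K `<=` X `*` U.
Proof. by move=> [K0 [_ KX] ->] w [/KX]. Qed.

Lemma jap_ge1 w : 1 <= jap w. Proof. exact: japanese_ge1. Qed.

Definition nxi (s : seq (('I_n' + 'I_n) + 'I_p)) : nat := \sum_j count_mem (inr j) s.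
Definition nz (s : seq (('I_n' + 'I_n) + 'I_p)) : nat := \sum_k count_mem (inl k) s.

Lemma nxi_nz s : (nxi s + nz s = size s)%N.
Proof. by rewrite -(sum_count_mem s) big_sumType addnC. Qed.

Lemma sum_fullwt rho delta s :
  \sum_(i <- s) fullwt rho delta i = - rho * (nxi s)%:R + delta * (nz s)%:R.
Proof.
elim: s => [|i s IH].
  by rewrite big_nil /nxi /nz !big1// !mulr0 addr0.
have nxiS : nxi (i :: s) = (nxi [:: i] + nxi s)%N.
  by rewrite /nxi -big_split; apply: eq_bigr => j _ /=; rewrite addn0.
have nzS : nz (i :: s) = (nz [:: i] + nz s)%N.
  by rewrite /nz -big_split; apply: eq_bigr => j _ /=; rewrite addn0.
rewrite big_cons IH nxiS nzS !natrD !mulrDr.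
suff -> : fullwt rho delta i = - rho * (nxi [:: i])%:R + delta * (nz [:: i])%:R by ring.
case: i {IH nxiS nzS} => [k|j] /=; rewrite /nxi /nz.
  rewrite big1 ?mulr0 ?add0r//.
  by rewrite (bigD1 k)//= eqxx big1 ?mulr1// => l; rewrite (inj_eq inl_inj) eq_sym => /negPf->.
rewrite [X in delta * X%:R]big1 ?mulr0 ?addr0//.
by rewrite (bigD1 j)//= eqxx big1 ?mulr1// => l; rewrite (inj_eq inr_inj) eq_sym => /negPf->.
Qed.

Lemma cword_map (I J : Type) (V : normedModType R) (e : I -> V) (r : J -> I) s f :
  cword_deriv e (map r s) f = cword_deriv (e \o r) s f.
Proof. by elim: s => //= j s ->. Qed.

Lemma cword_mixed U (f : Z -> C) s w : open U -> csmooth_on eZ U f -> U w ->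
  cword_deriv eZ s f w =
  mixed_deriv (fun j => count_mem (inr j) s) (fun k => count_mem (inl k) s) f w.
Proof.
move=> oU sf Uw; rewrite /mixed_deriv !multi_cderivE.
set l1 := flatten _; set l2 := flatten _.
have -> : cword_deriv exi l1 (cword_deriv ez l2 f) =
    cword_deriv eZ (map inr l1 ++ map inl l2) f.
  by rewrite cword_deriv_cat !cword_map.
apply: cword_deriv_perm oU sf _ _ Uw.
have cnt (I : finType) (h : I -> nat) (i : I) :
    count_mem i (flatten [seq nseq (h j) j | j <- enum I]) = h i.
  rewrite count_flatten -map_comp (eq_map (g := fun j => (j == i) * h j)%N); last first.
    by move=> j /=; rewrite count_nseq.
  by rewrite sumnE big_map big_enum/= (bigD1 i)//= eqxx mul1n big1 ?addn0// => j /negPf->.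
have dl (k : 'I_n' + 'I_n) l : count_mem (inl k : _ + 'I_p) (map inl l) = count_mem k l.
  by rewrite count_map; apply: eq_count => x /=; rewrite (inj_eq inl_inj).
have dr (j : 'I_p) l : count_mem (inr j : ('I_n' + 'I_n) + _) (map inr l) = count_mem j l.
  by rewrite count_map; apply: eq_count => x /=; rewrite (inj_eq inr_inj).
have dlr (k : 'I_n' + 'I_n) (l : seq 'I_p) : count_mem (inl k) (map inr l) = 0%N.
  by elim: l.
have drl (j : 'I_p) (l : seq ('I_n' + 'I_n)) : count_mem (inr j) (map inl l) = 0%N.
  by elim: l.
apply/allP => i _ /=; apply/eqP; rewrite count_cat.
by case: i => [k|j]; rewrite ?dl ?dlr ?dr ?drl cnt ?addn0.
Qed.

Context {E : Type} (eps : E -> R).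

Lemma rel_symbol_words (rho delta m : R) (f g : E -> Z -> C) (U : set 'rV[R]_p) k :
  (forall s K, (size s <= k)%N -> compact_in X K -> exists A B, [/\ tempered A, rapid B &
    forall e z xi, K z -> U xi ->
    let b := m - rho * (nxi s)%:R + delta * (nz s)%:R in
    [/\ normc (cword_deriv eZ s (f e) (z, xi)) <= A (eps e) * japanese xi `^ b,
        normc (cword_deriv eZ s (g e) (z, xi)) <= A (eps e) * japanese xi `^ b &
        normc (cword_deriv eZ s (f e) (z, xi) - cword_deriv eZ s (g e) (z, xi))
          <= B (eps e) * japanese xi `^ b]]) ->
  nrel eps eZ (fullwt rho delta) (cylinders U) jap k m f g.
Proof.
move=> H; apply: rel_words => s sk S [K cK ->].
have [A [B [tA rB HAB]]] := H s K sk cK; exists A, B; split=> // e [z xi] [Kz Ux].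
by rewrite sum_fullwt mulNr addrA; exact: HAB.
Qed.

End SymbolClass.

(** * Representatives of generalized symbols *)

Section SymbolReprs.
Context {R : realType} {n' n p : nat}.
Local Notation C := R[i].
Local Notation Z := ('rV[R]_n' * 'rV[R]_n * 'rV[R]_p)%type.
Context (Omega' : set 'rV[R]_n') (Omega : set 'rV[R]_n).
Hypotheses (oO' : open Omega') (oO : open Omega).
Local Notation X := (Omega' `*` Omega).
Context (m rho delta : R).

(** Nets are constrained on ]0, 1] only. With the interval itself as index type, statements about
    all indices carry no side condition. *)
Definition epsdom := {e : R | 0 < e <= 1}.
Definition epsval (e : epsdom) : R := sval e.

Lemma epsval01 e : 0 < epsval e <= 1. Proof. by case: e. Qed.

Local Notation srel := (nrel epsval (@eZ R n' n p) (fullwt rho delta)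
  (cylinders Omega' Omega setT) jap).
Local Notation ssmooth := (nsmooth (@eZ R n' n p) (X `*` setT)).

Definition restr (T : Type) (u : R -> T) : epsdom -> T := fun e => u (epsval e).

Let oD : open (X `*` [set: 'rV[R]_p]).
Proof. by apply: open_domain => //; exact: openT. Qed.

Lemma symbol_seminorm_ge0 K j (a : Z -> C) :
  (0 <= symbol_seminorm m rho delta K j a)%E.
Proof. exact: sup0_ge0. Qed.

Lemma symbol_seminorm_word (K : set ('rV[R]_n' * 'rV[R]_n)) (j : nat) (a : Z -> C) s z xi :
  csmooth_on eZ (X `*` setT) a -> K `<=` X -> (size s <= j)%N -> K z ->
  ((japanese xi `^ (- (m - rho * (nxi s)%:R + delta * (nz s)%:R)) *
    normc (cword_deriv eZ s a (z, xi)))%:E <= symbol_seminorm m rho delta K j a)%E.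
Proof.
move=> sa KX sj Kz; apply: sup0_ub.
exists z, xi, (fun j => count_mem (inr j) s), (fun k => count_mem (inl k) s); split=> //.
  by rewrite /order -/(nxi s) -/(nz s) nxi_nz.
rewrite -(cword_mixed s oD sa); last by split=> //; exact: KX.
rewrite /order -/(nxi s) -/(nz s); congr (_ `^ _ * _)%:E; ring.
Qed.

Lemma powR_shift (x y b A : R) : 0 < x -> x `^ (- b) * y <= A -> y <= A * x `^ b.
Proof.
move=> x0; rewrite powRN mulrC ler_pdivrMr ?powR_gt0//.
Qed.

Lemma symbol_word_le (u : net R Z) (K : set ('rV[R]_n' * 'rV[R]_n)) s :
  in_space (symbol_space m rho delta X) u -> compact_in X K ->
  forall (e : epsdom) z xi, K z ->
  normc (cword_deriv eZ s (u (epsval e)) (z, xi)) <=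
    sizes (fun t => symbol_seminorm m rho delta K (size s) (u t)) (epsval e) *
    japanese xi `^ (m - rho * (nxi s)%:R + delta * (nz s)%:R).
Proof.
move=> iu cK e z xi Kz; have [su uoo] := iu _ (epsval01 e).
apply: powR_shift; first exact: japanese_gt0.
apply: le_sizes; first by move=> t; exact: symbol_seminorm_ge0.
- exact: epsval01.
- exact: uoo.
- by apply: symbol_seminorm_word => //; have [] := cK.
Qed.

Lemma moderate_srel (u : net R Z) : moderate (symbol_space m rho delta X) u ->
  ssmooth (restr u) /\ forall k, srel k m (restr u) (restr u).
Proof.
move=> [iu mu]; split=> [e|k]; first by have [] := iu _ (epsval01 e).
apply: rel_symbol_words => // s K sk cK.
exists (sizes (fun t => symbol_seminorm m rho delta K (size s) (u t))), (fun=> 0); split.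
- apply: tempered_sizes => [t|]; first exact: symbol_seminorm_ge0.
  by apply: mu; exists K, (size s).
- exact: rapid0.
move=> e z xi Kz _; split; try exact: symbol_word_le.
by rewrite subrr normc0 mul0r.
Qed.

Lemma negligible_srel (u : net R Z) : Defs.negligible (symbol_space m rho delta X) u ->
  ssmooth (restr u) /\ forall k, srel k m (restr u) (fun _ _ => 0).
Proof.
move=> [iu nu]; split=> [e|k]; first by have [] := iu _ (epsval01 e).
apply: rel_symbol_words => // s K sk cK.
set q := sizes (fun t => symbol_seminorm m rho delta K (size s) (u t)).
have rq : rapid q.
  apply: rapid_sizes => [t|]; first exact: symbol_seminorm_ge0.
  by apply: nu; exists K, (size s).
exists q, q; split; [exact: rapid_tempered|exact: rq|].
have q0 t : 0 <= q t by have [] := rq.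
have z0 : forall w, cword_deriv eZ s (fun _ : Z => 0 : C) w = 0.
  elim: s {sk q rq q0} => // i s IH w /=.
  by rewrite (_ : cword_deriv _ _ _ = fun=> 0) ?cderiv_cst//; apply/funext.
move=> e z xi Kz _; rewrite /= z0 subr0 normc0.
have h := symbol_word_le s iu cK e xi Kz.
by split; [exact: h|apply: mulr_ge0; [exact: q0|exact: powR_ge0]|exact: h].
Qed.

Lemma reprs_srel (a : Stilde m rho delta X) (a1 a2 : net R Z) :
  (a : set (net R Z)) a1 -> (a : set (net R Z)) a2 ->
  [/\ ssmooth (restr a1), ssmooth (restr a2) &
      forall k, srel k m (restr a1) (restr a2)].
Proof.
case: a => A [u mu /= ->]; have [su ru] := moderate_srel mu.
have H b : coset (symbol_space m rho delta X) u b ->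
    ssmooth (restr b) /\ forall k, srel k m (restr b) (restr u).
  move=> /negligible_srel[sd rd].
  have bE e w : (X `*` setT) w -> restr (b - u) e w + restr u e w = restr b e w.
    by move=> _; rewrite -[restr (b - u) e w]/(restr b e w - restr u e w) subrK.
  split=> [e|k].
    by apply: csmooth_on_eq (nsmooth_add oD sd su e) => // w; exact: bE.
  have z0 : ssmooth (fun (_ : epsdom) _ => 0) by move=> e; exact: csmooth_on_cst.
  have KD := @cylinders_sub R n' n p Omega' Omega setT.
  have := rel_add oD KD sd z0 su su (rd k) (ru k).
  by apply: (rel_eq oD KD) => e w Dw; [exact: bE|exact: add0r].
move=> /H[s1 r1] /H[s2 r2]; split=> // k.
exact: rel_trans (r1 k) (rel_sym (r2 k)).
Qed.

End SymbolReprs.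

Section Linear.
Context {R : realType} {V : normedModType R}.

Lemma is_derive_near0 (f : V -> R) x v :
  (\forall h \near (0 : R), f (h *: v + x) = 0) -> is_derive x v f 0.
Proof.
move=> f0; have fx : f x = 0 by have := nbhs_singleton f0; rewrite scale0r add0r.
have cv : h^-1 *: (f (h *: v + x) - f x) @[h --> 0^'] --> (0 : R).
  apply: (@cvg_trans _ ((fun=> 0 : R) @ (0 : R)^')); last exact: cvg_cst.
  apply: near_eq_cvg; apply: cvg_within.
  by apply: filterS f0 => h /= ->; rewrite fx subrr scaler0.
by split; [apply/cvg_ex; exists 0|exact: cvg_lim cv].
Qed.

Lemma is_derive_linear (f : V -> R) x v :
  (forall (h : R) u w, f (h *: u + w) = h * f u + f w) -> is_derive x v f (f v).
Proof.
move=> lf.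
have cv : h^-1 *: (f (h *: v + x) - f x) @[h --> 0^'] --> f v.
  apply: (@cvg_trans _ ((fun=> f v : R) @ (0 : R)^')); last exact: cvg_cst.
  apply: near_eq_cvg; near=> h.
  have h0 : h != 0 by near: h; exact: nbhs_dnbhs_neq.
  by rewrite lf addrK; apply: esym; exact: mulKf.
by split; [apply/cvg_ex; exists (f v)|exact: cvg_lim cv].
Unshelve. all: by end_near. Qed.

Lemma smooth_on_linear (I : Type) (e : I -> V) (U : set V) (f : V -> R) :
  (forall (h : R) u w, f (h *: u + w) = h * f u + f w) -> continuous f ->
  smooth_on e U f.
Proof.
move=> lf cf; apply/smooth_onP; case=> [|k]; first by split=> // x _; exact: cf.
split=> [x _|i]; first exact: cf.
split=> [x _|]; first by have [d _] := is_derive_linear x (e i) lf; exact: d.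
have -> : 'D_(e i) f = fun=> f (e i); last exact: Ck_cst.
by apply/funext => x; have [_ E] := is_derive_linear x (e i) lf; exact: E.
Qed.

Lemma derive_dirZ (f : V -> R) x v (t : R) : derivable f x v ->
  is_derive x (t *: v) f (t * 'D_v f x).
Proof.
move=> df.
have df0 : derivable f ((0 * t) *: v + x) v by rewrite mul0r scale0r add0r.
have [d E] := is_derive_lineZ df0; rewrite mul0r scale0r add0r in E.
have lE : (fun h : R => h^-1 *: (f (h *: (t *: v) + x) - f x)) =
    (fun h : R => h^-1 *: (f (((h *: (1 : R) + 0) * t) *: v + x) - f ((0 * t) *: v + x))).
  by apply/funext => h; rewrite mul0r scale0r add0r addr0 [h *: 1]mulr1 scalerA.
by split; [rewrite /derivable lE; exact: d|rewrite /derive lE; exact: E].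
Qed.

Lemma compact_norm_bound (A : set V) (f : V -> R) : compact A ->
  (forall x, A x -> {for x, continuous f}) -> exists2 M, 0 <= M & forall x, A x -> `|f x| <= M.
Proof.
move=> cA cf; have cfA : {within A, continuous f}.
  by apply: continuous_in_subspaceT => x /set_mem; exact: cf.
have /compact_bounded[M [_ HM]] := continuous_compact cfA cA.
exists (`|M| + 1); first by rewrite addr_ge0.
move=> x Ax; apply: HM; last by exists x.
by rewrite (le_lt_trans (ler_norm M))// ltrDl.
Qed.

End Linear.

(** * The Euclidean norm *)

Section Enorm.
Context {R : realType}.

Lemma continuous_enorm_sqr n : continuous (fun v : 'rV[R]_n => enorm v ^+ 2).
Proof.
suff sm : smooth_on (fun i : 'I_n => std i) setT (fun v : 'rV[R]_n => enorm v ^+ 2).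
  by move=> v; exact: (smooth_on_cont sm).
have sc (i : 'I_n) : smooth_on (fun i : 'I_n => std i) setT (fun v : 'rV[R]_n => v 0 i).
  apply: smooth_on_linear => [h u w|]; first by rewrite !mxE.
  exact: coord_continuous.
have := @smooth_on_sum R _ _ (fun i : 'I_n => std i) _ (index_enum 'I_n) setT
  (fun i v => v 0 i * v 0 i) openT (fun i => smooth_on_mul openT (sc i) (sc i)).
apply: smooth_on_eq => [|v _]; first exact: openT.
by rewrite enorm_sqr; apply: eq_bigr => i _; rewrite expr2.
Qed.

Lemma continuous_enorm n : continuous (@enorm R n).
Proof.
move=> v; have -> : @enorm R n = Num.sqrt \o (fun v => enorm v ^+ 2).
  by apply/funext => w /=; rewrite sqrtr_sqr ger0_norm// enorm_ge0.
by apply: continuous_comp; [exact: continuous_enorm_sqr|exact: sqrt_continuous].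
Qed.

Lemma open_enorm_gt n (r : R) : open [set v : 'rV[R]_n | r < enorm v].
Proof.
apply: (@open_comp _ _ (@enorm R n) [set x | r < x]); last exact: open_gt.
by move=> v _; exact: continuous_enorm.
Qed.

Lemma open_enorm_lt n (r : R) : open [set v : 'rV[R]_n | enorm v < r].
Proof.
apply: (@open_comp _ _ (@enorm R n) [set x | x < r]); last exact: open_lt.
by move=> v _; exact: continuous_enorm.
Qed.

Lemma enormZ n (t : R) (v : 'rV[R]_n) : enorm (t *: v) = `|t| * enorm v.
Proof.
rewrite /enorm; under eq_bigr do rewrite mxE exprMn.
by rewrite -mulr_sumr sqrtrM ?sqr_ge0// sqrtr_sqr.
Qed.

Lemma coord_le_enorm n (v : 'rV[R]_n) i : `|v 0 i| <= enorm v.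
Proof.
rewrite -(@ler_pXn2r _ 2)// ?nnegrE ?enorm_ge0// real_normK ?num_real// enorm_sqr.
by rewrite (bigD1 i)//= lerDl sumr_ge0// => j _; exact: sqr_ge0.
Qed.

Lemma enorm_eq0 n (v : 'rV[R]_n) : enorm v = 0 -> v = 0.
Proof.
move=> v0; apply/rowP => i; rewrite mxE; apply/eqP; rewrite -normr_le0 -v0.
exact: coord_le_enorm.
Qed.

Lemma enorm_gt0 n (v : 'rV[R]_n) : v != 0 -> 0 < enorm v.
Proof.
move=> v0; rewrite lt_neqAle enorm_ge0 andbT eq_sym.
by apply: contra_neq v0; exact: enorm_eq0.
Qed.

Lemma enorm0 n : enorm (0 : 'rV[R]_n) = 0.
Proof. by have := enormZ 0 (0 : 'rV[R]_n); rewrite scale0r normr0 mul0r. Qed.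

Definition sphere n := [set v : 'rV[R]_n | enorm v = 1].

Lemma sphere_normalize n (v : 'rV[R]_n) : v != 0 -> sphere ((enorm v)^-1 *: v).
Proof.
move=> v0; rewrite /sphere/= enormZ ger0_norm ?invr_ge0 ?enorm_ge0//.
by rewrite mulVf// gt_eqF// enorm_gt0.
Qed.

Lemma sphere_neq0 n (v : 'rV[R]_n) : sphere v -> v != 0.
Proof. by rewrite /sphere/= => v1; apply/eqP => v0; move: v1; rewrite v0 enorm0 => /esym/eqP; rewrite oner_eq0. Qed.

Lemma compact_sphere n : compact (@sphere n).
Proof.
apply: bounded_closed_compact.
  exists 1; split=> // M M1 v /= v1; apply: (le_trans _ (ltW M1)).
  rewrite [ `|v|]mx_normrE; apply/bigmax_leP; split=> // -[i j] _ /=.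
  by rewrite ord1 (le_trans (coord_le_enorm _ _))// v1.
rewrite (_ : @sphere n = @enorm R n @^-1` [set 1])//.
apply: closed_comp => [v _|]; [exact: continuous_enorm|exact: closed_eq].
Qed.

Lemma enorm_le_japanese n (v : 'rV[R]_n) : enorm v <= japanese v.
Proof.
rewrite -(@ler_pXn2r _ 2)// ?nnegrE ?enorm_ge0 ?(ltW (japanese_gt0 v))//.
by rewrite japanese_sqr -enorm_sqr lerDr.
Qed.

(** For |v| > 1/8 the norm and the bracket are comparable: |v| <= <v> <= 9 |v|, the second because 1
    <= 80 |v|^2. The sign of b decides which inequality is used. *)
Lemma enorm_powR_le n (v : 'rV[R]_n) (b : R) : 8^-1 < enorm v ->
  enorm v `^ b <= 9 `^ `|b| * japanese v `^ b.
Proof.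
move=> hv; have v0 : 0 < enorm v by lra.
have [b0|b0] := leP 0 b.
  have h1 : enorm v `^ b <= japanese v `^ b.
    by apply: ge0_ler_powR; rewrite ?nnegrE ?(ltW v0) ?(ltW (japanese_gt0 v)) ?enorm_le_japanese.
  rewrite (le_trans h1)// ler_peMl ?powR_ge0//.
  by rewrite -[leLHS](powRr0 (9 : R)); apply: ler_powR => //; lra.
rewrite ltr0_norm// -powRVn// -powRM ?invr_ge0 ?(ltW (japanese_gt0 v))//.
apply: ler_powRn; [by rewrite mulr_gt0 ?invr_gt0 ?japanese_gt0| |exact: ltW].
rewrite -(@ler_pXn2r _ 2)// ?nnegrE ?mulr_ge0 ?(ltW v0) ?(ltW (japanese_gt0 v))//.
rewrite exprMn japanese_sqr -enorm_sqr !expr2; nra.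
Qed.

End Enorm.

(** * Homogeneous functions *)

Section Homogeneous.
Context {R : realType} {n' n p : nat}.
Local Notation C := R[i].
Local Notation Z := ('rV[R]_n' * 'rV[R]_n * 'rV[R]_p)%type.
Context (Omega' : set 'rV[R]_n') (Omega : set 'rV[R]_n).
Hypotheses (oO' : open Omega') (oO : open Omega).
Local Notation X := (Omega' `*` Omega).
Local Notation N0 := [set xi : 'rV[R]_p | xi != 0].
Local Notation cRe := (@complex.Re _).
Local Notation cIm := (@complex.Im _).

Definition dil (t : R) (w : Z) : Z := (w.1, t *: w.2).

Lemma open_neq0 : open N0.
Proof.
rewrite (_ : N0 = [set xi | 0 < enorm xi]); first exact: open_enorm_gt.
apply/seteqP; split=> x /=; first exact: enorm_gt0.
by apply: contraTneq => ->; rewrite enorm0 ltxx.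
Qed.

Lemma open_XN0 : open (X `*` N0).
Proof. by apply: open_domain => //; exact: open_neq0. Qed.

Definition homogeneous (d : R) (g : Z -> R) :=
  forall w t, (X `*` N0) w -> 0 < t -> g (dil t w) = t `^ d * g w.

Lemma dil_linear t (h : R) v w : dil t (h *: v + w) = h *: dil t v + dil t w.
Proof. by congr pair; rewrite /= scalerDr !scalerA mulrC. Qed.

Lemma derive_dil t (g : Z -> R) (v w : Z) : 'D_v (g \o dil t) w = 'D_(dil t v) g (dil t w).
Proof.
rewrite /derive.
have -> // : (fun h : R => h^-1 *: ((g \o dil t) (h *: v + w) - (g \o dil t) w)) =
  (fun h : R => h^-1 *: (g (h *: dil t v + dil t w) - g (dil t w))).
by apply/funext => h; rewrite /= dil_linear.
Qed.

#[local] Opaque derive derivable.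

Lemma dil_dom t w : 0 < t -> (X `*` N0) w -> (X `*` N0) (dil t w).
Proof.
by move=> t0 [Xw w0]; split=> //=; rewrite scaler_eq0 gt_eqF.
Qed.

Lemma homogeneous_derive d (g : Z -> R) (v : Z) t (w : Z) : 0 < t -> (X `*` N0) w ->
  homogeneous d g -> derivable g w v ->
  'D_(dil t v) g (dil t w) = t `^ d * 'D_v g w.
Proof.
move=> t0 Dw hg dg; rewrite -derive_dil.
have -> : 'D_v (g \o dil t) w = 'D_v (t `^ d \*: g) w.
  by apply: near_eq_derive; apply: (near_eq_on open_XN0 Dw) => y Dy; exact: hg.
by rewrite deriveZ.
Qed.

(** The dilation [dil t] fixes the z-directions and multiplies the xi-directions by t. Dividing by
    this t lowers the degree by one for each xi-derivative. *)
Lemma homogeneous_D d (g : Z -> R) (i : ('I_n' + 'I_n) + 'I_p) :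
  smooth_on eZ (X `*` N0) g -> homogeneous d g ->
  homogeneous (d - (nxi [:: i])%:R) ('D_(eZ i) g).
Proof.
move=> sg hg w t Dw t0.
have dgw : derivable g w (eZ i) by exact: (smooth_on_derivable sg Dw).
have dgt : derivable g (dil t w) (eZ i).
  exact: (smooth_on_derivable sg (dil_dom t0 Dw)).
have E := homogeneous_derive t0 Dw hg dgw.
case: i E dgw dgt => [k|j] E dgw dgt.
  have dv : dil t (eZ (inl k)) = eZ (inl k) by rewrite /dil /= scaler0; case: k {E dgw dgt}.
  rewrite dv in E; rewrite E; congr (_ `^ _ * _).
  by rewrite /nxi big1 ?subr0// => j _ /=.
have dv : dil t (eZ (inr j)) = t *: eZ (inr j).
  by congr pair; rewrite /= scaler0.
have [_ E2] := derive_dirZ t dgt.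
rewrite dv E2 in E.
have -> : nxi [:: inr j : ('I_n' + 'I_n) + 'I_p] = 1%N.
  by rewrite /nxi (bigD1 j)//= eqxx big1// => l; rewrite (inj_eq inr_inj) eq_sym => /negPf->.
have t0' : t != 0 by rewrite gt_eqF.
rewrite powRB ?t0' ?implybT// powRr1 ?(ltW t0)//.
apply: (mulfI t0'); rewrite E mulrA; congr (_ * _).
by rewrite mulrCA mulfV ?mulr1.
Qed.

Lemma homogeneous_word d (g : Z -> R) s : smooth_on eZ (X `*` N0) g -> homogeneous d g ->
  homogeneous (d - (nxi s)%:R) (word_deriv eZ s g).
Proof.
elim/last_ind: s d g => [|s i IH] d g sg hg.
  by rewrite (_ : nxi [::] = 0%N) ?subr0// /nxi big1.
rewrite word_deriv_rcons.
have -> : nxi (rcons s i) = (nxi [:: i] + nxi s)%N.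
  rewrite /nxi -big_split; apply: eq_bigr => j _ /=.
  by rewrite -cats1 count_cat addnC.
rewrite natrD opprD addrA; apply: IH; first exact: smooth_on_D.
exact: homogeneous_D.
Qed.

(** The function is bounded on the compact product of K with the unit sphere, and homogeneity
    spreads the bound to all xi. *)
Lemma homogeneous_bound d (g : Z -> R) (K : set ('rV[R]_n' * 'rV[R]_n)) :
  (forall w, (X `*` N0) w -> {for w, continuous g}) -> homogeneous d g ->
  compact_in X K -> exists2 M, 0 <= M & forall z xi, K z -> xi != 0 ->
  `|g (z, xi)| <= M * enorm xi `^ d.
Proof.
move=> cg hg [cK KX].
have cKS : compact (K `*` @sphere R p) by apply: compact_setX => //; exact: compact_sphere.
have [M M0 HM] : exists2 M, 0 <= M & forall x, (K `*` @sphere R p) x -> `|g x| <= M.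
  apply: compact_norm_bound => // x [Kx Sx]; apply: cg; split; first exact: KX.
  exact: sphere_neq0 Sx.
exists M => // z xi Kz xi0.
have n0 := enorm_gt0 xi0.
have -> : (z, xi) = dil (enorm xi) (z, (enorm xi)^-1 *: xi).
  by rewrite /dil /= scalerA mulfV ?scale1r// gt_eqF.
rewrite hg//; last by split; [exact: KX|exact: sphere_neq0 (sphere_normalize xi0)].
rewrite normrM ger0_norm ?powR_ge0// mulrC ler_wpM2r ?powR_ge0//.
by apply: HM; split=> //; exact: sphere_normalize.
Qed.

Lemma hg_homogeneous (a : Z -> C) : lcs_dom (hg_space X) a ->
  homogeneous 1 (cRe \o a) /\ homogeneous 1 (cIm \o a).
Proof.
move=> [_ ha]; split=> -[z xi] t [Xz x0] t0; rewrite powRr1 ?(ltW t0)//.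
  have E := congr1 (@complex.Re R) (ha z xi t Xz x0 t0).
  by rewrite ReM /= mul0r subr0 in E.
have E := congr1 (@complex.Im R) (ha z xi t Xz x0 t0).
by rewrite ImM /= mul0r addr0 in E.
Qed.

Lemma hg_word_bound (a : Z -> C) s K : lcs_dom (hg_space X) a -> compact_in X K ->
  exists2 M, 0 <= M & forall z xi, K z -> xi != 0 ->
  normc (cword_deriv eZ s a (z, xi)) <= M * enorm xi `^ (1 - (nxi s)%:R).
Proof.
move=> da cK; have [h1 h2] := hg_homogeneous da; have [[s1 s2] _] := da.
have c1 w : (X `*` N0) w -> {for w, continuous (word_deriv eZ s (cRe \o a))}.
  by move=> Dw; have [] := s1 s w Dw.
have c2 w : (X `*` N0) w -> {for w, continuous (word_deriv eZ s (cIm \o a))}.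
  by move=> Dw; have [] := s2 s w Dw.
have [M1 M10 H1] := homogeneous_bound c1 (homogeneous_word s s1 h1) cK.
have [M2 M20 H2] := homogeneous_bound c2 (homogeneous_word s s2 h2) cK.
exists (M1 + M2) => [|z xi Kz x0]; first exact: addr_ge0.
have e1 : cRe (cword_deriv eZ s a (z, xi)) = word_deriv eZ s (cRe \o a) (z, xi).
  by rewrite -Re_cword.
have e2 : cIm (cword_deriv eZ s a (z, xi)) = word_deriv eZ s (cIm \o a) (z, xi).
  by rewrite -Im_cword.
apply: (le_trans (normc_le _)); rewrite e1 e2 mulrDl; apply: lerD; first exact: H1.
exact: H2.
Qed.

Lemma hg_word_seminorm (K : set ('rV[R]_n' * 'rV[R]_n)) (a : Z -> C) s z xi :
  csmooth_on eZ (X `*` N0) a -> K `<=` X -> K z -> xi != 0 ->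
  ((enorm xi `^ (- (1 - (nxi s)%:R)) * normc (cword_deriv eZ s a (z, xi)))%:E <=
   hg_seminorm K (fun j => count_mem (inr j) s) (fun k => count_mem (inl k) s) a)%E.
Proof.
move=> sa KX Kz x0; apply: sup0_ub; exists z, xi; split=> //.
rewrite -(cword_mixed s open_XN0 sa); last by split=> //; exact: KX.
by rewrite /order -/(nxi s) opprB addrC.
Qed.

(** Finiteness is not built into [hg_space]; it follows from homogeneity, and it is what makes
    [sizes] faithful. *)
Lemma hg_finite (K : set ('rV[R]_n' * 'rV[R]_n)) (a : Z -> C) s :
  lcs_dom (hg_space X) a -> compact_in X K ->
  (hg_seminorm K (fun j => count_mem (inr j) s) (fun k => count_mem (inl k) s) a < +oo)%E.
Proof.
move=> da cK; have [M M0 HM] := hg_word_bound s da cK.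
apply: (@le_lt_trans _ _ M%:E); last exact: ltry.
apply: sup0_le; first by rewrite lee_fin.
have [[sa _] [_ KX]] := (da, cK).
move=> _ [z [xi [Kz x0 ->]]]; rewrite lee_fin -(cword_mixed s open_XN0 sa); last first.
  by split=> //; exact: KX.
rewrite /order -/(nxi s).
have -> : -1 + (nxi s)%:R = - (1 - (nxi s)%:R) :> R by rewrite opprB addrC.
by rewrite powRN mulrC ler_pdivrMr ?powR_gt0 ?enorm_gt0// HM.
Qed.

Lemma hg_word_le (u : net R Z) (K : set ('rV[R]_n' * 'rV[R]_n)) s :
  in_space (hg_space X) u -> compact_in X K ->
  forall (e : epsdom) z xi, K z -> xi != 0 ->
  normc (cword_deriv eZ s (u (epsval e)) (z, xi)) <=
    sizes (fun t => hg_seminorm K (fun j => count_mem (inr j) s)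
       (fun k => count_mem (inl k) s) (u t)) (epsval e) *
    enorm xi `^ (1 - (nxi s)%:R).
Proof.
move=> iu cK e z xi Kz x0; have du := iu _ (epsval01 e).
apply: powR_shift; first exact: enorm_gt0.
apply: le_sizes; first by move=> t; exact: sup0_ge0.
- exact: epsval01.
- exact: hg_finite.
- by apply: hg_word_seminorm => //; [have [] := du|have [] := cK].
Qed.

End Homogeneous.

Section CompactNeighborhoods.
Context {R : realType}.

Lemma compact_nbhs_rV n (U : set 'rV[R]_n) x : open U -> U x ->
  exists K, compact_in U K /\ nbhs x K.
Proof.
move=> oU Ux; have /nbhs_normP[r /= r0 rU] := open_nbhs_nbhs (conj oU Ux).
have r20 : 0 < r / 2 by rewrite divr_gt0.
exists (closed_ball x (r / 2)); split; last first.
  by apply: filterS (nbhsx_ballx x (r / 2) r20); exact: subset_closed_ball.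
split; last first.
  move=> y; rewrite closed_ballE//= => xy; apply: rU => /=.
  by rewrite (le_lt_trans xy)// ltr_pdivrMr// ltr_pMr// ltr1n.
apply: bounded_closed_compact; last exact: closed_ball_closed.
exists (`|x| + r); split; first exact: num_real.
move=> M hM y; rewrite closed_ballE//= => xy.
have := ler_normD (y - x) x; rewrite subrK distrC => H.
apply: (le_trans H); apply: le_trans (ltW hM); rewrite addrC lerD2l.
by apply: (le_trans xy); rewrite ler_pdivrMr// ler_pMr// ler1n.
Qed.

Lemma compact_nbhs_prod n' n (O' : set 'rV[R]_n') (O : set 'rV[R]_n) z :
  open O' -> open O -> (O' `*` O) z -> exists K, compact_in (O' `*` O) K /\ nbhs z K.
Proof.
move=> oO' oO [Oz1 Oz2].
have [K1 [[cK1 KO1] n1]] := compact_nbhs_rV oO' Oz1.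
have [K2 [[cK2 KO2] n2]] := compact_nbhs_rV oO Oz2.
exists (K1 `*` K2); split; last by exists (K1, K2).
split; first exact: compact_setX.
by move=> w [/KO1 ? /KO2 ?].
Qed.

End CompactNeighborhoods.

(** * Nets of homogeneous functions, off xi = 0 and across it *)

Section HomogeneousNets.
Context {R : realType} {n' n p : nat}.
Local Notation C := R[i].
Local Notation Z := ('rV[R]_n' * 'rV[R]_n * 'rV[R]_p)%type.
Context (Omega' : set 'rV[R]_n') (Omega : set 'rV[R]_n).
Hypotheses (oO' : open Omega') (oO : open Omega).
Local Notation X := (Omega' `*` Omega).
Local Notation N0 := [set xi : 'rV[R]_p | xi != 0].
Local Notation U1 := [set xi : 'rV[R]_p | 8^-1 < enorm xi].
Local Notation cRe := (@complex.Re _).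
Local Notation cIm := (@complex.Im _).

Definition xdir (i : 'I_n') : Z := eZ (inl (inl i)).
Definition xlift (s : seq 'I_n') : seq (('I_n' + 'I_n) + 'I_p) := map (inl \o inl) s.

Lemma nxi_xlift s : nxi (xlift s) = 0%N.
Proof. by rewrite /nxi big1// => j _; elim: s. Qed.

Lemma word_xlift s (g : Z -> R) : word_deriv xdir s g = word_deriv eZ (xlift s) g.
Proof. by elim: s => //= i s ->. Qed.

Lemma cword_xlift s (f : Z -> C) : cword_deriv xdir s f = cword_deriv eZ (xlift s) f.
Proof. by elim: s => //= i s ->. Qed.

(** A move in x stays in the section xi = 0, where g vanishes. Nothing is assumed of g off that
    section. *)
Lemma word_zero_section (g : Z -> R) s z : (forall z, X z -> g (z, 0) = 0) ->
  X z -> is_derive (z, 0) (xdir s) (g : Z -> R) 0.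
Proof.
move=> g0 Xz; apply: is_derive_near0.
have cz : (fun h : R => h *: (xdir s).1 + z) @ (0 : R) --> z.
  have H : (fun h : R => h *: (xdir s).1 + z) @ (0 : R) --> 0 *: (xdir s).1 + z.
    by apply: cvgD; [exact: scalel_continuous|exact: cvg_cst].
  by rewrite scale0r add0r in H; exact: H.
have : \forall h \near (0 : R), X (h *: (xdir s).1 + z).
  by apply: cz; apply: open_nbhs_nbhs; split=> //; exact: openX_.
apply: filterS => h Xh.
have -> : h *: xdir s + (z, 0) = (h *: (xdir s).1 + z, 0) by congr pair; rewrite /= scaler0 addr0.
exact: g0.
Qed.

Lemma word_zero (g : Z -> R) s : (forall z, X z -> g (z, 0) = 0) ->
  forall z, X z -> word_deriv xdir s g (z, 0) = 0.
Proof.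
move=> g0; elim: s => [|i s IH] z Xz; first exact: g0.
by have [_ E] := word_zero_section i IH Xz; exact: E.
Qed.

(** The x-derivatives of g are again homogeneous of degree 1. They are O(|xi|) locally uniformly in
    z and vanish on the section xi = 0, hence are continuous across it, although g need not be
    differentiable in xi there. *)
Lemma xsmooth_homogeneous (g : Z -> R) :
  smooth_on eZ (X `*` N0) g -> homogeneous Omega' Omega 1 g ->
  (forall z, X z -> g (z, 0) = 0) -> smooth_on xdir (X `*` setT) g.
Proof.
move=> sg hg g0 s [z xi] [/= Xz _].
have [->|x0] := eqVneq xi 0; last first.
  have Dw : (X `*` N0) (z, xi) by [].
  rewrite word_xlift; have [c d] := sg (xlift s) _ Dw; split=> // i; exact: d.
split; last by move=> i; have [d _] := word_zero_section i (word_zero s g0) Xz; exact: d.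
have [K [cK nK]] := compact_nbhs_prod oO' oO Xz.
have cw w : (X `*` N0) w -> {for w, continuous (word_deriv eZ (xlift s) g)}.
  by move=> Dw; have [] := sg (xlift s) w Dw.
have [M M0 HM] := homogeneous_bound cw (homogeneous_word oO' oO (xlift s) sg hg) cK.
rewrite nxi_xlift subr0 in HM.
rewrite /prop_for /continuous_at (word_zero s g0 Xz).
apply/cvgrPdist_lt => eps eps0.
have M1 : 0 < M + 1 by rewrite ltr_wpDl.
have near2 : \forall xi \near (0 : 'rV[R]_p), enorm xi < eps / (M + 1).
  apply: open_nbhs_nbhs; split; first exact: open_enorm_lt.
  by rewrite /= enorm0 divr_gt0.
exists (K, [set xi | enorm xi < eps / (M + 1)]) => //= -[z' xi'] [/= Kz' xi'lt].
rewrite sub0r normrN.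
have [->|x0] := eqVneq xi' 0.
  by rewrite (word_zero s g0) ?normr0//; have [_ KX] := cK; exact: KX.
rewrite word_xlift; apply: (le_lt_trans (HM _ _ Kz' x0)).
rewrite powRr1 ?enorm_ge0//.
rewrite ltr_pdivlMr// in xi'lt; apply: le_lt_trans xi'lt.
by rewrite mulrC ler_wpM2l ?enorm_ge0// lerDl.
Qed.

Context (rho delta : R).
Hypotheses (rho1 : rho <= 1) (delta0 : 0 <= delta).

Local Notation hrel := (nrel (@epsval R) (@eZ R n' n p) (fullwt rho delta)
  (cylinders Omega' Omega U1) jap).
Local Notation hsmooth := (nsmooth (@eZ R n' n p) (X `*` U1)).
Local Notation xrel := (nrel (@epsval R) xdir (fun=> 1)
  (cylinders Omega' Omega setT) jap).
Local Notation xsmooth := (nsmooth xdir (X `*` setT)).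

Lemma sub_U1 : X `*` U1 `<=` X `*` N0.
Proof.
move=> w [Xw]; rewrite /= => hw; split=> //=.
by apply: contraTneq hw => ->; rewrite enorm0 -leNgt invr_ge0.
Qed.

Lemma U1_neq0 (xi : 'rV[R]_p) : 8^-1 < enorm xi -> xi != 0.
Proof. by apply: contraTneq => ->; rewrite enorm0 -leNgt invr_ge0. Qed.

Let hgsize (u : net R Z) (K : set ('rV[R]_n' * 'rV[R]_n)) s :=
  sizes (fun t => hg_seminorm K (fun j => count_mem (inr j) s)
       (fun k => count_mem (inl k) s) (u t)).

(** Away from the origin a function homogeneous of degree 1 is a symbol of order 1 and type (1, 0),
    a fortiori of every type with [rho] <= 1 and 0 <= [delta]. *)
Lemma hg_word_U1 (u : net R Z) (K : set ('rV[R]_n' * 'rV[R]_n)) s :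
  in_space (hg_space X) u -> compact_in X K ->
  forall (e : epsdom) z xi, K z -> 8^-1 < enorm xi ->
  normc (cword_deriv eZ s (u (epsval e)) (z, xi)) <=
    hgsize u K s (epsval e) * 9 `^ `|1 - (nxi s)%:R| *
    japanese xi `^ (1 - rho * (nxi s)%:R + delta * (nz s)%:R).
Proof.
move=> iu cK e z xi Kz hx.
have q0 : 0 <= hgsize u K s (epsval e) by apply: sizes_ge0 => t; exact: sup0_ge0.
apply: (le_trans (hg_word_le oO' oO s iu cK e Kz (U1_neq0 hx))).
rewrite -mulrA ler_wpM2l//; apply: (le_trans (enorm_powR_le _ hx)).
rewrite ler_wpM2l ?powR_ge0//; apply: ler_powR; first exact: japanese_ge1.
have h1 : rho * (nxi s)%:R <= 1 * (nxi s)%:R by rewrite ler_wpM2r ?ler0n.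
have h2 : 0 <= delta * (nz s)%:R by rewrite mulr_ge0 ?ler0n.
by lra.
Qed.

Lemma hg_word_x (u : net R Z) (K : set ('rV[R]_n' * 'rV[R]_n)) s :
  in_space (hg_space X) u -> (forall e z, 0 < e <= 1 -> X z -> u e (z, 0) = 0) ->
  compact_in X K -> forall (e : epsdom) z xi, K z ->
  normc (cword_deriv xdir s (u (epsval e)) (z, xi)) <=
    hgsize u K (xlift s) (epsval e) * japanese xi `^ (1 + \sum_(i <- s) 1).
Proof.
move=> iu u0 cK e z xi Kz.
have q0 : 0 <= hgsize u K (xlift s) (epsval e).
  by apply: sizes_ge0 => t; exact: sup0_ge0.
have Xz : X z by have [_ KX] := cK; exact: KX.
have [->|x0] := eqVneq xi 0.
  have h0 z' : X z' -> u (epsval e) (z', 0) = 0 by apply: u0; exact: epsval01.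
  have e1 : cRe (cword_deriv xdir s (u (epsval e)) (z, 0)) = 0.
    have := congr1 (@^~ (z, 0)) (Re_cword xdir s (u (epsval e))) => /= ->.
    by apply: word_zero Xz => z' Xz' /=; rewrite h0.
  have e2 : cIm (cword_deriv xdir s (u (epsval e)) (z, 0)) = 0.
    have := congr1 (@^~ (z, 0)) (Im_cword xdir s (u (epsval e))) => /= ->.
    by apply: word_zero Xz => z' Xz' /=; rewrite h0.
  apply: (le_trans (normc_le _)); rewrite e1 e2 normr0 addr0.
  by rewrite mulr_ge0// powR_ge0.
rewrite cword_xlift.
have h := hg_word_le oO' oO (xlift s) iu cK e Kz x0.
rewrite nxi_xlift subr0 powRr1 ?enorm_ge0// in h.
apply: (le_trans h); rewrite ler_wpM2l//; apply: (le_trans (enorm_le_japanese _)).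
rewrite -[leLHS]powRr1; last exact: (le_trans ler01 (japanese_ge1 xi)).
by apply: ler_powR; [exact: japanese_ge1|rewrite lerDl sumr_ge0].
Qed.

Lemma moderate_hrel (u : net R Z) : moderate (hg_space X) u ->
  hsmooth (restr u) /\ forall k, hrel k 1 (restr u) (restr u).
Proof.
move=> [iu mu]; split=> [e|k].
  have [su _] := iu _ (epsval01 e); exact: csmooth_on_sub sub_U1 su.
apply: rel_symbol_words => // s K sk cK.
exists (fun t => hgsize u K s t * 9 `^ `|1 - (nxi s)%:R|), (fun=> 0); split.
- apply: tempered_mul; last by apply: tempered_cst; exact: powR_ge0.
  apply: tempered_sizes => [t|]; first exact: sup0_ge0.
  by apply: mu; exists K, (fun j => count_mem (inr j) s), (fun k => count_mem (inl k) s).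
- exact: rapid0.
move=> e z xi Kz hx; have h := hg_word_U1 s iu cK e Kz hx.
by split; [exact: h|exact: h|rewrite subrr normc0 mul0r].
Qed.

Lemma negligible_hrel (u : net R Z) : Defs.negligible (hg_space X) u ->
  hsmooth (restr u) /\ forall k, hrel k 1 (restr u) (fun _ _ => 0).
Proof.
move=> [iu nu]; split=> [e|k].
  have [su _] := iu _ (epsval01 e); exact: csmooth_on_sub sub_U1 su.
apply: rel_symbol_words => // s K sk cK.
pose q t := 9 `^ `|1 - (nxi s)%:R| * hgsize u K s t.
have rq : rapid q.
  apply: rapid_mul; first by apply: tempered_cst; exact: powR_ge0.
  apply: rapid_sizes => [t|]; first exact: sup0_ge0.
  by apply: nu; exists K, (fun j => count_mem (inr j) s), (fun k => count_mem (inl k) s).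
exists q, q; split; [exact: rapid_tempered|exact: rq|].
have z0 : forall w, cword_deriv eZ s (fun _ : Z => 0 : C) w = 0.
  elim: s {sk q rq} => // i s IH w /=.
  by rewrite (_ : cword_deriv _ _ _ = fun=> 0) ?cderiv_cst//; apply/funext.
move=> e z xi Kz hx; rewrite /= z0 subr0 normc0.
have h := hg_word_U1 s iu cK e Kz hx; rewrite [_ * 9 `^ _]mulrC in h.
have q0 : 0 <= q (epsval e) by have [] := rq.
by split; [exact: h|apply: mulr_ge0; [exact: q0|exact: powR_ge0]|exact: h].
Qed.

Lemma xsmooth_hg (u : net R Z) : in_space (hg_space X) u ->
  (forall e z, 0 < e <= 1 -> X z -> u e (z, 0) = 0) -> xsmooth (restr u).
Proof.
move=> iu u0 e; have du := iu _ (epsval01 e); have [h1 h2] := hg_homogeneous du.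
have [[s1 s2] _] := du.
have z0 z : X z -> u (epsval e) (z, 0) = 0 by apply: u0; exact: epsval01.
split; [apply: (xsmooth_homogeneous s1 h1)|apply: (xsmooth_homogeneous s2 h2)];
  by move=> z Xz; rewrite /= z0.
Qed.

Lemma moderate_xrel (u : net R Z) : moderate (hg_space X) u ->
  (forall e z, 0 < e <= 1 -> X z -> u e (z, 0) = 0) ->
  forall k, xrel k 1 (restr u) (restr u).
Proof.
move=> [iu mu] u0 k; apply: rel_words => s sk _ [K cK ->].
exists (hgsize u K (xlift s)), (fun=> 0); split.
- apply: tempered_sizes => [t|]; first exact: sup0_ge0.
  by apply: mu; exists K, (fun j => count_mem (inr j) (xlift s)), (fun k => count_mem (inl k) (xlift s)).
- exact: rapid0.
move=> e [z xi] [Kz _]; have h := hg_word_x s iu u0 cK e xi Kz.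
by split; [exact: h|exact: h|rewrite subrr normc0 mul0r].
Qed.

Lemma negligible_xrel (u : net R Z) : Defs.negligible (hg_space X) u ->
  (forall e z, 0 < e <= 1 -> X z -> u e (z, 0) = 0) ->
  forall k, xrel k 1 (restr u) (fun _ _ => 0).
Proof.
move=> [iu nu] u0 k; apply: rel_words => s sk _ [K cK ->].
pose q := hgsize u K (xlift s).
have rq : rapid q.
  apply: rapid_sizes => [t|]; first exact: sup0_ge0.
  by apply: nu; exists K, (fun j => count_mem (inr j) (xlift s)), (fun k => count_mem (inl k) (xlift s)).
exists q, q; split; [exact: rapid_tempered|exact: rq|].
have z0 : forall w, cword_deriv xdir s (fun _ : Z => 0 : C) w = 0.
  elim: s {sk q rq} => // i s IH w /=.
  by rewrite (_ : cword_deriv _ _ _ = fun=> 0) ?cderiv_cst//; apply/funext.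
move=> e [z xi] [Kz _]; rewrite /= z0 subr0 normc0.
have h := hg_word_x s iu u0 cK e xi Kz.
have q0 : 0 <= q (epsval e) by have [] := rq.
by split; [exact: h|apply: mulr_ge0; [exact: q0|exact: powR_ge0]|exact: h].
Qed.

End HomogeneousNets.

(** * Representatives of generalized phase functions *)

Section PhaseReprs.
Context {R : realType} {n' n p : nat}.
Local Notation C := R[i].
Local Notation Z := ('rV[R]_n' * 'rV[R]_n * 'rV[R]_p)%type.
Context (Omega' : set 'rV[R]_n') (Omega : set 'rV[R]_n).
Hypotheses (oO' : open Omega') (oO : open Omega).
Local Notation X := (Omega' `*` Omega).
Local Notation N0 := [set xi : 'rV[R]_p | xi != 0].
Local Notation U1 := [set xi : 'rV[R]_p | 8^-1 < enorm xi].
Local Notation hrel := (nrel (@epsval R) (@eZ R n' n p) (fullwt 1 0)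
  (cylinders Omega' Omega U1) jap).
Local Notation hsmooth := (nsmooth (@eZ R n' n p) (X `*` U1)).
Local Notation xrel := (nrel (@epsval R) (@xdir R n' n p) (fun=> 1)
  (cylinders Omega' Omega setT) jap).
Local Notation xsmooth := (nsmooth (@xdir R n' n p) (X `*` setT)).

Lemma oU1 : open (X `*` U1).
Proof. by apply: open_domain => //; exact: open_enorm_gt. Qed.

Lemma oXT : open (X `*` [set: 'rV[R]_p]).
Proof. by apply: open_domain => //; exact: openT. Qed.

(** Homogeneity with t = 2 at xi = 0 says that the value equals its double. *)
Lemma M_Phi_zero (phi : R -> Z -> R) e z : M_Phi Omega' Omega phi ->
  0 < e <= 1 -> X z -> phi e (z, 0) = 0.
Proof.
case: z => x y [_ ph _ _] e01 [Ox Oy]; have [_ hom _] := ph e e01 x Ox.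
have := hom y 0 2 Oy (ltr0Sn _ 1); rewrite scaler0 /= => h.
by apply: (@addrI _ (phi e (x, y, 0))); rewrite addr0 -mulr2n -mulr_natl -h.
Qed.

Lemma phi_reprs_rel (phi : Phi Omega' Omega) (phi1 phi2 : R -> Z -> R) :
  (phi : set (R -> Z -> R)) phi1 -> (phi : set (R -> Z -> R)) phi2 ->
  [/\ hsmooth (restr (cnet phi1)),
      forall k, hrel k 1 (restr (cnet phi1)) (restr (cnet phi2)),
      xsmooth (restr (cnet phi1)) &
      forall k, xrel k 1 (restr (cnet phi1)) (restr (cnet phi2))].
Proof.
case: phi => A [phi0 m0 /= ->].
have KD1 := @cylinders_sub R n' n p Omega' Omega U1.
have KDT := @cylinders_sub R n' n p Omega' Omega setT.
have H om : M_Phi Omega' Omega om ->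
    Defs.negligible (hg_space (Omega' `*` Omega)) (cnet (phi0 - om)) ->
    [/\ hsmooth (restr (cnet om)),
      forall k, hrel k 1 (restr (cnet phi0)) (restr (cnet om)),
      xsmooth (restr (cnet om)) &
      forall k, xrel k 1 (restr (cnet phi0)) (restr (cnet om))].
  move=> mo ng; have [_ _ mg _] := mo.
  have z1 e z : 0 < e <= 1 -> X z -> cnet om e (z, 0) = 0.
    by move=> e01 Xz; rewrite /cnet (M_Phi_zero mo e01 Xz).
  have z2 e z : 0 < e <= 1 -> X z -> cnet (phi0 - om) e (z, 0) = 0.
    move=> e01 Xz; rewrite /cnet -[(phi0 - om) e (z, 0)]/(phi0 e (z, 0) - om e (z, 0)).
    by rewrite (M_Phi_zero mo e01 Xz) (M_Phi_zero m0 e01 Xz) subr0.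
  have [s1 r1] := moderate_hrel oO' oO (lexx 1) (lexx 0) mg.
  have [s2 r2] := negligible_hrel oO' oO (lexx 1) (lexx 0) ng.
  have x1 := xsmooth_hg oO' oO mg.1 z1; have x2 := xsmooth_hg oO' oO ng.1 z2.
  have y1 := moderate_xrel oO' oO mg z1; have y2 := negligible_xrel oO' oO ng z2.
  have E (e : epsdom) w : restr (cnet (phi0 - om)) e w + restr (cnet om) e w = restr (cnet phi0) e w.
    rewrite /restr /cnet -[(phi0 - om) _ w]/(phi0 (epsval e) w - om (epsval e) w).
    by apply: complex_eq; rewrite ?ReD ?ImD/= ?addr0 ?subrK.
  have z3 := nsmooth_cst (@eZ R n' n p) (X `*` U1) (fun _ : @epsdom R => 0).
  have z4 := nsmooth_cst (@xdir R n' n p) (X `*` setT) (fun _ : @epsdom R => 0).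
  split=> // k.
    have := rel_add oU1 KD1 s2 z3 s1 s1 (r2 k) (r1 k).
    by apply: (rel_eq oU1 KD1) => e w Dw; [exact: E|exact: add0r].
  have := rel_add oXT KDT x2 z4 x1 x1 (y2 k) (y1 k).
  by apply: (rel_eq oXT KDT) => e w Dw; [exact: E|exact: add0r].
move=> [m1 n1] [m2 n2]; have [a1 b1 c1 d1] := H _ m1 n1; have [a2 b2 c2 d2] := H _ m2 n2.
split=> // k; first exact: rel_trans (rel_sym (b1 k)) (b2 k).
exact: rel_trans (rel_sym (d1 k)) (d2 k).
Qed.

Lemma homogeneous_hrel d (g : Z -> R) k : smooth_on eZ (X `*` N0) g ->
  homogeneous Omega' Omega d g ->
  hrel k d (fun _ w => (g w)%:C%C) (fun _ w => (g w)%:C%C).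
Proof.
move=> sg hg; apply: rel_symbol_words => // s K sk cK.
have cw w : (X `*` N0) w -> {for w, continuous (word_deriv eZ s g)}.
  by move=> Dw; have [] := sg s w Dw.
have [M M0 HM] := homogeneous_bound cw (homogeneous_word oO' oO s sg hg) cK.
pose b := d - (nxi s)%:R.
exists (fun=> M * 9 `^ `|b|), (fun=> 0); split; [|exact: rapid0|].
  by apply: tempered_cst; rewrite mulr_ge0// powR_ge0.
move=> e z xi Kz hx /=; rewrite mul1r mul0r addr0 -/b.
suff h : normc (cword_deriv eZ s (fun w => (g w)%:C%C) (z, xi)) <=
    M * 9 `^ `|b| * japanese xi `^ b.
  by split; [exact: h|exact: h|rewrite subrr normc0 mul0r].
have -> : cword_deriv eZ s (fun w => (g w)%:C%C) (z, xi) = (word_deriv eZ s g (z, xi))%:C%C.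
  elim: (s) (z, xi) => //= i s' IH w; rewrite -cderiv_real.
  by congr (cderiv _ _ w); apply/funext => w'; exact: IH.
rewrite normc_real; apply: (le_trans (HM _ _ Kz (U1_neq0 hx))).
by rewrite -mulrA ler_wpM2l//; exact: enorm_powR_le.
Qed.

End PhaseReprs.

(** * Functions pulled back along a coordinate projection *)

Section Projections.
Context {R : realType} {V W : normedModType R} {I J : Type}.
Context (e : I -> V) (e' : J -> W) (sg : I -> option J) (pr : V -> W).
Hypothesis prL : forall (h : R) u w, pr (h *: u + w) = h *: pr u + pr w.
Hypothesis pre : forall i, pr (e i) = if sg i is Some j then e' j else 0.
Hypothesis prC : continuous pr.

Lemma derive_pr (f : W -> R) v w : 'D_v (f \o pr) w = 'D_(pr v) f (pr w) /\
  (derivable f (pr w) (pr v) -> derivable (f \o pr) w v).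
Proof.
have E : (fun h : R => h^-1 *: ((f \o pr) (h *: v + w) - (f \o pr) w)) =
  (fun h : R => h^-1 *: (f (h *: pr v + pr w) - f (pr w))).
  by apply/funext => h; rewrite /= prL.
by rewrite /derivable /derive E.
Qed.

Lemma Ck_pr k (U : set W) (f : W -> R) : Ck e' k U f -> Ck e k (pr @^-1` U) (f \o pr).
Proof.
elim: k f => [|k IH] f [cf df].
  split=> // x Ux; apply: continuous_comp; [exact: prC|exact: cf].
split=> [x Ux|i]; first by apply: continuous_comp; [exact: prC|exact: cf].
case E : (sg i) => [j|].
  have pe : pr (e i) = e' j by rewrite pre E.
  have [dj Cj] := df j; split=> [x Ux|].
    by apply: (derive_pr f (e i) x).2; rewrite pe; exact: dj.
  have -> : 'D_(e i) (f \o pr) = 'D_(e' j) f \o pr.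
    by apply/funext => x; rewrite (derive_pr f (e i) x).1 pe.
  exact: IH.
have pe : pr (e i) = 0 by rewrite pre E.
split=> [x Ux|].
  by apply: (derive_pr f (e i) x).2; rewrite pe; exact: derivable0.
have -> : 'D_(e i) (f \o pr) = fun=> 0.
  by apply/funext => x; rewrite (derive_pr f (e i) x).1 pe derive0.
exact: Ck_cst.
Qed.

Lemma csmooth_on_pr (U : set W) (f : W -> R[i]) : csmooth_on e' U f ->
  csmooth_on e (pr @^-1` U) (f \o pr).
Proof.
by move=> [/smooth_onP f1 /smooth_onP f2]; split; apply/smooth_onP => k;
   [exact: (Ck_pr (f1 k))|exact: (Ck_pr (f2 k))].
Qed.

Lemma cderiv_pr (f : W -> R[i]) i :
  cderiv (e i) (f \o pr) = if sg i is Some j then cderiv (e' j) f \o pr else fun=> 0.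
Proof.
have E v w : cderiv v (f \o pr) w = cderiv (pr v) f (pr w).
  by rewrite /cderiv; congr Complex; exact: (derive_pr _ v w).1.
apply/funext => w; rewrite E pre; case: (sg i) => // .
by rewrite /cderiv !derive0.
Qed.

(** Either some letter is a direction killed by [pr], and the derivative vanishes identically, or
    every letter projects and the word can be computed on the base. The alternative depends on s
    alone, not on f. *)
Lemma cword_pr_cases s :
  (forall f : W -> R[i], cword_deriv e s (f \o pr) = fun=> 0) \/
  exists2 t, map sg s = map Some t &
    forall f : W -> R[i], cword_deriv e s (f \o pr) = cword_deriv e' t f \o pr.
Proof.
elim: s => [|i s [E|[t ts E]]]; first by right; exists [::].
  by left=> f; apply/funext => w; rewrite /= E cderiv_cst.
case E1 : (sg i) => [j|]; last by left=> f; rewrite /= E cderiv_pr E1.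
by right; exists (j :: t) => [|f] /=; rewrite ?E1 ?ts// E cderiv_pr E1.
Qed.

End Projections.

(** * Symbol classes of the coefficients of L *)

Section Classes.
Context {R : realType} {E : Type} (eps : E -> R) {V : normedModType R}.
Local Notation C := R[i].
Context {I : Type} (e_ : I -> V) (wt : I -> R).
Context (D : set V) (KK : set (set V)) (J : V -> R).
Hypotheses (oD : open D) (KD : forall K, KK K -> K `<=` D).
Hypothesis J1 : forall w, D w -> 1 <= J w.
Implicit Types f g : E -> V -> C.

Definition same_class mu f g :=
  [/\ nsmooth e_ D f, nsmooth e_ D g & forall k, nrel eps e_ wt KK J k mu f g].

Lemma class_eq mu f g f' g' : (forall e w, D w -> f e w = f' e w) ->
  (forall e w, D w -> g e w = g' e w) -> same_class mu f g -> same_class mu f' g'.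
Proof.
move=> ff gg [sf sg r]; split; last by move=> k; exact: (rel_eq oD KD ff gg (r k)).
  by move=> e; apply: (csmooth_on_eq oD _ (sf e)) => w; exact: ff.
by move=> e; apply: (csmooth_on_eq oD _ (sg e)) => w; exact: gg.
Qed.

Lemma class_mono mu nu f g : mu <= nu -> same_class mu f g -> same_class nu f g.
Proof. by move=> mn [sf sg r]; split=> // k; exact: (rel_mono KD J1 mn (r k)). Qed.

Lemma class_D mu f g i : same_class mu f g ->
  same_class (mu + wt i) (nderiv e_ i f) (nderiv e_ i g).
Proof.
move=> [sf sg r]; split; [exact: nsmooth_D|exact: nsmooth_D|].
by move=> k; case: (r k.+1) => _; exact.
Qed.

Lemma class_add mu f f' g g' : same_class mu f f' -> same_class mu g g' ->
  same_class mu (fun e w => f e w + g e w) (fun e w => f' e w + g' e w).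
Proof.
move=> [sf sf' r] [sg sg' r']; split; [exact: nsmooth_add|exact: nsmooth_add|].
by move=> k; exact: (rel_add oD KD sf sf' sg sg' (r k) (r' k)).
Qed.

Lemma class_mul mu nu f f' g g' : same_class mu f f' -> same_class nu g g' ->
  same_class (mu + nu) (fun e w => f e w * g e w) (fun e w => f' e w * g' e w).
Proof.
move=> [sf sf' r] [sg sg' r']; split; [exact: nsmooth_mul|exact: nsmooth_mul|].
by move=> k; exact: (rel_mul oD KD J1 sf sf' sg sg' (r k) (r' k)).
Qed.

Lemma class_sum (T : Type) (r : seq T) mu (F F' : T -> E -> V -> C) :
  (forall j, same_class mu (F j) (F' j)) ->
  same_class mu (fun e w => \sum_(j <- r) F j e w) (fun e w => \sum_(j <- r) F' j e w).
Proof.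
move=> H; split.
- by apply: nsmooth_sum => // j; case: (H j).
- by apply: nsmooth_sum => // j; case: (H j).
- by move=> k; apply: (rel_sum oD KD) => j; case: (H j) => // _ _; exact.
Qed.

Lemma class_cst mu c : 0 <= mu -> same_class mu (fun _ _ => c) (fun _ _ => c).
Proof.
by move=> mu0; split=> [||k]; [exact: nsmooth_cst|exact: nsmooth_cst|exact: (rel_cst _ _ _ oD KD J1)].
Qed.

Lemma class_opp mu f g : same_class mu f g ->
  same_class mu (fun e w => - f e w) (fun e w => - g e w).
Proof.
move=> fg; have := class_mul (class_cst (-1) (lexx 0)) fg; rewrite add0r.
by apply: class_eq => e w _; rewrite mulN1r.
Qed.

End Classes.

(** * The gradient of a phase and its inverse *)

Section Gradient.
Context {R : realType} {n' n p : nat}.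
Local Notation Z := ('rV[R]_n' * 'rV[R]_n * 'rV[R]_p)%type.
Context (Omega' : set 'rV[R]_n') (Omega : set 'rV[R]_n).
Hypotheses (oO' : open Omega') (oO : open Omega).
Local Notation X := (Omega' `*` Omega).
Local Notation N0 := [set xi : 'rV[R]_p | xi != 0].
Local Notation U1 := [set xi : 'rV[R]_p | 8^-1 < enorm xi].

Definition xi_coord (j : 'I_p) (w : Z) : R := w.2 0 j.

Definition enorm2 (w : Z) : R := \sum_(j < p) xi_coord j w ^+ 2.

Lemma enorm2E w : enorm2 w = enorm w.2 ^+ 2.
Proof. by rewrite enorm_sqr. Qed.

Lemma smooth_xi_coord (U : set Z) j : smooth_on eZ U (xi_coord j).
Proof.
apply: smooth_on_linear; first by move=> h u w; rewrite /xi_coord/= !mxE.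
move=> w; apply: (@continuous_comp _ _ _ snd (fun v : 'rV[R]_p => v 0 j)).
  exact: cvg_snd.
exact: coord_continuous.
Qed.

Lemma smooth_enorm2 : smooth_on eZ (X `*` N0) enorm2.
Proof.
apply: smooth_on_sum => [|j]; first exact: open_XN0.
rewrite (_ : (fun _ => _) = fun w => xi_coord j w * xi_coord j w); last first.
  by apply/funext => w; rewrite expr2.
by apply: smooth_on_mul; [exact: open_XN0|exact: smooth_xi_coord|exact: smooth_xi_coord].
Qed.

Lemma enorm2_neq0 w : (X `*` N0) w -> enorm2 w != 0.
Proof. by move=> [_ /= w0]; rewrite enorm2E expf_neq0// gt_eqF// enorm_gt0. Qed.

Lemma smooth_enorm2V : smooth_on eZ (X `*` N0) (fun w => (enorm2 w)^-1).
Proof. exact: smooth_on_inv (open_XN0 oO' oO) enorm2_neq0 smooth_enorm2. Qed.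

Lemma homogeneous_enorm2V : homogeneous Omega' Omega (- 2) (fun w => (enorm2 w)^-1).
Proof.
move=> w t Dw t0; rewrite !enorm2E /dil/= enormZ gtr0_norm// exprMn invfM.
by rewrite powRN; congr (_^-1 * _); rewrite -powR_mulrn// ltW.
Qed.

(** By homogeneity this is the squared gradient at the normalized point, see [rescaled_gradE].
    Written with derivatives at w itself, it inherits smoothness and symbol estimates from the
    phase. *)
Definition rescaled_grad (g : Z -> R) (w : Z) : R :=
  (enorm2 w)^-1 * \sum_(k < n) 'D_(ey k) g w * 'D_(ey k) g w +
  \sum_(j < p) 'D_(exi j) g w * 'D_(exi j) g w.

Section OnePhase.
Context (g : Z -> R).
Hypotheses (sg : smooth_on eZ (X `*` N0) g) (hg : homogeneous Omega' Omega 1 g).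

Lemma smooth_rescaled_grad : smooth_on eZ (X `*` N0) (rescaled_grad g).
Proof.
have o := @open_XN0 R n' n p Omega' Omega oO' oO.
have sD i := smooth_on_D i sg.
have sDD i := smooth_on_mul o (sD i) (sD i).
exact: (smooth_on_add o (smooth_on_mul o smooth_enorm2V
  (smooth_on_sum _ o (fun k => sDD (inl (inr k)))))
  (smooth_on_sum _ o (fun j => sDD (inr j)))).
Qed.

Lemma nxi1 (i : ('I_n' + 'I_n) + 'I_p) :
  (nxi [:: i])%:R = if i is inl _ then 0 else 1 :> R.
Proof.
have := @sum_fullwt R n' n p 1 0 [:: i].
by rewrite big_seq1 mul0r addr0 mulN1r; case: i => i /= => [/esym/eqP|/oppr_inj <-//]; rewrite oppr_eq0 => /eqP.
Qed.

Lemma rescaled_gradE w : (X `*` N0) w -> grad_sq g (normalized w) = rescaled_grad g w.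
Proof.
move=> Dw; have [_ /= w0] := Dw; have e0 := enorm_gt0 w0.
have -> : normalized w = dil (enorm w.2)^-1 w by [].
have i0 : 0 < (enorm w.2)^-1 by rewrite invr_gt0.
rewrite /grad_sq /rescaled_grad mulr_sumr; congr (_ + _); apply: eq_bigr => i _.
  have := homogeneous_D oO' oO (inl (inr i)) sg hg Dw i0.
  rewrite nxi1 subr0 powRr1 ?(ltW i0)// -/(ey i) => ->.
  by rewrite enorm2E -expr2 exprMn exprVn.
have := homogeneous_D oO' oO (inr i) sg hg Dw i0.
by rewrite nxi1 subrr powRr0 mul1r -/(exi i) => ->; rewrite expr2.
Qed.

Lemma homogeneous_rescaled_grad : homogeneous Omega' Omega 0 (rescaled_grad g).
Proof.
move=> w t Dw t0; rewrite powRr0 mul1r -!rescaled_gradE//; last exact: dil_dom.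
congr grad_sq; rewrite /normalized/=; congr pair.
have [_ /= w0] := Dw; have e0 := enorm_gt0 w0.
rewrite enormZ gtr0_norm// scalerA; congr (_ *: _).
by rewrite invfM -mulrA mulrC -mulrA mulfV ?mulr1// gt_eqF.
Qed.

End OnePhase.

Lemma M_Phi_smooth (phi : R -> Z -> R) e : M_Phi Omega' Omega phi -> 0 < e <= 1 ->
  smooth_on eZ (X `*` N0) (phi e).
Proof. by move=> [_ _ [mg _] _] e01; have [[]] := mg e e01. Qed.

Lemma M_Phi_homogeneous (phi : R -> Z -> R) e : M_Phi Omega' Omega phi -> 0 < e <= 1 ->
  homogeneous Omega' Omega 1 (phi e).
Proof. by move=> [_ _ [mg _] _] e01; have [] := hg_homogeneous (mg e e01). Qed.

(** The bound of condition (ii) is available for small epsilon only. The nondegeneracy of each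
    single phase covers every epsilon, so that the inverse is smooth throughout. *)
Lemma grad_sq_gt0 (phi : R -> Z -> R) e w : M_Phi Omega' Omega phi -> 0 < e <= 1 ->
  (X `*` N0) w -> 0 < grad_sq (phi e) w.
Proof.
case: w => -[x y] xi [_ ph _ _] e01 [[/= Ox Oy] xi0].
have [_ _ /(_ y xi Oy xi0)[k]] := ph e e01 x Ox.
have [i ->] : exists i : 'I_n + 'I_p,
    'D_(bprod std std k) (fun w => phi e (x, w.1, w.2)) (y, xi) =
    'D_(if i is inl k then ey k else match i with inr j => exi j | inl k => ey k end)
      (phi e) (x, y, xi).
  exists k; rewrite /derive.
  set f1 := (fun h : R => _); set f2 := (fun h : R => _); suff -> : f1 = f2 by [].
  apply/funext => h; rewrite /f1 /f2.
  have E (v1 : 'rV[R]_n) (v2 : 'rV[R]_p) : h *: ((0, v1), v2) + ((x, y), xi) =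
      ((x, h *: v1 + y), h *: v2 + xi).
    by rewrite -[LHS]/(((h *: 0 + x, h *: v1 + y), h *: v2 + xi) : Z) scaler0 add0r.
  by clear f1 f2; case: k => k; congr (_ *: (_ - _)); congr (phi e _); exact: (esym (E _ _)).
move=> d0; rewrite /grad_sq.
have sq (T : finType) (F : T -> R) : 0 <= \sum_k F k ^+ 2.
  by apply: sumr_ge0 => j _; exact: sqr_ge0.
have sq1 (T : finType) (F : T -> R) j : F j != 0 -> 0 < \sum_k F k ^+ 2.
  move=> Fj; rewrite (bigD1 j)//= ltr_wpDr ?sumr_ge0 ?exprn_even_gt0//.
  by move=> l _; exact: sqr_ge0.
case: i d0 => i d0; first by apply: ltr_wpDr; [exact: sq|exact: (sq1 _ _ i d0)].
by apply: ltr_wpDl; [exact: sq|exact: (sq1 _ _ i d0)].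
Qed.

Lemma normalized_dom w : (X `*` N0) w -> (X `*` N0) (normalized w).
Proof.
by move=> [Xw /= w0]; split=> //=; apply: sphere_neq0; exact: sphere_normalize.
Qed.

Lemma rescaled_grad_gt0 (phi : R -> Z -> R) e w : M_Phi Omega' Omega phi ->
  0 < e <= 1 -> (X `*` N0) w -> 0 < rescaled_grad (phi e) w.
Proof.
move=> mp e01 Dw; rewrite -rescaled_gradE//.
- by apply: grad_sq_gt0 => //; exact: normalized_dom.
- exact: M_Phi_smooth.
- exact: M_Phi_homogeneous.
Qed.

(** Condition (ii), on the projections of K, gives the power bound for small epsilon. For each fixed
    epsilon the supremum is finite because the inverse is homogeneous of degree 0 and the sphere is
    compact. *)
Lemma rescaled_grad_inv_tempered (phi : R -> Z -> R) K : M_Phi Omega' Omega phi ->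
  compact_in X K -> exists2 A, tempered A & forall (e : epsdom) z xi, K z -> xi != 0 ->
    `|(rescaled_grad (phi (epsval e)) (z, xi))^-1| <= A (epsval e).
Proof.
move=> mp cK; have [cptK KX] := cK.
pose q t := Defs.sup0 [set s | exists z xi, [/\ K z, xi != 0 &
  s = `|(rescaled_grad (phi t) (z, xi))^-1|%:E]].
have q0 t : (0 <= q t)%E by exact: sup0_ge0.
exists (sizes q).
  apply: tempered_sizes => //.
  have [_ _ _ sn] := mp.
  have c1 : compact_in Omega' (fst @` K).
    split; last by move=> _ [w Kw <-]; have [] := KX _ Kw.
    apply: continuous_compact => //; apply: continuous_subspaceT => w; exact: cvg_fst.
  have c2 : compact_in Omega (snd @` K).
    split; last by move=> _ [w Kw <-]; have [] := KX _ Kw.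
    apply: continuous_compact => //; apply: continuous_subspaceT => w; exact: cvg_snd.
  have [r [eta [r0 /andP[eta0 eta1] H]]] := sn _ _ c1 c2.
  (* The exponent in [tempered] is a natural number, so r is rounded up; this only weakens the
     bound, as t <= 1. *)
  exists (Num.bound r), 1; near=> t.
  have t01 : 0 < t <= 1 by near: t; exact: near0_unit.
  have te : t <= eta by near: t; exact: nbhs_right_le.
  have t0 : 0 < t by case/andP: t01.
  apply: sup0_le; first by rewrite lee_fin mul1r powR_ge0.
  move=> _ [z [xi [Kz xi0 ->]]]; rewrite lee_fin mul1r.
  have Dw : (X `*` N0) (z, xi) by split=> //; exact: KX.
  have g0 := rescaled_grad_gt0 mp t01 Dw.
  rewrite gtr0_norm ?invr_gt0// powRN lef_pV2 ?posrE ?powR_gt0//.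
  have : ((t `^ r)%:E <= (grad_sq (phi t) (normalized (z, xi)))%:E)%E.
    apply: le_trans (H t _) _; first by rewrite t0 te.
    apply: ereal_inf_lbound; exists (z, xi) => //; split=> //; split; exact: (imageP _ Kz).
  rewrite lee_fin rescaled_gradE; [|exact: M_Phi_smooth|exact: M_Phi_homogeneous|by []].
  apply: le_trans; apply: ger_powR; first by [].
  exact: (ltW (archi_boundP (ltW r0))).
move=> e z xi Kz xi0; have e01 := epsval01 e.
apply: le_sizes => //; last by apply: sup0_ub; exists z, xi.
have sm := M_Phi_smooth mp e01; have hm := M_Phi_homogeneous mp e01.
have g0 w Dw := rescaled_grad_gt0 (w := w) mp e01 Dw.
have [|w t Dw t0|M M0 HM] := @homogeneous_bound _ _ _ _ Omega' Omega 0
    (fun w => (rescaled_grad (phi (epsval e)) w)^-1) K _ _ cK.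
- move=> w Dw; apply: (smooth_on_cont _ Dw).
  apply: smooth_on_inv; [exact: open_XN0| |exact: smooth_rescaled_grad].
  by move=> w' Dw'; rewrite gt_eqF// g0.
- by rewrite homogeneous_rescaled_grad// powRr0 !mul1r.
apply: (@le_lt_trans _ _ M%:E); last exact: ltry.
apply: sup0_le; first by rewrite lee_fin.
move=> _ [z' [xi' [Kz' xi'0 ->]]]; rewrite lee_fin.
by have := HM z' xi' Kz' xi'0; rewrite powRr0 mulr1.
Unshelve. all: by end_near. Qed.

End Gradient.

(** * Change of type and domain of symbol classes *)

Section ClassChange.
Context {R : realType} {n' n p : nat}.
Local Notation C := R[i].
Local Notation Z := ('rV[R]_n' * 'rV[R]_n * 'rV[R]_p)%type.
Context (Omega' : set 'rV[R]_n') (Omega : set 'rV[R]_n).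
Hypotheses (oO' : open Omega') (oO : open Omega).
Local Notation X := (Omega' `*` Omega).
Local Notation U1 := [set xi : 'rV[R]_p | 8^-1 < enorm xi].
Local Notation U0 := [set xi : 'rV[R]_p | enorm xi < 4^-1].
Context {E : Type} (eps : E -> R).
Local Notation cls rho delta U := (same_class eps (@eZ R n' n p) (fullwt rho delta)
  (X `*` U) (cylinders Omega' Omega U) jap).
Implicit Types f g : E -> Z -> C.

Lemma class_pull {E' : Type} (r : E' -> E) rho delta U mu f g :
  cls rho delta U mu f g ->
  same_class (eps \o r) (@eZ R n' n p) (fullwt rho delta)
    (X `*` U) (cylinders Omega' Omega U) jap mu (f \o r) (g \o r).
Proof.
move=> [sf sg h]; split=> [e|e|k]; [exact: sf|exact: sg|exact: rel_pull].
Qed.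

Lemma class_weaken rho' delta' rho delta (U : set 'rV[R]_p) mu f g :
  rho <= rho' -> delta' <= delta ->
  open U -> cls rho' delta' U mu f g -> cls rho delta U mu f g.
Proof.
move=> r1 d0 oU [sf sg h]; split=> // k.
apply: (@rel_restrict _ _ eps _ _ _ (@eZ R n' n p) (fullwt rho' delta') id (fullwt rho delta)
  (X `*` U) (cylinders Omega' Omega U) (cylinders Omega' Omega U) jap k mu f g _ _ _ _ _ (h k)).
- by move=> K KK; exists K.
- exact: cylinders_sub.
- by move=> w _; exact: jap_ge1.
- exact: open_domain.
- by case=> i /=; rewrite ?lerN2.
Qed.

Lemma class_shrink rho delta (U U' : set 'rV[R]_p) mu f g : open U -> U' `<=` U ->
  cls rho delta U mu f g -> cls rho delta U' mu f g.
Proof.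
move=> oU UU [sf sg h].
have sub : X `*` U' `<=` X `*` U by move=> w [Xw Uw]; split=> //; exact: UU.
split; [move=> e; exact: csmooth_on_sub sub (sf e)|move=> e; exact: csmooth_on_sub sub (sg e)|].
move=> k.
apply: (@rel_restrict _ _ eps _ _ _ (@eZ R n' n p) (fullwt rho delta) id (fullwt rho delta)
  (X `*` U) (cylinders Omega' Omega U) (cylinders Omega' Omega U') jap k mu f g _ _ _ _ _ (h k)).
- move=> _ [K cK ->]; exists (K `*` U); first by exists K.
  by move=> w [Kw Uw]; split=> //; exact: UU.
- by move=> S /cylinders_sub SX w Sw; exact/sub/SX.
- by move=> w _; exact: jap_ge1.
- exact: open_domain.
- by [].
Qed.

(** The open sets |xi| > 1/8 and |xi| < 1/4 cover everything. On the second one the nets and all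
    their derivatives vanish, so the estimates on the first suffice. *)
Lemma class_extend rho delta mu f g :
  (forall e w, (X `*` U0) w -> f e w = 0) -> (forall e w, (X `*` U0) w -> g e w = 0) ->
  cls rho delta U1 mu f g -> cls rho delta setT mu f g.
Proof.
have oU0 : open (X `*` U0) by apply: open_domain => //; exact: open_enorm_lt.
have cov w : (X `*` setT) w -> (X `*` U1 `|` X `*` U0) w.
  move=> [Xw _]; case: (ltP (8^-1) (enorm w.2)) => h; [by left; split|right; split=> //].
  by rewrite /=; apply: (le_lt_trans h); rewrite ltf_pV2 ?posrE ?ltr_nat.
have ext (h : E -> Z -> C) : (forall e w, (X `*` U0) w -> h e w = 0) ->
    nsmooth (@eZ R n' n p) (X `*` U1) h -> nsmooth (@eZ R n' n p) (X `*` setT) h.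
  move=> h0 sh e; apply: (csmooth_on_sub cov); apply: csmooth_onU; first exact: sh.
  apply: (csmooth_on_eq (f := fun=> 0) oU0); last exact: csmooth_on_cst.
  by move=> w Dw; rewrite h0.
move=> f0 g0 [sf sg h]; split; [exact: ext|exact: ext|move=> k].
have {h sf sg} := h k; elim: k mu f g f0 g0 => [|k IH] mu' f1 g1 f0 g0 [b d]; split=> //; last first.
  move=> i; apply: IH (d i) => e w Dw; rewrite /nderiv (cderiv_eq (g := fun=> 0) _ oU0) ?cderiv_cst//.
    by move=> w' Dw'; exact: f0.
  by move=> w' Dw'; exact: g0.
all: move=> _ [K cK ->]; have [|A [B [tA rB H]]] := b (K `*` U1); first by exists K.
all: exists A, B; split=> // e w [Kw _]; have [A0 _] := tA; have [B0 _] := rB.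
all: have [|[_ h1]|[_ h0]] := cov w; [by split=> //; exact: cK.2|by apply: H|].
all: have Dw : (X `*` U0) w by split=> //; exact: cK.2.
all: by rewrite f0// g0// subrr normc0; split; apply: mulr_ge0; rewrite ?powR_ge0.
Qed.

Lemma compact_ball n0 (r : R) : compact [set v : 'rV[R]_n0 | enorm v <= r].
Proof.
apply: bounded_closed_compact.
  exists r; split=> [|M rM v /= vr]; first exact: num_real.
  apply: (le_trans _ (ltW rM)).
  rewrite [ `|v|]mx_normrE; apply/bigmax_leP; split=> [|[i j] _ /=].
    exact: le_trans (enorm_ge0 v) vr.
  by rewrite ord1 (le_trans (coord_le_enorm _ _)).
rewrite (_ : mkset _ = @enorm R n0 @^-1` [set x | x <= r])//.
apply: closed_comp => [v _|]; [exact: continuous_enorm|exact: closed_le].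
Qed.

Lemma japanese_le2 n0 (v : 'rV[R]_n0) : enorm v <= 1 -> japanese v <= 2.
Proof.
move=> v1; rewrite -(@ler_pXn2r _ 2)// ?nnegrE ?(ltW (japanese_gt0 v))//.
rewrite japanese_sqr; apply: (@le_trans _ _ (1 + 1)); last by lra.
by rewrite lerD2l -enorm_sqr; apply: exprn_ile1 => //; exact: enorm_ge0.
Qed.

(** Derivatives of chi vanish for |xi| > 1/2 and are bounded on the remaining compact ball, so chi
    is a symbol of every order and type. *)
Lemma class_cutoff rho delta mu (chi : 'rV[R]_p -> C) : cutoff chi ->
  cls rho delta setT mu (fun _ w => chi w.2) (fun _ w => chi w.2).
Proof.
move=> [sc c1 c0].
pose sg (i : ('I_n' + 'I_n) + 'I_p) := if i is inr j then Some j else None.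
have prL (h : R) (u w : Z) : (h *: u + w).2 = h *: u.2 + w.2 by [].
have pre i : (eZ i).2 = if sg i is Some j then std j else 0 :> 'rV[R]_p by case: i.
have prC : continuous (@snd ('rV[R]_n' * 'rV[R]_n) 'rV[R]_p) by move=> w; exact: cvg_snd.
have ss : csmooth_on (@eZ R n' n p) (X `*` setT) (fun w => chi w.2).
  have := csmooth_on_pr prL pre prC sc; exact: csmooth_on_sub.
split=> [e|e|k]; [exact: ss|exact: ss|].
apply: rel_words => s _ _ [K cK ->].
suff [M M0 HM] : exists2 M, 0 <= M & forall w, normc (cword_deriv eZ s (fun w : Z => chi w.2) w) <=
    M * jap w `^ (mu + \sum_(i <- s) fullwt rho delta i).
  exists (fun=> M), (fun=> 0); split; [exact: tempered_cst|exact: rapid0|].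
  by move=> e w Kw; split; rewrite ?HM// subrr normc0 mul0r.
set b := mu + _.
have [/(_ chi) E0|[t _ /(_ chi) E0]] := cword_pr_cases prL pre s.
  exists 0 => // w; rewrite mul0r.
  have -> : cword_deriv eZ s (fun w : Z => chi w.2) w = 0 by exact: (congr1 (@^~ w) E0).
  by rewrite normc0.
have sw := csmooth_on_word t sc.
have [M M0 HM] : exists2 M, 0 <= M & forall v, enorm v <= 2^-1 ->
    normc (cword_deriv std t chi v) <= M.
  have [M1 M10 H1] := compact_norm_bound (@compact_ball p 2^-1) (fun v _ => smooth_on_cont sw.1 (I : setT v)).
  have [M2 M20 H2] := compact_norm_bound (@compact_ball p 2^-1) (fun v _ => smooth_on_cont sw.2 (I : setT v)).
  exists (M1 + M2); first exact: addr_ge0.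
  by move=> v hv; apply: (le_trans (normc_le _)); apply: lerD; [exact: H1|exact: H2].
(* On the ball |xi| <= 1/2 the bracket lies between 1 and 2, so its power b is at least 2^(-
   |b|). *)
exists (M * 2 `^ `|b|) => [|w]; first by rewrite mulr_ge0 ?powR_ge0.
have -> : cword_deriv eZ s (fun w : Z => chi w.2) w = cword_deriv std t chi w.2.
  exact: (congr1 (@^~ w) E0).
have J0 : 0 <= 2 `^ `|b| * jap w `^ b by rewrite mulr_ge0 ?powR_ge0.
case: (leP (enorm w.2) 2^-1) => hw; last first.
  have -> : cword_deriv std t chi w.2 = cword_deriv std t (fun=> 0) w.2.
    apply: (@cword_deriv_eq R _ _ std [set v | 2^-1 < enorm v] chi (fun=> 0) t) => //.
    exact: open_enorm_gt.
  have -> : cword_deriv std t (fun=> 0) w.2 = 0 :> C.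
    by elim: (t) (w.2) => //= j t' IH v; rewrite (cderiv_eq (g := fun=> 0) _ openT)// cderiv_cst.
  by rewrite normc0 -mulrA mulr_ge0.
apply: (le_trans (HM _ hw)); rewrite -[leLHS]mulr1 -mulrA ler_wpM2l//.
have J1 : 1 <= jap w by exact: jap_ge1.
have J2 : jap w <= 2 by apply: japanese_le2; apply: (le_trans hw); rewrite invf_le1// ler1n.
have j0 : 0 < jap w by exact: lt_le_trans J1.
apply: (@le_trans _ _ (jap w `^ `|b| * jap w `^ b)).
  rewrite -powRD; last by rewrite (gt_eqF j0) implybT.
  rewrite -[leLHS](powRr0 (jap w)); apply: ler_powR => //.
  by rewrite -lerBlDr sub0r ler_normr lexx orbT.
rewrite ler_wpM2r ?powR_ge0//; apply: ge0_ler_powR => //; rewrite ?nnegrE ?(ltW j0)//.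
Qed.

End ClassChange.

(** * Orders of the coefficients and the gain of one application of L *)

Section Coefficients.
Context {R : realType} {n' n p : nat}.
Local Notation C := R[i].
Local Notation Z := ('rV[R]_n' * 'rV[R]_n * 'rV[R]_p)%type.
Context (Omega' : set 'rV[R]_n') (Omega : set 'rV[R]_n).
Hypotheses (oO' : open Omega') (oO : open Omega).
Local Notation X := (Omega' `*` Omega).
Local Notation N0 := [set xi : 'rV[R]_p | xi != 0].
Local Notation U1 := [set xi : 'rV[R]_p | 8^-1 < enorm xi].
Local Notation U0 := [set xi : 'rV[R]_p | enorm xi < 4^-1].
Local Notation cls rho delta U := (same_class (@epsval R) (@eZ R n' n p)
  (fullwt rho delta) (X `*` U) (cylinders Omega' Omega U) jap).
Context (chi : 'rV[R]_p -> C) (hchi : cutoff chi).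
Context (phi1 phi2 : R -> Z -> R).
Hypotheses (m1 : M_Phi Omega' Omega phi1) (m2 : M_Phi Omega' Omega phi2).
Hypothesis r12 : cls 1 0 U1 1 (restr (cnet phi1)) (restr (cnet phi2)).

Let o1 := @oU1 R n' n p Omega' Omega oO' oO.
Let oT := @oXT R n' n p Omega' Omega oO' oO.
Let KD1 := @cylinders_sub R n' n p Omega' Omega U1.
Let KDT := @cylinders_sub R n' n p Omega' Omega setT.
Let J1 : forall w : Z, (X `*` U1) w -> 1 <= jap w. Proof. by move=> w _; exact: jap_ge1. Qed.
Let JT : forall w : Z, (X `*` setT) w -> 1 <= jap w. Proof. by move=> w _; exact: jap_ge1. Qed.

Lemma class_gradient i : cls 1 0 U1 (1 + fullwt 1 0 i)
  (fun e w => ('D_(eZ i) (phi1 (epsval e)) w)%:C%C)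
  (fun e w => ('D_(eZ i) (phi2 (epsval e)) w)%:C%C).
Proof.
have := class_D i r12.
by apply: (class_eq o1 KD1) => e w Dw; exact: cderiv_real.
Qed.

Lemma class_enorm2V : cls 1 0 U1 (- 2)
  (fun _ w => ((enorm2 w)^-1)%:C%C) (fun _ w => ((enorm2 w)^-1)%:C%C).
Proof.
have sm := csmooth_on_sub (@sub_U1 R n' n p Omega' Omega)
  (csmooth_on_real (@smooth_enorm2V R n' n p Omega' Omega oO' oO)).
split=> [e|e|k]; [exact: sm|exact: sm|].
exact: (homogeneous_hrel oO' oO k (@smooth_enorm2V R n' n p Omega' Omega oO' oO)
  (@homogeneous_enorm2V R n' n p Omega' Omega)).
Qed.

Lemma realCD (x y : R) : (x + y)%:C%C = x%:C%C + y%:C%C :> C.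
Proof. by apply: complex_eq; rewrite ?ReD ?ImD/= ?addr0. Qed.

Lemma realCM (x y : R) : (x * y)%:C%C = x%:C%C * y%:C%C :> C.
Proof. by apply: complex_eq; rewrite ?ReM ?ImM/=; ring. Qed.

Lemma realC_sum (T : Type) (r : seq T) (F : T -> R) :
  (\sum_(i <- r) F i)%:C%C = \sum_(i <- r) (F i)%:C%C :> C.
Proof.
elim: r => [|i r IH]; first by rewrite !big_nil.
by rewrite !big_cons realCD IH.
Qed.

(** Two y-derivatives of the phase have order 2 together, which the factor |xi|^(-2) compensates;
    the xi-derivatives have order 0. *)
Lemma class_rescaled_grad : cls 1 0 U1 0
  (fun e w => (rescaled_grad (phi1 (epsval e)) w)%:C%C)
  (fun e w => (rescaled_grad (phi2 (epsval e)) w)%:C%C).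
Proof.
have sq i := class_mul o1 KD1 J1 (class_gradient i) (class_gradient i).
have cy := class_mul o1 KD1 J1 class_enorm2V
  (class_sum o1 KD1 (index_enum 'I_n)
    (fun k => sq (inl (inr k)) : cls 1 0 U1 (1 + 0 + (1 + 0)) _ _)).
have cx := class_sum o1 KD1 (index_enum 'I_p)
  (fun k => sq (inr k) : cls 1 0 U1 (1 - 1 + (1 - 1)) _ _).
have cy' := class_mono KD1 J1 (_ : _ <= 0) cy.
have cx' := class_mono KD1 J1 (_ : _ <= 0) cx.
have E (phi : R -> Z -> R) (e : epsdom) w :
  ((enorm2 w)^-1)%:C%C * (\sum_(k < n) ('D_(eZ (inl (inr k))) (phi (epsval e)) w)%:C%C *
    ('D_(eZ (inl (inr k))) (phi (epsval e)) w)%:C%C) +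
  (\sum_(j < p) ('D_(eZ (inr j)) (phi (epsval e)) w)%:C%C *
    ('D_(eZ (inr j)) (phi (epsval e)) w)%:C%C) =
  (rescaled_grad (phi (epsval e)) w)%:C%C :> C.
  rewrite /rescaled_grad realCD realCM !realC_sum.
  by congr (_ * _ + _); apply: eq_bigr => i _; rewrite realCM.
apply: (class_eq o1 KD1 (fun e w _ => E phi1 e w) (fun e w _ => E phi2 e w)).
by apply: (class_add o1 KD1); [apply: cy'|apply: cx']; rewrite /=; lra.
Qed.

Lemma class_rescaled_gradV : cls 1 0 U1 0
  (fun e w => ((rescaled_grad (phi1 (epsval e)) w)^-1)%:C%C)
  (fun e w => ((rescaled_grad (phi2 (epsval e)) w)^-1)%:C%C).
Proof.
have sub := @sub_U1 R n' n p Omega' Omega.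
have sm (phi : R -> Z -> R) : M_Phi Omega' Omega phi -> forall e : epsdom,
    smooth_on eZ (X `*` U1) (rescaled_grad (phi (epsval e))).
  move=> mp e; apply: (smooth_on_sub sub).
  exact: (smooth_rescaled_grad oO' oO (M_Phi_smooth mp (epsval01 e))).
have n0 (phi : R -> Z -> R) : M_Phi Omega' Omega phi -> forall (e : epsdom) w, (X `*` U1) w ->
    rescaled_grad (phi (epsval e)) w != 0.
  move=> mp e w Dw; rewrite gt_eqF//.
  exact: (rescaled_grad_gt0 oO' oO mp (epsval01 e) (sub _ Dw)).
have smV (phi : R -> Z -> R) : M_Phi Omega' Omega phi ->
    nsmooth eZ (X `*` U1) (fun (e : epsdom) w => ((rescaled_grad (phi (epsval e)) w)^-1)%:C%C).
  move=> mp e; apply: (csmooth_on_real (g := fun w => (rescaled_grad (phi (epsval e)) w)^-1)).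
  exact: (smooth_on_inv o1 (n0 _ mp e) (sm _ mp e)).
split; [exact: smV|exact: smV|move=> k].
have [_ _ cl] := class_rescaled_grad.
apply: (rel_inv o1 KD1 J1 (sm _ m1) (sm _ m2) _ _ (cl k)).
  by move=> e w Dw; split; exact: n0.
move=> _ [K cK ->].
have [A1 t1 H1] := rescaled_grad_inv_tempered oO' oO m1 cK.
have [A2 t2 H2] := rescaled_grad_inv_tempered oO' oO m2 cK.
exists (fun t => A1 t + A2 t); first exact: tempered_add.
move=> e [z xi] [/= Kz hx]; have x0 := U1_neq0 hx.
by split; [apply: (le_trans (H1 _ _ _ Kz x0)); rewrite lerDl; exact: t2.1|
  apply: (le_trans (H2 _ _ _ Kz x0)); rewrite lerDr; exact: t1.1].
Qed.

Lemma class_1chi mu : 0 <= mu -> cls 1 0 U1 mu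
  (fun _ w => Complex 0 1 * (1 - chi w.2)) (fun _ w => Complex 0 1 * (1 - chi w.2)).
Proof.
move=> mu0; have c := class_shrink oO' oO openT (@subsetT _ U1)
  (class_cutoff Omega' Omega (@epsval R) 1 0 mu hchi).
have c1 := class_add o1 KD1 (class_cst _ _ _ o1 KD1 J1 1 mu0) (class_opp o1 KD1 J1 c).
by have := class_mul o1 KD1 J1 (class_cst _ _ _ o1 KD1 J1 (Complex 0 1) (lexx 0)) c1; rewrite add0r.
Qed.

Lemma varphiE (phi : R -> Z -> R) (e : epsdom) w : M_Phi Omega' Omega phi -> (X `*` N0) w ->
  varphi (phi (epsval e)) w = (rescaled_grad (phi (epsval e)) w)^-1.
Proof.
move=> mp Dw; congr (_^-1); apply: (rescaled_gradE oO' oO _ _ Dw).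
  exact: (M_Phi_smooth mp (epsval01 e)).
exact: (M_Phi_homogeneous mp (epsval01 e)).
Qed.

(** The estimates are made where the phase is smooth, for |xi| > 1/8, and extended by zero thanks to
    the factor 1 - chi. *)
Lemma class_La j : cls 1 0 setT 0 (fun e => La chi (phi1 (epsval e)) j)
  (fun e => La chi (phi2 (epsval e)) j).
Proof.
have z (phi : R -> Z -> R) (e : epsdom) w : (X `*` U0) w -> La chi (phi (epsval e)) j w = 0.
  by move=> [_ h]; rewrite /La; case: hchi => _ -> // _; rewrite subrr mulr0 mul0r.
apply: (@class_extend _ _ _ _ _ _ oO' oO _ _ _ _ _ (fun e => La chi (phi1 (epsval e)) j)
  (fun e => La chi (phi2 (epsval e)) j) (z phi1) (z phi2)).
have c := class_mul o1 KD1 J1 (class_1chi (lexx 0))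
  (class_mul o1 KD1 J1 class_rescaled_gradV (class_gradient (inr j))).
have E (phi : R -> Z -> R) : M_Phi Omega' Omega phi -> forall (e : epsdom) w, (X `*` U1) w ->
   (Complex 0 1 * (1 - chi w.2)) * (((rescaled_grad (phi (epsval e)) w)^-1)%:C%C *
   ('D_(eZ (inr j)) (phi (epsval e)) w)%:C%C) = La chi (phi (epsval e)) j w.
  move=> mp e w Dw; rewrite /La varphiE//; last exact: (@sub_U1 R n' n p Omega' Omega).
  by rewrite realCM.
apply: (class_eq o1 KD1 (E _ m1) (E _ m2)).
by apply: (class_mono KD1 J1 _ c); rewrite /=; lra.
Qed.

Lemma class_Lb k : cls 1 0 setT (-1) (fun e => Lb chi (phi1 (epsval e)) k)
  (fun e => Lb chi (phi2 (epsval e)) k).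
Proof.
have z (phi : R -> Z -> R) (e : epsdom) w : (X `*` U0) w -> Lb chi (phi (epsval e)) k w = 0.
  by move=> [_ h]; rewrite /Lb; case: hchi => _ -> // _; rewrite subrr mulr0 mul0r.
apply: (@class_extend _ _ _ _ _ _ oO' oO _ _ _ _ _ (fun e => Lb chi (phi1 (epsval e)) k)
  (fun e => Lb chi (phi2 (epsval e)) k) (z phi1) (z phi2)).
have c := class_mul o1 KD1 J1 (class_1chi (lexx 0)) (class_mul o1 KD1 J1 (class_mul o1 KD1 J1
  class_enorm2V class_rescaled_gradV) (class_gradient (inl (inr k)))).
have E (phi : R -> Z -> R) : M_Phi Omega' Omega phi -> forall (e : epsdom) w, (X `*` U1) w ->
   (Complex 0 1 * (1 - chi w.2)) * (((enorm2 w)^-1)%:C%C *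
   ((rescaled_grad (phi (epsval e)) w)^-1)%:C%C *
   ('D_(eZ (inl (inr k))) (phi (epsval e)) w)%:C%C) = Lb chi (phi (epsval e)) k w.
  move=> mp e w Dw; rewrite /Lb varphiE//; last exact: (@sub_U1 R n' n p Omega' Omega).
  by rewrite enorm2E !realCM.
apply: (class_eq o1 KD1 (E _ m1) (E _ m2)).
by apply: (class_mono KD1 J1 _ c); rewrite /=; lra.
Qed.

(** In type (1, 0) the xi-derivative of a_j drops from order 0 to -1, and the y-derivative of b_k
    stays at -1. The cutoff has every order. *)
Lemma class_Lc : cls 1 0 setT (-1) (fun e => Lc chi (phi1 (epsval e)))
  (fun e => Lc chi (phi2 (epsval e))).
Proof.
have c0 := class_cutoff Omega' Omega (@epsval R) 1 0 (-1) hchi.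
have ca j := class_D (inr j) (class_La j).
have cb k := class_D (inl (inr k)) (class_Lb k).
apply: (class_add oT KDT); first apply: (class_add oT KDT).
- exact: c0.
- apply: (class_sum oT KDT) => j; apply: (class_mono KDT JT _ (ca j)); rewrite /=; lra.
- apply: (class_sum oT KDT) => k; apply: (class_mono KDT JT _ (cb k)); rewrite /=; lra.
Qed.

Section Transport.
Context (rho delta : R) (hrho : 0 < rho <= 1) (hdelta : 0 <= delta < 1).
Local Notation s := (Num.min rho (1 - delta)).
Context {E : Type} (r : E -> @epsdom R).
Local Notation erel := (nrel (@epsval R \o r) (@eZ R n' n p) (fullwt rho delta)
  (cylinders Omega' Omega setT) jap).
Local Notation esmooth := (nsmooth (@eZ R n' n p) (X `*` setT)).
Implicit Types f g : E -> Z -> C.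

Definition netL (phi : R -> Z -> R) f : E -> Z -> C :=
  fun e => L chi (phi (epsval (r e))) (f e).

Let weak mu (f g : @epsdom R -> Z -> C) : cls 1 0 setT mu f g -> same_class (@epsval R \o r) (@eZ R n' n p)
  (fullwt rho delta) (X `*` setT) (cylinders Omega' Omega setT) jap mu (f \o r) (g \o r).
Proof.
move=> c; apply: class_pull; case/andP: hrho => _ r1; case/andP: hdelta => d0 _.
exact: (class_weaken oO' oO r1 d0 openT c).
Qed.

Lemma netL_smooth f : esmooth f -> esmooth (netL phi1 f) /\ esmooth (netL phi2 f).
Proof.
move=> sf; have sfD i := nsmooth_D i sf.
suff H (phi : R -> Z -> R) : (forall j, esmooth (fun e => La chi (phi (epsval (r e))) j)) ->
    (forall k, esmooth (fun e => Lb chi (phi (epsval (r e))) k)) ->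
    esmooth (fun e => Lc chi (phi (epsval (r e)))) -> esmooth (netL phi f).
  split; apply: H => [j|k|].
  - exact: (let: And3 h _ _ := weak (class_La j) in h).
  - exact: (let: And3 h _ _ := weak (class_Lb k) in h).
  - exact: (let: And3 h _ _ := weak class_Lc in h).
  - exact: (let: And3 _ h _ := weak (class_La j) in h).
  - exact: (let: And3 _ h _ := weak (class_Lb k) in h).
  - exact: (let: And3 _ h _ := weak class_Lc in h).
move=> sa sb sc.
exact: (nsmooth_add oT (nsmooth_add oT
  (nsmooth_sum oT _ (fun j => nsmooth_mul oT (sa j) (sfD (inr j))))
  (nsmooth_sum oT _ (fun k => nsmooth_mul oT (sb k) (sfD (inl (inr k))))))
  (nsmooth_mul oT sc sf)).
Qed.

(** The three kinds of terms change the order by - [rho], by -1 + [delta] and by -1; each is at most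
    - s because s = min ([rho], 1 - [delta]) and [rho] <= 1. One level of [nrel] is spent since L
    differentiates once. *)
Lemma netL_rel k mu f g : esmooth f -> esmooth g -> erel k.+1 mu f g ->
  erel k (mu - s) (netL phi1 f) (netL phi2 g).
Proof.
move=> sf sg fg; have [_ d] := fg.
have [sc1 sc2 rc] := weak class_Lc.
have wa j := weak (class_La j); have wb l := weak (class_Lb l).
have sm : s <= rho /\ s <= 1 - delta by rewrite !ge_min !lexx orbT.
have s1 : s <= 1 by apply: (le_trans sm.1); case/andP: hrho.
have sfD i := nsmooth_D i sf; have sgD i := nsmooth_D i sg.
have ta j : erel k (mu - s)
    (fun e w => La chi (phi1 (epsval (r e))) j w * cderiv (exi j) (f e) w)
    (fun e w => La chi (phi2 (epsval (r e))) j w * cderiv (exi j) (g e) w).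
  have [s1' s2' ra] := wa j.
  apply: (rel_mono KDT JT _ (rel_mul oT KDT JT s1' s2' (sfD _) (sgD _) (ra k) (d (inr j)))).
  by rewrite /=; have [] := sm; lra.
have tb l : erel k (mu - s)
    (fun e w => Lb chi (phi1 (epsval (r e))) l w * cderiv (ey l) (f e) w)
    (fun e w => Lb chi (phi2 (epsval (r e))) l w * cderiv (ey l) (g e) w).
  have [s1' s2' rb] := wb l.
  apply: (rel_mono KDT JT _ (rel_mul oT KDT JT s1' s2' (sfD _) (sgD _) (rb k) (d (inl (inr l))))).
  by rewrite /=; have [] := sm; lra.
have tc : erel k (mu - s) (fun e w => Lc chi (phi1 (epsval (r e))) w * f e w)
    (fun e w => Lc chi (phi2 (epsval (r e))) w * g e w).
  apply: (rel_mono KDT JT _ (rel_mul oT KDT JT sc1 sc2 sf sg (rc k) (rel_leq fg))).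
  by lra.
have SA1 j : esmooth (fun e w => La chi (phi1 (epsval (r e))) j w * cderiv (exi j) (f e) w).
  exact: (nsmooth_mul oT (let: And3 h _ _ := wa j in h) (sfD _)).
have SA2 j : esmooth (fun e w => La chi (phi2 (epsval (r e))) j w * cderiv (exi j) (g e) w).
  exact: (nsmooth_mul oT (let: And3 _ h _ := wa j in h) (sgD _)).
have SB1 l : esmooth (fun e w => Lb chi (phi1 (epsval (r e))) l w * cderiv (ey l) (f e) w).
  exact: (nsmooth_mul oT (let: And3 h _ _ := wb l in h) (sfD _)).
have SB2 l : esmooth (fun e w => Lb chi (phi2 (epsval (r e))) l w * cderiv (ey l) (g e) w).
  exact: (nsmooth_mul oT (let: And3 _ h _ := wb l in h) (sgD _)).
exact: (rel_add oT KDT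
  (nsmooth_add oT (nsmooth_sum oT _ SA1) (nsmooth_sum oT _ SB1))
  (nsmooth_add oT (nsmooth_sum oT _ SA2) (nsmooth_sum oT _ SB2))
  (nsmooth_mul oT sc1 sf) (nsmooth_mul oT sc2 sg)
  (rel_add oT KDT (nsmooth_sum oT _ SA1) (nsmooth_sum oT _ SA2)
     (nsmooth_sum oT _ SB1) (nsmooth_sum oT _ SB2)
     (rel_sum oT KDT _ SA1 SA2 ta) (rel_sum oT KDT _ SB1 SB2 tb)) tc).
Qed.

Lemma netL_iter k h mu f g : esmooth f -> esmooth g -> erel (h + k) mu f g ->
  [/\ esmooth (iter h (netL phi1) f), esmooth (iter h (netL phi2) g) &
      erel k (mu - h%:R * s) (iter h (netL phi1) f) (iter h (netL phi2) g)].
Proof.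
elim: h k => [|h IH] k sf sg fg; first by rewrite mul0r subr0; exact: And3 sf sg fg.
have [|s1 s2 r'] := IH k.+1 sf sg; first by rewrite addnS.
split; [exact: (netL_smooth s1).1|exact: (netL_smooth s2).2|].
have := netL_rel s1 s2 r'.
rewrite (_ : mu - h%:R * s - s = mu - h.+1%:R * s); first exact.
by rewrite -[in RHS]natr1 mulrDl mul1r opprD addrA.
Qed.

End Transport.
End Coefficients.

(** * Exponentials of phases *)

Section Expi.
Context {R : realType}.
Local Notation C := R[i].

Lemma cos_sin_lipschitz (a b : R) : `|cos a - cos b| <= `|a - b| /\ `|sin a - sin b| <= `|a - b|.
Proof.
have L (f g : R -> R) : (forall x : R, is_derive x 1 f (g x)) -> (forall x, `|g x| <= 1) ->
    `|f a - f b| <= `|a - b|.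
  move=> df g1; have [|s _] := @MVT_line R R f 1 b (a - b).
    by move=> s _; have [] := df ((s * (a - b)) *: (1 : R) + b).
  have -> : (a - b) *: (1 : R) + b = a by rewrite [_ *: _]mulr1 subrK.
  move=> ->; have [_ ->] := df ((s * (a - b)) *: (1 : R) + b).
  by rewrite normrM -[leRHS]mulr1 ler_wpM2l.
split.
  apply: (L _ (fun x => - sin x) (fun x => is_derive_cos x)) => x.
  by rewrite normrN ler_norml sin_geN1 sin_le1.
apply: (L _ cos (fun x => is_derive_sin x)) => x.
by rewrite ler_norml cos_geN1 cos_le1.
Qed.

Lemma normc_expiB (a b : R) : normc (expi a - expi b) <= 2 * `|a - b|.
Proof.
have [h1 h2] := cos_sin_lipschitz a b.
by apply: (le_trans (normc_le _)); rewrite ReD ReN ImD ImN /=; lra.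
Qed.

Context {E : Type} (eps : E -> R) {V : normedModType R}.
Context {I : Type} (e_ : I -> V) (wt : I -> R).
Context (D : set V) (KK : set (set V)) (J : V -> R).
Hypotheses (oD : open D) (KD : forall K, KK K -> K `<=` D).
Hypothesis J1 : forall w, D w -> 1 <= J w.

Lemma nsmooth_expi (F : E -> V -> R) : (forall e, smooth_on e_ D (F e)) ->
  nsmooth e_ D (fun e w => expi (F e w)).
Proof. by move=> sF e; exact: csmooth_on_expi. Qed.

(* Only the difference of the phases is controlled in order nu, not the
   phases: for equal phases nu = 0 is allowed. *)
Lemma rel_expi k nu (F F' : E -> V -> R) : 0 <= nu ->
  (forall e, smooth_on e_ D (F e)) -> (forall e, smooth_on e_ D (F' e)) ->
  (forall K, KK K -> exists2 B, rapid B & forall e w, K w ->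
     `|F e w - F' e w| <= B (eps e) * J w `^ nu) ->
  (forall i, nrel eps e_ wt KK J k (wt i)
     (fun e w => ('D_(e_ i) (F e) w)%:C%C) (fun e w => ('D_(e_ i) (F' e) w)%:C%C)) ->
  nrel eps e_ wt KK J k nu (fun e w => expi (F e w)) (fun e w => expi (F' e w)).
Proof.
move=> nu0 sF sF' HB; have s1 := nsmooth_expi sF; have s2 := nsmooth_expi sF'.
have b : bound eps KK J nu (fun e w => expi (F e w)) (fun e w => expi (F' e w)).
  move=> K KK_; have [B rB H] := HB K KK_; exists (fun=> 1), (fun t => 2 * B t).
  split; [exact: tempered_cst|by apply: rapid_mul => //; exact: tempered_cst|].
  move=> e w Kw; have Jw := J1 (KD KK_ Kw).
  have J0 : 1 <= J w `^ nu by rewrite -(powRr0 (J w)); apply: ler_powR.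
  rewrite !normc_expi mul1r; split=> //.
  by apply: (le_trans (normc_expiB _ _)); rewrite -mulrA ler_wpM2l// H.
have cD (G : E -> V -> R) i : (forall e, smooth_on e_ D (G e)) ->
    nsmooth e_ D (fun e w => ('D_(e_ i) (G e) w)%:C%C).
  by move=> sG e; exact: (csmooth_on_real (smooth_on_D i (sG e))).
have ci := nsmooth_cst e_ D (fun _ : E => Complex 0 1 : C).
elim: k => [|k IH] H; first by split.
have {}IH := IH (fun i => rel_leq (H i)); split=> // i.
have rd := rel_mul oD KD J1 (nsmooth_mul oD ci (cD _ i sF)) (nsmooth_mul oD ci (cD _ i sF')) s1 s2
   (rel_mul oD KD J1 ci ci (cD _ i sF) (cD _ i sF')
      (rel_cst eps e_ wt oD KD J1 k (Complex 0 1) (lexx 0)) (rel_leq (H i))) IH.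
rewrite add0r addrC in rd.
have E1 (G : E -> V -> R) : (forall e, smooth_on e_ D (G e)) -> forall e w, D w ->
   Complex 0 1 * ('D_(e_ i) (G e) w)%:C%C * expi (G e w) = nderiv e_ i (fun e w => expi (G e w)) e w.
  move=> sG e w Dw; rewrite /nderiv; apply: esym; apply: cderiv_expi.
  exact: (smooth_on_derivable (sG e) Dw).
exact: (rel_eq oD KD (E1 _ sF) (E1 _ sF') rd).
Qed.

End Expi.

Lemma continuous_at_lipschitz {R : realType} {V : normedModType R} (f : V -> R) x (r M : R) :
  0 < r -> 0 <= M -> (forall z, ball x r z -> `|f z - f x| <= M * `|z - x|) ->
  {for x, continuous f}.
Proof.
move=> r0 M0 H; apply/cvgrPdist_lt => eta eta0.
have nM : 0 < M + 1 by rewrite ltr_wpDl.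
have d0 : 0 < Num.min r (eta / (M + 1)) by rewrite lt_min r0 divr_gt0.
have : \forall z \near x, ball x (Num.min r (eta / (M + 1))) z by exact: nbhsx_ballx.
apply: filterS => z bz.
have br : ball x r z by apply: le_ball bz; rewrite ge_min lexx.
rewrite distrC; apply: (le_lt_trans (H _ br)).
have zx : `|z - x| < eta / (M + 1).
  rewrite distrC; move: bz; rewrite -ball_normE /= => bz.
  by apply: (lt_le_trans bz); rewrite ge_min lexx orbT.
have : (M + 1) * `|z - x| < eta by rewrite mulrC -ltr_pdivlMr.
by rewrite mulrDl mul1r; apply: le_lt_trans; rewrite lerDl.
Qed.

(** * Continuity from bounded partial derivatives *)

Section Partials.
Context {R : realType}.

(** One coordinate is changed at a time, from x to z, with the mean value theorem at each step. The
    intermediate segments stay in the ball because it is a cube, the norm being the sup norm. *)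
Lemma lipschitz_partials n (f : 'rV[R]_n -> R) x (r M : R) : 0 <= M ->
  (forall z, ball x r z -> forall i, derivable f z (std i) /\ `|'D_(std i) f z| <= M) ->
  forall z, ball x r z -> `|f z - f x| <= n%:R * (M * `|z - x|).
Proof.
move=> M0 H z bz.
pose q m : 'rV[R]_n := \row_i if (i < m)%N then z 0 i else x 0 i.
have q0 : q 0%N = x by apply/rowP => i; rewrite mxE.
have qn : q n = z by apply/rowP => i; rewrite mxE ltn_ord.
have step (m : 'I_n) : `|f (q m.+1) - f (q m)| <= M * `|z - x|.
  have bl (s : R) : 0 <= s <= 1 -> ball x r ((s * (z 0 m - x 0 m)) *: std m + q m).
    move=> /andP[s0 s1]; move: bz; rewrite -!ball_normE /= => bz; apply: le_lt_trans bz.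
    rewrite [leLHS]mx_normrE; apply/bigmax_leP; split=> [|[i j] _ /=]; first exact: normr_ge0.
    rewrite (ord1 i) !mxE eqxx/=.
    have zj : `|x 0 j - z 0 j| <= `|x - z|.
      have := @coord_le_norm _ _ (x - z) j; by rewrite !mxE.
    case: eqVneq => [jm|jm]; last first.
      rewrite mulr0 add0r; case: ifP => _; first exact: zj.
      by rewrite subrr normr0.
    rewrite jm ltnn mulr1 in zj *; apply: le_trans zj.
    have -> : x 0 m - (s * (z 0 m - x 0 m) + x 0 m) = s * (x 0 m - z 0 m) by ring.
    by rewrite normrM (ger0_norm s0) ler_piMl.
  have -> : q m.+1 = (z 0 m - x 0 m) *: std m + q m.
    apply/rowP => j; rewrite !mxE eqxx/= ltnS leq_eqVlt; case: (eqVneq j m) => [->|jm].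
      by rewrite eqxx/= ltnn mulr1 subrK.
    by rewrite (inj_eq val_inj) (negbTE jm)/= mulr0 add0r.
  have [s hs|s hs ->] := @MVT_line R _ f (std m) (q m) (z 0 m - x 0 m).
    by have [] := H _ (bl s hs) m.
  have [_ dm] := H _ (bl s hs) m.
  rewrite normrM mulrC ler_pM//; have := @coord_le_norm _ _ (z - x) m; by rewrite !mxE.
suff S k : (k <= n)%N -> `|f (q k) - f x| <= k%:R * (M * `|z - x|).
  by have := S n (leqnn n); rewrite qn.
elim: k => [|k IH] kn; first by rewrite q0 subrr normr0 mul0r.
have -> : f (q k.+1) - f x = (f (q k.+1) - f (q k)) + (f (q k) - f x) by rewrite subrKA.
apply: (le_trans (ler_normD _ _)); rewrite -natr1 mulrDl mul1r addrC.
by apply: lerD; [exact: IH (ltnW kn)|exact: (step (Ordinal kn))].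
Qed.

(** Gives continuity of the integral in x without a limit under the integral sign: bounds on its
    partial derivatives are enough. *)
Lemma continuous_partials n (f : 'rV[R]_n -> R) x (r M : R) : 0 < r -> 0 <= M ->
  (forall z, ball x r z -> forall i, derivable f z (std i) /\ `|'D_(std i) f z| <= M) ->
  {for x, continuous f}.
Proof.
move=> r0 M0 H; apply: (@continuous_at_lipschitz _ _ f x r (n%:R * M)) => //.
  by rewrite mulr_ge0.
by move=> z bz; rewrite -mulrA; exact: lipschitz_partials M0 H z bz.
Qed.

End Partials.

#[local] Opaque derive.

Lemma continuous_pair_slice {T1 T2 T3 : topologicalType} (x : T1) (z : T2 * T3) :
  {for z, continuous (fun z : T2 * T3 => (x, z.1, z.2))}.
Proof.
apply: (cvg_pair (G := nbhs (x, z.1)) (H := nbhs z.2)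
  (f := fun z : T2 * T3 => (x, z.1)) (g := snd)); last exact: cvg_snd.
by apply: (cvg_pair (G := nbhs x) (H := nbhs z.1) (f := fun z : T2 * T3 => x) (g := fst));
  [exact: cvg_cst|exact: cvg_fst].
Qed.

Lemma continuous_slice {T1 T2 T3 U : topologicalType} (g : T1 * T2 * T3 -> U)
    (x : T1) (z : T2 * T3) : {for (x, z.1, z.2), continuous g} ->
  {for z, continuous (fun z => g (x, z.1, z.2))}.
Proof.
move=> cg; apply: (@continuous_comp _ _ _ (fun z : T2 * T3 => (x, z.1, z.2)) g).
  exact: continuous_pair_slice.
exact: cg.
Qed.

Lemma tempered_sum {R : realType} (T : finType) (A : T -> R -> R) :
  (forall i, tempered (A i)) -> tempered (fun t => \sum_i A i t).
Proof.
move=> tA; rewrite (_ : (fun t => _) = \sum_i A i); last first.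
  by apply/funext => t; rewrite fct_sumE.
elim/big_ind: _ => [|f g tf tg|i _]; [exact: (tempered_cst (lexx 0))|exact: tempered_add|exact: tA].
Qed.

Lemma rapid_sum {R : realType} (T : finType) (A : T -> R -> R) :
  (forall i, rapid (A i)) -> rapid (fun t => \sum_i A i t).
Proof.
move=> tA; rewrite (_ : (fun t => _) = \sum_i A i); last first.
  by apply/funext => t; rewrite fct_sumE.
elim/big_ind: _ => [|f g tf tg|i _]; [exact: rapid0|exact: rapid_add|exact: tA].
Qed.

(** * Smooth dependence of the integral on x *)

Section XIntegral.
Context {R : realType} {n' n p : nat}.
Local Notation C := R[i].
Local Notation Z := ('rV[R]_n' * 'rV[R]_n * 'rV[R]_p)%type.
Context (Omega' : set 'rV[R]_n') (Omega : set 'rV[R]_n).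
Hypotheses (oO' : open Omega') (oO : open Omega).
Local Notation X := (Omega' `*` Omega).
Local Notation cRe := (@complex.Re _).
Local Notation cIm := (@complex.Im _).
Context {E : Type} (eps : E -> R).
Local Notation xrel := (nrel eps (@xdir R n' n p) (fun=> 2)
  (cylinders Omega' Omega setT) jap).
Local Notation xbound := (bound eps (cylinders Omega' Omega setT) (@jap R n' n p)).
Local Notation xsmooth := (nsmooth (@xdir R n' n p) (X `*` setT)).
Local Notation xnderiv := (nderiv (@xdir R n' n p)).
Context (K : set 'rV[R]_n) (cK : compact_in Omega K).
Implicit Types P Q : E -> Z -> C.

Let KDT := @cylinders_sub R n' n p Omega' Omega setT.
Let JT : forall w : Z, (X `*` setT) w -> 1 <= jap w. Proof. by move=> w _; exact: jap_ge1. Qed.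

Definition ysupp P := forall e w, X w.1 -> ~ K w.1.2 -> P e w = 0.

Definition xint P (e : E) (x : 'rV[R]_n') : C :=
  cintegral_yxi Omega (fun y xi => P e (x, y, xi)).

Lemma open_off_K : open [set w : Z | X w.1 /\ ~ K w.1.2].
Proof.
have cl : closed K by apply: compact_closed => //; case: cK.
rewrite (_ : mkset _ = (Omega' `*` (Omega `&` ~` K)) `*` setT).
  apply: open_setX; last exact: openT.
  by apply: open_setX => //; apply: openI => //; exact: closed_openC.
apply/seteqP; split=> -[[x y] xi] /=; first by move=> [[? ?] ?].
by move=> [[? [? ?]] _].
Qed.

Lemma ysupp_D P i : ysupp P -> ysupp (xnderiv i P).
Proof.
move=> sP e w Xw Kw; rewrite /nderiv.
rewrite (@cderiv_eq _ _ [set w : Z | X w.1 /\ ~ K w.1.2] _ (fun=> 0) _ _ open_off_K).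
- exact: cderiv_cst.
- by move=> w' [Xw' Kw']; exact: sP.
- by [].
Qed.

Lemma ysupp_radius : exists b, forall y, K y -> `|y| <= b.
Proof.
have [M _ HM] := @compact_norm_bound R _ K (fun y => `|y|) cK.1
  (fun y _ => @norm_continuous _ _ y).
by exists M => y /HM; rewrite normr_id.
Qed.

Lemma adm_slice (g : Z -> R) x A mu b : Omega' x ->
  (forall w, (X `*` setT) w -> {for w, continuous g}) ->
  (forall w, X w.1 -> ~ K w.1.2 -> g w = 0) -> (forall y, K y -> `|y| <= b) ->
  0 <= A -> (forall y xi, K y -> `|g (x, y, xi)| <= A * japanese xi `^ mu) ->
  adm Omega b mu A (fun y xi => g (x, y, xi)).
Proof.
move=> Ox cg g0 Kb A0 gA; split.
- by move=> z Oz; apply: (@continuous_slice _ _ _ _ g x z); apply: cg.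
- move=> y xi Oy by_; apply: (g0 (x, y, xi)) => //= /Kb; by rewrite leNgt by_.
- move=> y xi Oy; have [Ky|Ky] := pselect (K y); first exact: gA.
  by rewrite (g0 (x, y, xi))// normr0 mulr_ge0 ?powR_ge0.
Qed.

Lemma xsmooth_continuous P e w : xsmooth P -> (X `*` setT) w ->
  {for w, continuous (cRe \o P e)} /\ {for w, continuous (cIm \o P e)}.
Proof.
by move=> sP Dw; have [h1 h2] := sP e; split; [exact: (smooth_on_cont h1 Dw)|exact: (smooth_on_cont h2 Dw)].
Qed.

Lemma xint_bound mu P Q (K' : set 'rV[R]_n') : xsmooth P -> xsmooth Q ->
  ysupp P -> ysupp Q -> xbound mu P Q -> mu < - p%:R -> compact_in Omega' K' ->
  exists A B, [/\ tempered A, rapid B & forall e x, K' x ->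
    [/\ normc (xint P e x) <= A (eps e), normc (xint Q e x) <= A (eps e) &
        normc (xint P e x - xint Q e x) <= B (eps e)]].
Proof.
move=> sP sQ zP zQ H hmu cK'.
have [b Kb] := ysupp_radius.
have [c c0 Hc] := @adm_bound R n p Omega b mu oO hmu.
have cKK : compact_in X (K' `*` K).
  split; first by apply: compact_setX; [case: cK'|case: cK].
  by move=> z [k1 k2]; split; [exact: cK'.2|exact: cK.2].
have [|A [B [tA rB {}H]]] := H ((K' `*` K) `*` setT); first by exists (K' `*` K).
(* The factor 2 pays for estimating real and imaginary parts separately. *)
exists (fun t => 2 * (A t * c)), (fun t => 2 * (B t * c)).
have tc : tempered (fun=> c : R) by exact: tempered_cst.
have t2 : tempered (fun=> 2 : R) by exact: tempered_cst.
split; [exact: tempered_mul t2 (tempered_mul tA tc)| |].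
  apply: rapid_mul => //; rewrite (_ : (fun t => B t * c) = fun t => c * B t).
    exact: rapid_mul.
  by apply/funext => t; rewrite mulrC.
move=> e x Kx; have Ox : Omega' x by exact: cK'.2.
have A0 := tA.1 (eps e); have B0 := rB.1 (eps e).
have HK y xi : K y -> [/\ normc (P e (x, y, xi)) <= A (eps e) * japanese xi `^ mu,
    normc (Q e (x, y, xi)) <= A (eps e) * japanese xi `^ mu &
    normc (P e (x, y, xi) - Q e (x, y, xi)) <= B (eps e) * japanese xi `^ mu].
  by move=> Ky; exact: (H e (x, y, xi)).
have zRe (P' : E -> Z -> C) : ysupp P' -> forall w, X w.1 -> ~ K w.1.2 -> (cRe \o P' e) w = 0.
  by move=> z w Xw Kw; rewrite /= z.
have zIm (P' : E -> Z -> C) : ysupp P' -> forall w, X w.1 -> ~ K w.1.2 -> (cIm \o P' e) w = 0.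
  by move=> z w Xw Kw; rewrite /= z.
have aPR := adm_slice Ox (fun w Dw => (xsmooth_continuous e sP Dw).1) (zRe _ zP) Kb A0
  (fun y xi Ky => le_trans (normc_Re _) (let: And3 h _ _ := HK y xi Ky in h)).
have aPI := adm_slice Ox (fun w Dw => (xsmooth_continuous e sP Dw).2) (zIm _ zP) Kb A0
  (fun y xi Ky => le_trans (normc_Im _) (let: And3 h _ _ := HK y xi Ky in h)).
have aQR := adm_slice Ox (fun w Dw => (xsmooth_continuous e sQ Dw).1) (zRe _ zQ) Kb A0
  (fun y xi Ky => le_trans (normc_Re _) (let: And3 _ h _ := HK y xi Ky in h)).
have aQI := adm_slice Ox (fun w Dw => (xsmooth_continuous e sQ Dw).2) (zIm _ zQ) Kb A0
  (fun y xi Ky => le_trans (normc_Im _) (let: And3 _ h _ := HK y xi Ky in h)).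
have two (a b' c' : R) : a <= c' -> b' <= c' -> a + b' <= 2 * c' by lra.
split.
- by apply: (le_trans (normc_le _)); apply: two; [exact: (Hc _ _ A0 aPR)|exact: (Hc _ _ A0 aPI)].
- by apply: (le_trans (normc_le _)); apply: two; [exact: (Hc _ _ A0 aQR)|exact: (Hc _ _ A0 aQI)].
have dif (F G : 'rV[R]_n -> 'rV[R]_p -> R) : adm Omega b mu (A (eps e)) F ->
    adm Omega b mu (A (eps e)) G ->
    (forall y xi, Omega y -> `|F y xi - G y xi| <= B (eps e) * japanese xi `^ mu) ->
    `|integral_yxi Omega F - integral_yxi Omega G| <= B (eps e) * c.
  move=> aF aG d; have aG' := adm_scale (-1) aG.
  have [h1 h2 _] := adm_add aF aG'.
  have aD : adm Omega b mu (B (eps e)) (fun y xi => F y xi + -1 * G y xi).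
    by split=> // y xi Oy; rewrite mulN1r; exact: d.
  have -> : integral_yxi Omega F - integral_yxi Omega G =
      integral_yxi Omega (fun y xi => F y xi + -1 * G y xi).
    rewrite (integral_yxiD oO hmu A0 _ aF aG') ?(integral_yxiZ _ oO hmu A0 aG) ?mulN1r//.
    by rewrite mulr_ge0.
  exact: Hc.
have dd y xi : Omega y -> normc (P e (x, y, xi) - Q e (x, y, xi)) <= B (eps e) * japanese xi `^ mu.
  move=> Oy; have [Ky|Ky] := pselect (K y); first by have [] := HK y xi Ky.
  by rewrite (zP e (x, y, xi))// (zQ e (x, y, xi))// subrr normc0 mulr_ge0 ?powR_ge0.
apply: (le_trans (normc_le _)); apply: two.
  rewrite ReD ReN; apply: (dif _ _ aPR aQR) => y xi Oy.
  have := le_trans (normc_Re _) (dd y xi Oy); by rewrite ReD ReN.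
rewrite ImD ImN; apply: (dif _ _ aPI aQI) => y xi Oy.
have := le_trans (normc_Im _) (dd y xi Oy); by rewrite ImD ImN.
Qed.

(** The ball around x inside [K'] keeps the segment of Taylor's formula where the bounds hold. Off
    the support K all quantities vanish, so bounds over K are enough. *)
Lemma is_derive_slice_integral (g : Z -> R) x i mu b A (r : R) (K' : set 'rV[R]_n') :
  compact_in Omega' K' -> 0 < r -> (forall z, ball x r z -> K' z) ->
  (forall y, K y -> `|y| <= b) -> mu < - p%:R -> 0 <= A ->
  smooth_on (@xdir R n' n p) (X `*` setT) g ->
  (forall w, X w.1 -> ~ K w.1.2 -> [/\ g w = 0, 'D_(xdir i) g w = 0 &
     'D_(xdir i) ('D_(xdir i) g) w = 0]) ->
  (forall z y xi, K' z -> K y -> [/\ `|g (z, y, xi)| <= A * japanese xi `^ mu,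
     `|'D_(xdir i) g (z, y, xi)| <= A * japanese xi `^ mu &
     `|'D_(xdir i) ('D_(xdir i) g) (z, y, xi)| <= A * japanese xi `^ mu]) ->
  is_derive x (std i) (fun x => integral_yxi Omega (fun y xi => g (x, y, xi)))
    (integral_yxi Omega (fun y xi => 'D_(xdir i) g (x, y, xi))).
Proof.
move=> cK' r0 bK' Kb hmu A0 sg z g_le.
have line h y xi : h *: (xdir i : Z) + (x, y, xi) = (h *: std i + x, y, xi).
  by rewrite -[LHS]/(((h *: std i + x, h *: 0 + y), h *: 0 + xi) : Z) !scaler0 !add0r.
have Kh (h : R) : `|h| < r -> K' (h *: std i + x).
  move=> hr; apply: bK'; rewrite -ball_normE /=.
  have -> : x - (h *: std i + x) = - h *: std i by rewrite opprD addrCA subrr addr0 scaleNr.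
  apply: le_lt_trans hr; rewrite [leLHS]mx_normrE; apply/bigmax_leP; split=> [|[a b'] _ /=].
    exact: normr_ge0.
  rewrite !mxE normrM normrN; case: (_ && _); last by rewrite normr0 mulr0.
  by rewrite normr1 mulr1.
have sD := smooth_on_D i sg.
apply: (@is_derive_integral R n p _ Omega b mu A A r
  (fun x y xi => g (x, y, xi)) _ x (std i) oO hmu A0 A0 r0).
- move=> h hr; apply: (adm_slice (cK'.2 _ (Kh h hr)) (smooth_on_cont sg) _ Kb A0).
    by move=> w Xw Kw; have [] := z w Xw Kw.
  by move=> y xi Ky; have [] := g_le _ y xi (Kh h hr) Ky.
- have Kx : K' x by apply: bK'; exact: ballxx.
  apply: (adm_slice (cK'.2 _ Kx) (smooth_on_cont sD) _ Kb A0).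
    by move=> w Xw Kw; have [] := z w Xw Kw.
  by move=> y xi Ky; have [] := g_le _ y xi Kx Ky.
move=> h y xi hr Oy.
have Dw s : 0 <= s <= 1 -> (X `*` setT) ((s * h) *: (xdir i : Z) + (x, y, xi)) /\
    K' ((s * h) *: std i + x).
  move=> /andP[s0 s1]; have k : K' ((s * h) *: std i + x).
    by apply: Kh; rewrite normrM (ger0_norm s0) (le_lt_trans _ hr)// ler_piMl.
  by rewrite line; split=> //; split=> //; split=> //; exact: cK'.2.
have [s1 hs1|s1 hs1|s [s' [/andP[s0 s1] hs' T]]] := @Taylor_line R _ g (xdir i) (x, y, xi) h.
- exact: (smooth_on_derivable sg (Dw _ hs1).1).
- exact: (smooth_on_derivable sD (Dw _ hs1).1).
move: T; rewrite !line => ->.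
have [[Xw _] K'w] := Dw _ hs'; rewrite line in Xw.
have d2 : `|'D_(xdir i) ('D_(xdir i) g) ((s' * h) *: std i + x, y, xi)| <= A * japanese xi `^ mu.
  have [Ky|Ky] := pselect (K y); first by have [] := g_le _ y xi K'w Ky.
  have [_ _ ->] := z _ Xw Ky; by rewrite normr0 mulr_ge0 ?powR_ge0.
move: ('D_(xdir i) ('D_(xdir i) g) _) d2 => d d2.
rewrite normrM (ger0_norm (mulr_ge0 s0 (sqr_ge0 h))) -(mulrA (h ^+ 2) A).
by apply: ler_pM d2; [exact: mulr_ge0 s0 (sqr_ge0 h)|exact: normr_ge0|exact: ler_piMl (sqr_ge0 h) s1].
Qed.

(** The Taylor remainder contains two x-derivatives, each of weight 2, so the second derivative, of
    order mu + 2 + 2, has to be integrable. *)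
Lemma xint_derive mu P x i e : xsmooth P -> ysupp P -> xrel 2 mu P P ->
  mu + 2 + 2 < - p%:R -> Omega' x ->
  cderivable (xint P e) x (std i) /\ cderiv (std i) (xint P e) x = xint (xnderiv i P) e x.
Proof.
move=> sP zP rP hmu Ox.
have [K' [cK' nK']] := compact_nbhs_rV oO' Ox.
have [r r0 bK'] : exists2 r, 0 < r & forall z, ball x r z -> K' z.
  by move/nbhs_ballP: nK' => [r r0 h]; exists r.
have [b Kb] := ysupp_radius.
have cKK : compact_in X (K' `*` K).
  split; first by apply: compact_setX; [case: cK'|case: cK].
  by move=> z [k1 k2]; split; [exact: cK'.2|exact: cK.2].
have m1 : mu <= mu + 2 + 2 by lra.
have m2 : mu + 2 <= mu + 2 + 2 by lra.
have CY : cylinders Omega' Omega [set: 'rV[R]_p] ((K' `*` K) `*` setT) by exists (K' `*` K).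
have rD : xrel 1 (mu + 2) (xnderiv i P) (xnderiv i P) := rP.2 i.
have [A0 [B0 [t0 _ H0]]] := rel_bound (rel_mono KDT JT m1 rP) CY.
have [A1 [B1 [t1 _ H1]]] := rel_bound (rel_mono KDT JT m2 rD) CY.
have [A2 [B2 [t2 _ H2]]] := rel_bound (rD.2 i : xrel 0 (mu + 2 + 2) _ _) CY.
pose A := A0 (eps e) + A1 (eps e) + A2 (eps e).
have [a0 a1 a2] : [/\ 0 <= A0 (eps e), 0 <= A1 (eps e) & 0 <= A2 (eps e)].
  by split; [exact: t0.1|exact: t1.1|exact: t2.1].
have Age : 0 <= A by rewrite /A; lra.
have zD := ysupp_D i zP; have zDD := ysupp_D i zD.
have up z y xi : K' z -> K y -> [/\ normc (P e (z, y, xi)) <= A * japanese xi `^ (mu + 2 + 2),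
    normc (xnderiv i P e (z, y, xi)) <= A * japanese xi `^ (mu + 2 + 2) &
    normc (xnderiv i (xnderiv i P) e (z, y, xi)) <= A * japanese xi `^ (mu + 2 + 2)].
  move=> Kz Ky; have D1 : ((K' `*` K) `*` [set: 'rV[R]_p]) (z, y, xi) by [].
  have J0 := powR_ge0 (japanese xi) (mu + 2 + 2).
  have [h0 _ _] := H0 e _ D1; have [h1 _ _] := H1 e _ D1; have [h2 _ _] := H2 e _ D1.
  have le3 a : a <= A -> a * japanese xi `^ (mu + 2 + 2) <= A * japanese xi `^ (mu + 2 + 2).
    by move=> aA; rewrite ler_wpM2r.
  by split; [apply: (le_trans h0)|apply: (le_trans h1)|apply: (le_trans h2)];
     apply: le3; rewrite /A; lra.
have [sR sI] := sP e.
have dR := @is_derive_slice_integral (cRe \o P e) x i _ b A r K' cK' r0 bK' Kb hmu Age sR.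
have dI := @is_derive_slice_integral (cIm \o P e) x i _ b A r K' cK' r0 bK' Kb hmu Age sI.
have {}dR : is_derive x (std i) (cRe \o xint P e) (cRe (xint (xnderiv i P) e x)).
  apply: dR => [w Xw Kw|z y xi Kz Ky].
    exact: (And3 (congr1 cRe (zP e w Xw Kw)) (congr1 cRe (zD e w Xw Kw)) (congr1 cRe (zDD e w Xw Kw))).
  have [h0 h1 h2] := up z y xi Kz Ky.
  exact: (And3 (le_trans (normc_Re _) h0) (le_trans (normc_Re _) h1) (le_trans (normc_Re _) h2)).
have {}dI : is_derive x (std i) (cIm \o xint P e) (cIm (xint (xnderiv i P) e x)).
  apply: dI => [w Xw Kw|z y xi Kz Ky].
    exact: (And3 (congr1 cIm (zP e w Xw Kw)) (congr1 cIm (zD e w Xw Kw)) (congr1 cIm (zDD e w Xw Kw))).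
  have [h0 h1 h2] := up z y xi Kz Ky.
  exact: (And3 (le_trans (normc_Im _) h0) (le_trans (normc_Im _) h1) (le_trans (normc_Im _) h2)).
have [d1 e1] := dR; have [d2 e2] := dI.
split; first exact: (conj d1 d2).
by rewrite /cderiv e1 e2; case: (xint _ _ _).
Qed.

Lemma xsmooth_D P i : xsmooth P -> xsmooth (xnderiv i P).
Proof. exact: nsmooth_D. Qed.

Lemma rel_selfl k mu P Q : xrel k mu P Q -> xrel k mu P P.
Proof. by move=> r; exact: rel_trans r (rel_sym r). Qed.

(** The k derivatives cost 2 k. The additional 4 lets the last one be differentiated under the
    integral once more, which yields its continuity through [continuous_partials]. *)
Lemma xint_Ck k mu P : xsmooth P -> ysupp P -> xrel k.+2 mu P P ->
  mu + 2 * k%:R + 4 < - p%:R ->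
  forall e, Ck std k Omega' (cRe \o xint P e) /\ Ck std k Omega' (cIm \o xint P e).
Proof.
move=> sP zP rP hmu e.
have dP k' mu' P' x i : xsmooth P' -> ysupp P' -> xrel k'.+2 mu' P' P' ->
    mu' + 2 * k'%:R + 4 < - p%:R -> Omega' x ->
    cderivable (xint P' e) x (std i) /\
    cderiv (std i) (xint P' e) x = xint (xnderiv i P') e x.
  move=> sP' zP' rP' hmu' Ox; have k0 := ler0n R k'.
  apply: (xint_derive (mu := mu') i e sP' zP' _ _ Ox); last by lra.
  by elim: k' rP' {hmu' k0} => [//|k' IH] /rel_leq; exact: IH.
have cP k' mu' P' x : xsmooth P' -> ysupp P' -> xrel k'.+2 mu' P' P' ->
    mu' + 2 * k'%:R + 4 < - p%:R -> Omega' x ->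
    {for x, continuous (cRe \o xint P' e)} /\ {for x, continuous (cIm \o xint P' e)}.
  move=> sP' zP' rP' hmu' Ox; have k0 := ler0n R k'.
  have [K' [cK' nK']] := compact_nbhs_rV oO' Ox.
  have [r r0 bK'] : exists2 r, 0 < r & forall z, ball x r z -> K' z.
    by move/nbhs_ballP: nK' => [r r0 h]; exists r.
  have h2 : mu' + 2 < - p%:R by lra.
  have H i := xint_bound (xsmooth_D i sP') (xsmooth_D i sP') (ysupp_D i zP') (ysupp_D i zP')
    (rel_bound (rP'.2 i : xrel k'.+1 (mu' + 2) _ _)) h2 cK'.
  have [A HA] := choice H.
  pose M := \sum_i A i (eps e).
  have A0 i : 0 <= A i (eps e) by have [B [tA _ _]] := HA i; exact: tA.1.
  have M0 : 0 <= M by apply: sumr_ge0 => i _; exact: A0.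
  have AM i : A i (eps e) <= M.
    by rewrite /M (bigD1 i)//= lerDl; apply: sumr_ge0 => j _; exact: A0.
  have le z i : ball x r z -> normc (xint (xnderiv i P') e z) <= M.
    move=> /bK' Kz; have [B [_ _ HB]] := HA i; have [h _ _] := HB e z Kz.
    exact: le_trans h (AM i).
  split; apply: (@continuous_partials R n' _ x r M r0 M0) => z bz i.
    have [[d1 _] E1] := dP _ _ _ z i sP' zP' rP' hmu' (cK'.2 _ (bK' _ bz)).
    split; first exact: d1.
    apply: le_trans (le z i bz); rewrite -E1.
    exact: (normc_Re (cderiv (std i) (xint P' e) z)).
  have [[_ d1] E1] := dP _ _ _ z i sP' zP' rP' hmu' (cK'.2 _ (bK' _ bz)).
  split; first exact: d1.
  apply: le_trans (le z i bz); rewrite -E1.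
  exact: (normc_Im (cderiv (std i) (xint P' e) z)).
elim: k mu P sP zP rP hmu => [|k IH] mu P sP zP rP hmu.
  split; split=> [x Ox|].
  - exact: (cP _ _ _ x sP zP rP hmu Ox).1.
  - exact: I.
  - exact: (cP _ _ _ x sP zP rP hmu Ox).2.
  - exact: I.
have hmu2 : (mu + 2) + 2 * k%:R + 4 < - p%:R.
  by move: hmu; rewrite -natr1; lra.
have C i := IH (mu + 2) _ (xsmooth_D i sP) (ysupp_D i zP) (rP.2 i) hmu2.
split; split=> [x Ox|i].
- exact: (cP _ _ _ x sP zP rP hmu Ox).1.
- split=> [x Ox|]; first exact: (dP _ _ _ x i sP zP rP hmu Ox).1.1.
  apply: (Ck_eq oO' _ (C i).1) => x Ox.
  exact: (esym (congr1 cRe (dP _ _ _ x i sP zP rP hmu Ox).2)).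
- exact: (cP _ _ _ x sP zP rP hmu Ox).2.
- split=> [x Ox|]; first exact: (dP _ _ _ x i sP zP rP hmu Ox).1.2.
  apply: (Ck_eq oO' _ (C i).2) => x Ox.
  exact: (esym (congr1 cIm (dP _ _ _ x i sP zP rP hmu Ox).2)).
Qed.

Lemma xint_words k mu P Q (K' : set 'rV[R]_n') : xsmooth P -> xsmooth Q ->
  ysupp P -> ysupp Q -> xrel k.+2 mu P Q -> mu + 2 * k%:R + 4 < - p%:R ->
  compact_in Omega' K' ->
  exists A B, [/\ tempered A, rapid B & forall s e x, (size s <= k)%N -> K' x ->
    [/\ normc (cword_deriv std s (xint P e) x) <= A (eps e),
        normc (cword_deriv std s (xint Q e) x) <= A (eps e) &
        normc (cword_deriv std s (xint P e) x - cword_deriv std s (xint Q e) x) <= B (eps e)]].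
Proof.
move=> sP sQ zP zQ rPQ hmu cK'.
elim: k mu P Q sP sQ zP zQ rPQ hmu => [|k IH] mu P Q sP sQ zP zQ r hmu.
  have hmu' : mu < - p%:R by move: hmu; rewrite mulr0 addr0; lra.
  have [A [B [tA rB H]]] := xint_bound sP sQ zP zQ (rel_bound r) hmu' cK'.
  by exists A, B; split=> // -[|//] e x _ Kx; exact: H.
have k0 := ler0n R k.+1.
have hmu' : mu < - p%:R by lra.
have hmu2 : (mu + 2) + 2 * k%:R + 4 < - p%:R.
  by move: hmu; rewrite -natr1; lra.
have [A [B [tA rB H]]] := xint_bound sP sQ zP zQ (rel_bound r) hmu' cK'.
have /choice[A' /choice[B' H']] := fun i => IH (mu + 2) _ _ (xsmooth_D i sP) (xsmooth_D i sQ)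
  (ysupp_D i zP) (ysupp_D i zQ) (r.2 i) hmu2.
have tA' i : tempered (A' i) by have [] := H' i.
have rB' i : rapid (B' i) by have [] := H' i.
have dX P' i e x : xsmooth P' -> ysupp P' -> xrel k.+3 mu P' P' -> Omega' x ->
    cderiv (std i) (xint P' e) x = xint (xnderiv i P') e x.
  move=> sP' zP' rP' Ox.
  have [] // := xint_derive (mu := mu) i e sP' zP' _ _ Ox; last by lra.
  by elim: (k) rP' {IH hmu hmu2 r H'} => [/rel_leq //|k' IH'] /rel_leq; exact: IH'.
have dW P' s i e x : xsmooth P' -> ysupp P' -> xrel k.+3 mu P' P' -> Omega' x ->
    cword_deriv std (rcons s i) (xint P' e) x = cword_deriv std s (xint (xnderiv i P') e) x.
  move=> sP' zP' rP' Ox; rewrite cword_deriv_rcons.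
  by apply: (@cword_deriv_eq R _ _ std Omega' _ _ s oO' _ x Ox) => z Oz; exact: dX.
have A0 t : 0 <= \sum_i A' i t by apply: sumr_ge0 => i _; exact: (tA' i).1.
have B0 t : 0 <= \sum_i B' i t by apply: sumr_ge0 => i _; exact: (rB' i).1.
have leA i t : A' i t <= \sum_i A' i t.
  by rewrite (bigD1 i)//= lerDl; apply: sumr_ge0 => j _; exact: (tA' j).1.
have leB i t : B' i t <= \sum_i B' i t.
  by rewrite (bigD1 i)//= lerDl; apply: sumr_ge0 => j _; exact: (rB' j).1.
exists (fun t => A t + \sum_i A' i t), (fun t => B t + \sum_i B' i t); split.
- by apply: tempered_add => //; exact: tempered_sum.
- by apply: rapid_add => //; exact: rapid_sum.
move=> s e x; case/lastP: s => [_ Kx|s i].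
  have [h1 h2 h3] := H e x Kx.
  split; [apply: (le_trans h1)|apply: (le_trans h2)|apply: (le_trans h3)]; by rewrite lerDl.
rewrite size_rcons ltnS => sk Kx; have Ox := cK'.2 _ Kx.
rewrite (dW P s i e x sP zP (rel_selfl r) Ox) (dW Q s i e x sQ zQ (rel_selfl (rel_sym r)) Ox).
have [_ _ /(_ s e x sk Kx)[h1 h2 h3]] := H' i.
split; [apply: (le_trans h1)|apply: (le_trans h2)|apply: (le_trans h3)].
- by rewrite (le_trans (leA i _))// lerDr; exact: tA.1.
- by rewrite (le_trans (leA i _))// lerDr; exact: tA.1.
- by rewrite (le_trans (leB i _))// lerDr; exact: rB.1.
Qed.

End XIntegral.

(** * Integration by parts *)

Section IntegrationByParts.
Context {R : realType} {n' n p : nat}.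
Local Notation Z := ('rV[R]_n' * 'rV[R]_n * 'rV[R]_p)%type.
Local Notation Y := ('rV[R]_n * 'rV[R]_p)%type.
Context (Omega' : set 'rV[R]_n') (Omega : set 'rV[R]_n).
Hypotheses (oO' : open Omega') (oO : open Omega).
Local Notation X := (Omega' `*` Omega).
Context (K : set 'rV[R]_n) (cK : compact_in Omega K).

(** Translation invariance holds on the whole space only. Functions vanishing off the compact K
    extend by zero past the boundary of [Omega] without loss of regularity. *)
Definition ext (x : 'rV[R]_n') (g : Z -> R) (z : Y) : R :=
  if `[< Omega z.1 >] then g (x, z.1, z.2) else 0.

Definition yxi_dir (i : 'I_n + 'I_p) : Y := bprod std std i.

Definition zdir (i : 'I_n + 'I_p) : ('I_n' + 'I_n) + 'I_p :=
  match i with inl k => inl (inr k) | inr j => inr j end.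

Lemma ext_in x g z : Omega z.1 -> ext x g z = g (x, z.1, z.2).
Proof. by move=> Oz; rewrite /ext asboolT. Qed.

Lemma ext_out x g z : Omega' x -> (forall w, X w.1 -> ~ K w.1.2 -> g w = 0) ->
  ~ K z.1 -> ext x g z = 0.
Proof.
move=> Ox g0 Kz; rewrite /ext; case: asboolP => // Oz.
exact: (g0 (x, z.1, z.2)).
Qed.

Lemma open_off_KY : open [set z : Y | ~ K z.1].
Proof.
have cl : closed K by apply: compact_closed => //; case: cK.
rewrite (_ : mkset _ = (~` K) `*` setT).
  by apply: open_setX; [exact: closed_openC|exact: openT].
by apply/seteqP; split=> z //= [].
Qed.

Lemma open_OY : open [set z : Y | Omega z.1].
Proof.
rewrite (_ : mkset _ = Omega `*` setT); first by apply: open_setX => //; exact: openT.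
by apply/seteqP; split=> z //= [].
Qed.

Lemma derive_slice (g : Z -> R) x i (z : Y) :
  'D_(yxi_dir i) (fun z : Y => g (x, z.1, z.2)) z = 'D_(eZ (zdir i)) g (x, z.1, z.2) /\
  (derivable g (x, z.1, z.2) (eZ (zdir i)) ->
   derivable (fun z : Y => g (x, z.1, z.2)) z (yxi_dir i)).
Proof.
have F : (fun h : R => h^-1 *: (g (x, (h *: yxi_dir i + z).1, (h *: yxi_dir i + z).2) -
     g (x, z.1, z.2))) =
   (fun h : R => h^-1 *: (g (h *: (eZ (zdir i) : Z) + (x, z.1, z.2)) - g (x, z.1, z.2))).
  apply/funext => h; congr (_ *: (g _ - _)).
  have L (v1 : 'rV[R]_n) (v2 : 'rV[R]_p) : h *: (((0, v1), v2) : Z) + ((x, z.1), z.2) =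
      ((x, h *: v1 + z.1), h *: v2 + z.2).
    by rewrite -[LHS]/(((h *: 0 + x, h *: v1 + z.1), h *: v2 + z.2) : Z) scaler0 add0r.
  by case: i => k; exact: (esym (L _ _)).
Transparent derive.
by split=> [|dg]; rewrite /derive /derivable F.
Opaque derive.
Qed.

(** The open sets where y is in [Omega] and where y is not in K cover the space; near a point of the
    second kind the extension is 0. *)
Lemma derive_ext (g : Z -> R) x i (z : Y) : Omega' x ->
  (forall w, (X `*` setT) w -> derivable g w (eZ (zdir i))) ->
  (forall w, X w.1 -> ~ K w.1.2 -> g w = 0) ->
  derivable (ext x g) z (yxi_dir i) /\
  'D_(yxi_dir i) (ext x g) z = ext x ('D_(eZ (zdir i)) g) z.
Proof.
move=> Ox dg g0; have [Oz|Oz] := pselect (Omega z.1).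
  have N : \near z, ext x g z = g (x, z.1, z.2).
    by apply: (near_eq_on open_OY Oz) => y Oy; exact: ext_in.
  have [D1 D2] := derive_slice g x i z.
  have dz : derivable g (x, z.1, z.2) (eZ (zdir i)) by exact: dg.
  have N' : \near z, g (x, z.1, z.2) = ext x g z.
    by apply: (near_eq_on open_OY Oz) => y Oy; exact: (esym (ext_in _ _ Oy)).
  split; first exact: near_eq_derivable N' (D2 dz).
  by rewrite (near_eq_derive _ N) D1 ext_in.
have Kz : ~ K z.1 by move=> /cK.2.
have N : \near z, (fun=> 0 : R) z = ext x g z.
  by apply: (near_eq_on open_off_KY Kz) => y Ky; exact: (esym (ext_out Ox g0 Ky)).
have N' : \near z, ext x g z = (fun=> 0 : R) z.
  by apply: (near_eq_on open_off_KY Kz) => y Ky; exact: (ext_out Ox g0 Ky).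
split; first exact: near_eq_derivable N (derivable_cst _ _ _).
rewrite (near_eq_derive _ N') derive_cst /ext asboolF//.
Qed.

Lemma integral_ext x g : integral_yxi setT (fun y xi => ext x g (y, xi)) =
  integral_yxi Omega (fun y xi => g (x, y, xi)).
Proof.
rewrite /integral_yxi [RHS]Rintegral_mkcond.
rewrite (_ : [set t : n.-tuple (measurableTypeR R) * p.-tuple (measurableTypeR R) | setT (row_of_tuple t.1)] = setT)//.
Qed.

Lemma ext_continuous x g : Omega' x ->
  (forall w, (X `*` setT) w -> {for w, continuous g}) ->
  (forall w, X w.1 -> ~ K w.1.2 -> g w = 0) -> forall z, {for z, continuous (ext x g)}.
Proof.
move=> Ox cg g0 z; have [Oz|Oz] := pselect (Omega z.1).
  apply: (continuous_eq_on open_OY Oz (f := fun z => g (x, z.1, z.2))).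
    by move=> y Oy; rewrite ext_in.
  by apply: (@continuous_slice _ _ _ _ g x z); apply: cg.
have Kz : ~ K z.1 by move=> /cK.2.
apply: (continuous_eq_on open_off_KY Kz (f := fun=> 0 : R)); last exact: cst_continuous.
by move=> y Ky; rewrite (ext_out Ox g0 Ky).
Qed.

Lemma ext_bound x g (A mu : R) : Omega' x -> 0 <= A ->
  (forall w, X w.1 -> ~ K w.1.2 -> g w = 0) ->
  (forall y xi, K y -> `|g (x, y, xi)| <= A * japanese xi `^ mu) ->
  forall y xi, `|ext x g (y, xi)| <= A * japanese xi `^ mu.
Proof.
move=> Ox A0 g0 gA y xi; have [Ky|Ky] := pselect (K y).
  by rewrite ext_in ?gA//; exact: cK.2.
by rewrite (ext_out Ox g0)// normr0 mulr_ge0 ?powR_ge0.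
Qed.

Lemma ext_adm x g (A b mu : R) : Omega' x -> 0 <= A -> (forall y, K y -> `|y| <= b) ->
  (forall w, (X `*` setT) w -> {for w, continuous g}) ->
  (forall w, X w.1 -> ~ K w.1.2 -> g w = 0) ->
  (forall y xi, K y -> `|g (x, y, xi)| <= A * japanese xi `^ mu) ->
  adm setT b mu A (fun y xi => ext x g (y, xi)).
Proof.
move=> Ox A0 Kb cg g0 gA; split=> [[z1 z2] _|y xi _ yb|y xi _].
- rewrite (_ : (fun z => _) = ext x g); last by apply/funext => -[].
  exact: ext_continuous.
- by apply: (ext_out Ox g0) => /= /Kb; rewrite leNgt yb.
- exact: ext_bound.
Qed.

Lemma integral_slice_derive_eq0 (g : Z -> R) x i (A mu : R) : Omega' x ->
  mu < - p%:R -> 0 <= A ->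
  smooth_on eZ (X `*` setT) g -> (forall w, X w.1 -> ~ K w.1.2 -> g w = 0) ->
  (forall w, X w.1 -> ~ K w.1.2 -> 'D_(eZ (zdir i)) g w = 0) ->
  (forall w, X w.1 -> ~ K w.1.2 -> 'D_(eZ (zdir i)) ('D_(eZ (zdir i)) g) w = 0) ->
  (forall y xi, K y -> [/\ `|g (x, y, xi)| <= A * japanese xi `^ mu,
     `|'D_(eZ (zdir i)) g (x, y, xi)| <= A * japanese xi `^ mu &
     `|'D_(eZ (zdir i)) ('D_(eZ (zdir i)) g) (x, y, xi)| <= A * japanese xi `^ mu]) ->
  integral_yxi Omega (fun y xi => 'D_(eZ (zdir i)) g (x, y, xi)) = 0.
Proof.
move=> Ox hmu A0 sg g0 g1 g2 gA.
have [b Kb] := ysupp_radius cK.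
have sD := smooth_on_D (zdir i) sg; have sDD := smooth_on_D (zdir i) sD.
have d1 z := derive_ext (i := i) z Ox (fun w Dw => smooth_on_derivable sg Dw) g0.
have d2 z := derive_ext (i := i) z Ox (fun w Dw => smooth_on_derivable sD Dw) g1.
have E1 : 'D_(yxi_dir i) (ext x g) = ext x ('D_(eZ (zdir i)) g).
  by apply/funext => z; exact: (d1 z).2.
have dir m (k : 'I_m) : `|std k : 'rV[R]_m| <= 1 /\ enorm (std k : 'rV[R]_m) <= 1.
  split.
    rewrite [leLHS]mx_normrE; apply/bigmax_leP; split=> [|[a c] _ /=]; first exact: ler01.
    by rewrite mxE; case: (_ && _); rewrite ?normr1 ?normr0.
  rewrite -(@ler_pXn2r _ 2)// ?nnegrE ?enorm_ge0// enorm_sqr expr1n (bigD1 k)//=.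
  rewrite big1 ?addr0 ?mxE ?eqxx ?expr1n// => l lk.
  by rewrite mxE eqxx (negbTE lk) expr0n.
have [v1 v2] : `|(yxi_dir i).1| <= 1 /\ enorm (yxi_dir i).2 <= 1.
  by case: i {gA g2 g1 sD sDD d1 d2 E1} => k /=; rewrite ?normr0 ?enorm0 ?ler01;
    split=> //; have [] := dir _ k.
have a0 := ext_adm Ox A0 Kb (smooth_on_cont sg) g0 (fun y xi Ky => let: And3 h _ _ := gA y xi Ky in h).
have a1 := ext_adm Ox A0 Kb (smooth_on_cont sD) g1 (fun y xi Ky => let: And3 _ h _ := gA y xi Ky in h).
have d3 z : derivable ('D_(yxi_dir i) (ext x g)) z (yxi_dir i) by rewrite E1; exact: (d2 z).1.
have F1 : (fun y xi => ext x ('D_(eZ (zdir i)) g) (y, xi)) =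
    fun y xi => 'D_(yxi_dir i) (ext x g) (y, xi).
  by apply/funext => y; apply/funext => xi; exact: (esym (d1 (y, xi)).2).
have z2 y xi : b < `|y| -> 'D_(yxi_dir i) ('D_(yxi_dir i) (ext x g)) (y, xi) = 0.
  move=> yb; rewrite E1 (d2 (y, xi)).2.
  by apply: (ext_out Ox g2) => /= /Kb; rewrite leNgt yb.
have b2 y xi : `|'D_(yxi_dir i) ('D_(yxi_dir i) (ext x g)) (y, xi)| <= A * japanese xi `^ mu.
  rewrite E1 (d2 (y, xi)).2.
  by apply: (ext_bound Ox A0 g2) => y' xi' Ky; have [_ _] := gA y' xi' Ky.
rewrite -(integral_ext x ('D_(eZ (zdir i)) g)) F1; rewrite F1 in a1.
exact: (@integral_derive_eq0 R n p (yxi_dir i) b mu A (ext x g) hmu A0 v1 v2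
  (fun z => (d1 z).1) d3 a0 a1 z2 b2).
Qed.

End IntegrationByParts.

(** * Additivity of the parametric integral *)

Section XIntAdditive.
Context {R : realType} {n' n p : nat}.
Local Notation C := R[i].
Local Notation Z := ('rV[R]_n' * 'rV[R]_n * 'rV[R]_p)%type.
Context (Omega' : set 'rV[R]_n') (Omega : set 'rV[R]_n).
Hypotheses (oO' : open Omega') (oO : open Omega).
Local Notation X := (Omega' `*` Omega).
Local Notation cRe := (@complex.Re _).
Local Notation cIm := (@complex.Im _).
Context {E : Type} (eps : E -> R) (K : set 'rV[R]_n) (cK : compact_in Omega K).
Implicit Types P Q : E -> Z -> C.

(** Continuity is asked rather than smoothness: the product of e^{i phi} with a symbol need not be
    smooth at xi = 0. *)
Definition xadm mu P := [/\ forall e w, (X `*` setT) w ->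
    {for w, continuous (cRe \o P e)} /\ {for w, continuous (cIm \o P e)},
  ysupp Omega' Omega K P & bound eps (cylinders Omega' Omega setT) jap mu P P].

Lemma compact_in_point x : Omega' x -> compact_in X ([set x] `*` K).
Proof.
move=> Ox; split; first by apply: compact_setX; [exact: compact_set1|case: cK].
by move=> z [/= -> k2]; split=> //; exact: cK.2.
Qed.

Lemma xadm_adm mu P e x : xadm mu P -> Omega' x -> exists b A, [/\ 0 <= A,
  (forall b', b <= b' -> adm Omega b' mu A (fun y xi => cRe (P e (x, y, xi)))) &
  (forall b', b <= b' -> adm Omega b' mu A (fun y xi => cIm (P e (x, y, xi))))].
Proof.
move=> [cP zP bP] Ox; have [b Kb] := ysupp_radius cK.
have [|A [B [tA rB H]]] := bP (([set x] `*` K) `*` setT).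
  by exists ([set x] `*` K) => //; exact: compact_in_point.
have A0 := tA.1 (eps e).
have HK y xi : K y -> normc (P e (x, y, xi)) <= A (eps e) * japanese xi `^ mu.
  by move=> Ky; have [] := H e (x, y, xi).
exists b, (A (eps e)); split=> // b' bb'.
  apply: (adm_slice (K := K) (b := b') (g := cRe \o P e) Ox (fun w Dw => (cP e w Dw).1) _ _ A0).
  - by move=> w Xw Kw; exact: (congr1 cRe (zP e w Xw Kw)).
  - by move=> y Ky; exact: le_trans (Kb y Ky) bb'.
  - by move=> y xi Ky; exact: le_trans (normc_Re _) (HK y xi Ky).
apply: (adm_slice (K := K) (b := b') (g := cIm \o P e) Ox (fun w Dw => (cP e w Dw).2) _ _ A0).
- by move=> w Xw Kw; exact: (congr1 cIm (zP e w Xw Kw)).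
- by move=> y Ky; exact: le_trans (Kb y Ky) bb'.
- by move=> y xi Ky; exact: le_trans (normc_Im _) (HK y xi Ky).
Qed.

Lemma xintD mu P Q e x : xadm mu P -> xadm mu Q -> mu < - p%:R -> Omega' x ->
  xint Omega (fun e w => P e w + Q e w) e x = xint Omega P e x + xint Omega Q e x.
Proof.
move=> aP aQ hmu Ox.
have [b [A [A0 R1 I1]]] := xadm_adm e aP Ox.
have [b' [B [B0 R2 I2]]] := xadm_adm e aQ Ox.
have l1 : b <= Num.max b b' by rewrite le_max lexx.
have l2 : b' <= Num.max b b' by rewrite le_max lexx orbT.
apply: complex_eq.
  rewrite ReD /= -(integral_yxiD oO hmu A0 B0 (R1 _ l1) (R2 _ l2)).
  by apply: eq_integral_yxi => y xi _; rewrite ReD.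
rewrite ImD /= -(integral_yxiD oO hmu A0 B0 (I1 _ l1) (I2 _ l2)).
by apply: eq_integral_yxi => y xi _; rewrite ImD.
Qed.

Lemma xint_eq P Q e x : (forall y xi, Omega y -> P e (x, y, xi) = Q e (x, y, xi)) ->
  xint Omega P e x = xint Omega Q e x.
Proof. by move=> PQ; apply: complex_eq; apply: eq_integral_yxi => y xi Oy; rewrite PQ. Qed.

Lemma xint0 e x : xint Omega (fun (_ : E) (_ : Z) => 0) e x = 0.
Proof.
have Z0 : integral_yxi Omega (fun (_ : 'rV[R]_n) (_ : 'rV[R]_p) => 0) = 0 :> R.
  by rewrite /integral_yxi /Rintegral integral0.
by apply: complex_eq; exact: Z0.
Qed.

Lemma continuous_csmooth (V : normedModType R) (I : Type) (e_ : I -> V) (D : set V) (f : V -> C) w :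
  csmooth_on e_ D f -> D w -> {for w, continuous (cRe \o f)} /\ {for w, continuous (cIm \o f)}.
Proof. by move=> [h1 h2] Dw; split; [exact: (smooth_on_cont h1 Dw)|exact: (smooth_on_cont h2 Dw)]. Qed.

Lemma xadm_sum (T : Type) (r : seq T) mu (F : T -> E -> Z -> C) :
  (forall j, xadm mu (F j)) -> (forall j, nsmooth eZ (X `*` setT) (F j)) ->
  xadm mu (fun e w => \sum_(j <- r) F j e w).
Proof.
have oT := @oXT R n' n p Omega' Omega oO' oO.
move=> aF sF; split.
- move=> e w Dw; exact: (continuous_csmooth (nsmooth_sum oT r sF e) Dw).
- by move=> e w Xw Kw; rewrite big1// => j _; have [_ z _] := aF j; exact: z.
elim: r => [|j r IH].
  have -> : (fun e w => \sum_(j <- [::]) F j e w) = fun (_ : E) (_ : Z) => 0 :> C.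
    by apply/funext => e; apply/funext => w; rewrite big_nil.
  move=> S _; exists (fun=> 0), (fun=> 0); split; [exact: (tempered_cst (lexx 0))|exact: rapid0|].
  by move=> e w _; rewrite subrr normc0 mul0r.
have -> : (fun e w => \sum_(j <- j :: r) F j e w) =
    fun e w => F j e w + \sum_(j <- r) F j e w.
  by apply/funext => e; apply/funext => w; rewrite big_cons.
by apply: bound_add => //; have [] := aF j.
Qed.

Lemma xint_sum0 (T : Type) (r : seq T) mu (F : T -> E -> Z -> C) e x :
  mu < - p%:R -> Omega' x ->
  (forall j, xadm mu (F j)) -> (forall j, nsmooth eZ (X `*` setT) (F j)) ->
  (forall j, xint Omega (F j) e x = 0) ->
  xint Omega (fun e w => \sum_(j <- r) F j e w) e x = 0.
Proof.
move=> hmu Ox aF sF F0; elim: r => [|j r IH].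
  by rewrite -[RHS](xint0 e x); apply: xint_eq => y xi _; rewrite big_nil.
have S := xintD e (aF j) (xadm_sum r aF sF) hmu Ox; rewrite (F0 j) IH addr0 in S.
by rewrite -[RHS]S; apply: xint_eq => y xi _; rewrite big_cons.
Qed.

End XIntAdditive.

Lemma sum_split3 {R : realType} m (A B D : 'I_m -> R[i]) (a b : R[i]) :
  \sum_j (A j * a * b + B j * b + D j * (a * b)) =
  (\sum_j A j) * a * b + (\sum_j B j) * b + (\sum_j D j) * (a * b).
Proof. by rewrite !mulr_suml -!big_split. Qed.

(** * The transposed identity under the integral *)

Section NetIntegrationByParts.
Context {R : realType} {n' n p : nat}.
Local Notation C := R[i].
Local Notation Z := ('rV[R]_n' * 'rV[R]_n * 'rV[R]_p)%type.
Context (Omega' : set 'rV[R]_n') (Omega : set 'rV[R]_n).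
Hypotheses (oO' : open Omega') (oO : open Omega).
Local Notation X := (Omega' `*` Omega).
Local Notation cRe := (@complex.Re _).
Local Notation cIm := (@complex.Im _).
Local Notation N0 := [set xi : 'rV[R]_p | xi != 0].
Local Notation U1 := [set xi : 'rV[R]_p | 8^-1 < enorm xi].
Local Notation U0 := [set xi : 'rV[R]_p | enorm xi < 4^-1].
Local Notation cls rho delta U := (same_class (@epsval R) (@eZ R n' n p)
  (fullwt rho delta) (X `*` U) (cylinders Omega' Omega U) jap).
Local Notation xadm := (xadm Omega' Omega (@epsval R)).
Context (K : set 'rV[R]_n) (cK : compact_in Omega K).

Let o1 := @oU1 R n' n p Omega' Omega oO' oO.
Let oT := @oXT R n' n p Omega' Omega oO' oO.
Let KD1 := @cylinders_sub R n' n p Omega' Omega U1.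
Let KDT := @cylinders_sub R n' n p Omega' Omega setT.
Let J1 : forall w : Z, (X `*` U1) w -> 1 <= jap w. Proof. by move=> w _; exact: jap_ge1. Qed.
Let JT : forall w : Z, (X `*` setT) w -> 1 <= jap w. Proof. by move=> w _; exact: jap_ge1. Qed.

Lemma ysupp_cderiv E (P : E -> Z -> C) v : ysupp Omega' Omega K P ->
  ysupp Omega' Omega K (fun e => cderiv v (P e)).
Proof.
move=> sP e w Xw Kw.
rewrite (@cderiv_eq _ _ [set w : Z | X w.1 /\ ~ K w.1.2] _ (fun=> 0) _ _ (open_off_K oO' oO cK)).
- exact: cderiv_cst.
- by move=> w' [Xw' Kw']; exact: sP.
- by [].
Qed.

Lemma class_xadm mu nu (Psi : @epsdom R -> Z -> C) : cls 0 1 setT mu Psi Psi ->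
  ysupp Omega' Omega K Psi -> mu <= nu -> xadm K nu Psi.
Proof.
move=> c zP mn; have [sP _ r] := class_mono KDT JT mn c; split=> //.
  by move=> e w Dw; exact: (continuous_csmooth (sP e) Dw).
exact: (rel_bound (r 0%N)).
Qed.

(** The type is (0, 1) because of the factor e^{i phi}: a y-derivative may raise the order by 1, a
    xi-derivative gains nothing. Two derivatives enter through the Taylor remainder. *)
Lemma xint_div_eq0 mu (Psi : @epsdom R -> Z -> C) i e x : cls 0 1 setT mu Psi Psi ->
  ysupp Omega' Omega K Psi ->
  mu + fullwt 0 1 (@zdir n' n p i) + fullwt 0 1 (@zdir n' n p i) < - p%:R -> Omega' x ->
  xint Omega (fun e => cderiv (eZ (@zdir n' n p i)) (Psi e)) e x = 0.
Proof.
move=> c zP; set d := fullwt 0 1 (@zdir n' n p i) => hmu Ox.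
have d0 : 0 <= d by rewrite /d; case: (i) => k /=; rewrite ?oppr0 ?ler01.
set nu := mu + d + d in hmu *.
have cD := class_D (@zdir n' n p i) c; have cDD := class_D (@zdir n' n p i) cD.
have zD := ysupp_cderiv (eZ (@zdir n' n p i)) zP; have zDD := ysupp_cderiv (eZ (@zdir n' n p i)) zD.
have [sP _ _] := c.
have l1 : mu <= nu by rewrite /nu; lra.
have l2 : mu + d <= nu by rewrite /nu; lra.
have CY : cylinders Omega' Omega [set: 'rV[R]_p] (([set x] `*` K) `*` setT).
  by exists ([set x] `*` K) => //; exact: compact_in_point.
have [_ _ r0] := class_mono KDT JT l1 c; have [A0 [B0 [t0 _ H0]]] := rel_bound (r0 0%N) CY.
have [_ _ r1] := class_mono KDT JT l2 cD; have [A1 [B1 [t1 _ H1]]] := rel_bound (r1 0%N) CY.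
have [_ _ r2] := cDD; have [A2 [B2 [t2 _ H2]]] := rel_bound (r2 0%N) CY.
pose A := A0 (epsval e) + A1 (epsval e) + A2 (epsval e).
have [a0 a1 a2] : [/\ 0 <= A0 (epsval e), 0 <= A1 (epsval e) & 0 <= A2 (epsval e)].
  by split; [exact: t0.1|exact: t1.1|exact: t2.1].
have Age : 0 <= A by rewrite /A; lra.
have up y xi : K y -> [/\ normc (Psi e (x, y, xi)) <= A * japanese xi `^ nu,
    normc (cderiv (eZ (@zdir n' n p i)) (Psi e) (x, y, xi)) <= A * japanese xi `^ nu &
    normc (cderiv (eZ (@zdir n' n p i)) (cderiv (eZ (@zdir n' n p i)) (Psi e)) (x, y, xi)) <=
      A * japanese xi `^ nu].
  move=> Ky; have D1 : (([set x] `*` K) `*` [set: 'rV[R]_p]) (x, y, xi) by [].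
  have J0 := powR_ge0 (japanese xi) nu.
  have [h0 _ _] := H0 e _ D1; have [h1 _ _] := H1 e _ D1; have [h2 _ _] := H2 e _ D1.
  have le3 a : a <= A -> a * japanese xi `^ nu <= A * japanese xi `^ nu.
    by move=> aA; rewrite ler_wpM2r.
  by split; [apply: (le_trans h0)|apply: (le_trans h1)|apply: (le_trans h2)];
     apply: le3; rewrite /A; lra.
apply: complex_eq.
  apply: (@integral_slice_derive_eq0 R n' n p Omega' Omega oO K cK (cRe \o Psi e) x i A nu
    Ox hmu Age (sP e).1 (fun w Xw Kw => congr1 cRe (zP e w Xw Kw))
    (fun w Xw Kw => congr1 cRe (zD e w Xw Kw)) (fun w Xw Kw => congr1 cRe (zDD e w Xw Kw))).
  move=> y xi Ky; have [h0 h1 h2] := up y xi Ky.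
  exact: (And3 (le_trans (normc_Re _) h0) (le_trans (normc_Re _) h1) (le_trans (normc_Re _) h2)).
apply: (@integral_slice_derive_eq0 R n' n p Omega' Omega oO K cK (cIm \o Psi e) x i A nu
  Ox hmu Age (sP e).2 (fun w Xw Kw => congr1 cIm (zP e w Xw Kw))
  (fun w Xw Kw => congr1 cIm (zD e w Xw Kw)) (fun w Xw Kw => congr1 cIm (zDD e w Xw Kw))).
move=> y xi Ky; have [h0 h1 h2] := up y xi Ky.
exact: (And3 (le_trans (normc_Im _) h0) (le_trans (normc_Im _) h1) (le_trans (normc_Im _) h2)).
Qed.

Section Identity.
Context (chi : 'rV[R]_p -> C) (hchi : cutoff chi).
Context (phi : R -> Z -> R) (mphi : M_Phi Omega' Omega phi).
Hypothesis r1 : cls 1 0 U1 1 (restr (cnet phi)) (restr (cnet phi)).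

Let sLa j (e : epsdom) : csmooth_on eZ (X `*` setT) (La chi (phi (epsval e)) j).
Proof. exact: (let: And3 h _ _ := class_La oO' oO hchi mphi mphi r1 j in h e). Qed.

Let sLb k (e : epsdom) : csmooth_on eZ (X `*` setT) (Lb chi (phi (epsval e)) k).
Proof. exact: (let: And3 h _ _ := class_Lb oO' oO hchi mphi mphi r1 k in h e). Qed.

(** The squared imaginary unit gives the sign, and [varphi] is exactly the inverse of the weighted
    sum of squares that appears. *)
Lemma La_grad (e : epsdom) w : (X `*` N0) w ->
  \sum_j La chi (phi (epsval e)) j w * (Complex 0 1 * ('D_(exi j) (phi (epsval e)) w)%:C%C) +
  \sum_k Lb chi (phi (epsval e)) k w * (Complex 0 1 * ('D_(ey k) (phi (epsval e)) w)%:C%C) =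
  chi w.2 - 1.
Proof.
move=> Dw; set g := phi (epsval e).
have ii : Complex 0 1 * Complex 0 1 = -1 :> C.
  by apply: complex_eq; rewrite ?ReM ?ImM ?ReN ?ImN /=; ring.
have Ea j : La chi g j w * (Complex 0 1 * ('D_(exi j) g w)%:C%C) =
    (chi w.2 - 1) * (varphi g w * ('D_(exi j) g w * 'D_(exi j) g w))%:C%C.
  rewrite /La !realCM; move: ('D_(exi j) g w)%:C%C (varphi g w)%:C%C (chi w.2) => a b c.
  have -> : Complex 0 1 * (1 - c) * (b * a) * (Complex 0 1 * a) =
    (Complex 0 1 * Complex 0 1) * ((1 - c) * (b * (a * a))) by ring.
  by rewrite ii; ring.
have Eb k : Lb chi g k w * (Complex 0 1 * ('D_(ey k) g w)%:C%C) =
    (chi w.2 - 1) * (varphi g w * ((enorm2 w)^-1 * ('D_(ey k) g w * 'D_(ey k) g w)))%:C%C.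
  rewrite /Lb enorm2E !realCM.
  move: ('D_(ey k) g w)%:C%C (varphi g w)%:C%C (chi w.2) ((enorm w.2 ^+ 2)^-1)%:C%C => a b c d.
  have -> : Complex 0 1 * (1 - c) * (d * b * a) * (Complex 0 1 * a) =
    (Complex 0 1 * Complex 0 1) * ((1 - c) * (b * (d * (a * a)))) by ring.
  by rewrite ii; ring.
rewrite (eq_bigr _ (fun j _ => Ea j)) (eq_bigr _ (fun k _ => Eb k)).
rewrite -!mulr_sumr -mulrDr -!realC_sum -realCD -!mulr_sumr -mulrDr.
have V := varphiE oO' oO e mphi Dw; rewrite -/g in V.
have R0 : \sum_(j < p) 'D_(exi j) g w * 'D_(exi j) g w +
    (enorm2 w)^-1 * (\sum_(k < n) 'D_(ey k) g w * 'D_(ey k) g w) = rescaled_grad g w.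
  by rewrite addrC.
rewrite V R0 mulVf; first exact: mulr1.
exact: (lt0r_neq0 (rescaled_grad_gt0 oO' oO mphi (epsval01 e) Dw)).
Qed.

(** Expanding the divergence of (a, b) f e^{i phi} produces L f - chi f and, by [La_grad], the term
    (chi - 1) f, all times e^{i phi}. For |xi| <= 1/8, where the phase may not be differentiable, a
    and b vanish nearby and chi = 1, so both sides reduce to e^{i phi} f. *)
Lemma L_divergence (e : epsdom) (f : Z -> C) w : csmooth_on eZ (X `*` setT) f ->
  (X `*` setT) w -> let g := phi (epsval e) in
  expi (g w) * L chi g f w = expi (g w) * f w +
   (\sum_j cderiv (exi j) (fun w => La chi g j w * f w * expi (g w)) w +
    \sum_k cderiv (ey k) (fun w => Lb chi g k w * f w * expi (g w)) w).
Proof.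
move=> sf Dw g.
have oU0 : open (X `*` U0) by apply: open_domain => //; exact: open_enorm_lt.
case: (ltP (8^-1) (enorm w.2)) => hw; last first.
  have D0 : (X `*` U0) w.
    split; first by case: Dw.
    by rewrite /=; apply: (le_lt_trans hw); rewrite ltf_pV2 ?posrE ?ltr_nat.
  have za j w' : (X `*` U0) w' -> La chi g j w' = 0.
    by move=> [_ h]; rewrite /La; case: hchi => _ -> // _; rewrite subrr mulr0 mul0r.
  have zb k w' : (X `*` U0) w' -> Lb chi g k w' = 0.
    by move=> [_ h]; rewrite /Lb; case: hchi => _ -> // _; rewrite subrr mulr0 mul0r.
  have c1 : chi w.2 = 1 by case: hchi => _ h _; apply: h; case: D0.
  have da j : cderiv (exi j) (La chi g j) w = 0.
    by rewrite (cderiv_eq (g := fun=> 0) _ oU0 (za j) D0) cderiv_cst.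
  have db k : cderiv (ey k) (Lb chi g k) w = 0.
    by rewrite (cderiv_eq (g := fun=> 0) _ oU0 (zb k) D0) cderiv_cst.
  have pa j : cderiv (exi j) (fun w => La chi g j w * f w * expi (g w)) w = 0.
    rewrite (cderiv_eq (g := fun=> 0) _ oU0 _ D0) ?cderiv_cst// => w' Dw'.
    by rewrite za// !mul0r.
  have pb k : cderiv (ey k) (fun w => Lb chi g k w * f w * expi (g w)) w = 0.
    rewrite (cderiv_eq (g := fun=> 0) _ oU0 _ D0) ?cderiv_cst// => w' Dw'.
    by rewrite zb// !mul0r.
  rewrite (eq_bigr _ (fun j _ => pa j)) (eq_bigr _ (fun k _ => pb k)) !big1_eq !addr0.
  rewrite /L /Lc (eq_bigr _ (fun j _ => da j)) (eq_bigr _ (fun k _ => db k)) !big1_eq !addr0.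
  rewrite c1 mul1r (eq_bigr (fun=> 0)); last by move=> j _; rewrite za ?mul0r.
  rewrite (eq_bigr (fun=> 0) (F1 := fun k => Lb chi g k w * _)); last by move=> k _; rewrite zb ?mul0r.
  by rewrite !big1_eq !add0r.
have D1 : (X `*` U1) w by split=> //; case: Dw.
have DN : (X `*` N0) w by exact: (@sub_U1 R n' n p Omega' Omega).
have sg : smooth_on eZ (X `*` N0) g by exact: (M_Phi_smooth mphi (epsval01 e)).
have oN := @open_XN0 R n' n p Omega' Omega oO' oO.
have dg i : derivable g w (eZ i) by exact: (smooth_on_derivable sg DN).
have dE i : cderivable (fun w => expi (g w)) w (eZ i).
  exact: (csmooth_cderivable i (csmooth_on_expi oN sg) DN).
have df i : cderivable f w (eZ i) by exact: (csmooth_cderivable i sf Dw).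
have prod (c : Z -> C) i : csmooth_on eZ (X `*` setT) c ->
   cderiv (eZ i) (fun w => c w * f w * expi (g w)) w =
   cderiv (eZ i) c w * f w * expi (g w) + c w * cderiv (eZ i) f w * expi (g w) +
   c w * (Complex 0 1 * ('D_(eZ i) g w)%:C%C) * (f w * expi (g w)).
  move=> sc; have dc := csmooth_cderivable i sc Dw.
  have dcf := csmooth_cderivable i (csmooth_on_mul oT sc sf) Dw.
  rewrite (cderivM dcf (dE i)) (cderivM dc (df i)) (cderiv_expi (dg i)).
  move: (cderiv _ c w) (cderiv _ f w) (c w) (f w) (expi _) ('D_(eZ i) g w)%:C%C => a1 a2 a3 a4 a5 a6.
  by ring.
have gr := La_grad e DN; rewrite -/g in gr.
rewrite (eq_bigr _ (fun j _ => prod (La chi g j) (inr j) (sLa j e))).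
rewrite (eq_bigr _ (fun k _ => prod (Lb chi g k) (inl (inr k)) (sLb k e))).
rewrite !sum_split3.
rewrite /L /Lc.
match goal with |- _ = _ + (_ + _ + ?t1 * _ + (_ + _ + ?t2 * _)) =>
  have {gr} : t1 + t2 = chi w.2 - 1 by [exact: gr]; generalize t1 t2 => T1 T2 end.
set S1 := \sum_(j < p) _; set S2 := \sum_(j < n) _; set S3 := \sum_(j < p) _; set S4 := \sum_(j < n) _.
move: S1 S2 S3 S4 (f w) (expi _) (chi w.2) => S1 S2 S3 S4 a b c gr.
have -> : T2 = c - 1 - T1 by rewrite -gr addrC addKr.
by ring.
Qed.

Hypothesis xphi : nsmooth (@xdir R n' n p) (X `*` setT) (restr (cnet phi)).

(** In type (0, 1) a derivative costs 1 in z and 0 in xi, which are precisely the orders of the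
    derivatives of the phase. *)
Lemma class_expi : cls 0 1 U1 0 (fun e w => expi (phi (epsval e) w))
  (fun e w => expi (phi (epsval e) w)).
Proof.
have sg (e : epsdom) : smooth_on eZ (X `*` U1) (phi (epsval e)).
  by apply: (smooth_on_sub (@sub_U1 R n' n p Omega' Omega)); exact: (M_Phi_smooth mphi (epsval01 e)).
split; [exact: nsmooth_expi|exact: nsmooth_expi|move=> k].
apply: (rel_expi o1 KD1 J1 (lexx 0) sg sg) => [K' _|i].
  by exists (fun=> 0); [exact: rapid0|move=> e w _; rewrite subrr normr0 mul0r].
have le : 1 + fullwt 1 0 i <= fullwt 0 1 i :> R by case: (i) => j /=; lra.
have [_ _ r] := class_mono KD1 J1 le
  (class_weaken oO' oO ler01 ler01 (@open_enorm_gt R p 8^-1) (class_gradient oO' oO r1 i)).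
exact: r.
Qed.

(** The condition mu + 1 < - p is set by the y-terms: b_k lowers the order by 1, and two
    y-derivatives of the product with e^{i phi} raise it by 2. This accounts for the summand 1 in
    the condition on h. *)
Lemma xint_L mu (f : @epsdom R -> Z -> C) e x rho delta :
  0 < rho <= 1 -> 0 <= delta < 1 ->
  cls rho delta setT mu f f -> ysupp Omega' Omega K f -> mu + 1 < - p%:R -> Omega' x ->
  xint Omega (fun e w => expi (phi (epsval e) w) * L chi (phi (epsval e)) (f e) w) e x =
  xint Omega (fun e w => expi (phi (epsval e) w) * f e w) e x.
Proof.
move=> /andP[rho0 rho1] /andP[delta0 delta1] cf zf hmu Ox.
have {}cf : cls 0 1 setT mu f f.
  exact: (class_weaken oO' oO (ltW rho0) (ltW delta1) openT cf).
have [sf _ rf] := cf.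
have c01 : open U1 by exact: open_enorm_gt.
have cf1 := class_shrink oO' oO openT (@subsetT _ U1) cf.
pose Pa j (e : @epsdom R) w := La chi (phi (epsval e)) j w * f e w * expi (phi (epsval e) w).
pose Pb k (e : @epsdom R) w := Lb chi (phi (epsval e)) k w * f e w * expi (phi (epsval e) w).
have za j (e' : epsdom) w : (X `*` U0) w -> Pa j e' w = 0.
  by move=> [_ h]; rewrite /Pa /La; case: hchi => _ -> // _; rewrite subrr mulr0 !mul0r.
have zb k (e' : epsdom) w : (X `*` U0) w -> Pb k e' w = 0.
  by move=> [_ h]; rewrite /Pb /Lb; case: hchi => _ -> // _; rewrite subrr mulr0 !mul0r.
have ca j : cls 0 1 setT mu (Pa j) (Pa j).
  apply: (class_extend oO' oO (za j) (za j)).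
  have := class_mul o1 KD1 J1 (class_mul o1 KD1 J1 (class_weaken oO' oO ler01 ler01 c01
    (class_shrink oO' oO openT (@subsetT _ U1) (class_La oO' oO hchi mphi mphi r1 j))) cf1) class_expi.
  by rewrite add0r addr0.
have cb k : cls 0 1 setT (-1 + mu) (Pb k) (Pb k).
  apply: (class_extend oO' oO (zb k) (zb k)).
  have := class_mul o1 KD1 J1 (class_mul o1 KD1 J1 (class_weaken oO' oO ler01 ler01 c01
    (class_shrink oO' oO openT (@subsetT _ U1) (class_Lb oO' oO hchi mphi mphi r1 k))) cf1) class_expi.
  by rewrite addr0.
have ya j : ysupp Omega' Omega K (Pa j).
  by move=> e' w Xw Kw; rewrite /Pa (zf e' w Xw Kw) mulr0 mul0r.
have yb k : ysupp Omega' Omega K (Pb k).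
  by move=> e' w Xw Kw; rewrite /Pb (zf e' w Xw Kw) mulr0 mul0r.
pose Fa j (e : @epsdom R) := cderiv (exi j) (Pa j e).
pose Fb k (e : @epsdom R) := cderiv (ey k) (Pb k e).
have cFa j : cls 0 1 setT (mu + fullwt 0 1 (inr j)) (Fa j) (Fa j) := class_D (inr j) (ca j).
have cFb k : cls 0 1 setT (-1 + mu + fullwt 0 1 (inl (inr k))) (Fb k) (Fb k) :=
  class_D (inl (inr k)) (cb k).
have aFa j : xadm K (mu + 1) (Fa j).
  by apply: (class_xadm (cFa j) (ysupp_cderiv _ (ya j))); rewrite /=; lra.
have aFb k : xadm K (mu + 1) (Fb k).
  by apply: (class_xadm (cFb k) (ysupp_cderiv _ (yb k))); rewrite /=; lra.
have sFa j : nsmooth eZ (X `*` setT) (Fa j) by exact: (let: And3 h _ _ := cFa j in h).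
have sFb k : nsmooth eZ (X `*` setT) (Fb k) by exact: (let: And3 h _ _ := cFb k in h).
have Ia j : xint Omega (Fa j) e x = 0.
  by apply: (xint_div_eq0 (i := inr j) e (ca j) (ya j) _ Ox); rewrite /=; lra.
have Ib k : xint Omega (Fb k) e x = 0.
  by apply: (xint_div_eq0 (i := inl k) e (cb k) (yb k) _ Ox); rewrite /=; lra.
have aP : xadm K (mu + 1) (fun e w => expi (phi (epsval e) w) * f e w).
  split.
  - move=> e' w Dw.
    have sE := csmooth_on_expi oT ((xphi e').1 : smooth_on xdir (X `*` setT) (phi (epsval e'))).
    have sfx : csmooth_on (@xdir R n' n p) (X `*` setT) (f e').
      by have [h1 h2] := sf e'; split; [exact: (@smooth_on_reindex _ _ _ _ eZ (inl \o inl) _ _ h1)|exact: (@smooth_on_reindex _ _ _ _ eZ (inl \o inl) _ _ h2)].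
    exact: (continuous_csmooth (csmooth_on_mul oT sE sfx) Dw).
  - by move=> e' w Xw Kw; rewrite (zf e' w Xw Kw) mulr0.
  have l : mu <= mu + 1 by lra.
  have [_ _ r] := class_mono KDT JT l cf.
  move=> K' KK; have [A [B [tA rB H]]] := rel_bound (r 0%N) KK.
  exists A, (fun=> 0); split=> //; first exact: rapid0.
  move=> e' w Kw; have [h _ _] := H e' w Kw.
  have -> : normc (expi (phi (epsval e') w) * f e' w) = normc (f e' w).
    by rewrite normcM normc_expi mul1r.
  by split=> //; rewrite subrr normc0 mul0r.
have aA := xadm_sum oO' oO (index_enum 'I_p) aFa sFa.
have aB := xadm_sum oO' oO (index_enum 'I_n) aFb sFb.
have aAB : xadm K (mu + 1) (fun e w => \sum_j Fa j e w + \sum_k Fb k e w).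
  split.
  - by move=> e' w Dw; exact: (continuous_csmooth (nsmooth_add oT (nsmooth_sum oT _ sFa)
      (nsmooth_sum oT _ sFb) e') Dw).
  - by move=> e' w Xw Kw; have [_ -> // _] := aA; have [_ -> // _] := aB; rewrite addr0.
  by have [_ _ b1] := aA; have [_ _ b2] := aB; exact: bound_add.
rewrite -[RHS]addr0.
have I0 : xint Omega (fun e w => \sum_j Fa j e w + \sum_k Fb k e w) e x = 0.
  rewrite (xintD oO cK e aA aB hmu Ox).
  rewrite (xint_sum0 oO' oO cK _ hmu Ox aFa sFa Ia) (xint_sum0 oO' oO cK _ hmu Ox aFb sFb Ib).
  exact: addr0.
rewrite -I0 -(xintD oO cK e aP aAB hmu Ox).
apply: xint_eq => y xi Oy.
by rewrite (L_divergence e (sf e)).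
Qed.

End Identity.

End NetIntegrationByParts.

(** * Locality and linearity of L *)

Section Operator.
Context {R : realType} {n' n p : nat}.
Local Notation C := R[i].
Local Notation Z := ('rV[R]_n' * 'rV[R]_n * 'rV[R]_p)%type.

Lemma L_eq (chi : 'rV[R]_p -> C) (g : Z -> R) (D : set Z) f f' : open D ->
  (forall w, D w -> f w = f' w) -> forall w, D w -> L chi g f w = L chi g f' w.
Proof.
move=> oD ff w Dw; have d v := cderiv_eq v oD ff Dw.
rewrite /L (ff w Dw) (eq_bigr _ (fun j _ => congr1 (fun z => La chi g j w * z) (d (exi j)))).
by rewrite (eq_bigr _ (fun k _ => congr1 (fun z => Lb chi g k w * z) (d (ey k)))).
Qed.

Lemma csmooth_lin (V : normedModType R) (I : Type) (e : I -> V) (D : set V) (l : C) f f' :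
  open D -> csmooth_on e D f -> csmooth_on e D f' -> csmooth_on e D (fun w => l * f w + f' w).
Proof.
move=> oD sf sf'; exact: (csmooth_on_add oD (csmooth_on_mul oD (csmooth_on_cst e D l) sf) sf').
Qed.

Lemma cderiv_lin (V : normedModType R) (I : Type) (e : I -> V) (D : set V) (l : C) f f' i w :
  open D -> csmooth_on e D f -> csmooth_on e D f' -> D w ->
  cderiv (e i) (fun w => l * f w + f' w) w = l * cderiv (e i) f w + cderiv (e i) f' w.
Proof.
move=> oD sf sf' Dw; have sl := csmooth_on_cst e D l.
have dl := csmooth_cderivable i sl Dw; have df := csmooth_cderivable i sf Dw.
have dlf := csmooth_cderivable i (csmooth_on_mul oD sl sf) Dw.
have df' := csmooth_cderivable i sf' Dw.
by rewrite (cderivD dlf df') (cderivM dl df) cderiv_cst mul0r add0r.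
Qed.

Lemma cword_lin (V : normedModType R) (I : Type) (e : I -> V) (D : set V) (l : C) f f' s :
  open D -> csmooth_on e D f -> csmooth_on e D f' -> forall w, D w ->
  cword_deriv e s (fun w => l * f w + f' w) w = l * cword_deriv e s f w + cword_deriv e s f' w.
Proof.
move=> oD sf sf'; elim: s => [//|i s IH] w Dw /=.
rewrite (cderiv_eq _ oD IH Dw).
exact: (cderiv_lin l i oD (csmooth_on_word s sf) (csmooth_on_word s sf') Dw).
Qed.

Lemma L_lin (chi : 'rV[R]_p -> C) (g : Z -> R) (D : set Z) (l : C) f f' : open D ->
  csmooth_on eZ D f -> csmooth_on eZ D f' -> forall w, D w ->
  L chi g (fun w => l * f w + f' w) w = l * L chi g f w + L chi g f' w.
Proof.
move=> oD sf sf' w Dw; have d i := cderiv_lin l i oD sf sf' Dw.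
have S m (A : 'I_m -> C) (B B' : 'I_m -> C) : \sum_j A j * (l * B j + B' j) =
    l * (\sum_j A j * B j) + \sum_j A j * B' j.
  by rewrite mulr_sumr -big_split; apply: eq_bigr => j _ /=; ring.
rewrite /L (eq_bigr _ (fun j _ => congr1 (fun z => La chi g j w * z) (d (inr j)))) S.
rewrite (eq_bigr _ (fun k _ => congr1 (fun z => Lb chi g k w * z) (d (inl (inr k))))) S.
move: (\sum_j _) (\sum_j _) (\sum_j _) (\sum_j _) (Lc _ _ _) (f w) (f' w) => a1 a2 a3 a4 a5 a6 a7.
by ring.
Qed.

Lemma netL_iterE (chi : 'rV[R]_p -> C) E (r : E -> @epsdom R) (phi : R -> Z -> R) h f e :
  iter h (netL chi r phi) f e = iter h (L chi (phi (epsval (r e)))) (f e).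
Proof. by elim: h => //= h IH; rewrite {1}/netL IH. Qed.

End Operator.

(** * Test functions lifted to the product *)

Section LiftedNets.
Context {R : realType} {n' n p : nat}.
Local Notation C := R[i].
Local Notation Z := ('rV[R]_n' * 'rV[R]_n * 'rV[R]_p)%type.
Context (Omega' : set 'rV[R]_n') (Omega : set 'rV[R]_n).
Hypotheses (oO' : open Omega') (oO : open Omega).
Local Notation X := (Omega' `*` Omega).
Context {E : Type} (eps : E -> R) (K : set 'rV[R]_n) (cK : compact_in Omega K).
Implicit Types V : E -> 'rV[R]_n -> C.

Definition test_net V := (forall e, csmooth_on std Omega (V e)) /\
  (forall e y, Omega y -> ~ K y -> V e y = 0).

(** The length of words is bounded by k so that the number of derivatives of a test function that an
    estimate consumes stays visible. It becomes the index of a seminorm in the proof of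
    continuity. *)
Definition test_bound k V V' := exists A B, [/\ tempered A, rapid B &
  forall e t y, (size t <= k)%N -> K y ->
    [/\ normc (cword_deriv std t (V e) y) <= A (eps e),
        normc (cword_deriv std t (V' e) y) <= A (eps e) &
        normc (cword_deriv std t (V e) y - cword_deriv std t (V' e) y) <= B (eps e)]].

Definition lift_net V : E -> Z -> C := fun e w => V e w.1.2.

Let pr (w : Z) : 'rV[R]_n := w.1.2.
Let sg (i : ('I_n' + 'I_n) + 'I_p) := if i is inl (inr k) then Some k else None.

Let prL (h : R) (u w : Z) : pr (h *: u + w) = h *: pr u + pr w. Proof. by []. Qed.

Let pre i : pr (eZ i) = if sg i is Some k then std k else 0.
Proof. by case: i => [[]|]. Qed.

Let prC : continuous pr.
Proof.
move=> w; apply: (@continuous_comp _ _ _ fst snd); [exact: cvg_fst|exact: cvg_snd].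
Qed.

Lemma lift_smooth V : test_net V -> nsmooth eZ (X `*` setT) (lift_net V).
Proof.
move=> [sV _] e; apply: (csmooth_on_sub _ (csmooth_on_pr prL pre prC (sV e))).
by move=> w [[_ Oy] _].
Qed.

Lemma test_word_out V e t y : test_net V -> Omega y -> ~ K y -> cword_deriv std t (V e) y = 0.
Proof.
move=> [_ zV] Oy Ky.
have cl : closed K by apply: compact_closed => //; case: cK.
have oK : open (Omega `&` ~` K) := openI oO (closed_openC cl).
have D0 y' : (Omega `&` ~` K) y' -> V e y' = (fun=> 0) y' by move=> [Oz Kz]; exact: zV.
rewrite (cword_deriv_eq std t oK D0); last by split.
by elim: (t) (y) => //= i t' IH y'; rewrite (cderiv_eq (g := fun=> 0) _ openT)// cderiv_cst.
Qed.

(** A word with a letter in x or xi annihilates a lifted net, so any decay holds for it. The other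
    words are in y alone and have nonnegative weight as [delta] >= 0. *)
Lemma lift_rel rho delta k V V' : 0 <= delta -> test_net V -> test_net V' ->
  test_bound k V V' ->
  nrel eps eZ (fullwt rho delta) (cylinders Omega' Omega setT) jap k 0 (lift_net V) (lift_net V').
Proof.
move=> d0 tV tV' [A [B [tA rB H]]].
apply: rel_words => s sk S [K1 cK1 ->]; rewrite add0r.
have map_wt (s' : seq (('I_n' + 'I_n) + 'I_p)) t' : map sg s' = map Some t' ->
    0 <= \sum_(i <- s') fullwt rho delta i.
  elim: s' t' => [|i s' IH] [|j t'] //=; rewrite ?big_nil// big_cons.
  by case: i => [[i|i]|i] //= [_ /IH]; exact: addr_ge0.
exists A, B; split=> // e w [K1w _]; have [Ox Oy] := cK1.2 _ K1w.
have A0 := tA.1 (eps e); have B0 := rB.1 (eps e).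
have J0 := powR_ge0 (jap w) (\sum_(i <- s) fullwt rho delta i).
have [E0|[t ts E1]] := cword_pr_cases prL pre s.
  rewrite [cword_deriv eZ s (lift_net V e)](E0 (V e)) [cword_deriv eZ s (lift_net V' e)](E0 (V' e)).
  by rewrite subrr normc0; split; exact: mulr_ge0.
rewrite [cword_deriv eZ s (lift_net V e)](E1 (V e)) [cword_deriv eZ s (lift_net V' e)](E1 (V' e)).
have tk : (size t <= k)%N by rewrite -(size_map Some) -ts size_map.
have J1 : 1 <= jap w `^ (\sum_(i <- s) fullwt rho delta i).
  rewrite -(powRr0 (jap w)); apply: ler_powR; first exact: jap_ge1.
  exact: map_wt ts.
have up (x c : R) : 0 <= c -> x <= c -> x <= c * jap w `^ (\sum_(i <- s) fullwt rho delta i).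
  by move=> c0 xc; apply: (le_trans xc); rewrite ler_peMr.
have [Ky|Ky] := pselect (K w.1.2); last first.
  rewrite /= /pr (test_word_out e t tV Oy Ky) (test_word_out e t tV' Oy Ky).
  by rewrite subrr normc0; split; exact: mulr_ge0.
by have [h1 h2 h3] := H e t _ tk Ky; split; apply: up.
Qed.

End LiftedNets.

(** * Oscillatory integrals of test functions *)

Section OscillatoryNets.
Context {R : realType} {n' n p : nat}.
Local Notation C := R[i].
Local Notation Z := ('rV[R]_n' * 'rV[R]_n * 'rV[R]_p)%type.
Context (Omega' : set 'rV[R]_n') (Omega : set 'rV[R]_n).
Hypotheses (oO' : open Omega') (oO : open Omega).
Local Notation X := (Omega' `*` Omega).
Local Notation cRe := (@complex.Re _).
Local Notation cIm := (@complex.Im _).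
Local Notation U1 := [set xi : 'rV[R]_p | 8^-1 < enorm xi].
Context (K : set 'rV[R]_n) (cK : compact_in Omega K).
Context (chi : 'rV[R]_p -> C) (hchi : cutoff chi).
Context (m rho delta : R) (hrho : 0 < rho <= 1) (hdelta : 0 <= delta < 1).
Context (phi : @Phi R n' n p Omega' Omega) (a : @Stilde R n' n p m rho delta X).
Local Notation s := (Num.min rho (1 - delta)).
Local Notation cls rho delta U := (same_class (@epsval R) (@eZ R n' n p)
  (fullwt rho delta) (X `*` U) (cylinders Omega' Omega U) jap).

Let oT := @oXT R n' n p Omega' Omega oO' oO.
Let KDT := @cylinders_sub R n' n p Omega' Omega setT.
Let JT : forall w : Z, (X `*` setT) w -> 1 <= jap w. Proof. by move=> w _; exact: jap_ge1. Qed.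

Lemma Phi_mem (psi : R -> Z -> R) : (phi : set (R -> Z -> R)) psi -> M_Phi Omega' Omega psi.
Proof. by case: phi => A [phi0 m0 /= ->] []. Qed.

Lemma Phi_class (psi psi' : R -> Z -> R) : (phi : set (R -> Z -> R)) psi ->
  (phi : set (R -> Z -> R)) psi' -> cls 1 0 U1 1 (restr (cnet psi)) (restr (cnet psi')).
Proof.
move=> h h'; have [s1 r1 _ _] := phi_reprs_rel oO' oO h h'.
by have [s2 _ _ _] := phi_reprs_rel oO' oO h' h.
Qed.

Lemma Stilde_class (b b' : net R Z) : (a : set (net R Z)) b -> (a : set (net R Z)) b' ->
  cls rho delta setT m (restr b) (restr b').
Proof. by move=> h h'; exact: (reprs_srel oO' oO h h'). Qed.

Section Indexed.
Context {E : Type} (r : E -> @epsdom R).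
Local Notation erel := (nrel (@epsval R \o r) (@eZ R n' n p) (fullwt rho delta)
  (cylinders Omega' Omega setT) jap).
Local Notation xrel := (nrel (@epsval R \o r) (@xdir R n' n p) (fun=> 2)
  (cylinders Omega' Omega setT) jap).
Local Notation xsmooth := (nsmooth (@xdir R n' n p) (X `*` setT)).
Implicit Types V : E -> 'rV[R]_n -> C.

Definition amp (b : net R Z) V : E -> Z -> C := fun e w => b (epsval (r e)) w * V e w.1.2.

Definition oscP h (psi : R -> Z -> R) (b : net R Z) V : E -> Z -> C :=
  fun e w => expi (psi (epsval (r e)) w) * iter h (netL chi r psi) (amp b V) e w.

Lemma ysupp_netL (psi : R -> Z -> R) f : ysupp Omega' Omega K f ->
  ysupp Omega' Omega K (netL chi r psi f).
Proof.
move=> zf e w Xw Kw; rewrite /netL /L (zf e w Xw Kw) mulr0 addr0.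
rewrite !big1 ?addr0// => i _.
  by rewrite (ysupp_cderiv oO' oO cK _ zf) ?mulr0.
by rewrite (ysupp_cderiv oO' oO cK _ zf) ?mulr0.
Qed.

Lemma ysupp_oscP h psi b V : test_net Omega K V -> ysupp Omega' Omega K (oscP h psi b V).
Proof.
move=> tV; suff z : ysupp Omega' Omega K (iter h (netL chi r psi) (amp b V)).
  by move=> e w Xw Kw; rewrite /oscP (z e w Xw Kw) mulr0.
elim: h => [|h IH]; last exact: ysupp_netL.
by move=> e w [Ox Oy] Kw; rewrite /amp /= (tV.2 e w.1.2 Oy Kw) mulr0.
Qed.

Lemma amp_rel k V V' (b b' : net R Z) : (a : set (net R Z)) b -> (a : set (net R Z)) b' ->
  test_net Omega K V -> test_net Omega K V' -> test_bound (@epsval R \o r) K k V V' ->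
  [/\ nsmooth eZ (X `*` setT) (amp b V), nsmooth eZ (X `*` setT) (amp b' V') &
      erel k m (amp b V) (amp b' V')].
Proof.
move=> hb hb' tV tV' tb; have d0 : 0 <= delta by case/andP: hdelta.
have [sb sb' rb] := class_pull r (Stilde_class hb hb').
have sV : nsmooth eZ (X `*` [set: 'rV[R]_p]) (lift_net V) := lift_smooth Omega' tV.
have sV' : nsmooth eZ (X `*` [set: 'rV[R]_p]) (lift_net V') := lift_smooth Omega' tV'.
split; [exact: (nsmooth_mul oT sb sV)|exact: (nsmooth_mul oT sb' sV')|].
have := rel_mul oT KDT JT sb sb' sV sV' (rb k) (lift_rel Omega' oO cK rho d0 tV tV' tb).
by rewrite addr0.
Qed.

(** [phi_reprs_rel] counts order 1 for the phase and 1 more for each x-derivative, so first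
    derivatives have order 2; hence the weight 2. The order 1 of the exponentials is the growth of
    the difference of two phases. *)
Lemma xrel_expi k (psi psi' : R -> Z -> R) : (phi : set (R -> Z -> R)) psi ->
  (phi : set (R -> Z -> R)) psi' ->
  [/\ xsmooth (fun e w => expi (psi (epsval (r e)) w)),
      xsmooth (fun e w => expi (psi' (epsval (r e)) w)) &
      xrel k 1 (fun e w => expi (psi (epsval (r e)) w)) (fun e w => expi (psi' (epsval (r e)) w))].
Proof.
move=> h h'; have [_ _ sx rx] := phi_reprs_rel oO' oO h h'.
have [_ _ sx' _] := phi_reprs_rel oO' oO h' h.
have sF (e : E) : smooth_on (@xdir R n' n p) (X `*` setT) (psi (epsval (r e))) := (sx (r e)).1.
have sF' (e : E) : smooth_on (@xdir R n' n p) (X `*` setT) (psi' (epsval (r e))) := (sx' (r e)).1.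
split; [exact: nsmooth_expi|exact: nsmooth_expi|].
apply: (rel_expi oT KDT JT ler01 sF sF').
  move=> S KS; have [A [B [tA rB H]]] := rel_bound (rx 0%N) KS.
  exists B => // e w Sw; have [_ _] := H (r e) w Sw.
  by rewrite /restr /cnet normc_realB.
move=> i; have [_ rxi] := rx k.+1.
have e1 (q : R -> Z -> R) (e : epsdom) w : (X `*` setT) w ->
    nderiv (@xdir R n' n p) i (restr (cnet q)) e w = ('D_(xdir i) (q (epsval e)) w)%:C%C.
  by move=> Dw; exact: cderiv_real.
have := rel_pull r (rel_eq oT KDT (e1 psi) (e1 psi') (rxi i)).
move=> rp; apply: (@rel_restrict R E _ _ _ _ (@xdir R n' n p) (fun=> 1) id (fun=> 2)
  (X `*` setT) (cylinders Omega' Omega setT) (cylinders Omega' Omega setT) jap k 2 _ _ _ _ _ _ _ rp).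
- by move=> S KS; exists S.
- exact: KDT.
- exact: JT.
- exact: oT.
- by move=> _; lra.
Qed.

(** Each of the h applications of L consumes one derivative of the test functions and lowers the
    order by s; the exponential adds 1. *)
Lemma oscP_rel k h V V' (psi psi' : R -> Z -> R) (b b' : net R Z) :
  (phi : set (R -> Z -> R)) psi -> (phi : set (R -> Z -> R)) psi' ->
  (a : set (net R Z)) b -> (a : set (net R Z)) b' ->
  test_net Omega K V -> test_net Omega K V' -> test_bound (@epsval R \o r) K (h + k) V V' ->
  [/\ xsmooth (oscP h psi b V), xsmooth (oscP h psi' b' V') &
      xrel k (1 + (m - h%:R * s)) (oscP h psi b V) (oscP h psi' b' V')].
Proof.
move=> hp hp' hb hb' tV tV' tb.
have [sa sa' ra] := amp_rel hb hb' tV tV' tb.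
have [s1 s2 rl] := netL_iter oO' oO hchi (Phi_mem hp) (Phi_mem hp') (Phi_class hp hp')
  hrho hdelta sa sa' ra.
have [e1 e2 re] := xrel_expi k hp hp'.
have sx (f : E -> Z -> C) : nsmooth eZ (X `*` setT) f -> xsmooth f.
  move=> sf e; have [f1 f2] := sf e.
  by split; [exact: (@smooth_on_reindex _ _ _ _ eZ (inl \o inl) _ _ f1)|
    exact: (@smooth_on_reindex _ _ _ _ eZ (inl \o inl) _ _ f2)].
have d2 : delta <= 2 by case/andP: hdelta => _ d1; lra.
have rx := @rel_restrict R E _ _ _ _ (@eZ R n' n p) (fullwt rho delta) (inl \o inl) (fun=> 2)
  (X `*` setT) (cylinders Omega' Omega setT) (cylinders Omega' Omega setT) jap k _ _ _
  (fun S KS => ex_intro2 _ _ S KS (@subset_refl _ S)) KDT JT oT (fun=> d2) rl.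
split; [exact: (nsmooth_mul oT e1 (sx _ s1))|exact: (nsmooth_mul oT e2 (sx _ s2))|].
exact: (rel_mul oT KDT JT e1 e2 (sx _ s1) (sx _ s2) re rx).
Qed.

Lemma oscP_Ck k h V (psi : R -> Z -> R) (b : net R Z) :
  (phi : set (R -> Z -> R)) psi -> (a : set (net R Z)) b ->
  test_net Omega K V -> test_bound (@epsval R \o r) K (h + k.+2) V V ->
  (1 + (m - h%:R * s)) + 2 * k%:R + 4 < - p%:R ->
  forall e, Ck std k Omega' (cRe \o xint Omega (oscP h psi b V) e) /\
            Ck std k Omega' (cIm \o xint Omega (oscP h psi b V) e).
Proof.
move=> hp hb tV tb hmu; have [sP _ rP] := oscP_rel hp hp hb hb tV tV tb.
exact: (xint_Ck oO' oO cK sP (ysupp_oscP h psi b tV) rP hmu).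
Qed.

Lemma oscP_words k h V V' (psi psi' : R -> Z -> R) (b b' : net R Z) (K' : set 'rV[R]_n') :
  (phi : set (R -> Z -> R)) psi -> (phi : set (R -> Z -> R)) psi' ->
  (a : set (net R Z)) b -> (a : set (net R Z)) b' ->
  test_net Omega K V -> test_net Omega K V' ->
  test_bound (@epsval R \o r) K (h + k.+2) V V' ->
  (1 + (m - h%:R * s)) + 2 * k%:R + 4 < - p%:R -> compact_in Omega' K' ->
  test_bound (@epsval R \o r) K' k (xint Omega (oscP h psi b V)) (xint Omega (oscP h psi' b' V')).
Proof.
move=> hp hp' hb hb' tV tV' tb hmu cK'.
have [sP sP' rP] := oscP_rel hp hp' hb hb' tV tV' tb.
have [A [B [tA rB H]]] := xint_words oO' oO cK sP sP' (ysupp_oscP h psi b tV)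
  (ysupp_oscP h psi' b' tV') rP hmu cK'.
by exists A, B; split=> // e t x tk Kx; exact: H.
Qed.

End Indexed.

(** One value of [osc_net] without its constant factor, detached from nets so that a single phase,
    symbol and test function can be treated. *)
Definition oscI h (g : Z -> R) (b : Z -> C) (v : 'rV[R]_n -> C) (x : 'rV[R]_n') : C :=
  cintegral_yxi Omega (fun y xi => expi (g (x, y, xi)) *
    iter h (L chi g) (fun w => b w * v w.1.2) (x, y, xi)).

Lemma oscPE E (r : E -> @epsdom R) h psi b (V : E -> 'rV[R]_n -> C) e :
  xint Omega (oscP r h psi b V) e = oscI h (psi (epsval (r e))) (b (epsval (r e))) (V e).
Proof.
by apply/funext => x; rewrite /xint /oscP /oscI; congr cintegral_yxi; apply/funext => y;
  apply/funext => xi; rewrite netL_iterE.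
Qed.

Definition test_fun (v : 'rV[R]_n -> C) := csmooth_on std Omega v /\
  (forall y, Omega y -> ~ K y -> v y = 0).

Lemma compact_word_bound (v : 'rV[R]_n -> C) k : csmooth_on std Omega v ->
  exists2 M, 0 <= M & forall t y, (size t <= k)%N -> K y -> normc (cword_deriv std t v y) <= M.
Proof.
have one (w : 'rV[R]_n -> C) : csmooth_on std Omega w ->
    exists2 M, 0 <= M & forall y, K y -> normc (w y) <= M.
  move=> [w1 w2].
  have [M1 M10 H1] := compact_norm_bound cK.1 (fun y Ky => smooth_on_cont w1 (cK.2 y Ky)).
  have [M2 M20 H2] := compact_norm_bound cK.1 (fun y Ky => smooth_on_cont w2 (cK.2 y Ky)).
  exists (M1 + M2); first exact: addr_ge0.
  by move=> y Ky; apply: (le_trans (normc_le _)); apply: lerD; [exact: H1|exact: H2].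
elim: k v => [|k IH] v sv.
  have [M M0 H] := one v sv; exists M => // -[|//] y _; exact: H.
have [M M0 H] := one v sv.
have /choice[M' HM'] : forall i, exists M, 0 <= M /\ forall t y, (size t <= k)%N -> K y ->
    normc (cword_deriv std t (cderiv (std i) v) y) <= M.
  by move=> i; have [M' M'0 H'] := IH _ (csmooth_on_D i sv); exists M'.
have le i : M' i <= \sum_j M' j.
  by rewrite (bigD1 i)//= lerDl; apply: sumr_ge0 => j _; exact: (HM' j).1.
exists (M + \sum_j M' j).
  by apply: addr_ge0 => //; apply: sumr_ge0 => j _; exact: (HM' j).1.
move=> t y; case/lastP: t => [_ Ky|t i].
  apply: (le_trans (H y Ky)); rewrite lerDl; apply: sumr_ge0 => j _; exact: (HM' j).1.
rewrite size_rcons ltnS cword_deriv_rcons => tk Ky.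
by apply: (le_trans ((HM' i).2 t y tk Ky)); apply: (le_trans (le i)); rewrite lerDr.
Qed.

Lemma test_fun_net v : test_fun v -> test_net Omega K (fun _ : @epsdom R => v) /\
  forall k, test_bound (@epsval R \o id) K k (fun _ : @epsdom R => v) (fun _ : @epsdom R => v).
Proof.
move=> [sv zv]; split=> [|k]; first by split.
have [M M0 H] := compact_word_bound k sv.
exists (fun=> M), (fun=> 0); split; [exact: tempered_cst|exact: rapid0|].
by move=> e t y tk Ky; split; [exact: H|exact: H|rewrite subrr normc0].
Qed.

Lemma iter_class h (psi : R -> Z -> R) (b : net R Z) v : (phi : set (R -> Z -> R)) psi ->
  (a : set (net R Z)) b -> test_fun v ->
  cls rho delta setT (m - h%:R * s) (iter h (netL chi id psi) (amp id b (fun=> v)))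
    (iter h (netL chi id psi) (amp id b (fun=> v))).
Proof.
move=> hp hb tv; have [tV tb] := test_fun_net tv.
have H k := let: And3 sa sa' ra := amp_rel hb hb tV tV (tb (h + k)%N) in
  netL_iter oO' oO hchi (Phi_mem hp) (Phi_mem hp) (Phi_class hp hp) hrho hdelta sa sa' ra.
by split=> [||k]; [have [] := H 0%N|have [] := H 0%N|have [_ _] := H k].
Qed.

Lemma iter_ysupp h (psi : R -> Z -> R) (b : net R Z) v : test_fun v ->
  ysupp Omega' Omega K (iter h (netL chi id psi) (amp id b (fun=> v))).
Proof.
move=> [_ zv]; elim: h => [|h IH]; last exact: ysupp_netL.
by move=> e w [_ Oy] Kw; rewrite /amp /= zv ?mulr0.
Qed.

(** [xint_L] removes one application of L at a time. The condition on the order persists as h grows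
    because s >= 0. *)
Lemma oscI_indep h d (psi : R -> Z -> R) (b : net R Z) v (e : epsdom) x :
  (phi : set (R -> Z -> R)) psi -> (a : set (net R Z)) b -> test_fun v ->
  m - h%:R * s + 1 < - p%:R -> Omega' x ->
  oscI (h + d) (psi (epsval e)) (b (epsval e)) v x = oscI h (psi (epsval e)) (b (epsval e)) v x.
Proof.
move=> hp hb tv hmu Ox; elim: d => [|d <-]; first by rewrite addn0.
have [_ _ sx _] := phi_reprs_rel oO' oO hp hp.
have s0 : 0 <= s by rewrite le_min; case/andP: hrho => r0 _; case/andP: hdelta => _ d1; lra.
have hmu' : m - (h + d)%:R * s + 1 < - p%:R.
  apply: le_lt_trans hmu; rewrite natrD mulrDl opprD addrA -!addrA lerD2l lerD2l.
  by rewrite -[leRHS]add0r lerD2r oppr_le0 mulr_ge0.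
have := xint_L oO' oO cK hchi (Phi_mem hp) (Phi_class hp hp) sx e hrho hdelta
  (iter_class (h + d) hp hb tv) (iter_ysupp (h + d) psi b tv) hmu' Ox.
rewrite /xint /oscI addnS /= netL_iterE => ->.
by [].
Qed.

End OscillatoryNets.

(** * Smoothness and uniform estimates of oscillatory integrals *)

Section OscillatoryIntegrals.
Context {R : realType} {n' n p : nat}.
Local Notation C := R[i].
Local Notation Z := ('rV[R]_n' * 'rV[R]_n * 'rV[R]_p)%type.
Context (Omega' : set 'rV[R]_n') (Omega : set 'rV[R]_n).
Hypotheses (oO' : open Omega') (oO : open Omega).
Local Notation X := (Omega' `*` Omega).
Local Notation cRe := (@complex.Re _).
Local Notation cIm := (@complex.Im _).
Context (K : set 'rV[R]_n) (cK : compact_in Omega K).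
Context (chi : 'rV[R]_p -> C) (hchi : cutoff chi).
Context (m rho delta : R) (hrho : 0 < rho <= 1) (hdelta : 0 <= delta < 1).
Context (phi : @Phi R n' n p Omega' Omega) (a : @Stilde R n' n p m rho delta X).
Local Notation s := (Num.min rho (1 - delta)).
Local Notation osc := (oscI Omega chi).
Local Notation test := (test_fun Omega K).
Local Notation admissible h := (m - h%:R * s + 1 < - p%:R).

Lemma gain_gt0 : 0 < s.
Proof. by rewrite lt_min; case/andP: hrho => -> _; case/andP: hdelta => _ d1; lra. Qed.

Lemma large_index (c : R) : exists d : nat, c < d%:R * s.
Proof.
exists (Num.bound (`|c| / s)); rewrite -ltr_pdivrMr ?gain_gt0//.
apply: (@le_lt_trans _ _ (`|c| / s)); last first.
  by apply: archi_boundP; rewrite divr_ge0// ltW// gain_gt0.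
by rewrite ler_pM2r ?invr_gt0 ?gain_gt0// ler_norm.
Qed.

Lemma oscI_eq h h' (psi : R -> Z -> R) (b : net R Z) v (e : epsdom) x :
  (phi : set (R -> Z -> R)) psi -> (a : set (net R Z)) b -> test v ->
  (h <= h')%N -> admissible h -> Omega' x ->
  osc h' (psi (epsval e)) (b (epsval e)) v x = osc h (psi (epsval e)) (b (epsval e)) v x.
Proof.
move=> hp hb tv hh hmu Ox; rewrite -(subnKC hh).
exact: (oscI_indep oO' oO cK hchi hrho hdelta (h' - h) e hp hb tv hmu Ox).
Qed.

(** The given h need not allow differentiation under the integral. For each k the integral is
    rewritten with a larger index h + d, which does not change its value. *)
Lemma oscI_smooth h (psi : R -> Z -> R) (b : net R Z) v (e : epsdom) :
  (phi : set (R -> Z -> R)) psi -> (a : set (net R Z)) b -> test v -> admissible h ->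
  csmooth_on std Omega' (osc h (psi (epsval e)) (b (epsval e)) v).
Proof.
move=> hp hb tv hmu; have [tV tb] := test_fun_net cK tv.
suff H k : Ck std k Omega' (cRe \o osc h (psi (epsval e)) (b (epsval e)) v) /\
    Ck std k Omega' (cIm \o osc h (psi (epsval e)) (b (epsval e)) v).
  by split; apply/smooth_onP => k; have [] := H k.
have [d hd] := large_index (1 + m + 2 * k%:R + 4 + p%:R - h%:R * s).
have hm : (1 + (m - (h + d)%:R * s)) + 2 * k%:R + 4 < - p%:R.
  by rewrite natrD mulrDl; lra.
have [c1 c2] := oscP_Ck oO' oO cK hchi hrho hdelta hp hb tV (tb _) hm e.
rewrite oscPE in c1 c2.
split; [apply: (Ck_eq oO' _ c1) => x Ox|apply: (Ck_eq oO' _ c2) => x Ox].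
  exact: (congr1 cRe (oscI_eq e hp hb tv (leq_addr d h) hmu Ox)).
exact: (congr1 cIm (oscI_eq e hp hb tv (leq_addr d h) hmu Ox)).
Qed.

(** Both integrals are moved to the common index h + h' + d, with d large. The number j of
    derivatives is fixed before the index set E, which may therefore be chosen in terms of j. *)
Lemma osc_bound k h h' : admissible h -> admissible h' -> exists j,
  forall E (r : E -> @epsdom R) V V' (psi psi' : R -> Z -> R) (b b' : net R Z) K',
  (phi : set (R -> Z -> R)) psi -> (phi : set (R -> Z -> R)) psi' ->
  (a : set (net R Z)) b -> (a : set (net R Z)) b' ->
  test_net Omega K V -> test_net Omega K V' -> test_bound (@epsval R \o r) K j V V' ->
  compact_in Omega' K' ->
  test_bound (@epsval R \o r) K' k
    (fun e => osc h (psi (epsval (r e))) (b (epsval (r e))) (V e))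
    (fun e => osc h' (psi' (epsval (r e))) (b' (epsval (r e))) (V' e)).
Proof.
move=> hmu hmu'.
have [d hd] := large_index (1 + m + 2 * k%:R + 4 + p%:R - (h + h')%:R * s).
have hm : (1 + (m - (h + h' + d)%:R * s)) + 2 * k%:R + 4 < - p%:R.
  by rewrite natrD mulrDl; lra.
exists (h + h' + d + k.+2)%N => E r V V' psi psi' b b' K' hp hp' hb hb' tV tV' tb cK'.
have [A [B [tA rB H]]] := oscP_words oO' oO cK hchi hrho hdelta hp hp' hb hb' tV tV' tb hm cK'.
exists A, B; split=> // e t x tk Kx; have Ox := cK'.2 _ Kx.
have tv : test (V e) by split; [exact: tV.1|exact: tV.2].
have tv' : test (V' e) by split; [exact: tV'.1|exact: tV'.2].
have le1 : (h <= h + h' + d)%N by rewrite -addnA leq_addr.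
have le2 : (h' <= h + h' + d)%N by rewrite addnAC leq_addl.
have G1 := cword_deriv_eq std t oO' (fun y Oy => oscI_eq (r e) hp hb tv le1 hmu Oy) Ox.
have G2 := cword_deriv_eq std t oO' (fun y Oy => oscI_eq (r e) hp' hb' tv' le2 hmu' Oy) Ox.
have F1 := oscPE Omega chi r (h + h' + d) psi b V e.
have F2 := oscPE Omega chi r (h + h' + d) psi' b' V' e.
rewrite -F1 in G1; rewrite -F2 in G2; rewrite -G1 -G2.
exact: (H e t x tk Kx).
Qed.

Lemma xint_lin mu (P Q : @epsdom R -> Z -> C) (l : C) e x :
  xadm Omega' Omega (@epsval R) K mu P -> xadm Omega' Omega (@epsval R) K mu Q ->
  mu < - p%:R -> Omega' x ->
  xint Omega (fun e w => l * P e w + Q e w) e x = l * xint Omega P e x + xint Omega Q e x.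
Proof.
move=> aP aQ hmu Ox.
have [b [A [A0 R1 I1]]] := xadm_adm cK e aP Ox.
have [b' [B [B0 R2 I2]]] := xadm_adm cK e aQ Ox.
have l1 : b <= Num.max b b' by rewrite le_max lexx.
have l2 : b' <= Num.max b b' by rewrite le_max lexx orbT.
have comb (x1 x2 : R) (F1 F2 F3 : 'rV[R]_n -> 'rV[R]_p -> R) : adm Omega (Num.max b b') mu A F1 ->
    adm Omega (Num.max b b') mu A F2 -> adm Omega (Num.max b b') mu B F3 ->
    integral_yxi Omega (fun y xi => x1 * F1 y xi + x2 * F2 y xi + F3 y xi) =
    x1 * integral_yxi Omega F1 + x2 * integral_yxi Omega F2 + integral_yxi Omega F3.
  move=> a1 a2 a3; have s1 := adm_scale x1 a1; have s2 := adm_scale x2 a2.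
  have p1 : 0 <= `|x1| * A by rewrite mulr_ge0.
  have p2 : 0 <= `|x2| * A by rewrite mulr_ge0.
  rewrite (integral_yxiD oO hmu (addr_ge0 p1 p2) B0 (adm_add s1 s2) a3).
  rewrite (integral_yxiD oO hmu p1 p2 s1 s2).
  by rewrite (integral_yxiZ x1 oO hmu A0 a1) (integral_yxiZ x2 oO hmu A0 a2).
apply: complex_eq.
  rewrite ReD ReM -mulNr -(comb _ _ _ _ _ (R1 _ l1) (I1 _ l1) (R2 _ l2)).
  by apply: eq_integral_yxi => y xi _; rewrite ReD ReM mulNr.
rewrite ImD ImM -(comb _ _ _ _ _ (I1 _ l1) (R1 _ l1) (I2 _ l2)).
by apply: eq_integral_yxi => y xi _; rewrite ImD ImM.
Qed.

Lemma test_lin l v v' : test v -> test v' -> test (fun y => l * v y + v' y).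
Proof.
move=> [sv zv] [sv' zv']; split; first exact: csmooth_lin oO sv sv'.
by move=> y Oy Ky; rewrite zv// zv'// mulr0 addr0.
Qed.

Lemma oscI_lin h (psi : R -> Z -> R) (b : net R Z) l v v' (e : epsdom) x :
  (phi : set (R -> Z -> R)) psi -> (a : set (net R Z)) b -> test v -> test v' ->
  admissible h -> Omega' x ->
  osc h (psi (epsval e)) (b (epsval e)) (fun y => l * v y + v' y) x =
  l * osc h (psi (epsval e)) (b (epsval e)) v x + osc h (psi (epsval e)) (b (epsval e)) v' x.
Proof.
move=> hp hb tv tv' hmu Ox.
have oT := @oXT R n' n p Omega' Omega oO' oO.
have aP w : test w -> xadm Omega' Omega (@epsval R) K (1 + (m - h%:R * s))
    (oscP chi id h psi b (fun=> w)).
  move=> tw; have [tV tb] := test_fun_net cK tw.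
  have [sP _ rP] := oscP_rel oO' oO cK hchi hrho hdelta hp hp hb hb tV tV (tb (h + 0)%N).
  split; [|exact: (ysupp_oscP oO' oO cK chi id h psi b tV)|exact: (rel_bound rP)].
  by move=> e' w' Dw; exact: (continuous_csmooth (sP e') Dw).
have hmu1 : 1 + (m - h%:R * s) < - p%:R by lra.
have := xint_lin l e (aP _ tv) (aP _ tv') hmu1 Ox; rewrite !oscPE => <-.
rewrite -(oscPE Omega chi id h psi b (fun=> (fun y => l * v y + v' y)) e).
apply: xint_eq => y xi Oy.
rewrite /oscP !netL_iterE mulrCA -mulrDr; congr (_ * _).
have Dw : (X `*` [set: 'rV[R]_p]) (x, y, xi) by [].
have sm w h' : test w -> csmooth_on eZ (X `*` setT)
    (iter h' (L chi (psi (epsval e))) (amp id b (fun=> w) e)).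
  move=> tw; have [H _ _] := iter_class oO' oO cK hchi hrho hdelta h' hp hb tw.
  by have := H e; rewrite netL_iterE.
move: Dw; move: (x, y, xi); elim: h {hmu hmu1 aP} => [|h IH] w Dw.
  by rewrite /= /amp; ring.
by rewrite !iterS (L_eq chi _ oT IH Dw) (L_lin chi _ l oT (sm _ h tv) (sm _ h tv') Dw).
Qed.

(** [osc_bound] is applied to the net indexed by all pairs of an epsilon and a test function whose
    derivatives of order at most j are bounded by 1. Its moderate bound depends on epsilon only, and
    linearity rescales from 1 to c. *)
Lemma osc_estimate k h (psi : R -> Z -> R) (b : net R Z) K' :
  (phi : set (R -> Z -> R)) psi -> (a : set (net R Z)) b -> admissible h ->
  compact_in Omega' K' -> exists j A, tempered A /\
  forall (e : epsdom) v c, test v -> 0 < c ->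
    (forall t y, (size t <= j)%N -> K y -> normc (cword_deriv std t v y) <= c) ->
  forall t x, (size t <= k)%N -> K' x ->
    normc (cword_deriv std t (osc h (psi (epsval e)) (b (epsval e)) v) x) <= A (epsval e) * c.
Proof.
move=> hp hb hmu cK'; have [j H] := osc_bound k hmu hmu.
pose good (ev : @epsdom R * ('rV[R]_n -> C)) := test ev.2 /\
  forall t y, (size t <= j)%N -> K y -> normc (cword_deriv std t ev.2 y) <= 1.
pose E := {ev | good ev}; pose r (w : E) := (sval w).1; pose V (w : E) := (sval w).2.
have tV : test_net Omega K V by split=> e; have [[]] := svalP e.
have tb : test_bound (@epsval R \o r) K j V V.
  exists (fun=> 1), (fun=> 0); split; [exact: tempered_cst|exact: rapid0|].
  by move=> e t y tj Ky; have [_ h1] := svalP e; rewrite subrr normc0; split=> //; exact: h1.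
have [A [B [tA _ HA]]] := H E r V V psi psi b b K' hp hp hb hb tV tV tb cK'.
exists j, A; split=> // e v c tv c0 vc t x tk Kx.
have t0 : test (fun=> 0) by split=> [|//]; exact: csmooth_on_cst.
pose v' y := (c^-1)%:C%C * v y + 0.
have tv' : test v' by exact: test_lin.
have vE : v = fun y => c%:C%C * v' y + 0.
  apply/funext => y; rewrite /v' !addr0 mulrA -realCM mulfV ?gt_eqF//.
  by rewrite [(1)%:C%C](_ : _ = 1)// mul1r.
have gd : good (e, v').
  split=> // t' y tj Ky /=.
  rewrite (cword_lin _ t' oO tv.1 t0.1 (cK.2 y Ky)).
  have -> : cword_deriv std t' (fun=> 0) y = 0 :> C.
    by elim: (t') (y) => //= i t'' IH y'; rewrite (cderiv_eq (g := fun=> 0) _ openT)// cderiv_cst.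
  rewrite addr0 normcM normc_real gtr0_norm ?invr_gt0// mulrC ler_pdivrMr// mul1r.
  exact: vc.
have [h1 _ _] := HA (exist _ (e, v') gd) t x tk Kx.
have Ox := cK'.2 _ Kx.
have osc0 y : Omega' y -> osc h (psi (epsval e)) (b (epsval e)) (fun=> 0) y = 0.
  move=> Oy; have := oscI_lin (-1) e hp hb t0 t0 hmu Oy.
  have -> : (fun y : 'rV[R]_n => -1 * (fun=> 0) y + (fun=> 0) y) = fun=> 0 :> C.
    by apply/funext => z; rewrite mulr0 addr0.
  by move=> I0; rewrite I0 mulN1r addNr.
have lin y : Omega' y -> osc h (psi (epsval e)) (b (epsval e)) v y =
    c%:C%C * osc h (psi (epsval e)) (b (epsval e)) v' y + (fun=> 0) y.
  by move=> Oy; rewrite {1}vE (oscI_lin c%:C%C e hp hb tv' t0 hmu Oy) (osc0 y Oy).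
rewrite (cword_deriv_eq std t oO' lin Ox).
rewrite (cword_lin _ t oO' (oscI_smooth e hp hb tv' hmu) (csmooth_on_cst std Omega' 0) Ox).
have -> : cword_deriv std t (fun=> 0) x = 0 :> C.
  by elim: (t) (x) => //= i t'' IH y'; rewrite (cderiv_eq (g := fun=> 0) _ openT)// cderiv_cst.
by rewrite addr0 normcM normc_real gtr0_norm// mulrC ler_wpM2r// ltW.
Qed.

End OscillatoryIntegrals.

(** * Compactly supported representatives *)

Section Bump.
Context {R : realType}.

(* The functions x^-k exp (-1/x), extended by 0 to x <= 0, are stable under
   differentiation. *)
Definition flat k (x : R) : R := if 0 < x then x^-1 ^+ k * expR (- x^-1) else 0.

Lemma flat_pos k x : 0 < x -> flat k x = x^-1 ^+ k * expR (- x^-1).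
Proof. by rewrite /flat => ->. Qed.

Lemma flat_npos k x : x <= 0 -> flat k x = 0.
Proof. by rewrite /flat leNgt => /negbTE ->. Qed.

(** With q = 1 / h, e^q is the power k + 2 of e^{q / (k + 2)}, hence at least (q / (k + 2))^(k + 2).
    So q^k e^{-q} is at most (k + 2)^(k + 2) / q^2, the quadratic bound from which differentiability
    at 0 follows. *)
Lemma flat_quadratic k h : `|flat k h| <= h ^+ 2 * k.+2%:R ^+ k.+2.
Proof.
have [h0|h0] := ltP 0 h; last first.
  by rewrite flat_npos// normr0 mulr_ge0// ?sqr_ge0// exprn_ge0.
have m0 : 0 < k.+2%:R :> R by rewrite ltr0Sn.
rewrite flat_pos//; set q := h^-1; have q0 : 0 < q by rewrite invr_gt0.
have eq_ge : (q / k.+2%:R) ^+ k.+2 <= expR q.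
  have -> : q = k.+2%:R * (q / k.+2%:R) by rewrite mulrCA mulfV ?mulr1// gt_eqF.
  rewrite expRM_natl mulrAC mulfV ?gt_eqF// mul1r lerXn2r ?nnegrE ?expR_ge0//.
    by rewrite divr_ge0// ltW.
  by apply: (le_trans _ (expR_ge1Dx _)); rewrite lerDr.
rewrite ger0_norm; last by rewrite mulr_ge0 ?expR_ge0// exprn_ge0// ltW.
rewrite expRN ler_pdivrMr ?expR_gt0//.
apply: (@le_trans _ _ (h ^+ 2 * k.+2%:R ^+ k.+2 * (q / k.+2%:R) ^+ k.+2)); last first.
  by rewrite ler_wpM2l// mulr_ge0// ?sqr_ge0// exprn_ge0.
have k0 : k.+2%:R ^+ k.+2 != 0 :> R by rewrite expf_neq0// gt_eqF.
rewrite expr_div_n (_ : h ^+ 2 = (q ^+ 2)^-1); last by rewrite /q exprVn invrK.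
have q20 : q ^+ 2 != 0 by rewrite expf_neq0// gt_eqF.
rewrite (_ : q ^+ k.+2 = q ^+ 2 * q ^+ k); last by rewrite -exprD.
move: (q ^+ 2) (q ^+ k) (_ ^+ k.+2) q20 k0 => b c M b0 M0.
suff -> : b^-1 * M * (b * c / M) = c by [].
by field; rewrite b0 M0.
Qed.

Lemma is_derive_flat k (x : R) :
  is_derive x 1 (flat k) (- k%:R * flat k.+1 x + flat k.+2 x).
Proof.
have [x0|x0|x0] := ltgtP 0 x; last first.
- rewrite -x0 !flat_npos// mulr0 addr0.
  apply: (@is_derive_quadratic _ _ _ _ _ _ (k.+2%:R ^+ k.+2) 1) => //.
  move=> h _; rewrite [_ *: _]mulr1 addr0 (@flat_npos k 0)// mulr0 !subr0.
  exact: flat_quadratic.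
- rewrite !flat_npos ?(ltW x0)// mulr0 addr0.
  have N : \near x, (fun=> 0 : R) x = flat k x.
    have : \near x, x < 0 by exact: lt_nbhsl.
    by apply: filterS => y y0; rewrite flat_npos// ltW.
  have D0 : is_derive x (1 : R) (fun=> 0 : R) 0 by exact: is_derive_cst.
  exact: near_eq_is_derive N D0.
pose G (q : R) := q ^+ k * expR (- q).
have dG (q : R) : is_derive q (1 : R) G (k%:R * q ^+ k.-1 * expR (- q) - q ^+ k * expR (- q)).
  have d1 : is_derive q (1 : R) (fun q : R => q ^+ k) (k%:R * q ^+ k.-1).
    have := @is_deriveX R R id k q (1 : R) 1 (is_derive_id q (1 : R)).
    rewrite [_ *: _]mulr1 (_ : id ^+ k = fun q : R => q ^+ k)//.
    by apply/funext => z; rewrite exprfctE.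
  have d2 : is_derive q (1 : R) (fun q : R => expR (- q)) (- expR (- q)).
    have dN : derivable (fun q : R => - q) q (1 : R) by have [] := is_deriveNid q (1 : R).
    have := is_derive_comp1 (is_derive_expR (- q)) dN.
    have -> : 'D_1 (fun q : R => - q) q = -1 by have [_ ->] := is_deriveNid q (1 : R).
    by rewrite mulrN1.
  apply: is_derive_eq (is_deriveM d1 d2) _.
  rewrite -[LHS]/(q ^+ k * (- expR (- q)) + expR (- q) * (k%:R * q ^+ k.-1)).
  by move: (q ^+ k) (q ^+ k.-1) (expR _) => A B D; ring.
have xn0 : x != 0 by rewrite gt_eqF.
have di : derivable (id : R -> R) x 1 by exact: derivable_id.
have dV : derivable (fun y : R => y^-1) x 1 by exact: (@derivableV R R id x 1 xn0 di).
have DV : 'D_1 (fun y : R => y^-1) x = - x ^- 2.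
  rewrite (@deriveV R R id x 1 xn0 di) derive_id; exact: mulr1.
have N : \near x, (G \o (fun y : R => y^-1)) x = flat k x.
  have : \near x, 0 < x by exact: lt_nbhsr.
  by apply: filterS => y y0; rewrite flat_pos.
apply: near_eq_is_derive N _; apply: is_derive_eq (is_derive_comp1 (dG x^-1) dV) _.
rewrite DV !flat_pos// -exprVn; set q := x^-1; set E := expR _.
by case: k {G dG} => [|k]; rewrite ?mul0r /= !exprS ?expr0; ring.
Qed.

Lemma smooth_flat k U : smooth_on (fun _ : unit => 1 : R) U (flat k).
Proof.
have cF j : continuous (flat j).
  by move=> x; apply: differentiable_continuous; apply/derivable1_diffP; have [] := is_derive_flat j x.
apply: (@smooth_on_sub _ _ _ _ setT) => //; apply/smooth_onP => l.
elim: l k => [|l IH] k; first by split=> // x _; exact: cF.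
split=> [x _|_]; first exact: cF.
split=> [x _|]; first by have [] := is_derive_flat k x.
have -> : 'D_1 (flat k) = fun x => - k%:R * flat k.+1 x + flat k.+2 x.
  by apply/funext => x; have [_ ->] := is_derive_flat k x.
by apply: Ck_add openT _ (IH _); apply: Ck_mul openT _ (IH _); exact: Ck_cst.
Qed.

(* Smooth on the line, 1 on t <= 1 and 0 on t >= 2. *)
Definition step (t : R) : R := flat 0 (2 - t) * (flat 0 (2 - t) + flat 0 (t - 1))^-1.

Lemma flat0_ge0 x : 0 <= flat 0 x.
Proof.
by rewrite /flat; case: ifP => // _; rewrite expr0 mul1r expR_ge0.
Qed.

Lemma flat0_gt0 x : 0 < x -> 0 < flat 0 x.
Proof. by move=> x0; rewrite flat_pos// expr0 mul1r expR_gt0. Qed.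

Lemma step1 t : t <= 1 -> step t = 1.
Proof.
move=> t1; rewrite /step (@flat_npos 0 (t - 1)) ?subr_le0// addr0 mulfV// gt_eqF// flat0_gt0//; lra.
Qed.

Lemma step0 t : 2 <= t -> step t = 0.
Proof. by move=> t2; rewrite /step flat_npos ?mul0r// subr_le0. Qed.

Lemma smooth_step : smooth_on (fun _ : unit => 1 : R) setT step.
Proof.
have id_s : smooth_on (fun _ : unit => 1 : R) setT (fun t : R => t).
  by apply: smooth_on_linear => // t; exact: cvg_id.
have cs (c : R) : smooth_on (fun _ : unit => 1 : R) setT (fun _ : R => c) by exact: smooth_on_cst.
have s1 : smooth_on (fun _ : unit => 1 : R) setT (fun t => flat 0 (2 - t)).
  exact: (smooth_on_comp openT (smooth_flat (U := setT) 0)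
    (smooth_on_add openT (cs 2) (smooth_on_opp openT id_s))).
have s2 : smooth_on (fun _ : unit => 1 : R) setT (fun t => flat 0 (t - 1)).
  exact: (smooth_on_comp openT (smooth_flat (U := setT) 0) (smooth_on_add openT id_s (cs (-1)))).
apply: (smooth_on_mul openT s1 (smooth_on_inv openT _ (smooth_on_add openT s1 s2))) => t _.
rewrite gt_eqF//; have [t2|t2] := ltP t 2.
  by apply: ltr_wpDr; [exact: flat0_ge0|apply: flat0_gt0; rewrite subr_gt0].
by apply: ltr_wpDl; [exact: flat0_ge0|apply: flat0_gt0; lra].
Qed.

End Bump.

(** Induction over compact sets. It builds cutoff functions without a partition of unity and passes
    from local to uniform estimates. *)
Lemma compact_local_ind {R : realType} (V : normedModType R) (A : set V) (P : set V -> Prop) :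
  compact A -> P set0 -> (forall B D, P B -> P D -> P (B `|` D)) ->
  (forall B D, B `<=` D -> P D -> P B) ->
  (forall x, A x -> exists2 N, nbhs x N & P N) -> P A.
Proof.
move=> cA P0 PU PS PN.
have /choice[N HN] : forall x, exists N, A x -> nbhs x N /\ P N.
  move=> x; have [Ax|Ax] := pselect (A x); last by exists set0.
  by have [N n1 n2] := PN x Ax; exists N.
rewrite compact_cover in cA.
have [x Ax|x Ax|D DA cov] := cA V A (fun x => (N x)^°).
- exact: open_interior.
- by exists x => //; have [n1 _] := HN x Ax.
have sub : A `<=` \bigcup_(x in [set` finmap.enum_fset D]) (N x).
  by move=> y /cov[x Dx Nx]; exists x => //; exact: interior_subset Nx.
have PD x : x \in finmap.enum_fset D -> P (N x).
  by move=> xD; have /set_mem Ax := DA x xD; have [] := HN x Ax.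
have S : P (\bigcup_(x in [set` finmap.enum_fset D]) (N x)).
  elim: (finmap.enum_fset D) PD => [|x l IH] PD; first by apply: PS P0 => y [x].
  have sub' : \bigcup_(z in [set` x :: l]) (N z) `<=` N x `|` \bigcup_(z in [set` l]) (N z).
    move=> y [z /=]; rewrite inE => /orP[/eqP->|zl] Nz; first by left.
    by right; exists z.
  apply: PS sub' (PU _ _ (PD x (mem_head _ _)) (IH _)).
  by move=> z zl; apply: PD; rewrite inE zl orbT.
exact: PS sub S.
Qed.

(** * Cutoff functions *)

Section Cutoff.
Context {R : realType} {n : nat} (Omega : set 'rV[R]_n) (oO : open Omega).

Lemma smooth_cutoff (S : set 'rV[R]_n) : compact_in Omega S ->
  exists (psi : 'rV[R]_n -> R) (O K : set 'rV[R]_n),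
    [/\ smooth_on std setT psi, open O /\ S `<=` O,
        forall y, O y -> psi y = 1, compact_in Omega K &
        forall y, ~ K y -> psi y = 0].
Proof.
move=> [cS SO].
pose P A := exists (psi : 'rV[R]_n -> R) (O K : set 'rV[R]_n),
    [/\ smooth_on std setT psi, open O /\ A `<=` O,
        forall y, O y -> psi y = 1, compact_in Omega K &
        forall y, ~ K y -> psi y = 0].
apply: (@compact_local_ind R _ S P cS).
- exists (fun=> 0), set0, set0; split=> //; first exact: smooth_on_cst.
    by split; [exact: open0|].
  by split; [exact: compact0|].
- move=> A B [f [OA [KA [sf [oA AO] f1 [cKA KAO] f0]]]] [g [OB [KB [sg [oB BO] g1 [cKB KBO] g0]]]].
  (* This is 1 - (1 - f) (1 - g): it equals 1 wherever f or g does, and 0 where both vanish. *)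
  exists (fun y => f y + g y + - (f y * g y)), (OA `|` OB), (KA `|` KB); split.
  + exact: (smooth_on_add openT (smooth_on_add openT sf sg) (smooth_on_opp openT (smooth_on_mul openT sf sg))).
  + by split; [exact: openU|move=> y [/AO|/BO] h; [left|right]].
  + by move=> y [/f1|/g1] ->; rewrite ?mul1r ?mulr1; lra.
  + by split; [exact: compactU|move=> y [/KAO|/KBO]].
  + move=> y Ky; have Ka : ~ KA y by move=> h; apply: Ky; left.
    have Kb : ~ KB y by move=> h; apply: Ky; right.
    by rewrite (f0 y Ka) (g0 y Kb) mul0r subr0 addr0.
- move=> A B AB [f [OB [KB [sf [oB BO] f1 cKB f0]]]].
  by exists f, OB, KB; split=> //; split=> // y /AB /BO.
move=> x Sx; have [K [[cK KO] nK]] := compact_nbhs_rV oO (SO x Sx).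
have [r r0 bK] : exists2 r, 0 < r & forall z, ball x r z -> K z.
  by move/nbhs_ballP: nK => [r r0 h]; exists r.
(* With f = |y - x|^2 / q the function [step] is 1 for f <= 1 and 0 for f >= 2. As 2 q = r^2 / 2 <
   r^2, the support stays in the ball of radius r. *)
pose q : R := (r / 2) ^+ 2; have q0 : 0 < q by rewrite exprn_gt0// divr_gt0.
pose f (y : 'rV[R]_n) : R := q^-1 * \sum_(j < n) (y 0 j - x 0 j) * (y 0 j - x 0 j).
have fE y : f y = q^-1 * enorm (y - x) ^+ 2.
  by rewrite /f enorm_sqr; congr (_ * _); apply: eq_bigr => j _; rewrite expr2 !mxE.
have sf : smooth_on std setT f.
  have sc j : smooth_on (@std R n) setT (fun y : 'rV[R]_n => y 0 j).
    apply: smooth_on_linear; first by move=> h u w; rewrite !mxE.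
    exact: coord_continuous.
  have sd j : smooth_on (@std R n) setT (fun y : 'rV[R]_n => y 0 j - x 0 j).
    by apply: smooth_on_add openT (sc j) _; exact: smooth_on_cst.
  apply: smooth_on_mul openT _ _; first exact: smooth_on_cst.
  by apply: smooth_on_sum openT _ => j; exact: smooth_on_mul openT (sd j) (sd j).
have cf : continuous f by move=> y; exact: (smooth_on_cont sf (I : setT y)).
exists [set y | f y < 1].
  apply: open_nbhs_nbhs; split.
    by apply: (@open_comp _ _ f [set t | t < 1]) => [y _|]; [exact: cf|exact: open_lt].
  by rewrite /= fE subrr enorm0 expr0n mulr0.
exists (step \o f), [set y | f y < 1], K; split.
- exact: smooth_on_comp openT smooth_step sf.
- split=> //; apply: (@open_comp _ _ f [set t | t < 1]) => [y _|]; [exact: cf|exact: open_lt].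
- by move=> y /ltW; exact: step1.
- by split.
move=> y Ky; apply: step0; rewrite fE leNgt; apply/negP => h; apply: Ky; apply: bK.
rewrite -ball_normE /= distrC.
have e2 : enorm (y - x) ^+ 2 < r ^+ 2.
  have : enorm (y - x) ^+ 2 < q * 2 by rewrite -ltr_pdivrMl.
  move/lt_trans; apply; rewrite /q expr_div_n.
  have rr : 0 < r ^+ 2 by rewrite exprn_gt0.
  by move: (r ^+ 2) rr => t t0; rewrite (_ : 2 ^+ 2 = 4); lra.
have e1 : enorm (y - x) < r.
  by rewrite -(@ltr_pXn2r _ 2)// ?nnegrE ?enorm_ge0 ?(ltW r0).
apply: le_lt_trans e1; rewrite [leLHS]mx_normrE; apply/bigmax_leP; split=> [|[i j] _ /=].
  exact: enorm_ge0.
by rewrite (ord1 i); exact: coord_le_enorm.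
Qed.

End Cutoff.

(** * Nets of smooth functions in terms of words *)

Section SmoothNets.
Context {R : realType} {n : nat}.
Local Notation C := R[i].
Local Notation V := 'rV[R]_n.
Implicit Types (O L : set V) (u v w : net R V).

Lemma Cinf_seminorm_ge0 L k (f : V -> C) : (0 <= Cinf_seminorm L k f)%E.
Proof. exact: sup0_ge0. Qed.

Lemma Cinf_word_ub O L k (f : V -> C) t y : open O -> csmooth_on std O f -> L `<=` O ->
  (size t <= k)%N -> L y -> ((normc (cword_deriv std t f y))%:E <= Cinf_seminorm L k f)%E.
Proof.
move=> oO sf LO tk Ly; apply: sup0_ub; exists y, (fun i => count_mem i t).
by split=> //; [rewrite sum_count_mem|rewrite (multi_cderiv_word t oO sf (LO y Ly))].
Qed.

Lemma Cinf_le L k (f : V -> C) (M : R) : 0 <= M ->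
  (forall t y, (size t <= k)%N -> L y -> normc (cword_deriv std t f y) <= M) ->
  (Cinf_seminorm L k f <= M%:E)%E.
Proof.
move=> M0 H; apply: sup0_le; first by rewrite lee_fin.
move=> _ [y [alpha [Ly sa ->]]]; rewrite lee_fin multi_cderivE; apply: H => //.
rewrite size_flatten /shape -map_comp sumnE big_map (eq_bigr alpha) ?big_enum//.
by move=> i _ /=; rewrite size_nseq.
Qed.

Definition word_bounded O (Q : (R -> R) -> Prop) u :=
  (forall e : @epsdom R, csmooth_on std O (u (epsval e))) /\
  forall L k, compact_in O L -> exists A, Q A /\ forall (e : epsdom) t y,
    (size t <= k)%N -> L y -> normc (cword_deriv std t (u (epsval e)) y) <= A (epsval e).

Lemma word_bounded_sizes O u L k (e : @epsdom R) t y : open O -> in_space (Cinf O) u ->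
  compact_in O L -> (size t <= k)%N -> L y ->
  normc (cword_deriv std t (u (epsval e)) y) <=
    sizes (fun t => Cinf_seminorm L k (u t)) (epsval e).
Proof.
move=> oO su cL tk Ly; have sf := su _ (epsval01 e).
apply: le_sizes.
- by move=> e'; exact: Cinf_seminorm_ge0.
- exact: epsval01.
- have [M M0 H] := compact_word_bound cL k sf.
  exact: le_lt_trans (Cinf_le M0 H) (ltry _).
- exact: (Cinf_word_ub oO sf cL.2 tk Ly).
Qed.

Lemma powO_bigO (q : R -> \bar R) A b : powO A b ->
  (forall e, 0 < e <= 1 -> (q e <= (A e)%:E)%E) -> bigO_eps q b.
Proof.
move=> [M HM] qA; exists M; near=> e.
have e01 : 0 < e <= 1 by near: e; exact: near0_unit.
apply: (le_trans (qA e e01)); rewrite lee_fin; near: e; exact: HM.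
Unshelve. all: by end_near. Qed.

Lemma in_spaceP O u : in_space (Cinf O) u <-> forall e : @epsdom R, csmooth_on std O (u (epsval e)).
Proof.
split=> [su e|su e e01]; first exact: su _ (epsval01 e).
exact: (su (exist _ e e01)).
Qed.

Lemma word_bounded_seminorm u L k A : (forall t, 0 <= A t) ->
  (forall (e : @epsdom R) t y, (size t <= k)%N -> L y ->
    normc (cword_deriv std t (u (epsval e)) y) <= A (epsval e)) ->
  forall e, 0 < e <= 1 -> (Cinf_seminorm L k (u e) <= (A e)%:E)%E.
Proof. by move=> A0 H e e01; apply: Cinf_le => // t y; exact: (H (exist _ e e01)). Qed.

Lemma moderateP O u : open O -> moderate (Cinf O) u <-> word_bounded O tempered u.
Proof.
move=> oO; split=> [[su mu]|[su wu]].
  split=> [|L k cL]; first by apply/in_spaceP.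
  exists (sizes (fun t => Cinf_seminorm L k (u t))); split.
    apply: tempered_sizes; first by move=> e; exact: Cinf_seminorm_ge0.
    by apply: mu; exists L, k.
  by move=> e t y tk Ly; exact: (word_bounded_sizes e oO su cL tk Ly).
split=> [|q [L [k [cL ->]]]]; first by apply/in_spaceP.
have [A [[A0 [N AN]] HA]] := wu L k cL; exists N.
exact: powO_bigO AN (word_bounded_seminorm A0 HA).
Qed.

Lemma negligibleP O u : open O -> Defs.negligible (Cinf O) u <-> word_bounded O rapid u.
Proof.
move=> oO; split=> [[su mu]|[su wu]].
  split=> [|L k cL]; first by apply/in_spaceP.
  exists (sizes (fun t => Cinf_seminorm L k (u t))); split.
    apply: rapid_sizes; first by move=> e; exact: Cinf_seminorm_ge0.
    by apply: mu; exists L, k.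
  by move=> e t y tk Ly; exact: (word_bounded_sizes e oO su cL tk Ly).
split=> [|q [L [k [cL ->]]] N]; first by apply/in_spaceP.
have [A [[A0 AN] HA]] := wu L k cL.
exact: powO_bigO (AN N) (word_bounded_seminorm A0 HA).
Qed.

(** Sums, differences and multiples by a moderate net of scalars are all of the form l u + v. *)
Lemma word_bounded_lin O (Q : (R -> R) -> Prop) (l : R -> C) T u v w : open O ->
  (forall A B, Q A -> Q B -> Q (fun t => A t + B t)) ->
  (forall A, Q A -> Q (fun t => T t * A t)) -> (forall A, Q A -> forall t, 0 <= A t) ->
  (forall t, 0 < t <= 1 -> normc (l t) <= T t) ->
  (forall t y, 0 < t <= 1 -> O y -> w t y = l t * u t y + v t y) ->
  word_bounded O Q u -> word_bounded O Q v -> word_bounded O Q w.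
Proof.
move=> oO QD QM Q0 lT wE [su wu] [sv wv].
have E (e : @epsdom R) y : O y -> l (epsval e) * u (epsval e) y + v (epsval e) y = w (epsval e) y.
  by move=> Oy; rewrite (wE _ _ (epsval01 e) Oy).
split=> [e|L k cL].
  exact: (csmooth_on_eq oO (E e) (csmooth_lin (l (epsval e)) oO (su e) (sv e))).
have [A [QA HA]] := wu L k cL; have [B [QB HB]] := wv L k cL.
exists (fun t => T t * A t + B t); split; first exact: QD (QM _ QA) QB.
move=> e t y tk Ly; have Oy := cL.2 y Ly.
rewrite -(cword_deriv_eq std t oO (E e) Oy) (cword_lin _ t oO (su e) (sv e) Oy).
apply: (le_trans (le_normcD _ _)); apply: lerD; last exact: HB.
rewrite normcM; apply: ler_pM; rewrite ?normc_ge0//; last exact: HA.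
exact: lT (epsval01 e).
Qed.

Lemma rapid_bounded_lin O (l : R -> C) T u v w : open O -> tempered T ->
  (forall t, 0 < t <= 1 -> normc (l t) <= T t) ->
  (forall t y, 0 < t <= 1 -> O y -> w t y = l t * u t y + v t y) ->
  word_bounded O rapid u -> word_bounded O rapid v -> word_bounded O rapid w.
Proof.
move=> oO tT; apply: word_bounded_lin => //; first exact: rapid_add.
  by move=> A; exact: rapid_mul.
by move=> A [].
Qed.

Lemma tempered_bounded_lin O (l : R -> C) T u v w : open O -> tempered T ->
  (forall t, 0 < t <= 1 -> normc (l t) <= T t) ->
  (forall t y, 0 < t <= 1 -> O y -> w t y = l t * u t y + v t y) ->
  word_bounded O tempered u -> word_bounded O tempered v -> word_bounded O tempered w.
Proof.
move=> oO tT; apply: word_bounded_lin => //; first exact: tempered_add.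
  by move=> A; exact: tempered_mul.
by move=> A [].
Qed.

Lemma rapid_bounded_sub O u v w : open O ->
  (forall t y, 0 < t <= 1 -> O y -> w t y = u t y - v t y) ->
  word_bounded O rapid u -> word_bounded O rapid v -> word_bounded O rapid w.
Proof.
move=> oO wE wu wv.
apply: (@rapid_bounded_lin O (fun=> -1) (fun=> 1) v u w oO (tempered_cst ler01)) => //.
  by move=> t _; rewrite normcN normc1.
by move=> t y t01 Oy; rewrite wE// mulN1r addrC.
Qed.

Lemma word_boundedS O O' Q u : open O' -> O' `<=` O -> word_bounded O Q u -> word_bounded O' Q u.
Proof.
move=> oO' OO [su wu]; split=> [e|L k [cL LO]]; first exact: csmooth_on_sub OO (su e).
by apply: wu; split=> // y /LO /OO.
Qed.

(** The bounds in [nrel] depend on the word. As I is finite, those for the words of length at most k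
    can be added up. *)
Lemma nrel_uniform_words (E : Type) (eps : E -> R) (I : finType) (W : normedModType R)
    (e_ : I -> W) (KK : set (set W)) (J : W -> R) k mu (f g : E -> W -> C) (L : set W) :
  nrel eps e_ (fun=> 0) KK J k mu f g -> KK L ->
  exists B, rapid B /\ forall s e y, (size s <= k)%N -> L y ->
    normc (cword_deriv e_ s (f e) y - cword_deriv e_ s (g e) y) <= B (eps e) * J y `^ mu.
Proof.
move=> + KL; elim: k f g => [|k IH] f g r.
  have [A [B [tA rB H]]] := rel_bound r KL; exists B; split=> // -[|//] e y _ Ly.
  by have [] := H e y Ly.
have [A [B [tA rB H]]] := rel_bound r KL.
have /choice[B' HB'] := fun i => IH (nderiv e_ i f) (nderiv e_ i g)
  (let: conj _ d := r in eq_rect _ (fun z => nrel eps e_ (fun=> 0) KK J k z _ _) (d i) _ (addr0 mu)).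
have rB' i : rapid (B' i) by have [] := HB' i.
have B'0 t : 0 <= \sum_i B' i t by apply: sumr_ge0 => i _; exact: (rB' i).1.
have leB i t : B' i t <= \sum_i B' i t.
  by rewrite (bigD1 i)//= lerDl; apply: sumr_ge0 => j _; exact: (rB' j).1.
exists (fun t => B t + \sum_i B' i t); split; first by apply: rapid_add => //; exact: rapid_sum.
move=> s e y; case/lastP: s => [_ Ly|s i].
  have [_ _ h] := H e y Ly; apply: (le_trans h); rewrite ler_wpM2r ?powR_ge0//.
  by rewrite lerDl.
rewrite size_rcons ltnS !cword_deriv_rcons => sk Ly.
have [_ h] := HB' i; apply: (le_trans (h s e y sk Ly)); rewrite ler_wpM2r ?powR_ge0//.
by rewrite (le_trans (leB i _))// lerDr; exact: rB.1.
Qed.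

Lemma rapid_bounded_mul O (g : V -> C) u w : open O -> csmooth_on std O g ->
  (forall (t : R) y, O y -> w t y = g y * u t y) ->
  word_bounded O rapid u -> word_bounded O rapid w.
Proof.
move=> oO sg wE [su wu].
have E (e : @epsdom R) y : O y -> g y * u (epsval e) y = w (epsval e) y by move=> Oy; rewrite wE.
split=> [e|L k cL].
  exact: (csmooth_on_eq oO (E e) (csmooth_on_mul oO sg (su e))).
(* With the constant weight 1 the calculus of symbols becomes a calculus of plain bounds on compact
   sets, and the product rule needs no second proof. *)
pose J (_ : V) : R := 1.
have J1 y : O y -> 1 <= J y by [].
have KD (L' : set V) : compact_in O L' -> L' `<=` O by case.
have s0 := nsmooth_cst (@std R n) O (fun _ : @epsdom R => 0 : C).
have JJ (b : R) y : J y `^ b = 1 by rewrite /J powR1.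
have ru : nrel (@epsval R) (@std R n) (fun=> 0) (compact_in O) J k 0 (fun e => u (epsval e)) (fun _ _ => 0).
  apply: rel_words => s sk L' cL'; have [A [rA HA]] := wu L' k cL'.
  exists A, A; split=> //; first exact: rapid_tempered.
  move=> e y Ly; rewrite JJ mulr1.
  have -> : cword_deriv std s (fun=> 0) y = 0 :> C.
    by elim: (s) (y) => //= i t'' IH y'; rewrite (cderiv_eq (g := fun=> 0) _ openT)// cderiv_cst.
  by rewrite subr0 normc0; split; [exact: HA|exact: rA.1|exact: HA].
have rg : nrel (@epsval R) (@std R n) (fun=> 0) (compact_in O) J k 0 (fun _ => g) (fun _ => g).
  apply: rel_words => s sk L' cL'; have [M M0 HM] := compact_word_bound cL' k sg.
  exists (fun=> M), (fun=> 0); split; [exact: tempered_cst|exact: rapid0|].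
  by move=> e y Ly; rewrite JJ mulr1 subrr normc0 mul0r; split=> //; exact: HM.
have rm := rel_mul oO KD J1 (fun=> sg) (fun=> sg) su s0 rg ru.
have [B [rB HB]] := nrel_uniform_words rm cL.
exists B; split=> // e t y tk Ly; have Oy := cL.2 y Ly.
have := HB t e y tk Ly; rewrite JJ mulr1.
have -> : cword_deriv std t (fun y => g y * 0) y = 0 :> C.
  have -> : (fun y => g y * 0) = fun=> 0 by apply/funext => z; rewrite mulr0.
  by elim: (t) (y) => //= i t'' IH y'; rewrite (cderiv_eq (g := fun=> 0) _ openT)// cderiv_cst.
by rewrite subr0 (cword_deriv_eq std t oO (E e) Oy).
Qed.

Lemma coset_sub_bounded O (u0 u v : net R V) : open O ->
  coset (Cinf O) u0 u -> coset (Cinf O) u0 v ->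
  word_bounded O rapid (fun t y => u t y - v t y).
Proof.
move=> oO /(negligibleP _ oO) hu /(negligibleP _ oO) hv.
apply: (rapid_bounded_sub oO _ hu hv) => t y _ _.
rewrite -[(u - u0) t y]/(u t y - u0 t y) -[(v - u0) t y]/(v t y - u0 t y).
by rewrite opprB addrA subrK.
Qed.

Section CompactSupport.
Context (Omega : set V) (oO : open Omega).

(* Off the support u has a negligible representative near every point, and
   the cutoff equals 1 near the support. *)
Lemma compact_representative (u : G Omega) : compact (gsupp u) ->
  exists u_ K, [/\ (u : set (net R V)) u_, compact_in Omega K & supported_in Omega K u_].
Proof.
move=> cS; have SO : gsupp u `<=` Omega by move=> x [].
have [psi [U1 [K [spsi [opO SO1] psi1 cK psi0]]]] := smooth_cutoff oO (conj cS SO).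
have [u0 mu0 uE] : exists2 u0, moderate (Cinf Omega) u0 & (u : set (net R V)) = coset (Cinf Omega) u0.
  by clear; case: u => A [u0 m0 E]; exists u0.
have mu := (moderateP _ oO).1 mu0.
have m00 : word_bounded Omega rapid (fun t y => u0 t y - u0 t y).
  split=> [e|L k cL].
    apply: (csmooth_on_eq (f := fun=> 0) oO _ (csmooth_on_cst std Omega 0)) => y _.
    by rewrite subrr.
  exists (fun=> 0); split; [exact: rapid0|move=> e t y _ _].
  have -> : (fun y => u0 (epsval e) y - u0 (epsval e) y) = fun=> 0.
    by apply/funext => z; rewrite subrr.
  have -> : cword_deriv std t (fun=> 0) y = 0 :> C.
    by elim: (t) (y) => //= i t'' IH y'; rewrite (cderiv_eq (g := fun=> 0) _ openT)// cderiv_cst.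
  by rewrite normc0.
have uu0 : (u : set (net R V)) u0.
  by rewrite uE; apply/(negligibleP _ oO).
pose g (y : V) : C := (psi y)%:C%C - 1.
have sg U : open U -> csmooth_on (@std R n) U g.
  move=> oU; apply: csmooth_on_add oU _ (csmooth_on_cst _ _ (-1)).
  apply: csmooth_on_real; exact: smooth_on_sub spsi.
pose u_ : net R V := fun t y => (psi y)%:C%C * u0 t y.
exists u_, K; split=> //; last first.
  by move=> e _ x _ Kx; rewrite /u_ psi0// mul0r.
rewrite uE; apply/(negligibleP _ oO).
pose w t y := g y * u0 t y.
have wE : u_ - u0 = w.
  apply/funext => t; apply/funext => y; rewrite -[LHS]/((psi y)%:C%C * u0 t y - u0 t y).
  by rewrite /w /g mulrBl mul1r.
rewrite wE; split=> [e|L k cL].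
  exact: (csmooth_on_mul oO (sg _ oO) (mu.1 e)).
pose P A := exists B, rapid B /\ forall (e : @epsdom R) t y, (size t <= k)%N -> A y -> Omega y ->
  normc (cword_deriv std t (w (epsval e)) y) <= B (epsval e).
suff [B [rB HB]] : P L by exists B; split=> // e t y tk Ly; exact: HB tk Ly (cL.2 y Ly).
apply: (@compact_local_ind R _ L P cL.1).
- by exists (fun=> 0); split; [exact: rapid0|].
- move=> A1 A2 [B1 [r1 H1]] [B2 [r2 H2]]; exists (fun t => B1 t + B2 t).
  split; first exact: rapid_add.
  move=> e t y tk [Ay|Ay] Oy.
    by apply: (le_trans (H1 e t y tk Ay Oy)); rewrite lerDl; exact: r2.1.
  by apply: (le_trans (H2 e t y tk Ay Oy)); rewrite lerDr; exact: r1.1.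
- by move=> A1 A2 AA [B [rB H]]; exists B; split=> // e t y tk /AA Ay; exact: H.
move=> x Lx; have Ox := cL.2 x Lx; have [Sx|Sx] := pselect (gsupp u x).
  exists U1; first exact: open_nbhs_nbhs (conj opO (SO1 x Sx)).
  exists (fun=> 0); split; [exact: rapid0|move=> e t y _ Oy _].
  have w0 z : U1 z -> w (epsval e) z = (fun=> 0) z by move=> Oz; rewrite /w /g psi1// subrr mul0r.
  rewrite (cword_deriv_eq std t opO w0 Oy).
  have -> : cword_deriv std t (fun=> 0) y = 0 :> C.
    by elim: (t) (y) => //= i t'' IH y'; rewrite (cderiv_eq (g := fun=> 0) _ openT)// cderiv_cst.
  by rewrite normc0.
have [W [oW WO Wx [v uv nv]]] : exists W : set V, [/\ open W, W `<=` Omega, W x &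
    exists2 v, (u : set (net R V)) v & Defs.negligible (Cinf W) v].
  by apply: contrapT => h; apply: Sx; split.
have [N [cN nN]] := compact_nbhs_rV oW Wx; exists N => //.
have uv' : coset (Cinf Omega) u0 v by rewrite -uE.
have uu' : coset (Cinf Omega) u0 u0 by rewrite -uE.
have d1 := word_boundedS oW WO (coset_sub_bounded oO uv' uu').
have bu : word_bounded W rapid u0.
  apply: (rapid_bounded_sub oW _ ((negligibleP _ oW).1 nv) d1) => t y _ _.
  by rewrite opprB addrCA subrr addr0.
have [_ /(_ N k cN)[B [rB HB]]] := rapid_bounded_mul oW (sg _ oW) (fun t y _ => erefl (w t y)) bu.
by exists B; split=> // e t y tk Ny _; exact: HB.
Qed.

End CompactSupport.

End SmoothNets.

(** * Continuity of the operator *)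

Lemma cword_deriv0 {R : realType} (V : normedModType R) (I : Type) (e : I -> V) s :
  cword_deriv e s (fun=> 0) = fun=> 0 :> R[i].
Proof. by elim: s => //= i s ->; apply/funext => w; exact: cderiv_cst. Qed.

Section Ultranorm.
Context {R : realType}.
Local Notation C := R[i].

(** The supremum in the valuation need not be attained, but a strict inequality is witnessed by one
    representative and one exponent. All reasoning on ultraballs goes through such witnesses. *)
Lemma ultranorm_lt (T : Type) (q : (T -> C) -> \bar R) (S : set (net R T)) (r : R) : 0 < r ->
  (ultranorm q S < r%:E)%E <->
  exists s b, [/\ S s, bigO_eps (fun e => q (s e)) b & expR (- b) < r].
Proof.
move=> r0; rewrite /ultranorm; split=> [h|[s [b [Ss sb br]]]].
  apply: contrapT => H; move: h; apply/negP; rewrite -leNgt.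
  have le : (valuation q S <= (- ln r)%:E)%E.
    apply: ge_ereal_sup => _ [b [s Ss sb] <-]; rewrite lee_fin leNgt; apply/negP => rb.
    apply: H; exists s, b; split=> //.
    by rewrite -[ltRHS](lnK (x := r)) ?posrE// ltr_expR ltrNl.
  have le' : ((ln r)%:E <= - valuation q S)%E by rewrite leeNr -EFinN.
  have -> : r%:E = expeR (ln r)%:E by rewrite /= lnK ?posrE.
  by rewrite lee_expeR.
have le : (b%:E <= valuation q S)%E.
  by apply: ereal_sup_ubound; exists b => //; exists s.
have le' : (- valuation q S <= (- b)%:E)%E by rewrite EFinN leeN2.
apply: (@le_lt_trans _ _ (expeR (- b)%:E)); first by rewrite lee_expeR.
by rewrite /= lte_fin.
Qed.

End Ultranorm.

(** * Neighbourhoods in topologies given by subbases *)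

Section Subbase.
Context {R : realType}.

Lemma colombeau_nbhs (T : Type) (E : lcspace R T) (y : colombeau E) (W : set (colombeau E)) :
  nbhs y W -> exists F : {fset (set (colombeau E))},
    {subset F <= @ultraballs R T E} /\
    (\bigcap_(B in [set` F]) B) y /\ \bigcap_(B in [set` F]) B `<=` W.
Proof.
rewrite nbhsE => -[B [[D DF <-] [S DS Sy]] BW].
have [F FU FS] := DF S DS; exists F; split=> //; split; first by rewrite FS.
by move=> z Fz; apply: BW; exists S => //; rewrite -FS.
Qed.

Lemma indlim_nbhs n (Omega : set 'rV[R]_n) Kex (u : Gc Omega Kex) B :
  @indlim_subbase R n Omega Kex B -> B u -> nbhs u B.
Proof.
move=> sB Bu; apply: open_nbhs_nbhs; split=> //.
exists [set B]; last by rewrite bigcup_set1.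
move=> _ ->; exists [fset B]%fset; first by move=> S /fset1P ->; exact: mem_set.
by rewrite bigcap_fset big_seq_fset1.
Qed.

(** Finite intersections are dealt with here once, so that continuity reduces to a single
    ultraball. *)
Lemma continuous_subbase (T : Type) (E : lcspace R T) n (Omega : set 'rV[R]_n) Kex
    (f : Gc Omega Kex -> colombeau E) :
  (forall u B, @ultraballs R T E B -> B (f u) -> exists2 D, @indlim_subbase R n Omega Kex D &
     D u /\ D `<=` f @^-1` B) -> continuous f.
Proof.
move=> H u W /colombeau_nbhs[F [FU [Fy FW]]].
apply: (@filterS _ (nbhs u) _ (\bigcap_(B in [set` F]) (f @^-1` B))).
  by move=> v Fv; apply: FW => B FB; exact: Fv.
apply: filter_bigI => B FB.
have [D sD [Du DB]] := H u B (set_mem (FU B FB)) (Fy B FB).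
exact: filterS DB (indlim_nbhs sD Du).
Qed.

End Subbase.

Section SeminormEstimates.
Context {R : realType} {n : nat}.
Local Notation C := R[i].
Local Notation V := 'rV[R]_n.

(** Both the ultrametric triangle inequality, with l = 1 and c = 0, and the additivity of exponents
    under scaling, with g = 0, are instances. *)
Lemma bigO_lin (O : set V) L k (l : R -> C) (f g h : net R V) (c b1 b2 b : R) : open O -> L `<=` O ->
  in_space (Cinf O) f -> in_space (Cinf O) g ->
  (forall t y, 0 < t <= 1 -> O y -> h t y = l t * f t y + g t y) ->
  (exists M : R, \forall t \near 0^'+, normc (l t) <= M * t `^ c) ->
  bigO_eps (fun t => Cinf_seminorm L k (f t)) b1 ->
  bigO_eps (fun t => Cinf_seminorm L k (g t)) b2 -> b <= c + b1 -> b <= b2 ->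
  bigO_eps (fun t => Cinf_seminorm L k (h t)) b.
Proof.
move=> oO LO sf sg hE [M HM] [M1 H1] [M2 H2] bc b2b.
exists (`|M| * `|M1| + `|M2|); near=> t.
have t01 : 0 < t <= 1 by near: t; exact: near0_unit.
have t0 : 0 < t by case/andP: t01.
have lM : normc (l t) <= M * t `^ c by near: t.
have f1 : (Cinf_seminorm L k (f t) <= (M1 * t `^ b1)%:E)%E by near: t.
have g1 : (Cinf_seminorm L k (g t) <= (M2 * t `^ b2)%:E)%E by near: t.
apply: Cinf_le; first by rewrite mulr_ge0 ?powR_ge0// addr_ge0// mulr_ge0.
move=> s y sk Ly; have Oy := LO y Ly.
rewrite (cword_deriv_eq std s oO (fun z Oz => hE t z t01 Oz) Oy).
rewrite (cword_lin (l t) s oO (sf t t01) (sg t t01) Oy).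
have wf := le_trans (Cinf_word_ub oO (sf t t01) LO sk Ly) f1.
have wg := le_trans (Cinf_word_ub oO (sg t t01) LO sk Ly) g1.
rewrite lee_fin in wf; rewrite lee_fin in wg.
apply: (le_trans (le_normcD _ _)); rewrite normcM mulrDl.
have tle x x' : x <= x' -> t `^ x' <= t `^ x by apply: ger_powR.
apply: lerD.
  apply: (@le_trans _ _ ((`|M| * t `^ c) * (`|M1| * t `^ b1))).
    apply: ler_pM; rewrite ?normc_ge0//.
      by apply: (le_trans lM); rewrite ler_wpM2r ?powR_ge0// ler_norm.
    by apply: (le_trans wf); rewrite ler_wpM2r ?powR_ge0// ler_norm.
  rewrite mulrACA -powRD; last by rewrite (gt_eqF t0) implybT.
  by rewrite ler_wpM2l ?mulr_ge0// tle.
apply: (le_trans wg); apply: (@le_trans _ _ (`|M2| * t `^ b2)).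
  by rewrite ler_wpM2r ?powR_ge0// ler_norm.
by rewrite ler_wpM2l// tle.
Unshelve. all: by end_near. Qed.

End SeminormEstimates.

Section C0Nets.
Context {R : realType} {n : nat} (O : set 'rV[R]_n) (oO : open O).
Implicit Types u v : net R 'rV[R]_n.

Lemma negligible_C0_add u v : Defs.negligible (C0 O) u -> Defs.negligible (C0 O) v ->
  Defs.negligible (C0 O) (u + v).
Proof.
move=> [su nu] [sv nv]; split=> [e e01 x Ox|q [L cL ->] N].
  have [c1 c2] := su e e01 x Ox; have [d1 d2] := sv e e01 x Ox.
  split.
    rewrite (_ : _ \o _ = fun x => complex.Re (u e x) + complex.Re (v e x)); first exact: continuousD c1 d1.
    by apply/funext => y; exact: ReD.
  rewrite (_ : _ \o _ = fun x => complex.Im (u e x) + complex.Im (v e x)); first exact: continuousD c2 d2.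
  by apply/funext => y; exact: ImD.
have [M1 H1] := nu _ (ex_intro2 _ _ L cL erefl) N.
have [M2 H2] := nv _ (ex_intro2 _ _ L cL erefl) N.
exists (`|M1| + `|M2|); near=> e.
have u1 : (Defs.sup0 [set (normc (u e x))%:E | x in L] <= (M1 * e `^ N%:R)%:E)%E by near: e.
have v1 : (Defs.sup0 [set (normc (v e x))%:E | x in L] <= (M2 * e `^ N%:R)%:E)%E by near: e.
apply: sup0_le => [|_ [x Lx <-]]; rewrite lee_fin; first by rewrite mulr_ge0 ?powR_ge0 ?addr_ge0.
have u2 : ((normc (u e x))%:E <= (M1 * e `^ N%:R)%:E)%E.
  by apply: le_trans u1; apply: sup0_ub; exists x.
have v2 : ((normc (v e x))%:E <= (M2 * e `^ N%:R)%:E)%E.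
  by apply: le_trans v1; apply: sup0_ub; exists x.
rewrite !lee_fin in u2 v2; apply: (le_trans (le_normcD _ _)); rewrite mulrDl.
by apply: lerD; [apply: (le_trans u2)|apply: (le_trans v2)]; rewrite ler_wpM2r ?powR_ge0// ler_norm.
Unshelve. all: by end_near. Qed.

Lemma negligible_Cinf_C0 u : Defs.negligible (Cinf O) u -> Defs.negligible (C0 O) u.
Proof.
move=> [su nu]; split=> [e e01 x Ox|q [L cL ->] N].
  exact: (continuous_csmooth (su e e01) Ox).
have [M H] := nu _ (ex_intro _ L (ex_intro _ 0%N (conj cL erefl))) N.
exists M; near=> e.
have e01 : 0 < e <= 1 by near: e; exact: near0_unit.
have h : (Cinf_seminorm L 0 (u e) <= (M * e `^ N%:R)%:E)%E by near: e.
apply: sup0_le; first exact: le_trans (Cinf_seminorm_ge0 _ _ _) h.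
move=> _ [x Lx <-]; apply: le_trans h.
exact: (Cinf_word_ub (t := [::]) oO (su e e01) cL.2 (leqnn 0) Lx).
Unshelve. all: by end_near. Qed.

End C0Nets.

(** * Zero nets and the existence of representatives *)

Section ZeroNets.
Context {R : realType} {n' n p : nat}.
Local Notation C := R[i].
Local Notation Z := ('rV[R]_n' * 'rV[R]_n * 'rV[R]_p)%type.

Lemma mixed_deriv0 alpha beta : mixed_deriv alpha beta (fun _ : Z => 0 : C) = fun=> 0.
Proof. by rewrite /mixed_deriv !multi_cderivE !cword_deriv0. Qed.

Lemma bigO_zero (q : R -> \bar R) b : (forall e, (q e <= 0)%E) -> bigO_eps q b.
Proof. by move=> q0; exists 0; near=> e; rewrite mul0r. Unshelve. all: by end_near. Qed.

Lemma negligible_hg0 (X : set ('rV[R]_n' * 'rV[R]_n)) :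
  Defs.negligible (hg_space (p := p) X) (fun _ _ => 0).
Proof.
split=> [e _|q [K [alpha [beta [cK ->]]]] N].
  by split=> [|z xi t _ _ _]; [exact: csmooth_on_cst|rewrite mulr0].
apply: bigO_zero => e; apply: sup0_le => // _ [z [xi [_ _ ->]]].
by rewrite mixed_deriv0 normc0 mulr0.
Qed.

Lemma negligible_symbol0 m rho delta (X : set ('rV[R]_n' * 'rV[R]_n)) :
  Defs.negligible (symbol_space (p := p) m rho delta X) (fun _ _ => 0).
Proof.
have q0 (K : set ('rV[R]_n' * 'rV[R]_n)) j :
  (symbol_seminorm m rho delta K j (fun _ : Z => (0 : C)%R) <= 0)%E.
  apply: sup0_le => // _ [z [xi [alpha [beta [_ _ ->]]]]].
  by rewrite mixed_deriv0 normc0 mulr0.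
split=> [e _|q [K [j [cK ->]]] N]; last by apply: bigO_zero => e; exact: q0.
by split=> [|K j _]; [exact: csmooth_on_cst|exact: le_lt_trans (q0 K j) (ltry _)].
Qed.

Lemma Phi_inhabited (Omega' : set 'rV[R]_n') (Omega : set 'rV[R]_n) (phi : @Phi R n' n p Omega' Omega) :
  exists psi, (phi : set (R -> Z -> R)) psi.
Proof.
case: phi => A [psi mpsi AE]; exists psi; rewrite /= AE; split=> //.
rewrite (_ : cnet _ = fun _ _ => 0); first exact: negligible_hg0.
by apply/funext => e; apply/funext => w; rewrite /cnet -[(psi - psi) e w]/(psi e w - psi e w) subrr.
Qed.

Lemma Stilde_inhabited m rho delta X (a : @Stilde R n' n p m rho delta X) :
  exists b, (a : set (net R Z)) b.
Proof.
case: a => A [b mb AE]; exists b; rewrite /= AE /coset /=.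
rewrite (_ : b - b = fun _ _ => 0); first exact: negligible_symbol0.
by apply/funext => e; apply/funext => w; rewrite -[LHS]/(b e w - b e w) subrr.
Qed.

End ZeroNets.

Section ColombeauReprs.
Context {R : realType} {n : nat} (O : set 'rV[R]_n) (oO : open O).
Local Notation C := R[i].
Local Notation V := 'rV[R]_n.

Lemma cword_sub (f g : V -> C) t y : csmooth_on std O f -> csmooth_on std O g -> O y ->
  cword_deriv std t (fun y => f y - g y) y = cword_deriv std t f y - cword_deriv std t g y.
Proof.
move=> sf sg Oy; rewrite addrC -mulN1r -(cword_lin (-1) t oO sg sf Oy).
by apply: (cword_deriv_eq std t oO _ Oy) => z _; rewrite mulN1r addrC.
Qed.

Lemma word_bounded_zero : word_bounded O rapid (fun _ _ => 0).
Proof.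
split=> [e|L k cL]; first exact: csmooth_on_cst.
by exists (fun=> 0); split=> [|e t y _ _]; [exact: rapid0|rewrite cword_deriv0 normc0].
Qed.

Lemma word_bounded_weaken (u : net R V) : word_bounded O rapid u -> word_bounded O tempered u.
Proof.
move=> [su wu]; split=> // L k cL; have [A [rA HA]] := wu L k cL.
by exists A; split=> //; exact: rapid_tempered.
Qed.

Lemma coset_bounded (u0 u : net R V) : moderate (Cinf O) u0 -> coset (Cinf O) u0 u ->
  word_bounded O tempered u.
Proof.
move=> /(moderateP _ oO) w0 /(negligibleP _ oO) /word_bounded_weaken w.
apply: (@tempered_bounded_lin R n O (fun=> 1) (fun=> 1) _ _ _ oO (tempered_cst ler01) _ _ w w0).
  by move=> t _; rewrite normc1.
by move=> t y _ _; rewrite mul1r -[(u - u0) t y]/(u t y - u0 t y) subrK.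
Qed.

Lemma G_bounded (u : G O) u1 : (u : set (net R V)) u1 -> word_bounded O tempered u1.
Proof. by case: u => A [u0 m0 /= ->]; exact: coset_bounded. Qed.

Lemma G_sub (u : G O) u1 u2 : (u : set (net R V)) u1 -> (u : set (net R V)) u2 ->
  word_bounded O rapid (fun t y => u1 t y - u2 t y).
Proof. by case: u => A [u0 m0 /= ->]; exact: coset_sub_bounded. Qed.

Lemma G_shift (u : G O) u1 u2 : (u : set (net R V)) u1 ->
  word_bounded O rapid (fun t y => u2 t y - u1 t y) -> (u : set (net R V)) u2.
Proof.
case: u => A [u0 m0 /= ->] /(negligibleP _ oO) w1 w21; apply/(negligibleP _ oO).
apply: (@rapid_bounded_lin R n O (fun=> 1) (fun=> 1) _ _ _ oO (tempered_cst ler01) _ _ w21 w1).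
  by move=> t _; rewrite normc1.
move=> t y _ _; rewrite mul1r -[(u1 - u0) t y]/(u1 t y - u0 t y).
by rewrite -[(u2 - u0) t y]/(u2 t y - u0 t y) addrA subrK.
Qed.

Lemma test_bound_diff K j (u1 u2 : net R V) : compact_in O K ->
  word_bounded O tempered u1 -> word_bounded O tempered u2 ->
  word_bounded O rapid (fun t y => u1 t y - u2 t y) ->
  test_bound (@epsval R \o id) K j (fun e => u1 (epsval e)) (fun e => u2 (epsval e)).
Proof.
move=> cK [s1 w1] [s2 w2] [_ w]; have [A1 [t1 H1]] := w1 K j cK.
have [A2 [t2 H2]] := w2 K j cK; have [B [rB HB]] := w K j cK.
exists (fun t => A1 t + A2 t), B; split=> //; first exact: tempered_add.
move=> e t y tj Ky; split.
- by apply: (le_trans (H1 e t y tj Ky)); rewrite lerDl; exact: t2.1.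
- by apply: (le_trans (H2 e t y tj Ky)); rewrite lerDr; exact: t1.1.
by rewrite -(cword_sub t (s1 e) (s2 e) (cK.2 y Ky)); exact: HB.
Qed.

End ColombeauReprs.

(** * The operator on representatives *)

Section Operator.
Context {R : realType} {n' n p : nat}.
Local Notation C := R[i].
Local Notation Z := ('rV[R]_n' * 'rV[R]_n * 'rV[R]_p)%type.
Context (Omega' : set 'rV[R]_n') (Omega : set 'rV[R]_n).
Hypotheses (oO' : open Omega') (oO : open Omega).
Context (m rho delta : R) (hrho : 0 < rho <= 1) (hdelta : 0 <= delta < 1).
Context (chi : 'rV[R]_p -> C) (hchi : cutoff chi).
Context (Kex : nat -> set 'rV[R]_n).
Context (phi : @Phi R n' n p Omega' Omega) (a : @Stilde R n' n p m rho delta (Omega' `*` Omega)).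
Local Notation s := (Num.min rho (1 - delta)).
Local Notation admissible h := (m - h%:R * s + 1 < - p%:R).
Local Notation Gc := (Gc Omega Kex).
Local Notation osc := (osc_net chi Omega).
Local Notation oscI := (oscI Omega chi).

Let c0 : C := ((2 * pi) ^- p)%:C%C.

Lemma osc_smooth h psi b (u : net R 'rV[R]_n) K (e : @epsdom R) : compact_in Omega K ->
  (phi : set (R -> Z -> R)) psi -> (a : set (net R Z)) b ->
  (forall e : @epsdom R, csmooth_on std Omega (u (epsval e))) -> supported_in Omega K u ->
  admissible h -> csmooth_on std Omega' (oscI h (psi (epsval e)) (b (epsval e)) (u (epsval e))).
Proof.
move=> cK hp hb su zu hmu.
apply: (oscI_smooth oO' oO cK hchi hrho hdelta e hp hb _ hmu).
by split; [exact: su|move=> y Oy Ky; exact: zu (epsval01 e) _ Oy Ky].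
Qed.

(** One application of [osc_bound] gives moderateness and independence of h and of the
    representatives of the phase, the symbol and u. *)
Lemma osc_pair h h' psi psi' b b' (u u' : net R 'rV[R]_n) K :
  (phi : set (R -> Z -> R)) psi -> (phi : set (R -> Z -> R)) psi' ->
  (a : set (net R Z)) b -> (a : set (net R Z)) b' -> compact_in Omega K ->
  word_bounded Omega tempered u -> word_bounded Omega tempered u' ->
  word_bounded Omega rapid (fun t y => u t y - u' t y) ->
  supported_in Omega K u -> supported_in Omega K u' -> admissible h -> admissible h' ->
  word_bounded Omega' tempered (osc h psi b u) /\
  word_bounded Omega' rapid (fun t x => osc h psi b u t x - osc h' psi' b' u' t x).
Proof.
move=> hp hp' hb hb' cK wu wu' wd zu zu' hmu hmu'.
pose N h (psi : R -> Z -> R) (b : net R Z) (u : net R 'rV[R]_n) : net R 'rV[R]_n' :=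
  fun t => oscI h (psi t) (b t) (u t).
have sN e := osc_smooth e cK hp hb wu.1 zu hmu.
have sN' e := osc_smooth e cK hp' hb' wu'.1 zu' hmu'.
have T k L : compact_in Omega' L -> test_bound (@epsval R \o id) L k
    (fun e => N h psi b u (epsval e)) (fun e => N h' psi' b' u' (epsval e)).
  move=> cL; have [j H] := osc_bound oO' oO cK hchi hrho hdelta phi a k hmu hmu'.
  apply: (H _ id (fun e => u (epsval e)) (fun e => u' (epsval e)) psi psi' b b' L) => //.
  - by split=> [e|e y Oy Ky]; [exact: wu.1|exact: zu (epsval01 e) _ Oy Ky].
  - by split=> [e|e y Oy Ky]; [exact: wu'.1|exact: zu' (epsval01 e) _ Oy Ky].
  - exact: (test_bound_diff oO j cK wu wu' wd).
have wN : word_bounded Omega' tempered (N h psi b u).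
  split=> [e|L k cL]; first exact: sN.
  have [A [B [tA rB H]]] := T k L cL; exists A; split=> // e t y tk Ly.
  by have [] := H e t y tk Ly.
have wD : word_bounded Omega' rapid (fun t x => N h psi b u t x - N h' psi' b' u' t x).
  split=> [e|L k cL].
    exact: (csmooth_on_add oO' (sN e) (csmooth_on_opp oO' (sN' e))).
  have [A [B [tA rB H]]] := T k L cL; exists B; split=> // e t y tk Ly.
  by rewrite (cword_sub oO' t (sN e) (sN' e) (cL.2 y Ly)); have [] := H e t y tk Ly.
have z0 := word_bounded_zero Omega'.
have tc := tempered_cst (normc_ge0 c0).
split.
  apply: (@tempered_bounded_lin R n' Omega' (fun=> c0) _ _ _ _ oO' tc _ _ wN (word_bounded_weaken z0)) => //.
  by move=> t y _ _; rewrite addr0.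
apply: (@rapid_bounded_lin R n' Omega' (fun=> c0) _ _ _ _ oO' tc _ _ wD z0) => //.
by move=> t y _ _; rewrite addr0 mulrBr.
Qed.

Lemma osc_lin h psi b (l : R -> C) (u v : net R 'rV[R]_n) K t x : compact_in Omega K ->
  (phi : set (R -> Z -> R)) psi -> (a : set (net R Z)) b ->
  (forall e : @epsdom R, csmooth_on std Omega (u (epsval e))) -> supported_in Omega K u ->
  (forall e : @epsdom R, csmooth_on std Omega (v (epsval e))) -> supported_in Omega K v ->
  admissible h -> 0 < t <= 1 -> Omega' x ->
  osc h psi b (fun t y => l t * u t y + v t y) t x = l t * osc h psi b u t x + osc h psi b v t x.
Proof.
move=> cK hp hb su zu sv zv hmu t01 Ox; pose e : @epsdom R := exist _ t t01.
have tu : test_fun Omega K (u (epsval e)).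
  by split; [exact: su|move=> y Oy Ky; exact: zu (epsval01 e) _ Oy Ky].
have tv : test_fun Omega K (v (epsval e)).
  by split; [exact: sv|move=> y Oy Ky; exact: zv (epsval01 e) _ Oy Ky].
rewrite -[LHS]/(c0 * oscI h (psi (epsval e)) (b (epsval e)) (fun y => l t * u (epsval e) y + v (epsval e) y) x).
rewrite (oscI_lin oO' oO cK hchi hrho hdelta (l t) e hp hb tu tv hmu Ox) mulrDr mulrCA.
by [].
Qed.

End Operator.

Section ZeroElement.
Context {R : realType}.
Local Notation C := R[i].

Lemma powO_tempered (A : R -> R) c : (forall t, 0 <= A t) -> powO A c -> tempered A.
Proof.
move=> A0 Ac; split=> //; exists (Num.bound `|c|); apply: (powO_le A0 _ Ac).
rewrite lerNl; apply: (@le_trans _ _ `|c|); last by apply/ltW/archi_boundP.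
by rewrite -normrN ler_norm.
Qed.

Lemma normc_eps_power (b t : R) : normc ((t `^ b)%:C%C : C) = t `^ b.
Proof. by rewrite normc_real ger0_norm// powR_ge0. Qed.

Lemma bigO_zero_net n (L : set 'rV[R]_n) k b :
  bigO_eps (fun _ => Cinf_seminorm L k (fun _ => (0 : C))) b.
Proof.
by apply: bigO_zero => _; apply: Cinf_le => // t y _ _; rewrite cword_deriv0 normc0.
Qed.

Lemma negligible_zero_net n (O : set 'rV[R]_n) :
  Defs.negligible (Cinf O) (fun _ _ => 0 : C).
Proof.
split=> [e _|q [L [k [cL ->]]] N]; first exact: csmooth_on_cst.
exact: bigO_zero_net.
Qed.

(** [Gc] carries no module structure: sums and multiples are relations between cosets, and zero is
    known through its representatives. *)
Lemma Gc_zero n (O : set 'rV[R]_n) Kex : open O ->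
  exists z : Gc O Kex, forall w, Gc_reprs z w <-> Defs.negligible (Cinf O) w.
Proof.
move=> oO; pose zn : net R 'rV[R]_n := fun _ _ => 0.
have mz : moderate (Cinf O) zn.
  by apply/(moderateP _ oO)/word_bounded_weaken/word_bounded_zero.
pose g : G O := Colombeau (ex_intro2 _ _ zn mz erefl).
have zE w : w - zn = w.
  by apply/funext => e; apply/funext => y; rewrite -[LHS]/(w e y - 0) subr0.
have g0 : gsupp g = set0.
  rewrite -subset0 => x [Ox]; apply; exists O; split=> //; exists zn.
    by rewrite /= /coset /= zE; exact: negligible_zero_net.
  exact: negligible_zero_net.
have cg : compact (gsupp g) by rewrite g0; exact: compact0.
by exists (exist _ g cg) => w; rewrite /Gc_reprs /= /coset /= zE.
Qed.

End ZeroElement.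

(** * Construction and continuity of the operator *)

Section Continuity.
Context {R : realType} {n' n p : nat}.
Local Notation C := R[i].
Local Notation Z := ('rV[R]_n' * 'rV[R]_n * 'rV[R]_p)%type.
Context (Omega' : set 'rV[R]_n') (Omega : set 'rV[R]_n).
Hypotheses (oO' : open Omega') (oO : open Omega).
Context (m rho delta : R) (hrho : 0 < rho <= 1) (hdelta : 0 <= delta < 1).
Context (chi : 'rV[R]_p -> C) (hchi : cutoff chi).
Context (Kex : nat -> set 'rV[R]_n) (hKex : exhaustion Omega Kex).
Context (phi : @Phi R n' n p Omega' Omega) (a : @Stilde R n' n p m rho delta (Omega' `*` Omega)).
Local Notation s := (Num.min rho (1 - delta)).
Local Notation admissible h := (m - h%:R * s + 1 < - p%:R).
Local Notation Gc := (Gc Omega Kex).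
Local Notation osc := (osc_net chi Omega).
Local Notation oscI := (oscI Omega chi).

Lemma supported_in_sub (K K' : set 'rV[R]_n) (u : net R 'rV[R]_n) : K `<=` K' ->
  supported_in Omega K u -> supported_in Omega K' u.
Proof. by move=> KK su e e01 x Ox Kx; apply: su => // /KK. Qed.

Lemma compact_in_setU (K K' : set 'rV[R]_n) : compact_in Omega K -> compact_in Omega K' ->
  compact_in Omega (K `|` K').
Proof. by move=> [c1 s1] [c2 s2]; split; [exact: compactU|rewrite subUset]. Qed.

Lemma osc_same (u : G Omega) h h' psi psi' b b' u_ u' K K' :
  (phi : set (R -> Z -> R)) psi -> (phi : set (R -> Z -> R)) psi' ->
  (a : set (net R Z)) b -> (a : set (net R Z)) b' -> compact_in Omega K -> compact_in Omega K' ->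
  (u : set (net R 'rV[R]_n)) u_ -> (u : set (net R 'rV[R]_n)) u' ->
  supported_in Omega K u_ -> supported_in Omega K' u' -> admissible h -> admissible h' ->
  word_bounded Omega' tempered (osc h psi b u_) /\
  word_bounded Omega' rapid (fun t x => osc h psi b u_ t x - osc h' psi' b' u' t x).
Proof.
move=> hp hp' hb hb' cK cK' hu hu' zu zu' hmu hmu'.
apply: (osc_pair oO' oO hrho hdelta hchi hp hp' hb hb' (compact_in_setU cK cK')
  (G_bounded oO hu) (G_bounded oO hu') (G_sub oO hu hu') _ _ hmu hmu').
- exact: (supported_in_sub (@subsetUl _ K K') zu).
- exact: (supported_in_sub (@subsetUr _ K K') zu').
Qed.

(** All admissible choices are required to land in A u, so that each later argument may pick the
    most convenient one. *)
Definition represents_osc (A : Gc -> G Omega') := forall u h psi b u_ K,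
  (phi : set (R -> Z -> R)) psi -> (a : set (net R Z)) b -> compact_in Omega K ->
  Gc_reprs u u_ -> supported_in Omega K u_ -> admissible h ->
  (A u : set (net R 'rV[R]_n')) (osc h psi b u_).

Lemma admissible_exists : exists h, admissible h.
Proof.
have [h H] := large_index hrho hdelta (m + 1 + p%:R); exists h.
by move: H; lra.
Qed.

Lemma represents_osc_exists : exists A, represents_osc A.
Proof.
have [psi0 hp0] := Phi_inhabited phi; have [b0 hb0] := Stilde_inhabited a.
have [h0 hmu0] := admissible_exists.
have H (u : Gc) : exists g : G Omega', forall h psi b u_ K,
    (phi : set (R -> Z -> R)) psi -> (a : set (net R Z)) b -> compact_in Omega K ->
    Gc_reprs u u_ -> supported_in Omega K u_ -> admissible h ->
    (g : set (net R 'rV[R]_n')) (osc h psi b u_).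
  have [u0 [K0 [hu0 cK0 zu0]]] := compact_representative oO (svalP u).
  have [w0 _] := osc_same hp0 hp0 hb0 hb0 cK0 cK0 hu0 hu0 zu0 zu0 hmu0 hmu0.
  exists (Colombeau (ex_intro2 _ _ _ ((moderateP _ oO').2 w0) erefl)) => h psi b u_ K hp hb cK hu zu hmu.
  have [_ d] := osc_same hp hp0 hb hb0 cK cK0 hu hu0 zu zu0 hmu hmu0.
  by apply/(negligibleP _ oO'); exact: d.
by have [A HA] := choice H; exists A.
Qed.

Context (A : Gc -> G Omega') (HA : represents_osc A).

Lemma represents_osc_C0 u : to_C0 (A u) = osc_integral chi phi a (Gc_reprs u).
Proof.
apply/seteqP; split=> w.
  move=> [v Av wv].
  have [psi0 hp0] := Phi_inhabited phi; have [b0 hb0] := Stilde_inhabited a.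
  have [h0 hmu0] := admissible_exists.
  have [u0 [K0 [hu0 cK0 zu0]]] := compact_representative oO (svalP u).
  have A0 := HA hp0 hb0 cK0 hu0 zu0 hmu0.
  exists psi0, b0, u0, h0; split=> //; first by exists K0.
  rewrite /coset /= (_ : w - _ = (w - v) + (v - osc h0 psi0 b0 u0)); last by rewrite addrA subrK.
  apply: negligible_C0_add => //; apply: (negligible_Cinf_C0 oO').
  by apply/(negligibleP _ oO'); exact: (G_sub oO' Av A0).
move=> [psi [b [u_ [h [hp [hb hu] [K cK zu] hmu hw]]]]].
by exists (osc h psi b u_) => //; exact: (HA hp hb cK hu zu hmu).
Qed.

(** Here l is a net of scalars of polynomial size, so that addition and multiplication by
    generalized numbers are handled together. *)
Lemma operator_lin (u v w : Gc) (l : R -> C) c u_ v_ K K' wu wv :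
  powO (fun t => normc (l t)) c ->
  compact_in Omega K -> compact_in Omega K' ->
  Gc_reprs u u_ -> Gc_reprs v v_ -> Gc_reprs w (fun t y => l t * u_ t y + v_ t y) ->
  supported_in Omega K u_ -> supported_in Omega K' v_ ->
  (A u : set (net R 'rV[R]_n')) wu -> (A v : set (net R 'rV[R]_n')) wv ->
  (A w : set (net R 'rV[R]_n')) (fun t x => l t * wu t x + wv t x).
Proof.
move=> lc cK cK' hu hv hw zu zv Au Av.
have [psi hp] := Phi_inhabited phi; have [b hb] := Stilde_inhabited a.
have [h hmu] := admissible_exists.
have cKK := compact_in_setU cK cK'.
have zu' := supported_in_sub (@subsetUl _ K K') zu.
have zv' := supported_in_sub (@subsetUr _ K K') zv.
have zw : supported_in Omega (K `|` K') (fun t y => l t * u_ t y + v_ t y).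
  by move=> e e01 x Ox Kx; rewrite zu'// zv'// mulr0 addr0.
have Au' := G_sub oO' Au (HA hp hb cK hu zu hmu).
have Av' := G_sub oO' Av (HA hp hb cK' hv zv hmu).
apply: (G_shift oO' (HA hp hb cKK hw zw hmu)).
have tl : tempered (fun t => normc (l t)) by apply: powO_tempered lc => t; exact: normc_ge0.
apply: (rapid_bounded_lin oO' tl _ _ Au' Av') => // t x t01 Ox.
rewrite (osc_lin oO' oO hrho hdelta hchi l cKK hp hb (G_bounded oO hu).1 zu' (G_bounded oO hv).1 zv' hmu t01 Ox).
by rewrite mulrBr opprD addrACA.
Qed.

Lemma operator_zero (z : Gc) : (forall w, Gc_reprs z w <-> Defs.negligible (Cinf Omega) w) ->
  (A z : set (net R 'rV[R]_n')) (fun _ _ => 0).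
Proof.
move=> hz; pose zn : net R 'rV[R]_n := fun _ _ => 0.
have [psi hp] := Phi_inhabited phi; have [b hb] := Stilde_inhabited a.
have [h hmu] := admissible_exists.
have c0 : compact_in Omega set0 by split=> //; exact: compact0.
have z0 : supported_in Omega set0 zn by [].
have hzn : Gc_reprs z zn by apply/hz; exact: negligible_zero_net.
apply: (G_shift oO' (HA hp hb c0 hzn z0 hmu)).
have wz := word_bounded_zero Omega'.
apply: (rapid_bounded_lin (l := fun=> 1) oO' (tempered_cst ler01) _ _ wz wz).
  by move=> t _; rewrite normc1.
move=> t x t01 Ox; rewrite mulr0 addr0.
have sz := (G_bounded oO hzn).1.
(* The zero net is 1 times itself plus itself, so its integral equals its own double. *)
have := osc_lin oO' oO hrho hdelta hchi (fun=> 1) c0 hp hb sz z0 sz z0 hmu t01 Ox.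
rewrite mul1r (_ : (fun t0 y => 1 * zn t0 y + zn t0 y) = zn).
  move=> E; rewrite sub0r; apply/eqP; rewrite oppr_eq0; apply/eqP.
  by apply: (addrI (osc h psi b zn t x)); rewrite addr0 -E.
by apply/funext => e; apply/funext => y; rewrite mul1r addr0.
Qed.

Lemma Gc_rep (u : Gc) : exists u_ K, [/\ Gc_reprs u u_, compact_in Omega K & supported_in Omega K u_].
Proof. exact: (compact_representative oO (svalP u)). Qed.

Section Ball.
Context (L : set 'rV[R]_n') (k : nat) (r : R) (cL : compact_in Omega' L) (r0 : 0 < r).
Local Notation pL := (Cinf_seminorm L k).

Let U : set Gc := [set v | (ultranorm pL (A v) < r%:E)%E].

Let in_space_A (v : Gc) w : (A v : set (net R 'rV[R]_n')) w -> in_space (Cinf Omega') w.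
Proof. by move=> Aw; apply/in_spaceP; exact: (G_bounded oO' Aw).1. Qed.

Let one_near : exists M : R, \forall t \near 0^'+, normc (1 : C) <= M * t `^ 0.
Proof. by exists 1; near=> t; rewrite normc1 powRr0 mulr1. Unshelve. all: by end_near. Qed.

Let expR_min b1 b2 : expR (- b1) < r -> expR (- b2) < r -> expR (- Num.min b1 b2) < r.
Proof. by move=> h1 h2; rewrite minEle; case: ifP. Qed.

Lemma ball_add : forall u v w : Gc, U u -> U v ->
  Gc_reprs w = coset_add (Gc_reprs u) (Gc_reprs v) -> U w.
Proof.
move=> u v w /(ultranorm_lt _ _ r0)[wu [b1 [Au Ob1 r1]]] /(ultranorm_lt _ _ r0)[wv [b2 [Av Ob2 r2]]] wE.
have [u_ [K [hu cK zu]]] := Gc_rep u; have [v_ [K' [hv cK' zv]]] := Gc_rep v.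
have hw : Gc_reprs w (fun t y => 1 * u_ t y + v_ t y).
  rewrite wE; exists u_ => //; exists v_ => //.
  by apply/funext => t; apply/funext => y; rewrite mul1r.
have Aw := operator_lin (l := fun=> 1) one_near cK cK' hu hv hw zu zv Au Av.
apply/(ultranorm_lt _ _ r0); do 2 eexists; split; [exact: Aw| |exact: expR_min r1 r2].
apply: (bigO_lin oO' cL.2 (in_space_A Au) (in_space_A Av) _ one_near Ob1 Ob2) => //.
  by rewrite add0r ge_min lexx.
by rewrite ge_min lexx orbT.
Qed.

Lemma ball_scale (l : R -> C) c (u w : Gc) u_ b1 wu K :
  powO (fun t => normc (l t)) c -> compact_in Omega K -> Gc_reprs u u_ ->
  supported_in Omega K u_ -> Gc_reprs w (fun t y => l t * u_ t y) ->
  (A u : set (net R 'rV[R]_n')) wu -> bigO_eps (fun e => pL (wu e)) b1 ->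
  expR (- (c + b1)) < r -> U w.
Proof.
move=> lc cK hu zu hw Au Ob1 r1.
have [z hz] := Gc_zero Kex oO; pose zn : net R 'rV[R]_n := fun _ _ => 0.
have hzn : Gc_reprs z zn by apply/hz; exact: negligible_zero_net.
have zz : supported_in Omega K zn by [].
have hw' : Gc_reprs w (fun t y => l t * u_ t y + zn t y).
  by move: hw; congr (Gc_reprs w _); apply/funext => t; apply/funext => y; rewrite addr0.
have Az := operator_zero hz.
have Aw := operator_lin lc cK cK hu hzn hw' zu zz Au Az.
apply/(ultranorm_lt _ _ r0); do 2 eexists; split; [exact: Aw| |exact: r1].
exact: (bigO_lin oO' cL.2 (in_space_A Au) (in_space_A Az) (fun _ _ _ _ => erefl) lc Ob1 (bigO_zero_net L k (c + b1)) (lexx _) (lexx _)).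
Qed.

Let scale_rep (l : Ctilde) (u w : Gc) l' u_ : (l : set (net R unit)) l' ->
  Gc_reprs u u_ -> Gc_reprs w = coset_scale (Cinf Omega) l (Gc_reprs u) ->
  Gc_reprs w (fun t y => l' t tt * u_ t y).
Proof.
move=> ll hu ->; exists l', u_; split=> //.
rewrite (_ : _ - _ = fun _ _ => 0); first exact: negligible_zero_net.
by apply/funext => e; apply/funext => y; rewrite -[LHS]/(l' e tt * u_ e y - l' e tt * u_ e y) subrr.
Qed.

Lemma ball_convex : gen_convex U.
Proof.
split=> [|b l u w b0 lb /(ultranorm_lt _ _ r0)[wu [b1 [Au Ob1 r1]]] wE]; first exact: ball_add.
have [u_ [K [hu cK zu]]] := Gc_rep u.
apply: (ball_scale (c := b) _ cK hu zu (scale_rep lb hu wE) Au Ob1).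
  by exists 1; near=> t; rewrite normc_eps_power mul1r.
by apply: le_lt_trans r1; rewrite ler_expR lerN2 lerDr.
Unshelve. all: by end_near. Qed.

Lemma ball_balanced : gen_balanced U.
Proof.
move=> l u w l1 /(ultranorm_lt _ _ r0)[wu [b1 [Au Ob1 r1]]] wE.
have [u_ [K [hu cK zu]]] := Gc_rep u.
(* The ultranorm of l is at most 1, so its exponents come only arbitrarily close to 0. The strict
   inequality in [r1] leaves the room that is needed. *)
have r1' : 1 < r * expR b1 by rewrite -ltr_pdivrMr ?expR_gt0// mul1r -expRN.
have r0' : 0 < r * expR b1 by apply: lt_trans r1'.
have l1' : (scalar_ultranorm l < (r * expR b1)%:E)%E by apply: (le_lt_trans l1); rewrite lte_fin.
have [l' [c [ll Oc rc]]] := (ultranorm_lt _ _ r0').1 l1'.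
apply: (ball_scale (l := fun t => l' t tt) (c := c) _ cK hu zu (scale_rep ll hu wE) Au Ob1).
  by have [M HM] := Oc; exists M.
by rewrite opprD expRD [expR (- b1)]expRN ltr_pdivrMr// expR_gt0.
Qed.

Lemma ball_steps i : GK_nbhs0 (Kex i) U.
Proof.
have [cKex sKex _] := hKex.
have [psi hp] := Phi_inhabited phi; have [b hb] := Stilde_inhabited a.
have [h hmu] := admissible_exists.
have cK := cKex i.+1.
have [j [A1 [[A10 [N [M2 AN]]] H]]] := osc_estimate oO' oO cK hchi hrho hdelta k hp hb hmu cL.
(* The next step of the exhaustion contains the present one in its interior. The estimate lowers the
   exponent by at most N, which the factor e^(-N) in the radius makes up for. *)
exists (Kex i.+1), j, (r * expR (- N%:R)).
have rN : 0 < r * expR (- N%:R) by rewrite mulr_gt0 ?expR_gt0.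
split; [exact: cK|exact: sKex|exact: rN|move=> u _].
move=> /(ultranorm_lt _ _ rN)[u_ [c [[hu zu] [M1 Oc] rc]]].
apply/(ultranorm_lt _ _ r0); exists (osc h psi b u_), (c - N%:R); split.
- exact: (HA hp hb cK hu zu hmu).
- pose c0 : C := ((2 * pi) ^- p)%:C%C.
  (* The summand 1 makes the bound on u positive, as [osc_estimate] demands. *)
  exists (normc c0 * (`|M2| * (`|M1| + 1))); near=> t.
  have t01 : 0 < t <= 1 by near: t; exact: near0_unit.
  have t0 : 0 < t by case/andP: t01.
  have u1 : (Cinf_seminorm (Kex i.+1) j (u_ t) <= (M1 * t `^ c)%:E)%E by near: t.
  have A2 : A1 t <= M2 * t `^ (- N%:R) by near: t.
  have su := (G_bounded oO hu).1 (exist _ t t01).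
  apply: Cinf_le => [|tt y ttk Ly]; first by rewrite !mulr_ge0 ?normc_ge0 ?powR_ge0 ?addr_ge0.
  have so := osc_smooth oO' oO hrho hdelta hchi (exist _ t t01) cK hp hb (G_bounded oO hu).1 zu hmu.
  have -> : cword_deriv std tt (osc h psi b u_ t) y = c0 * cword_deriv std tt (oscI h (psi t) (b t) (u_ t)) y.
    have Oy := cL.2 y Ly.
    rewrite -[RHS]addr0 -[X in _ + X](congr1 (@^~ y) (cword_deriv0 std tt)).
    rewrite -(cword_lin c0 tt oO' so (csmooth_on_cst _ _ _) Oy).
    by apply: (cword_deriv_eq std tt oO' _ Oy) => z _; rewrite addr0.
  have c1 : 0 < (`|M1| + 1) * t `^ c by rewrite mulr_gt0 ?powR_gt0// ltr_wpDl.
  have tv : test_fun Omega (Kex i.+1) (u_ t) by split=> // z Oz Kz; exact: zu.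
  have := H (exist _ t t01) (u_ t) _ tv c1 _ tt y ttk Ly.
  rewrite normcM -!mulrA => /(_ _) HH; apply: ler_wpM2l; first exact: normc_ge0.
  apply: (le_trans (HH _)).
    move=> s z sj Kz; rewrite -lee_fin.
    apply: (le_trans (Cinf_word_ub oO su cK.2 sj Kz)); apply: (le_trans u1).
    rewrite lee_fin ler_wpM2r ?powR_ge0// (le_trans (ler_norm _))// lerDl//.
  rewrite powRD; last by rewrite (gt_eqF t0) implybT.
  rewrite (_ : `|M2| * _ = `|M2| * t `^ (- N%:R) * ((`|M1| + 1) * t `^ c)); last by ring.
  apply: ler_wpM2r; first exact: ltW.
  by apply: (le_trans A2); rewrite ler_wpM2r ?powR_ge0// ler_norm.
rewrite opprB addrC expRD -ltr_pdivlMr ?expR_gt0//.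
by rewrite -expRN.
Unshelve. all: by end_near. Qed.

Lemma ball_indlim : indlim_nbhs0 U.
Proof. by split; [exact: ball_convex|exact: ball_balanced|exact: ball_steps]. Qed.

Lemma ball_zero (z : Gc) : (forall w, Gc_reprs z w <-> Defs.negligible (Cinf Omega) w) -> U z.
Proof.
move=> hz; apply/(ultranorm_lt _ _ r0); exists (fun _ _ => 0), (- ln (r / 2)).
split; [exact: operator_zero|exact: bigO_zero_net|].
by rewrite opprK lnK ?posrE ?divr_gt0// ltr_pdivrMr// ltr_pMr// ltr1n.
Qed.

(** By the strong triangle inequality an ultraball is stable under adding elements of the ultraball
    of the same radius around 0, so the radius need not be reduced. *)
Lemma ball_shift (u0 : G Omega') (u v w : Gc) :
  (ultranorm pL (coset_sub (A u) u0) < r%:E)%E -> U v ->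
  Gc_reprs w = coset_add (Gc_reprs u) (Gc_reprs v) ->
  (ultranorm pL (coset_sub (A w) u0) < r%:E)%E.
Proof.
move=> /(ultranorm_lt _ _ r0)[_ [b1 [[wu Au [z0 hz0 <-]] Ob1 r1]]].
move=> /(ultranorm_lt _ _ r0)[wv [b2 [Av Ob2 r2]]] wE.
have [u_ [K [hu cK zu]]] := Gc_rep u; have [v_ [K' [hv cK' zv]]] := Gc_rep v.
have hw : Gc_reprs w (fun t y => 1 * u_ t y + v_ t y).
  rewrite wE; exists u_ => //; exists v_ => //.
  by apply/funext => t; apply/funext => y; rewrite mul1r.
have Aw := operator_lin (l := fun=> 1) one_near cK cK' hu hv hw zu zv Au Av.
apply/(ultranorm_lt _ _ r0); do 2 eexists; split; [|  |exact: expR_min r1 r2].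
  by exists (fun t x => 1 * wu t x + wv t x) => //; exists z0.
have sd : in_space (Cinf Omega') (wu - z0).
  apply/in_spaceP => e.
  exact: (csmooth_on_add oO' ((G_bounded oO' Au).1 e) (csmooth_on_opp oO' ((G_bounded oO' hz0).1 e))).
apply: (bigO_lin oO' cL.2 sd (in_space_A Av) _ one_near Ob1 Ob2) => //.
- move=> t y _ _; rewrite -[LHS]/(1 * wu t y + wv t y - z0 t y).
  by rewrite -[(wu - z0) t y]/(wu t y - z0 t y) !mul1r addrAC.
- by rewrite add0r ge_min lexx.
by rewrite ge_min lexx orbT.
Qed.

End Ball.

Lemma Gc_add_zero (u z : Gc) : (forall w, Gc_reprs z w <-> Defs.negligible (Cinf Omega) w) ->
  Gc_reprs u = coset_add (Gc_reprs u) (Gc_reprs z).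
Proof.
move=> hz; apply/seteqP; split=> w.
  move=> uw; exists w => //; exists (fun _ _ => 0); first by apply/hz; exact: negligible_zero_net.
  by apply/funext => e; apply/funext => y; rewrite -[LHS]/(w e y + 0) addr0.
move=> [w1 uw1 [w2 /hz /(negligibleP _ oO) w20 <-]]; apply: (G_shift oO uw1).
rewrite (_ : (fun _ _ => _) = w2) //; apply/funext => e; apply/funext => y.
by rewrite -[LHS]/(w1 e y + w2 e y - w1 e y) addrC addKr.
Qed.

Lemma represents_osc_continuous : continuous A.
Proof.
apply: continuous_subbase => u B [u0 [q [r [[L [k [cL ->]]] r0 ->]]]] /= Bu.
have [z hz] := Gc_zero Kex oO.
exists [set w : Gc | exists2 v, [set v | (ultranorm (Cinf_seminorm L k) (A v) < r%:E)%E] v &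
  Gc_reprs w = coset_add (Gc_reprs u) (Gc_reprs v)].
  by eexists; eexists; split; [exact: (ball_indlim k cL r0)|].
split; first by exists z; [exact: (ball_zero L k r0 hz)|exact: Gc_add_zero].
by move=> w [v Uv wE]; exact: (ball_shift cL r0 Bu Uv wE).
Qed.

End Continuity.

Theorem theorem3p5 (R : realType) (n' n p : nat)
  (Omega' : set 'rV[R]_n') (Omega : set 'rV[R]_n)
  (openOmega' : open Omega') (openOmega : open Omega)
  (m rho delta : R) (hrho : 0 < rho <= 1) (hdelta : 0 <= delta < 1)
  (chi : 'rV[R]_p -> R[i]) (hchi : cutoff chi)
  (Kex : nat -> set 'rV[R]_n) (hKex : exhaustion Omega Kex)
  (phi : Phi Omega' Omega) (a : Stilde m rho delta (Omega' `*` Omega)) :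
  exists A : Gc Omega Kex -> G Omega',
    (forall u : Gc Omega Kex,
       to_C0 (A u) = osc_integral chi phi a (Gc_reprs u)) /\
    continuous A.
Proof.
have [A HA] := represents_osc_exists openOmega' openOmega hrho hdelta hchi Kex phi a.
exists A; split=> [u|].
  exact: (represents_osc_C0 openOmega' openOmega hrho hdelta HA).
exact: (represents_osc_continuous openOmega' openOmega hrho hdelta hchi hKex HA).
Qed.
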